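(* Let $p$ be a prime. The class $\mathcal{C}_{(0,p)}^\mathrm{ring}$ of fields $K$ admitting a henselian valuation $v$ of mixed characteristic $(0,p)$ such that $\mathcal{O}_v/(p)$ is semiperfect and $vK$ is regular and non-discrete, is $\mathcal{L}_\mathrm{ring}$-elementary, and it is the $\mathcal{L}_\mathrm{ring}$-elementary class generated by all perfectoid fields of characteristic $(0,p)$ (i.e. the smallest $\mathcal{L}_\mathrm{ring}$-elementary class containing all fields of characteristic $0$ that are perfectoid with respect to a valuation of residue characteristic $p$).
   Context: $\mathcal{L}_\mathrm{ring}=\{0,1,+,\cdot,-\}$. Valuations are Krull valuations written additively; $\mathcal{O}_v$, $Kv$, $vK$ denote valuation ring, residue field and value group. A valuation $v$ on $K$ has mixed characteristic $(0,p)$ if $\mathrm{char}(K)=0$ and $\mathrm{char}(Kv)=p$. A valuation is discrete if $vK$ has a least positive element, non-discrete otherwise. An ordered abelian group is regular if every quotient by a nontrivial convex subgroup is divisible. A ring $R$ of characteristic $p$ is semiperfect if $x\mapsto x^p$ is surjective. A field $K$ with a nontrivial valuation $v:K^\times\to\mathbb{R}$ is perfectoid if $(K,v)$ is complete, $\mathcal{O}_v/(p)$ is semiperfect where $p=\mathrm{char}(Kv)>0$, and $vK$ is non-discrete. *)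

(* Defs.v *)
From Stdlib Require Import Reals.
From HB Require Import structures.
From mathcomp Require Import all_boot all_algebra.
Set Implicit Arguments. Unset Strict Implicit. Unset Printing Implicit Defensive.
Import GRing.Theory.
Local Open Scope ring_scope.

Inductive rterm : Type :=
  | tVar of nat
  | tZero | tOne
  | tAdd of rterm & rterm
  | tMul of rterm & rterm
  | tOpp of rterm.

Inductive rform : Type :=
  | fEq of rterm & rterm
  | fFalse
  | fNot of rform
  | fAnd of rform & rform
  | fOr of rform & rform
  | fImp of rform & rform
  | fAll of nat & rform
  | fEx of nat & rform.

Fixpoint term_fv (t : rterm) : seq nat :=
  match t with
  | tVar i => [:: i]
  | tZero | tOne => [::]
  | tAdd a b | tMul a b => term_fv a ++ term_fv b
  | tOpp a => term_fv a
  end.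

Fixpoint form_fv (f : rform) : seq nat :=
  match f with
  | fEq a b => term_fv a ++ term_fv b
  | fFalse => [::]
  | fNot g => form_fv g
  | fAnd g h | fOr g h | fImp g h => form_fv g ++ form_fv h
  | fAll i g | fEx i g => filter (fun j => j != i) (form_fv g)
  end.

Definition sentence (f : rform) : Prop := form_fv f = [::].

Fixpoint teval (K : fieldType) (e : nat -> K) (t : rterm) : K :=
  match t with
  | tVar i => e i
  | tZero => 0
  | tOne => 1
  | tAdd a b => teval e a + teval e b
  | tMul a b => teval e a * teval e b
  | tOpp a => - teval e a
  end.

Definition upd (K : Type) (e : nat -> K) (i : nat) (x : K) : nat -> K :=
  fun j => if j == i then x else e j.

Fixpoint sat (K : fieldType) (e : nat -> K) (f : rform) : Prop :=
  match f with
  | fEq a b => teval e a = teval e b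
  | fFalse => False
  | fNot g => ~ sat e g
  | fAnd g h => sat e g /\ sat e h
  | fOr g h => sat e g \/ sat e h
  | fImp g h => sat e g -> sat e h
  | fAll i g => forall x : K, sat (upd e i x) g
  | fEx i g => exists x : K, sat (upd e i x) g
  end.

(* K |= phi (for sentences the environment is irrelevant). *)
Definition models (K : fieldType) (f : rform) : Prop := forall e : nat -> K, sat e f.

Definition elementary (C : fieldType -> Prop) : Prop :=
  exists T : rform -> Prop,
    (forall f, T f -> sentence f) /\
    (forall K : fieldType, C K <-> (forall f, T f -> models K f)).

(* Krull valuations, represented by their valuation rings O_v ⊆ K     *)

Section Valuations.
Variable K : fieldType.
Variable O : K -> Prop.

Definition valuation_ring : Prop :=
  [/\ O 0, O 1, (forall x y, O x -> O y -> O (x - y)),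
      (forall x y, O x -> O y -> O (x * y)) &
      (forall x, x != 0 -> O x \/ O x^-1)].

Definition vunit (x : K) : Prop := x != 0 /\ O x /\ O x^-1.
Definition vmax (x : K) : Prop := O x /\ ~ vunit x.

(* v(x) <= v(y), for x, y nonzero *)
Definition vle (x y : K) : Prop := O (y / x).

Definition henselian : Prop :=
  forall (f : {poly K}) (a : K),
    f \is monic -> (forall i, O f`_i) -> O a ->
    vmax f.[a] -> vunit (f^`()).[a] ->
    exists b, [/\ O b, root f b & vmax (b - a)].

Definition char0 : Prop := forall n : nat, (n%:R : K) = 0 -> n = 0%N.
Definition mixed_char (p : nat) : Prop := char0 /\ vmax p%:R.

Definition semiperfect_mod (p : nat) : Prop :=
  forall x, O x -> exists y z, [/\ O y, O z & y ^+ p - x = p%:R * z].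

Definition nondiscrete : Prop :=
  ~ exists x, [/\ x != 0, vmax x &
                  forall y, y != 0 -> vmax y -> vle x y].

(* Convex subgroups of vK, described by their preimages H ⊆ K^x. *)
Definition convex_subgroup (H : K -> Prop) : Prop :=
  [/\ (forall x, H x -> x != 0), H 1,
      (forall x y, H x -> H y -> H (x * y^-1)) &
      (forall x y, H x -> y != 0 -> vle 1 y -> vle y x -> H y)].

Definition regular_value_group : Prop :=
  forall H : K -> Prop, convex_subgroup H -> (exists x, H x /\ ~ vunit x) ->
    forall x, x != 0 -> forall n : nat, (0 < n)%N ->
      exists y, y != 0 /\ H (y ^+ n / x).

End Valuations.

Definition C0p (p : nat) (K : fieldType) : Prop :=
  exists O : K -> Prop,
    [/\ valuation_ring O, henselian O, mixed_char O p,
        semiperfect_mod O p & regular_value_group O /\ nondiscrete O].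

Section RealValuations.
Variable K : fieldType.
Variable v : K -> R.   (* v restricted to K^x; v 0 = +oo is left implicit *)

Definition real_valuation : Prop :=
  (forall x y, x != 0 -> y != 0 -> v (x * y) = Rplus (v x) (v y)) /\
  (forall x y, x != 0 -> y != 0 -> x + y != 0 ->
      Rle (Rmin (v x) (v y)) (v (x + y))).

Definition rv_nontrivial : Prop := exists x, x != 0 /\ v x <> R0.

Definition rv_cauchy (s : nat -> K) : Prop :=
  forall M : R, exists N : nat, forall n m, (N <= n)%N -> (N <= m)%N ->
    s n != s m -> Rlt M (v (s n - s m)).

Definition rv_converges (s : nat -> K) (l : K) : Prop :=
  forall M : R, exists N : nat, forall n, (N <= n)%N ->
    s n != l -> Rlt M (v (s n - l)).

Definition rv_complete : Prop :=
  forall s, rv_cauchy s -> exists l, rv_converges s l.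

Definition rv_O (x : K) : Prop := x = 0 \/ Rle R0 (v x).
Definition rv_max (x : K) : Prop := x = 0 \/ Rlt R0 (v x).

Definition rv_semiperfect_mod (p : nat) : Prop :=
  forall x, rv_O x -> exists y z, [/\ rv_O y, rv_O z & y ^+ p - x = p%:R * z].

Definition rv_nondiscrete : Prop :=
  ~ exists x, [/\ x != 0, Rlt R0 (v x) &
                  forall y, y != 0 -> Rlt R0 (v y) -> Rle (v x) (v y)].

End RealValuations.

Definition perfectoid0p (p : nat) (K : fieldType) : Prop :=
  char0 K /\
  exists v : K -> R,
    [/\ real_valuation v, rv_nontrivial v, rv_complete v,
        rv_max v p%:R & rv_semiperfect_mod v p /\ rv_nondiscrete v].

(* Main.v *)
(** By the Ax-Kochen-Ershov principle, an ultraproduct over a countable index set of fields in the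
    class is elementarily equivalent to a perfectoid field: coarsening its valuation at [p] yields
    a henselian valuation of residue characteristic 0 with divisible value group, whose residue
    field is complete for the induced real valuation (by saturation), hence perfectoid; and a
    field with such a coarsening is equivalent to its residue field, because both become, after
    taking ultrapowers, henselian with divisible value groups and a common residue field. So every
    field in the class is a model of the theory of perfectoid fields.

    Conversely, a model [K] of that theory is elementarily equivalent to a perfectoid field [F].
    If [K] is not algebraically closed, let [f] be a rootless monic polynomial over [F] of least
    degree. Since [1 / f] is bounded and not locally constant, the values [t / f(z) - s], for
    suitable [s] and [t], form a definable set lying between two balls around 0. In [K], the
    elements whose powers all lie in a fixed multiple of the set defined by the same formula form
    a valuation ring, and each axiom of the class holds for it because [F] satisfies a quantitative
    version of this axiom. If [K] is algebraically closed, any extension of the [p]-adic valuation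
    will do. *)

Require Import Defs.
From Stdlib Require Import Reals Lra.

(** Membership in the class asserts that some valuation exists without giving a formula for it, so
    invariance under elementary equivalence is the obstacle. Countable saturation does not in
    general yield isomorphisms, so the Ax-Kochen-Ershov principle is proved by a back-and-forth
    through countable partial isomorphisms that preserve residues. The residue field is literally
    the same on both sides and the value groups are divisible, so neither needs a theory of its own.
    For models of the theory the obstacle is that a formula describes the valuation ring of a
    perfectoid field only up to a bounded error. Replacing [x] by [x ^ j] divides the error by [j],
    and the intersection over all [j] is a genuine valuation ring. Elementary equivalence transports
    only statements with fixed exponents, so each axiom is first proved with explicit exponents, at
    the cost of a constant factor. These statements must hold for all admissible parameters, not
    only for those that were constructed. The least degree ensures this: in characteristic 0 every
    rootless polynomial of that degree is separable, which bounds [1 / f]. *)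

(* Stated before [ring] is loaded, which redefines the tactic [field]. *)
Lemma Rfrac_add (a b c d n m : R) : n <> 0%R -> m <> 0%R ->
  ((a - b) / n + (c - d) / m = (a * m + c * n - (b * m + d * n)) / (n * m))%R.
Proof. intros; field; split; assumption. Qed.

From HB Require Import structures.
From mathcomp Require Import all_boot all_algebra.
From mathcomp Require Import boolp classical_sets filter.
From mathcomp Require Import ring.
Set Implicit Arguments. Unset Strict Implicit. Unset Printing Implicit Defensive.
Import GRing.Theory.
Local Open Scope ring_scope.
Delimit Scope R_scope with Re.

(** * Quotient fields and ultraproducts *)

(** Ultraproducts and residue fields are both obtained as quotients of such a structure. Inverses
    are only asked to exist, so that neither instance has to choose them. *)
Record setoid_field := SetoidField {
  sf_car : Type;
  sf_eq : sf_car -> sf_car -> Prop;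
  sf_zero : sf_car; sf_one : sf_car;
  sf_add : sf_car -> sf_car -> sf_car;
  sf_mul : sf_car -> sf_car -> sf_car;
  sf_opp : sf_car -> sf_car;
  sf_refl : forall x, sf_eq x x;
  sf_sym : forall x y, sf_eq x y -> sf_eq y x;
  sf_trans : forall x y z, sf_eq x y -> sf_eq y z -> sf_eq x z;
  sf_addP : forall x x' y y', sf_eq x x' -> sf_eq y y' -> sf_eq (sf_add x y) (sf_add x' y');
  sf_mulP : forall x x' y y', sf_eq x x' -> sf_eq y y' -> sf_eq (sf_mul x y) (sf_mul x' y');
  sf_oppP : forall x x', sf_eq x x' -> sf_eq (sf_opp x) (sf_opp x');
  sf_addA : forall x y z, sf_eq (sf_add x (sf_add y z)) (sf_add (sf_add x y) z);
  sf_addC : forall x y, sf_eq (sf_add x y) (sf_add y x);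
  sf_add0 : forall x, sf_eq (sf_add sf_zero x) x;
  sf_addN : forall x, sf_eq (sf_add (sf_opp x) x) sf_zero;
  sf_mulA : forall x y z, sf_eq (sf_mul x (sf_mul y z)) (sf_mul (sf_mul x y) z);
  sf_mulC : forall x y, sf_eq (sf_mul x y) (sf_mul y x);
  sf_mul1 : forall x, sf_eq (sf_mul sf_one x) x;
  sf_mulD : forall x y z, sf_eq (sf_mul (sf_add x y) z) (sf_add (sf_mul x z) (sf_mul y z));
  sf_10 : ~ sf_eq sf_one sf_zero;
  sf_inv : forall x, ~ sf_eq x sf_zero -> exists y, sf_eq (sf_mul y x) sf_one }.

Section SetoidFieldQuotient.
Variable S : setoid_field.
Local Notation X := (sf_car S).
Local Notation E := (@sf_eq S).

Definition sfq : Type := {A : X -> Prop | exists x, A = E x}.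

HB.instance Definition _ := gen_eqMixin sfq.
HB.instance Definition _ := gen_choiceMixin sfq.

Definition sfpi (x : X) : sfq := exist _ (E x) (ex_intro _ x erefl).
Definition sfrepr (q : sfq) : X := projT1 (cid (proj2_sig q)).

Lemma sfpiE x y : sfpi x = sfpi y <-> E x y.
Proof.
split=> [h|h].
  have : E x = E y := congr1 (@proj1_sig _ _) h.
  by move=> ->; apply: sf_refl.
have e : E x = E y.
  apply: funext => z; apply: propext; split=> hz.
    exact: sf_trans (sf_sym h) hz.
  exact: sf_trans h hz.
rewrite /sfpi; move: (ex_intro _ x _) (ex_intro _ y _); rewrite e => h1 h2.
by rewrite (Prop_irrelevance h1 h2).
Qed.

Lemma sfreprK q : sfpi (sfrepr q) = q.
Proof.
rewrite /sfrepr /sfpi; case: (cid _) => x /=; case: q => A hA /= e.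
by subst A; rewrite (Prop_irrelevance hA (ex_intro _ x erefl)).
Qed.

Lemma sfreprE x : E (sfrepr (sfpi x)) x.
Proof. by apply/sfpiE; rewrite sfreprK. Qed.

Definition sfq0 := sfpi (sf_zero S).
Definition sfq1 := sfpi (sf_one S).
Definition sfq_add a b := sfpi (sf_add (sfrepr a) (sfrepr b)).
Definition sfq_mul a b := sfpi (sf_mul (sfrepr a) (sfrepr b)).
Definition sfq_opp a := sfpi (sf_opp (sfrepr a)).

Lemma sfq_addE x y : sfq_add (sfpi x) (sfpi y) = sfpi (sf_add x y).
Proof. by apply/sfpiE; apply: sf_addP; apply: sfreprE. Qed.
Lemma sfq_mulE x y : sfq_mul (sfpi x) (sfpi y) = sfpi (sf_mul x y).
Proof. by apply/sfpiE; apply: sf_mulP; apply: sfreprE. Qed.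
Lemma sfq_oppE x : sfq_opp (sfpi x) = sfpi (sf_opp x).
Proof. by apply/sfpiE; apply: sf_oppP; apply: sfreprE. Qed.

Lemma sfq_ind (P : sfq -> Prop) : (forall x, P (sfpi x)) -> forall q, P q.
Proof. by move=> h q; rewrite -(sfreprK q). Qed.

Lemma sfq_addA : associative sfq_add.
Proof.
elim/sfq_ind=> x; elim/sfq_ind=> y; elim/sfq_ind=> z.
by rewrite !sfq_addE; apply/sfpiE/sf_addA.
Qed.
Lemma sfq_addC : commutative sfq_add.
Proof. by elim/sfq_ind=> x; elim/sfq_ind=> y; rewrite !sfq_addE; apply/sfpiE/sf_addC. Qed.
Lemma sfq_add0 : left_id sfq0 sfq_add.
Proof. by elim/sfq_ind=> x; rewrite !sfq_addE; apply/sfpiE/sf_add0. Qed.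
Lemma sfq_addN : left_inverse sfq0 sfq_opp sfq_add.
Proof. by elim/sfq_ind=> x; rewrite sfq_oppE sfq_addE; apply/sfpiE/sf_addN. Qed.
HB.instance Definition _ := GRing.isZmodule.Build sfq sfq_addA sfq_addC sfq_add0 sfq_addN.

Lemma sfq_mulA : associative sfq_mul.
Proof.
elim/sfq_ind=> x; elim/sfq_ind=> y; elim/sfq_ind=> z.
by rewrite !sfq_mulE; apply/sfpiE/sf_mulA.
Qed.
Lemma sfq_mulC : commutative sfq_mul.
Proof. by elim/sfq_ind=> x; elim/sfq_ind=> y; rewrite !sfq_mulE; apply/sfpiE/sf_mulC. Qed.
Lemma sfq_mul1 : left_id sfq1 sfq_mul.
Proof. by elim/sfq_ind=> x; rewrite !sfq_mulE; apply/sfpiE/sf_mul1. Qed.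
Lemma sfq_mulD : left_distributive sfq_mul sfq_add.
Proof.
elim/sfq_ind=> x; elim/sfq_ind=> y; elim/sfq_ind=> z.
by rewrite !(sfq_addE, sfq_mulE); apply/sfpiE/sf_mulD.
Qed.
Lemma sfq_10 : sfq1 != sfq0.
Proof. by apply/eqP => /sfpiE /sf_10. Qed.
HB.instance Definition _ :=
  GRing.Zmodule_isComNzRing.Build sfq sfq_mulA sfq_mulC sfq_mul1 sfq_mulD sfq_10.

Lemma sfq_inv_ex (a : sfq) : exists b : sfq, (a != 0 -> b * a = 1) /\ (a = 0 -> b = 0).
Proof.
have [->|/eqP a0] := eqVneq a 0; first by exists 0; split.
elim/sfq_ind: a a0 => x x0.
have [|y hy] := @sf_inv S x; first by move=> /sfpiE /x0.
exists (sfpi y); split=> // _.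
by rewrite [LHS]sfq_mulE; apply/sfpiE.
Qed.
Definition sfq_inv a := projT1 (cid (sfq_inv_ex a)).
Lemma sfq_mulV (a : sfq) : a != 0 -> sfq_inv a * a = 1.
Proof. by rewrite /sfq_inv; case: cid => b [/= h _] /h. Qed.
Lemma sfq_inv0 : sfq_inv 0 = 0.
Proof. by rewrite /sfq_inv; case: cid => b [/= _ ->]. Qed.
HB.instance Definition _ := GRing.ComNzRing_isField.Build sfq sfq_mulV sfq_inv0.

Definition quot_field : fieldType := sfq.
Definition qcls (x : X) : quot_field := sfpi x.

Lemma qclsE x y : qcls x = qcls y <-> E x y. Proof. exact: sfpiE. Qed.
Lemma qcls_surj (q : quot_field) : exists x, q = qcls x.
Proof. by exists (sfrepr q); rewrite /qcls sfreprK. Qed.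
Lemma qcls0 : qcls (sf_zero S) = 0. Proof. by []. Qed.
Lemma qcls1 : qcls (sf_one S) = 1. Proof. by []. Qed.
Lemma qclsD x y : qcls (sf_add x y) = qcls x + qcls y. Proof. by symmetry; exact: sfq_addE. Qed.
Lemma qclsM x y : qcls (sf_mul x y) = qcls x * qcls y. Proof. by symmetry; exact: sfq_mulE. Qed.
Lemma qclsN x : qcls (sf_opp x) = - qcls x. Proof. by symmetry; exact: sfq_oppE. Qed.

End SetoidFieldQuotient.

(** * A non-principal ultrafilter on the natural numbers *)

Lemma ultrafilter_ex : exists U : (nat -> Prop) -> Prop,
  [/\ forall A B : nat -> Prop, (forall n, A n -> B n) -> U A -> U B,
      forall A B : nat -> Prop, U A -> U B -> U (fun n => A n /\ B n),
      forall A : nat -> Prop, U A \/ U (fun n => ~ A n),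
      ~ U (fun=> False) &
      forall N, U (fun n => (N <= n)%N)].
Proof.
pose F0 : set_system nat := fun A => exists N, forall n, (N <= n)%N -> A n.
have F0P : ProperFilter F0.
  apply: Build_ProperFilter => [[N /(_ N (leqnn N))] //|].
  split.
  - by exists 0%N.
  - move=> P Q [N hN] [M hM]; exists (maxn N M) => n.
    by rewrite geq_max => /andP [/hN ? /hM ?].
  - by move=> P Q PQ [N hN]; exists N => n /hN /PQ.
have [G [GU sub]] := ultraFilterLemma F0P.
have GP : ProperFilter G by apply: ultra_proper.
exists G; split.
- move=> A B AB; exact: filterS.
- move=> A B; exact: filterI.
- move=> A; have [h|h] := EM (G A); first by left.
  (* The filter generated by [G] and the complement of [A] is proper because [A] is not in [G]; by
     maximality it equals [G]. *)
  right; pose H : set_system nat := fun B => exists2 C, G C & forall n, C n -> ~ A n -> B n.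
  have HF : ProperFilter H.
    apply: Build_ProperFilter => [[C GC hC]|].
      apply: h; apply: filterS GC => n Cn; apply: contrapT => nA.
      exact: hC Cn nA.
    split.
    - by exists setT => //; apply: filterT.
    - move=> P Q [C GC hC] [C' GC' hC']; exists (fun n => C n /\ C' n); first exact: filterI.
      by move=> n [Cn C'n] nA; split; [apply: hC|apply: hC'].
    - move=> P Q PQ [C GC hC]; exists C => // n Cn nA; apply: PQ; exact: hC.
  have <- : H = G.
    by apply: (max_filter HF) => B GB; exists B.
  by exists setT => //; apply: filterT.
- exact: filter_not_empty.
- by move=> N; apply: sub; exists N.
Qed.

Definition UF : (nat -> Prop) -> Prop := projT1 (cid ultrafilter_ex).

Section UltrafilterTheory.
Implicit Types A B : nat -> Prop.
Lemma UFS A B : (forall n, A n -> B n) -> UF A -> UF B.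
Proof. by rewrite /UF; case: cid => U [h /= _ _ _ _]; apply: h. Qed.
Lemma UFI A B : UF A -> UF B -> UF (fun n => A n /\ B n).
Proof. by rewrite /UF; case: cid => U [/= _ h _ _ _]; apply: h. Qed.
Lemma UFT A : (forall n, A n) -> UF A.
Proof.
move=> h; have : UF (fun n => (0 <= n)%N) by rewrite /UF; case: cid => U [/= _ _ _ _]; apply.
by apply: UFS => n _; apply: h.
Qed.
Lemma UFinf N : UF (fun n => (N <= n)%N).
Proof. by rewrite /UF; case: cid => U [/= _ _ _ _]; apply. Qed.
Lemma UFN A : UF (fun n => ~ A n) <-> ~ UF A.
Proof.
rewrite /UF; case: cid => U [/= hS hI hC hF _]; split=> [h1 h2|].
  by apply: hF; apply: hS (hI _ _ h1 h2) => n [].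
by case: (hC A).
Qed.
Lemma UFand A B : UF (fun n => A n /\ B n) <-> UF A /\ UF B.
Proof. by split=> [h|[]]; [split; apply: UFS h => n []|apply: UFI]. Qed.
Lemma UFor A B : UF (fun n => A n \/ B n) <-> UF A \/ UF B.
Proof.
split=> [h|]; last by case; apply: UFS; tauto.
apply: contrapT => /not_orP [/UFN hA /UFN hB].
have : UF (fun n => False) by apply: UFS (UFI h (UFI hA hB)) => n; tauto.
have /UFN := @UFT (fun n => ~ False) (fun _ h => h); exact.
Qed.
Lemma UFimp A B : UF (fun n => A n -> B n) <-> (UF A -> UF B).
Proof.
split=> [h hA|h]; first by apply: UFS (UFI h hA) => n [] ab /ab.
have [hA|/UFN hA] := EM (UF A); first by apply: UFS (h hA).
by apply: UFS hA => n na /na.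
Qed.
Lemma UFex A : UF A -> exists n, A n.
Proof.
move=> h; apply: contrapT => /forallNP h'.
have /UFN := @UFT (fun n => ~ A n) h'; exact.
Qed.
Lemma UFconst (P : Prop) : UF (fun=> P) <-> P.
Proof. by split=> [/UFex []|h]; last exact: UFT. Qed.
Lemma UFiff A B : UF (fun n => A n <-> B n) -> (UF A <-> UF B).
Proof.
by move=> h; split=> h'; apply: UFS (UFI h h') => n []; tauto.
Qed.
Lemma UFchoice (X : nat -> Type) (d : forall n, X n) (P : forall n, X n -> Prop) :
  UF (fun n => exists x, P n x) <-> exists f, UF (fun n => P n (f n)).
Proof.
split=> [h|[f]]; last by apply: UFS => n Pn; exists (f n).
have [f hf] : exists f : forall n, X n, forall n, (exists x, P n x) -> P n (f n).
  have h2 n : exists x : X n, (exists x, P n x) -> P n x.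
    have [[x Px]|no] := EM (exists x, P n x); first by exists x.
    by exists (d n) => ex; case: no.
  by exists (fun n => projT1 (cid (h2 n))) => n; case: (cid (h2 n)).
by exists f; apply: UFS h.
Qed.
Lemma UFall (X : nat -> Type) (d : forall n, X n) (P : forall n, X n -> Prop) :
  UF (fun n => forall x, P n x) <-> forall f, UF (fun n => P n (f n)).
Proof.
split=> [h f|h]; first by apply: UFS h.
apply: contrapT => /UFN h'.
have /(UFchoice d) [f hf] : UF (fun n => exists x, ~ P n x).
  by apply: UFS h' => n /existsNP.
by move: (UFex (UFI hf (h f))) => [n []].
Qed.

(** Countable saturation by a diagonal choice. At index [n], [f n] satisfies the first [k]
    conditions for the largest satisfiable [k <= n]. For fixed [k], almost every [n] is at least [k]
    and admits a witness, hence [f n] is one. *)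
Lemma UFsat (X : nat -> Type) (d : forall n, X n) (P : nat -> forall n, X n -> Prop) :
  (forall k, UF (fun n => exists x, forall j, (j <= k)%N -> P j n x)) ->
  exists f, forall k, UF (fun n => P k n (f n)).
Proof.
move=> h.
pose Q n x k := forall j, (j <= k)%N -> P j n x.
have [f hf] : exists f : forall n, X n, forall n k, (k <= n)%N ->
    (exists x, Q n x k) -> Q n (f n) k.
  suff h2 n m : exists x : X n, forall k, (k <= m)%N -> (exists x, Q n x k) -> Q n x k.
    by exists (fun n => projT1 (cid (h2 n n))) => n; case: (cid (h2 n n)).
  elim: m => [|m [x hx]].
    have [[x Qx]|no] := EM (exists x, Q n x 0%N).
      by exists x => k; rewrite leqn0 => /eqP ->.
    by exists (d n) => k; rewrite leqn0 => /eqP -> /no.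
  have [[y Qy]|no] := EM (exists x, Q n x m.+1).
    by exists y => k km _ j jk; apply: Qy; apply: leq_trans km.
  exists x => k; rewrite leq_eqVlt => /orP [/eqP -> /no //|]; exact: hx.
exists f => k; apply: UFS (UFI (h k) (UFinf k)) => n [ex kn].
exact: hf kn ex k (leqnn k).
Qed.
End UltrafilterTheory.

(** * Ultraproducts of fields *)

Section Ultraproduct.
Variable K : nat -> fieldType.

Definition useq := forall n, K n.

Program Definition ultra_setoid : setoid_field := {|
  sf_car := useq;
  sf_eq f g := UF (fun n => f n = g n);
  sf_zero n := 0; sf_one n := 1;
  sf_add f g n := f n + g n;
  sf_mul f g n := f n * g n;
  sf_opp f n := - f n |}.
Next Obligation. by move=> f; apply: UFT. Qed.
Next Obligation. by move=> f g; apply: UFS. Qed.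
Next Obligation. by move=> f g h fg gh; apply: UFS (UFI fg gh) => n [-> ->]. Qed.
Next Obligation. by move=> f f' g g' h h'; apply: UFS (UFI h h') => n [-> ->]. Qed.
Next Obligation. by move=> f f' g g' h h'; apply: UFS (UFI h h') => n [-> ->]. Qed.
Next Obligation. by move=> f f'; apply: UFS => n ->. Qed.
Next Obligation. by move=> f g h; apply: UFT => n; rewrite addrA. Qed.
Next Obligation. by move=> f g; apply: UFT => n; rewrite addrC. Qed.
Next Obligation. by move=> f; apply: UFT => n; rewrite add0r. Qed.
Next Obligation. by move=> f; apply: UFT => n; rewrite addNr. Qed.
Next Obligation. by move=> f g h; apply: UFT => n; rewrite mulrA. Qed.
Next Obligation. by move=> f g; apply: UFT => n; rewrite mulrC. Qed.
Next Obligation. by move=> f; apply: UFT => n; rewrite mul1r. Qed.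
Next Obligation. by move=> f g h; apply: UFT => n; rewrite mulrDl. Qed.
Next Obligation. by move=> /UFex [n /eqP]; rewrite oner_eq0. Qed.
Next Obligation.
move=> f /UFN f0; exists (fun n => (f n)^-1).
by apply: UFS f0 => n /eqP fn0; rewrite mulVf.
Qed.

Definition ultra : fieldType := quot_field ultra_setoid.
Definition cls (f : useq) : ultra := qcls (f : sf_car ultra_setoid).

Lemma clsE f g : cls f = cls g <-> UF (fun n => f n = g n). Proof. exact: qclsE. Qed.
Lemma cls_surj (q : ultra) : exists f, q = cls f. Proof. by have [f ->] := qcls_surj q; exists f. Qed.
Lemma cls0 : cls (fun=> 0) = 0. Proof. exact: qcls0. Qed.
Lemma cls1 : cls (fun=> 1) = 1. Proof. exact: qcls1. Qed.
Lemma clsD f g : cls (fun n => f n + g n) = cls f + cls g.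
Proof. by rewrite /cls -qclsD. Qed.
Lemma clsM f g : cls (fun n => f n * g n) = cls f * cls g.
Proof. by rewrite /cls -qclsM. Qed.
Lemma clsN f : cls (fun n => - f n) = - cls f.
Proof. by rewrite /cls -qclsN. Qed.
Lemma clsB f g : cls (fun n => f n - g n) = cls f - cls g.
Proof. by rewrite clsD clsN. Qed.
Lemma cls_eq0 f : cls f = 0 <-> UF (fun n => f n = 0).
Proof. by rewrite -cls0 clsE. Qed.
Lemma cls_neq0 f : cls f != 0 <-> UF (fun n => f n != 0).
Proof.
split=> [/eqP /cls_eq0 /UFN|h]; first by apply: UFS => n /eqP.
by apply/eqP => /cls_eq0; apply/UFN; apply: UFS h => n /eqP.
Qed.
Lemma clsV f : cls (fun n => (f n)^-1) = (cls f)^-1.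
Proof.
have [/cls_eq0 h|/cls_neq0 h] := eqVneq (cls f) 0.
  have -> : cls f = 0 by apply/cls_eq0.
  by rewrite invr0; apply/cls_eq0; apply: UFS h => n ->; rewrite invr0.
have f0 : cls f != 0 by apply/cls_neq0.
apply: (mulIf f0); rewrite mulVf // -clsM -cls1; apply/clsE.
by apply: UFS h => n f0n; rewrite mulVf.
Qed.
Lemma cls_div f g : cls (fun n => f n / g n) = cls f / cls g.
Proof. by rewrite clsM clsV. Qed.
Lemma clsX f k : cls (fun n => f n ^+ k) = cls f ^+ k.
Proof.
elim: k => [|k IH]; first by rewrite expr0 -cls1; apply/clsE/UFT.
by rewrite exprS -IH -clsM; apply/clsE/UFT => n; rewrite exprS.
Qed.
Lemma cls_nat k : cls (fun n => k%:R) = k%:R.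
Proof.
elim: k => [|k IH]; first by rewrite mulr0n -cls0; apply/clsE/UFT.
by rewrite -addn1 natrD -IH -cls1 -clsD; apply/clsE/UFT => n; rewrite natrD.
Qed.
Lemma cls_sum (m : nat) (F : 'I_m -> useq) :
  cls (fun n => \sum_i F i n) = \sum_i cls (F i).
Proof.
elim: m F => [|m IH] F.
  by rewrite big_ord0 -cls0; apply/clsE/UFT => n; rewrite big_ord0.
rewrite big_ord_recl -IH -clsD; apply/clsE/UFT => n; by rewrite big_ord_recl.
Qed.

Definition upred (P : forall n, K n -> Prop) (x : ultra) : Prop :=
  exists f, x = cls f /\ UF (fun n => P n (f n)).

Lemma upredE (P : forall n, K n -> Prop) f : upred P (cls f) <-> UF (fun n => P n (f n)).
Proof.
split=> [[g [/clsE e h]]|h]; last by exists f.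
by apply: UFS (UFI e h) => n [->].
Qed.

Definition urep (x : ultra) : useq := projT1 (cid (cls_surj x)).
Lemma urepK x : cls (urep x) = x. Proof. by rewrite /urep; case: cid. Qed.

Lemma cls_updE (E : nat -> useq) i (f : useq) j :
  cls ((fun j n => upd (fun j => E j n) i (f n) j) j) = upd (fun j => cls (E j)) i (cls f) j.
Proof. by rewrite /upd; case: ifP. Qed.

End Ultraproduct.

(** * Łoś's theorem and elementary equivalence *)

Section LosTheorem.
Variable K : nat -> fieldType.
Implicit Types E : nat -> useq K.
Lemma sat_agree (L : fieldType) (f : rform) : forall (e e' : nat -> L),
  (forall i, i \in form_fv f -> e i = e' i) -> sat e f <-> sat e' f.
Proof.
have ht t : forall (e e' : nat -> L),
    (forall i, i \in term_fv t -> e i = e' i) -> teval e t = teval e' t.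
  elim: t => //= [i|a iha b ihb|a iha b ihb|a iha] e e' h.
  - by apply: h; rewrite mem_seq1.
  - by rewrite (iha e e') ?(ihb e e') // => i hi; apply: h; rewrite mem_cat hi ?orbT.
  - by rewrite (iha e e') ?(ihb e e') // => i hi; apply: h; rewrite mem_cat hi ?orbT.
  - by rewrite (iha e e').
elim: f => //= [a b|f ih|f ihf g ihg|f ihf g ihg|f ihf g ihg|i f ih|i f ih] e e' h.
- by rewrite (ht a e e') ?(ht b e e') // => i hi; apply: h; rewrite mem_cat hi ?orbT.
- by rewrite (ih e e').
- by rewrite (ihf e e') ?(ihg e e') // => i hi; apply: h; rewrite mem_cat hi ?orbT.
- by rewrite (ihf e e') ?(ihg e e') // => i hi; apply: h; rewrite mem_cat hi ?orbT.
- by rewrite (ihf e e') ?(ihg e e') // => i hi; apply: h; rewrite mem_cat hi ?orbT.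
- split=> H x; [rewrite -(ih (upd e i x))|rewrite (ih _ (upd e' i x))] => // j hj;
    rewrite /upd; case: eqP => // /eqP ji; apply: h; by rewrite mem_filter ji.
- split=> -[x H]; exists x; [rewrite -(ih (upd e i x))|rewrite (ih _ (upd e' i x))] => // j hj;
    rewrite /upd; case: eqP => // /eqP ji; apply: h; by rewrite mem_filter ji.
Qed.

Lemma sat_ext (L : fieldType) (e e' : nat -> L) f : e =1 e' -> sat e f <-> sat e' f.
Proof. by move=> h; apply: sat_agree. Qed.

Lemma los_term E t : teval (fun i => cls (E i)) t = cls (fun n => teval (fun i => E i n) t).
Proof.
elim: t => //= [a -> b ->|a -> b ->|a ->].
- by rewrite -clsD. - by rewrite -clsM. - by rewrite -clsN.
Qed.

Lemma los (f : rform) : forall E,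
  sat (fun i => cls (E i)) f <-> UF (fun n => sat (fun i => E i n) f).
Proof.
elim: f => /= [a b||f ih|f ihf g ihg|f ihf g ihg|f ihf g ihg|i f ih|i f ih] E.
- by rewrite !los_term clsE.
- by split=> // /UFex [].
- by rewrite UFN ih.
- by rewrite UFand ihf ihg.
- by rewrite UFor ihf ihg.
- by rewrite UFimp ihf ihg.
- rewrite (UFall (fun n => 0)).
  have aux (g : useq K) : sat (upd (fun i => cls (E i)) i (cls g)) f <->
      UF (fun n => sat (upd (fun i => E i n) i (g n)) f).
    by rewrite -(ih (fun j n => upd (fun j => E j n) i (g n) j));
      apply: sat_ext => j; rewrite cls_updE.
  split=> H; first by move=> g; apply/aux.
  by move=> x; have [g ->] := cls_surj x; apply/aux.
- rewrite (UFchoice (fun n => 0)).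
  have aux (g : useq K) : sat (upd (fun i => cls (E i)) i (cls g)) f <->
      UF (fun n => sat (upd (fun i => E i n) i (g n)) f).
    by rewrite -(ih (fun j n => upd (fun j => E j n) i (g n) j));
      apply: sat_ext => j; rewrite cls_updE.
  split=> [[x]|[g /aux]]; last by exists (cls g).
  by have [g ->] := cls_surj x => /aux; exists g.
Qed.
End LosTheorem.

Definition elem_equiv (K L : fieldType) : Prop :=
  forall f, sentence f -> models K f <-> models L f.

Lemma sat_sentence (L : fieldType) (e e' : nat -> L) f : sentence f -> sat e f <-> sat e' f.
Proof. by move=> h; apply: sat_agree => i; rewrite h. Qed.

Lemma models_sentence (L : fieldType) (e : nat -> L) f : sentence f -> models L f <-> sat e f.
Proof. by move=> h; split=> [|H e']; [apply|apply/(sat_sentence e e' h)]. Qed.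

Lemma los_sentence (K : nat -> fieldType) f : sentence f ->
  models (ultra K) f <-> UF (fun n => models (K n) f).
Proof.
move=> h; rewrite (models_sentence (fun i => cls (fun n => 0 : K n)) h).
rewrite (los f (fun i n => 0)); apply: UFiff; apply: UFT => n.
by rewrite -(models_sentence _ h).
Qed.

Lemma ultrapower_equiv (K : fieldType) : elem_equiv K (ultra (fun=> K)).
Proof. by move=> f h; rewrite los_sentence // UFconst. Qed.

(** * Valuation rings *)

Section ValuationRing.
Variables (K : fieldType) (O : K -> Prop).
Hypothesis VR : valuation_ring O.
Implicit Types x y z w : K.
Local Notation m := (vmax O).
Local Notation u := (vunit O).

Lemma vr0 : O 0. Proof. by case: VR. Qed.
Lemma vr1 : O 1. Proof. by case: VR. Qed.
Lemma vrB x y : O x -> O y -> O (x - y). Proof. by case: VR => _ _ h _ _; apply: h. Qed.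
Lemma vrM x y : O x -> O y -> O (x * y). Proof. by case: VR => _ _ _ h _; apply: h. Qed.
Lemma vrV x : ~ O x -> O x^-1.
Proof.
case: VR => O0 _ _ _ h nx; have [x0|x0] := eqVneq x 0; first by rewrite x0 in nx.
by case: (h x x0).
Qed.
Lemma vrN x : O x -> O (- x). Proof. by move=> h; rewrite -sub0r; apply: vrB => //; apply: vr0. Qed.
Lemma vrD x y : O x -> O y -> O (x + y).
Proof. by move=> hx hy; rewrite -[y]opprK; apply: vrB => //; apply: vrN. Qed.
Lemma vrX x n : O x -> O (x ^+ n).
Proof. by move=> h; elim: n => [|n IH]; rewrite ?expr0 ?exprS; [apply: vr1|apply: vrM]. Qed.
Lemma vr_nat n : O n%:R.
Proof. by elim: n => [|n IH]; [apply: vr0|rewrite -addn1 natrD; apply: vrD => //; apply: vr1]. Qed.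
Lemma vr_sum n (F : 'I_n -> K) : (forall i, O (F i)) -> O (\sum_i F i).
Proof. by move=> h; apply: (big_ind O) => //; [apply: vr0|apply: vrD]. Qed.

Lemma vmaxW x : m x -> O x. Proof. by case. Qed.
Lemma vmax0 : m 0. Proof. by split; [apply: vr0|case; rewrite eqxx]. Qed.
Lemma vmaxP x : m x <-> x = 0 \/ ~ O x^-1.
Proof.
split=> [[ox nu]|]; first have [->|x0] := eqVneq x 0; [by left|right|].
  by move=> oi; apply: nu.
case=> [->|h]; first exact: vmax0.
by split; [rewrite -[x]invrK; apply: vrV|case=> _ []].
Qed.
Lemma vmaxVP x : x != 0 -> m x <-> ~ O x^-1.
Proof.
move=> x0; rewrite vmaxP; split=> [[xe|//]|]; last by right.
by rewrite xe eqxx in x0.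
Qed.
Lemma vmax_inv x : m x -> x != 0 -> ~ O x^-1. Proof. by move=> h x0; apply/vmaxVP. Qed.
Lemma not_vmax x : ~ m x -> O x^-1.
Proof. by move=> h; apply: contrapT => h'; apply: h; apply/vmaxP; right. Qed.
Lemma vunit_not_max x : u x -> ~ m x. Proof. by move=> ux [_]. Qed.
Lemma vunitP x : O x -> u x \/ m x.
Proof. by move=> ox; have [h|h] := EM (u x); [left|right]. Qed.
Lemma vrN_max x : ~ O x -> m x^-1.
Proof. by move=> h; apply/vmaxP; right; rewrite invrK. Qed.
Lemma vmax1 : ~ m 1.
Proof. by case=> _; apply; split; [exact: oner_neq0|rewrite invr1; split; apply: vr1]. Qed.
Lemma vunit1 : u 1.
Proof. by split; [exact: oner_neq0|rewrite invr1; split; apply: vr1]. Qed.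
Lemma vunitM x y : u x -> u y -> u (x * y).
Proof.
move=> [x0 [ox ix]] [y0 [oy iy]]; split; first by rewrite mulf_neq0.
by rewrite invfM; split; apply: vrM.
Qed.
Lemma vunitV x : u x -> u x^-1.
Proof. by move=> [x0 [ox ix]]; split; rewrite ?invr_eq0 ?invrK. Qed.
Lemma vunitX x n : u x -> u (x ^+ n).
Proof. by move=> h; elim: n => [|n IH]; rewrite ?expr0 ?exprS; [apply: vunit1|apply: vunitM]. Qed.
Lemma vunitN x : u x -> u (- x).
Proof. by move=> [x0 [ox ix]]; split; rewrite ?oppr_eq0 ?invrN //; split; apply: vrN. Qed.

(* [vdiv x y] means v(x) <= v(y), also when x or y is 0, and [vlt x y] means v(x) < v(y). *)
Definition vdiv x y : Prop := exists2 c, O c & y = c * x.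
Definition vlt x y : Prop := ~ vdiv y x.

Lemma vdivE x y : x != 0 -> vdiv x y <-> O (y / x).
Proof.
move=> x0; split=> [[c oc ->]|h]; first by rewrite mulfK.
by exists (y / x); rewrite ?divfK.
Qed.
Lemma vdiv1 x : vdiv 1 x <-> O x. Proof. by rewrite vdivE ?oner_neq0 // divr1. Qed.
Lemma vdiv_refl x : vdiv x x. Proof. by exists 1; rewrite ?mul1r; [apply: vr1|]. Qed.
Lemma vdiv_trans y x z : vdiv x y -> vdiv y z -> vdiv x z.
Proof. by move=> [c oc ->] [d od ->]; exists (d * c); rewrite ?mulrA //; apply: vrM. Qed.
Lemma vdivx0 x : vdiv x 0. Proof. by exists 0; rewrite ?mul0r; [apply: vr0|]. Qed.
Lemma vdiv0x x : vdiv 0 x -> x = 0. Proof. by case=> c _ ->; rewrite mulr0. Qed.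
Lemma vdiv_total x y : vdiv x y \/ vdiv y x.
Proof.
have [->|x0] := eqVneq x 0; first by right; apply: vdivx0.
have [->|y0] := eqVneq y 0; first by left; apply: vdivx0.
have [h|h] := EM (O (y / x)); first by left; apply/vdivE.
by right; apply/vdivE => //; rewrite -[x / y]invrK invf_div; apply: vrV.
Qed.
Lemma vltW x y : vlt x y -> vdiv x y.
Proof. by move=> h; case: (vdiv_total x y). Qed.
Lemma vlt_irrefl x : ~ vlt x x. Proof. by apply; apply: vdiv_refl. Qed.
Lemma vlt_le_trans y x z : vlt x y -> vdiv y z -> vlt x z.
Proof. by move=> h1 h2 h3; apply: h1; apply: vdiv_trans h3. Qed.
Lemma vle_lt_trans y x z : vdiv x y -> vlt y z -> vlt x z.
Proof. by move=> h1 h2 h3; apply: h2; apply: vdiv_trans h1. Qed.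
Lemma vlt_trans y x z : vlt x y -> vlt y z -> vlt x z.
Proof. by move=> h1 /vltW; apply: vlt_le_trans. Qed.
Lemma vleNgt x y : ~ vlt x y -> vdiv y x. Proof. exact: contrapT. Qed.
Lemma vlt_neq0 x y : vlt x y -> x != 0.
Proof. by move=> h; apply/eqP => x0; apply: h; rewrite x0; apply: vdivx0. Qed.
Lemma vltx0 x : vlt x 0 <-> x != 0.
Proof. by split=> [/vlt_neq0 //|x0 /vdiv0x xe]; rewrite xe eqxx in x0. Qed.
Lemma vdiv_neq0 x y : vdiv x y -> y != 0 -> x != 0.
Proof. by move=> h y0; apply/eqP => x0; move: h y0; rewrite x0 => /vdiv0x ->; rewrite eqxx. Qed.
Lemma vlt1 x : vlt 1 x <-> m x.
Proof.
rewrite vmaxP; have [->|x0] := eqVneq x 0.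
  by split=> [_|_]; [left|apply/vltx0; rewrite oner_neq0].
rewrite /vlt vdivE // div1r; split=> [h|]; first by right.
by case=> // xe; rewrite xe eqxx in x0.
Qed.
Lemma vltE x y : x != 0 -> vlt x y <-> m (y / x).
Proof.
move=> x0; rewrite -vlt1 /vlt; split=> h h'; apply: h.
  by case: h' => c oc e; exists c => //; rewrite -(divfK x0 y) mulrA -e mul1r.
by case: h' => c oc e; exists c => //; rewrite mulrA -e divff.
Qed.
Lemma vdivM x y z w : vdiv x y -> vdiv z w -> vdiv (x * z) (y * w).
Proof. by move=> [c oc ->] [d od ->]; exists (c * d); [apply: vrM|ring]. Qed.
Lemma vdiv_mul2l z x y : z != 0 -> vdiv (z * x) (z * y) <-> vdiv x y.
Proof.
move=> z0; split=> [[c oc e]|h]; last by apply: vdivM => //; apply: vdiv_refl.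
by exists c => //; apply: (mulfI z0); rewrite e; ring.
Qed.
Lemma vlt_mul2l z x y : z != 0 -> vlt (z * x) (z * y) <-> vlt x y.
Proof. by move=> z0; rewrite /vlt vdiv_mul2l. Qed.
Lemma vdiv_mul2r z x y : z != 0 -> vdiv (x * z) (y * z) <-> vdiv x y.
Proof. by move=> z0; rewrite ![_ * z]mulrC vdiv_mul2l. Qed.
Lemma vlt_mul2r z x y : z != 0 -> vlt (x * z) (y * z) <-> vlt x y.
Proof. by move=> z0; rewrite /vlt vdiv_mul2r. Qed.
Lemma vltM x y z w : vlt x y -> vdiv z w -> z != 0 -> vlt (x * z) (y * w).
Proof.
move=> h1 h2 z0; apply: (@vlt_le_trans (y * z)); first by apply/vlt_mul2r.
by apply: vdivM => //; apply: vdiv_refl.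
Qed.
Lemma vdivD z x y : vdiv z x -> vdiv z y -> vdiv z (x + y).
Proof. by move=> [c oc ->] [d od ->]; exists (c + d); [apply: vrD|ring]. Qed.
Lemma vdivN z x : vdiv z (- x) <-> vdiv z x.
Proof.
by split=> -[c oc e]; exists (- c); rewrite ?mulNr -?e ?opprK //; apply: vrN.
Qed.
Lemma vdivNl z x : vdiv (- z) x <-> vdiv z x.
Proof.
by split=> -[c oc e]; exists (- c); rewrite ?e; try ring; apply: vrN.
Qed.
Lemma vltN z x : vlt z (- x) <-> vlt z x. Proof. by rewrite /vlt vdivNl. Qed.
Lemma vdivB z x y : vdiv z x -> vdiv z y -> vdiv z (x - y).
Proof. by move=> h1 h2; apply: vdivD => //; apply/vdivN. Qed.
Lemma vltD z x y : vlt z x -> vlt z y -> vlt z (x + y).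
Proof.
move=> h1 h2; case: (vdiv_total x y) => h.
  by apply: vlt_le_trans h1 _; apply: vdivD => //; apply: vdiv_refl.
by apply: vlt_le_trans h2 _; apply: vdivD => //; apply: vdiv_refl.
Qed.
Lemma vltB z x y : vlt z x -> vlt z y -> vlt z (x - y).
Proof. by move=> h1 h2; apply: vltD => //; apply/vltN. Qed.
Lemma vlt_sum z n (P : pred 'I_n) (F : 'I_n -> K) : z != 0 ->
  (forall i, P i -> vlt z (F i)) -> vlt z (\sum_(i | P i) F i).
Proof. by move=> z0 h; apply: (big_ind (vlt z)) => //; [apply/vltx0|apply: vltD]. Qed.
Lemma vlt_addE x y : vlt x y -> vdiv x (x + y) /\ vdiv (x + y) x.
Proof.
move=> h; split; first by apply: vdivD; [apply: vdiv_refl|apply: vltW].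
apply: contrapT => h'; apply: (@vlt_irrefl x).
rewrite -{2}[x](addrK y); apply: vltB => //; exact: h'.
Qed.
Lemma vdivX n x y : vdiv x y -> vdiv (x ^+ n) (y ^+ n).
Proof.
move=> h; elim: n => [|n IH]; rewrite ?expr0 ?exprS; first exact: vdiv_refl.
exact: vdivM.
Qed.
Lemma vltX n x y : (0 < n)%N -> vlt x y -> vlt (x ^+ n) (y ^+ n).
Proof.
case: n => // n _ h; rewrite !exprS; apply: vltM => //.
  by apply: vdivX; apply: vltW.
by rewrite expf_neq0 // (vlt_neq0 h).
Qed.
Lemma vdivX_inv n x y : (0 < n)%N -> vdiv (x ^+ n) (y ^+ n) -> vdiv x y.
Proof. by move=> n0 h; apply: vleNgt => /(vltX n0); apply. Qed.
Lemma vltX_inv n x y : vlt (x ^+ n) (y ^+ n) -> vlt x y.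
Proof. by move=> h h'; apply: h; apply: vdivX. Qed.
Lemma vmaxD x y : m x -> m y -> m (x + y). Proof. by rewrite -!vlt1; apply: vltD. Qed.
Lemma vmaxN x : m (- x) <-> m x. Proof. by rewrite -!vlt1 vltN. Qed.
Lemma vmaxB x y : m x -> m y -> m (x - y). Proof. by rewrite -!vlt1; apply: vltB. Qed.
Lemma vmaxM x y : m x -> O y -> m (x * y).
Proof.
rewrite -!vlt1 -vdiv1 -[X in vlt X (x * y)]mul1r => h1 h2.
by apply: vltM => //; apply: oner_neq0.
Qed.
Lemma vmaxMr x y : O x -> m y -> m (x * y). Proof. by rewrite mulrC => h1 h2; apply: vmaxM. Qed.
Lemma vmaxX x n : (0 < n)%N -> m x -> m (x ^+ n).
Proof. by rewrite -!vlt1 -[X in vlt X (x ^+ n)](expr1n _ n); apply: vltX. Qed.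
Lemma vmaxX_inv x n : m (x ^+ n) -> m x.
Proof. by rewrite -!vlt1 -[X in vlt X (x ^+ n)](expr1n _ n); apply: vltX_inv. Qed.
Lemma vrX_inv x n : (0 < n)%N -> O (x ^+ n) -> O x.
Proof. by move=> n0; rewrite -!vdiv1 -[X in vdiv X (x ^+ n)](expr1n _ n); apply: vdivX_inv. Qed.
Lemma vmax_sum n (P : pred 'I_n) (F : 'I_n -> K) :
  (forall i, P i -> m (F i)) -> m (\sum_(i | P i) F i).
Proof. by move=> h; apply: (big_ind m) => //; [apply: vmax0|apply: vmaxD]. Qed.
Lemma vunit_add x y : u x -> m y -> u (x + y).
Proof.
move=> ux my; have [//|h] := vunitP (vrD (proj1 (proj2 ux)) (vmaxW my)).
by case: (vunit_not_max ux); rewrite -[x](addrK y); apply: vmaxB.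
Qed.
Lemma vunit_1max x : m x -> u (1 + x). Proof. by apply: vunit_add; apply: vunit1. Qed.
Lemma vunitE x y : x != 0 -> u (y / x) <-> vdiv x y /\ vdiv y x.
Proof.
move=> x0; split=> [[yx [h1 h2]]|[h1 h2]].
  have y0 : y != 0 by apply: contraNN yx => /eqP ->; rewrite mul0r.
  by split; apply/vdivE => //; rewrite -invf_div.
have y0 := vdiv_neq0 h2 x0.
by split; rewrite ?mulf_neq0 ?invr_eq0 // invf_div; split; apply/vdivE.
Qed.

Lemma vr_horner (P : {poly K}) x : (forall i, O P`_i) -> O x -> O P.[x].
Proof.
by move=> hP ox; rewrite horner_coef; apply: vr_sum => i; apply: vrM => //; apply: vrX.
Qed.
Lemma vmax_horner (P : {poly K}) x : (forall i, m P`_i) -> O x -> m P.[x].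
Proof.
by move=> hP ox; rewrite horner_coef; apply: vmax_sum => i _; apply: vmaxM => //; apply: vrX.
Qed.
Lemma vr_natmul x n : O x -> O (x *+ n).
Proof. by move=> h; rewrite -mulr_natr; apply: vrM => //; apply: vr_nat. Qed.
Lemma vr_nderivn (P : {poly K}) j : (forall i, O P`_i) -> forall i, O (P^`N(j))`_i.
Proof. by move=> h i; rewrite coef_nderivn; apply: vr_natmul. Qed.
End ValuationRing.

(** * Hensel's lemma in Newton form *)

(* Equivalent to [henselian], but involving only the maximal ideal, so that it passes at
   once to coarsenings and to relatively algebraically closed subfields. *)
Definition newtonian (K : fieldType) (O : K -> Prop) : Prop :=
  forall P : {poly K}, P`_0 = 1 -> P`_1 = 1 ->
    (forall i, (2 <= i)%N -> vmax O P`_i) ->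
    exists z, [/\ O z, P.[z] = 0 & vmax O (z + 1)].

Section Newton.
Variables (K : fieldType) (O : K -> Prop).
Hypothesis VR : valuation_ring O.

(** Taylor's formula at [c + f(c) / f'(c) * z], divided by [f(c)], is a polynomial
    [1 + z + d_2 z^2 + ...] in [z], to which [newtonian] applies. Smallness is asked of the [d_i]
    alone, so the lemma serves for coefficients of arbitrary value. *)
Lemma newton_lemma (f : {poly K}) (c : K) : newtonian O ->
  f^`().[c] != 0 ->
  (forall i, (2 <= i)%N -> vmax O (f^`N(i).[c] * f.[c] ^+ i.-1 / f^`().[c] ^+ i)) ->
  exists z, [/\ O z, f.[c + f.[c] / f^`().[c] * z] = 0 & vmax O (z + 1)].
Proof.
move=> hN c1 hi; have [f0|f0] := eqVneq f.[c] 0.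
  (* Every [z] gives a root when [f(c) = 0]; the value [-1] meets the condition on [z + 1]. *)
  exists (-1); rewrite f0 !mul0r addr0 f0 addNr; split=> //; last exact: vmax0.
  by apply: (vrN VR); apply: vr1.
pose d i := if (i < 2)%N then 1 else f^`N(i).[c] * f.[c] ^+ i.-1 / f^`().[c] ^+ i.
pose N := maxn 2 (size f).
have dE i : (\poly_(i < N) d i)`_i = if (i < N)%N then d i else 0 by rewrite coef_poly.
have [|||z [oz rz mz]] := hN (\poly_(i < N) d i).
- by rewrite dE leq_max.
- by rewrite dE leq_max.
- move=> i i2; rewrite dE; case: ifP => _; last exact: vmax0.
  by rewrite /d ltnNge i2 /=; apply: hi.
exists z; split=> //.
rewrite nderiv_taylor; last exact: mulrC.
suff -> : \sum_(i < size f) f^`N(i).[c] * (f.[c] / f^`().[c] * z) ^+ i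
    = f.[c] * (\poly_(i < N) d i).[z] by rewrite rz mulr0.
have -> : \sum_(i < size f) f^`N(i).[c] * (f.[c] / f^`().[c] * z) ^+ i
   = \sum_(i < N) f^`N(i).[c] * (f.[c] / f^`().[c] * z) ^+ i.
  rewrite /N -!(big_mkord xpredT (fun i => f^`N(i).[c] * (f.[c] / f^`().[c] * z) ^+ i)).
  rewrite (@big_cat_nat _ _ _ (size f) 0 (maxn 2 (size f))) ?leq_maxr //=.
  rewrite [X in _ + X]big_nat_cond [X in _ + X]big1 ?addr0 // => i; rewrite andbT => /andP [hs _].
  rewrite (_ : f^`N(i) = 0) ?horner0 ?mul0r //.
  by apply/polyP => j; rewrite coef_nderivn coef0 nth_default ?mul0rn // (leq_trans hs) // leq_addr.
rewrite horner_poly mulr_sumr; apply: eq_bigr => i _.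
case: i => -[|[|i]] hin /=; rewrite /d /=.
- by rewrite nderivn0 !expr0 !mulr1.
- by rewrite nderivn1 !expr1 mul1r; field.
- rewrite !exprMn exprVn; have : f^`().[c] ^+ i.+2 != 0 by rewrite expf_neq0.
  move: (f^`().[c] ^+ i.+2) (f^`N(_).[c]) => A B A0; rewrite exprS; field.
  exact: A0.
Qed.

Lemma newtonian_henselian : newtonian O -> henselian O.
Proof.
move=> hN f a _ hf oa ma [d0 [od oid]].
have [|z [oz rz mz]] := newton_lemma hN d0.
  case=> [|[|i]] // _ /=; rewrite [f.[a] ^+ _]exprS -exprVn.
  have oa' := vr_horner VR hf oa.
  apply: (vmaxM VR); last exact: vrX.
  apply: (vmaxMr VR); first by apply: vr_horner => //; apply: vr_nderivn.
  by apply: (vmaxM VR) => //; apply: vrX.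
have mq : vmax O (f.[a] / f^`().[a] * z) by rewrite -mulrA; apply: (vmaxM VR) => //; apply: vrM.
exists (a + f.[a] / f^`().[a] * z); split.
- by apply: (vrD VR) => //; apply: vmaxW.
- by apply/rootP.
- by rewrite addrC addKr.
Qed.

(** The reversed polynomial [X^n * P(1/X)] is monic and congruent to [X^n + X^(n-1)] modulo the
    maximal ideal. It has a simple root near [-1], whose inverse is the required root of [P]. *)
Lemma henselian_newtonian : henselian O -> newtonian O.
Proof.
move=> hH P P0 P1 hP.
have sP : (1 < size P)%N.
  by rewrite ltnNge; apply/negP => sz; move: P1; rewrite nth_default // => /esym /eqP;
     rewrite oner_eq0.
pose n := (size P).-1; have szn : size P = n.+1 by rewrite /n prednK // ltnW.
have n0 : (0 < n)%N by rewrite -ltnS -szn.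
pose R := \poly_(i < n.-1) P`_(n - i).
pose Q := 'X^n + ('X^(n.-1) + R).
have mR i : vmax O R`_i.
  rewrite coef_poly; case: ifP => hi; last exact: vmax0.
  by apply: hP; rewrite ltn_subRL addn1; case: (n) n0 hi.
have QE b : b != 0 -> Q.[b] = b ^+ n * P.[b^-1].
  move=> b0; rewrite /Q !(hornerD, hornerXn) horner_poly [in RHS]horner_coef szn mulr_sumr.
  rewrite big_ord_recl P0 mul1r expr0 mulr1; congr (_ + _).
  case: (n) n0 => // k _ /=; rewrite big_ord_recl /= P1 mul1r expr1.
  congr (_ + _); first by rewrite exprS mulrC mulKf.
  rewrite (reindex_inj rev_ord_inj) /=.
  apply: eq_bigr => i _; rewrite /bump /= !add1n.
  rewrite (_ : (k.+1 - (k - i.+1) = i.+2)%N); last first.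
    by rewrite subSn ?leq_subr // subKn.
  rewrite mulrCA; congr (_ * _).
  rewrite exprVn -exprB ?unitfE //.
  by rewrite ltnS (leq_trans (ltn_ord i)).
have oR i : O R`_i := vmaxW (mR i).
have Xn k i : O (('X^k : {poly K})`_i) by rewrite coefXn; apply: vr_nat.
have om1 : O (-1) by apply: (vrN VR); apply: vr1.
have sR : (size R <= n.-1)%N by apply: size_poly.
have s2 : (size ('X^(n.-1) + R)%R < size ('X^n : {poly K}))%N.
  rewrite size_polyXn ltnS (leq_trans (size_polyD _ _)) // geq_max size_polyXn prednK // leqnn /=.
  by rewrite (leq_trans sR) // leq_pred.
have mons : Q \is monic by rewrite monicE lead_coefDl // lead_coefXn.
have mder i : vmax O R^`()`_i.
  by rewrite coef_deriv -mulr_natr; apply: (vmaxM VR) => //; apply: vr_nat.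
have [|||b [ob rb mb]] := hH Q (-1) mons _ om1.
- by move=> i; rewrite !coefD; do 2?apply: (vrD VR).
- rewrite /Q !(hornerD, hornerXn) -{1}(prednK n0) exprS mulN1r addrA addNr add0r.
  exact: vmax_horner.
- rewrite /Q !derivE !(hornerD, hornerMn, hornerXn) addrA.
  apply: (vunit_add VR); last exact: vmax_horner.
  case: (n) n0 => // -[|k] _ /=; first by rewrite expr0 addr0; apply: vunit1.
  rewrite exprS mulN1r mulNrn mulrSr opprD addrAC addNr add0r.
  by apply: (vunitN VR); apply: (vunitX VR); apply: (vunitN VR); apply: vunit1.
rewrite opprK in mb.
have ub : vunit O b.
  by rewrite -[b](addrK 1) addrC; apply: (vunit_add VR) => //; apply: (vunitN VR); apply: vunit1.
have [b0 [_ oib]] := ub.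
exists b^-1; split=> //.
- by move/rootP: rb; rewrite QE // => /eqP; rewrite mulf_eq0 expf_eq0 (negPf b0) andbF => /eqP.
- rewrite (_ : b^-1 + 1 = (b + 1) * b^-1); last by rewrite mulrDl divff // mul1r addrC.
  exact: vmaxM.
Qed.
End Newton.

(** * Regular non-discrete value groups *)

(* Between any v(x) < v(x) + v(a) there is an n-divisible value. *)
Definition dense_divisible (K : fieldType) (O : K -> Prop) : Prop :=
  forall (a x : K) n, a != 0 -> vmax O a -> x != 0 -> (0 < n)%N ->
    exists y : K, [/\ y != 0, vmax O (y ^+ n / x) & vmax O (a * x / y ^+ n)].

Section Regular.
Variables (K : fieldType) (O : K -> Prop).
Hypothesis VR : valuation_ring O.
Local Notation m := (vmax O).

(** Choose [c] with value strictly between 0 and [v(a)]; the smaller of [v(c)] and [v(a / c)] is at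
    most half of [v(a)]. *)
Lemma nondiscrete_half a : nondiscrete O -> a != 0 -> m a ->
  exists b, [/\ b != 0, m b & O (a / b ^+ 2)].
Proof.
move=> nd a0 ma.
have [c [c0 mc nac]] : exists c, [/\ c != 0, m c & ~ vle O a c].
  apply: contrapT => H; apply: nd; exists a; split=> // y y0 my.
  by apply: contrapT => h; apply: H; exists y.
have mac : m (a / c).
  by rewrite -[a / c]invrK invf_div; apply: vrN_max.
have ac0 : a / c != 0 by rewrite mulf_neq0 ?invr_eq0.
case: (vdiv_total VR c (a / c)) => /vdivE h.
  by exists c; split=> //; rewrite expr2 invfM mulrA; apply: h.
exists (a / c); split=> //.
rewrite (_ : a / (a / c) ^+ 2 = c / (a / c)); first exact: h.
by field; rewrite ?a0 ?c0.
Qed.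

Lemma nondiscrete_div a n : nondiscrete O -> a != 0 -> m a ->
  exists b, [/\ b != 0, m b & O (a / b ^+ n.+1)].
Proof.
move=> nd a0 ma; elim: n => [|n [b [b0 mb hb]]].
  by exists a; split=> //; rewrite expr1 divff //; apply: (vr1 VR).
have [c [c0 mc hc]] := nondiscrete_half nd b0 mb.
exists c; split=> //.
have -> : a / c ^+ n.+2 = a / b ^+ n.+1 * (b / c ^+ 2) ^+ n.+1 * c ^+ n.
  have e : b ^+ n.+1 != 0 by rewrite expf_neq0.
  have e1 : c ^+ n.+2 != 0 by rewrite expf_neq0.
  have e2 : c ^+ n != 0 by rewrite expf_neq0.
  rewrite expr_div_n -exprM (_ : (2 * n.+1 = n.+2 + n)%N); last by rewrite mul2n -addnn addSnnS addnC.
  by rewrite exprD; move: (b ^+ n.+1) (c ^+ n.+2) (c ^+ n) e e1 e2 => B C D e e1 e2; field; rewrite ?e ?e1 ?e2.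
by apply: (vrM VR); [apply: (vrM VR) => //|]; apply: (vrX VR) => //; apply: vmaxW.
Qed.

(** This is the first-order description of dense regular groups due to Robinson and Zakon. If some
    non-trivial convex subgroup avoids [v(a)], divisibility modulo it is precise enough. Otherwise
    the multiples of any positive value pass [v(a)], and an archimedean argument in small steps
    applies. *)
Lemma regular_dense : regular_value_group O -> nondiscrete O -> dense_divisible O.
Proof.
move=> reg nd.
(* The lower bound may be weakened: for [b] with [2 v(b) <= v(a)], the weak form for [b] and [x * b]
   gives the strict form for [a] and [x]. *)
suff W a x n : a != 0 -> m a -> x != 0 -> (0 < n)%N ->
    exists y, [/\ y != 0, O (y ^+ n / x) & m (a * x / y ^+ n)].
  move=> a x n a0 ma x0 n0.
  have [b [b0 mb hb]] := nondiscrete_half nd a0 ma.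
  have [|y [y0 h1 h2]] := W b (x * b) n b0 mb _ n0; first by rewrite mulf_neq0.
  have yn0 : y ^+ n != 0 by rewrite expf_neq0.
  exists y; split=> //.
    by rewrite (_ : _ / _ = b * (y ^+ n / (x * b))); [apply: (vmaxM VR)|field; rewrite ?b0 ?x0].
  rewrite (_ : _ / _ = a / b ^+ 2 * (b * (x * b) / y ^+ n)); last by field; rewrite ?yn0 ?b0.
  exact: (vmaxMr VR).
move=> a0 ma x0 n0.
(* The largest convex subgroup that does not contain [v(a)]. *)
pose H h := h != 0 /\ forall k, m (a * h ^+ k) /\ m (a / h ^+ k).
have HV h : H h -> H h^-1.
  move=> [h0 hk]; split; rewrite ?invr_eq0 // => k.
  by rewrite !exprVn invrK; have [] := hk k.
have HM h h' : H h -> H h' -> H (h * h').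
  move=> [h0 hk] [h0' hk']; split; rewrite ?mulf_neq0 // => k.
  have e : h ^+ k != 0 by rewrite expf_neq0.
  have e' : h' ^+ k != 0 by rewrite expf_neq0.
  have [p1 p2] := hk (2 * k)%N; have [q1 q2] := hk' (2 * k)%N.
  rewrite exprMn; split; apply: (@vmaxX_inv _ _ VR _ 2%N).
    rewrite (_ : _ ^+ 2 = (a * h ^+ (2 * k)) * (a * h' ^+ (2 * k))).
      by apply: (vmaxM VR) => //; apply: vmaxW.
    by rewrite !mul2n -!addnn !exprD; ring.
  rewrite (_ : _ ^+ 2 = (a / h ^+ (2 * k)) * (a / h' ^+ (2 * k))).
    by apply: (vmaxM VR) => //; apply: vmaxW.
  by rewrite !mul2n -!addnn !exprD; field; rewrite ?e ?e'.
have Hcv : convex_subgroup O H.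
  split; first by move=> h [].
  - by split; [apply: oner_neq0|move=> k; rewrite expr1n mulr1 divr1].
  - by move=> h h' Hh Hh'; apply: HM => //; apply: HV.
  move=> h y [h0 hk] y0; rewrite /vle divr1 => oy oyh; split=> // k; split.
    by apply: (vmaxM VR) => //; apply: (vrX VR).
  have [_ h2] := hk k.
  rewrite (_ : _ / _ = a / h ^+ k * (h / y) ^+ k); first by apply: (vmaxM VR) => //; apply: (vrX VR).
  have e : h ^+ k != 0 by rewrite expf_neq0.
  have e' : y ^+ k != 0 by rewrite expf_neq0.
  by rewrite expr_div_n; field; rewrite ?e ?e'.
have [/(reg _ Hcv) Hdiv|noH] := EM (exists h, H h /\ ~ vunit O h).
  have [y [y0 Hy]] := Hdiv x x0 n n0.
  have [h0 _] := Hy.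
  set h := y ^+ n / x in Hy h0.
  have [g [Hg og]] : exists g, H g /\ O (h * g ^+ n).
    have [oh|noh] := EM (O h); first by exists h; split=> //; apply: (vrM VR) => //; apply: (vrX VR).
    exists h^-1; split; first exact: HV.
    rewrite -(prednK n0) exprS mulrA divff // mul1r; apply: (vrX VR); exact: vrV.
  have [g0 _] := Hg.
  have e : (y * g) ^+ n / x = h * g ^+ n by rewrite exprMn /h; field.
  have Hgn k : H (g ^+ k).
    elim: k => [|k IH]; last by rewrite exprS; apply: HM.
    by rewrite expr0; case: Hcv.
  have yg0 : y * g != 0 by rewrite mulf_neq0.
  exists (y * g); split=> //; first by rewrite e.
  have [_ /(_ 1%N) []] := HM _ _ Hy (Hgn n); rewrite !expr1 => _.
  by rewrite -e invf_div mulrA.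
(* Now [H] is trivial, so [b] is not in it and some multiple of [v(b)] reaches [v(a)]. *)
have [b [b0 mb hb]] : exists b, [/\ b != 0, m b & forall k, (k <= n)%N -> O (a / b ^+ k)].
  have [b [b0 mb hb]] := nondiscrete_div n nd a0 ma.
  exists b; split=> // k kn; rewrite (_ : _ / _ = a / b ^+ n.+1 * b ^+ (n.+1 - k)).
    by apply: (vrM VR) => //; apply: (vrX VR); apply: vmaxW.
  rewrite -{1}(subnK (leqW kn)) exprD.
  have e : b ^+ (n.+1 - k) != 0 by rewrite expf_neq0.
  have e' : b ^+ k != 0 by rewrite expf_neq0.
  by field; rewrite ?e ?e'.
have [k hk] : exists k, O (b ^+ k / a).
  apply: contrapT => /forallNP no; apply: noH; exists b; split; last by move=> /vunit_not_max.
  split=> // k; split; first by apply: (vmaxM VR) => //; apply: (vrX VR); apply: vmaxW.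
  by rewrite -[a / _]invrK invf_div; apply: vrN_max => //; apply: no.
(* The convex subgroup generated by [v(a)]. Divisibility modulo [H2] yields [y] with [y ^ n / x] of
   absolute value at most [j v(a)]. *)
pose H2 h := h != 0 /\ exists k, O (h * a ^+ k) /\ O (a ^+ k / h).
have H2V h : H2 h -> H2 h^-1.
  move=> [h0 [j [p1 p2]]]; split; rewrite ?invr_eq0 //; exists j.
  by rewrite invrK ![_^-1 * _]mulrC ![_ * h]mulrC.
have H2M h h' : H2 h -> H2 h' -> H2 (h * h').
  move=> [h0 [j [p1 p2]]] [h0' [j' [p1' p2']]]; split; rewrite ?mulf_neq0 //.
  exists (j + j')%N; rewrite exprD; split.
    by rewrite (_ : _ * _ = (h * a ^+ j) * (h' * a ^+ j')); [apply: (vrM VR)|ring].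
  rewrite (_ : _ / _ = (a ^+ j / h) * (a ^+ j' / h')); first exact: (vrM VR).
  by field; rewrite ?h0 ?h0'.
have H2cv : convex_subgroup O H2.
  split; first by move=> h [].
  - split; first exact: oner_neq0.
    by exists 0%N; rewrite expr0 mulr1 divr1; split; apply: (vr1 VR).
  - by move=> h h' Hh Hh'; apply: H2M => //; apply: H2V.
  move=> h y [h0 [j [p1 p2]]] y0; rewrite /vle divr1 => oy oyh; split=> //.
  exists j; split; first by apply: (vrM VR) => //; apply: (vrX VR); apply: vmaxW.
  by rewrite (_ : _ / _ = (a ^+ j / h) * (h / y)); [apply: (vrM VR)|field; rewrite ?h0 ?y0 ?x0 ?b0 ?a0 ?bX ?aX].
have H2a : H2 a.
  split=> //; exists 1%N; rewrite expr1 divff //; split; last exact: (vr1 VR).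
  by apply: (vrM VR); apply: vmaxW.
have [|y [y0 [h0 [j [p1 p2]]]]] := reg _ H2cv _ x x0 n n0.
  by exists a; split=> // /vunit_not_max.
set h := y ^+ n / x in h0 p1 p2.
have bX i : b ^+ i != 0 by rewrite expf_neq0.
have aX i : a ^+ i != 0 by rewrite expf_neq0.
(* The factor [a ^ j] makes [z 0 ^ n / x] integral. Each step lowers the value of the [n]-th power
   by [n v(b) <= v(a)], so the last integral one has value less than [v(a)]. *)
pose z i := y * a ^+ j / b ^+ i.
have zE i : z i ^+ n / x = h * a ^+ (j * n) / b ^+ (i * n).
  rewrite /z expr_div_n exprMn -!exprM /h; field.
  by rewrite x0 bX.
have z0 i : z i != 0 by rewrite /z !mulf_neq0 ?invr_eq0 //.
have oz0 : O (z 0%N ^+ n / x).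
  rewrite zE mul0n expr0 divr1 -(prednK n0) mulnS exprD mulrA; apply: (vrM VR) => //.
  by apply: (vrX VR); apply: vmaxW.
have [N nN] : exists N, ~ O (z N ^+ n / x).
  (* Since [v(h) <= j v(a)] and [v(a) <= k v(b)], the value of [h * a ^ (j * n)] is at most
     [k (j + j n) v(b)]; one further step makes the value negative. *)
  exists ((k * (j + j * n)).+1)%N => oN.
  have : O ((z (k * (j + j * n)).+1 ^+ n / x) * (a ^+ j / h) * (b ^+ k / a) ^+ (j + j * n)
            * b ^+ (n.-1 * (k * (j + j * n)).+1)).
    apply: (vrM VR); last by apply: (vrX VR); apply: vmaxW.
    apply: (vrM VR); last exact: (vrX VR).
    exact: (vrM VR).
  rewrite zE (_ : _ * _ * _ * _ = b^-1); first exact: vmax_inv.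
  rewrite expr_div_n -exprM (exprD a).
  have -> : ((k * (j + j * n)).+1 * n = 1 + k * (j + j * n) + (n.-1 * (k * (j + j * n)).+1))%N.
    by move: (k * _)%N => q; rewrite -{1}(prednK n0) mulnS add1n mulnC.
  rewrite !exprD expr1.
  move: (aX j) (aX (j * n)%N) (bX (k * (j + j * n))%N) (bX (n.-1 * (k * (j + j * n)).+1)%N).
  move: (b ^+ (n.-1 * (k * (j + j * n)).+1)) (b ^+ (k * (j + j * n))) => B B'.
  move: (a ^+ (j * n)) (a ^+ j) => A A' hA' hA hB' hB.
  by field; rewrite ?h0 ?hA ?hA' ?hB ?hB' ?b0.
have [i [oi noi]] : exists i, O (z i ^+ n / x) /\ ~ O (z i.+1 ^+ n / x).
  apply: contrapT => no; apply: nN; elim: N => // i IH.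
  by apply: contrapT => h'; apply: no; exists i.
exists (z i); split=> //.
have e : a * x / z i ^+ n = a / b ^+ n * (z i.+1 ^+ n / x)^-1.
  have -> : z i.+1 = z i / b by rewrite /z exprSr invfM mulrA.
  move: (z i) (z0 i) => w /(expf_neq0 n); rewrite expr_div_n.
  move: (w ^+ n) (b ^+ n) (bX n) => Z B B0 Z0.
  by field; rewrite ?x0 ?B0 ?Z0.
rewrite e; apply: (vmaxMr VR); last exact: vrN_max.
exact: hb.
Qed.

Lemma dense_regular : dense_divisible O -> regular_value_group O /\ nondiscrete O.
Proof.
move=> D; split.
  move=> H [H0 H1 HD Hc] [h [Hh nuh]] x x0 n n0.
  have [a [a0 ma Ha]] : exists a, [/\ a != 0, m a & H a].
    have h0 := H0 _ Hh.
    have [mh|nmh] := EM (m h); first by exists h.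
    exists h^-1; split; rewrite ?invr_eq0 //; last by rewrite -[h^-1]mul1r; apply: HD.
    apply: contrapT => h2; apply: nuh; split=> //.
    by split; [rewrite -[h]invrK|]; apply: not_vmax.
  have [y [y0 h1 h2]] := D a x n a0 ma x0 n0.
  have yn0 : y ^+ n != 0 by rewrite expf_neq0.
  exists y; split=> //; apply: (Hc a) => //; rewrite ?mulf_neq0 ?invr_eq0 ?expf_neq0 //.
    by rewrite /vle divr1; apply: vmaxW.
  by rewrite /vle invf_div mulrA; apply: vmaxW.
move=> [a [a0 ma Hmin]].
have [y [y0]] := D a 1 1%N a0 ma (oner_neq0 _) isT.
rewrite expr1 divr1 mulr1 => my may.
have := Hmin y y0 my; rewrite /vle -[y / a]invrK invf_div.
by apply: vmax_inv; rewrite // mulf_neq0 ?invr_eq0.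
Qed.
End Regular.

(** * Polynomials over valued fields *)

(** Both products of binomial coefficients become [(i + j + k)!] after multiplication by
    [i! j! k!]. *)
Lemma nderivn_nderivn (R : comNzRingType) (P : {poly R}) i j :
  (P^`N(i))^`N(j) = P^`N(i + j) *+ 'C(i + j, i).
Proof.
apply/polyP => k; rewrite coefMn !coef_nderivn -!mulrnA addnA; congr (_ *+ _).
set n := (i + j + k)%N.
have h1 : ('C(n, i) * 'C(j + k, j) * (i`! * j`! * k`!) = n`!)%N.
  have e1 := bin_fact (leq_addr (j + k) i); have e2 := bin_fact (leq_addr k j).
  rewrite addKn in e1; rewrite addKn in e2.
  by rewrite /n -addnA -e1 -e2; ring.
have h2 : ('C(n, i + j) * 'C(i + j, i) * (i`! * j`! * k`!) = n`!)%N.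
  have e1 := bin_fact (leq_addr k (i + j)); have e2 := bin_fact (leq_addr j i).
  rewrite addKn in e1; rewrite addKn in e2.
  by rewrite /n -e1 -e2; ring.
apply/eqP; rewrite -(@eqn_pmul2r (i`! * j`! * k`!)) ?muln_gt0 ?fact_gt0 //.
by apply/eqP; rewrite h2 -h1; ring.
Qed.

Lemma taylor_sub (K : fieldType) (P : {poly K}) b c :
  P.[c] = \sum_(i < size P) P^`N(i).[b] * (c - b) ^+ i.
Proof.
rewrite -{1}(subrK b c) [X in P.[X]]addrC nderiv_taylor //; exact: mulrC.
Qed.

Section ValuedPolynomials.
Variables (K : fieldType) (O : K -> Prop).
Hypothesis VR : valuation_ring O.
Local Notation m := (vmax O).
Local Notation "x <=v y" := (vdiv O x y) (at level 70).
Local Notation "x <v y" := (vlt O x y) (at level 70).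

Lemma vdiv_natmul x n : x <=v x *+ n.
Proof. by exists n%:R; [apply: vr_nat|rewrite mulr_natl]. Qed.

(* P varies little, compared with P(b), on the ball of radius r around b. *)
Definition stable (r b : K) (P : {poly K}) : Prop :=
  P.[b] != 0 /\ forall i, (0 < i)%N -> P.[b] <v P^`N(i).[b] * r ^+ i.

(** In the Taylor expansion of [P(c)] at [b] every term after the first has larger value than
    [P(b)]. The Hasse derivatives at [c] expand in the same way, which transports stability to the
    new centre. *)
Lemma stable_move r b c P : stable r b P -> r <=v c - b ->
  stable r c P /\ P.[b] <v P.[c] - P.[b].
Proof.
move=> [Pb0 st] rc.
have P0 : P != 0 by apply: contraNN Pb0 => /eqP ->; rewrite horner0.
have lt1 : P.[b] <v P.[c] - P.[b].
  rewrite (taylor_sub P b c) polySpred // big_ord_recl /= nderivn0 expr0 mulr1 [X in _ <v X]addrC addKr.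
  apply: vlt_sum => // i _.
  apply: (vlt_le_trans VR (st (lift ord0 i) _)) => //.
  by apply: (vdivM VR); [apply: (vdiv_refl VR)|apply: (vdivX VR)].
have [_ le1] := vlt_addE VR lt1; rewrite addrC subrK in le1.
split=> //; split; first exact: (vdiv_neq0 le1).
move=> i i0; apply: (vle_lt_trans VR le1).
rewrite (taylor_sub P^`N(i) b c) mulr_suml; apply: (vlt_sum VR) => // k _.
rewrite nderivn_nderivn hornerMn.
apply: (vlt_le_trans VR (st (i + k)%N _)); first by rewrite addn_gt0 i0.
rewrite addnC exprD mulrA addnC; apply: (vdivM VR); last exact: (vdiv_refl VR).
by apply: (vdivM VR); [apply: vdiv_natmul|apply: (vdivX VR)].
Qed.

Lemma stable_radius r r' b P : stable r b P -> r <=v r' -> stable r' b P.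
Proof.
move=> [Pb0 st] rr; split=> // i i0; apply: (vlt_le_trans VR (st i i0)).
by apply: (vdivM VR); [apply: (vdiv_refl VR)|apply: (vdivX VR)].
Qed.

Lemma stable_equiv r r' b P : r <=v r' -> r' <=v r -> stable r b P <-> stable r' b P.
Proof. by move=> h1 h2; split=> /stable_radius; apply. Qed.

Lemma stable_sub a c P : stable (a - c) c P <-> stable (a - c) a P.
Proof.
have r1 : a - c <=v a - c := vdiv_refl VR _.
have r2 : a - c <=v c - a by rewrite -(opprB a c); apply/vdivN.
by split=> h; [case: (stable_move h r1)|case: (stable_move h r2)].
Qed.

Lemma stable_const r b x : x != 0 -> stable r b x%:P.
Proof.
move=> x0; rewrite /stable hornerC; split=> // i i0.
by rewrite nderivnC eqn0Ngt i0 horner0 mul0r; apply/vltx0.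
Qed.

Hypothesis res0 : forall n, (0 < n)%N -> vunit O n%:R.

Lemma vunit_natmul x n : (0 < n)%N -> x *+ n <=v x.
Proof.
move=> /res0 [n0 [_ oi]]; exists n%:R^-1 => //.
by rewrite -(mulr_natl x) mulKf.
Qed.

Lemma nderivn_deriv (P : {poly K}) i : P^`()^`N(i) = P^`N(i.+1) *+ i.+1.
Proof. by rewrite -nderivn1 nderivn_nderivn add1n bin1. Qed.

(* If v(a-c), c in A, has no maximum, [P] is unstable near [a] but its derivative is
   stable, then Newton's method started at [a] produces a root that is as close to
   all points of [A] as [a] is. *)
Lemma immediate_root (A : K -> Prop) a (P : {poly K}) : newtonian O ->
  (forall c, A c -> exists2 c', A c' & a - c <v a - c') ->
  (exists2 c, A c & stable (a - c) a P^`()) ->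
  (forall c, A c -> ~ stable (a - c) a P) ->
  exists b, P.[b] = 0 /\ forall c, A c -> a - c <=v b - a.
Proof.
move=> hN hA [c0 Ac0 [P10 st]] nst.
pose q := P.[a] / P^`().[a].
(* Hasse derivatives of [P'] are those of [P] up to integer factors, which are units in residue
   characteristic 0. *)
have N1 c i : a - c0 <=v a - c -> (2 <= i)%N -> P^`().[a] <v P^`N(i).[a] * (a - c) ^+ i.-1.
  case: i => [|[|i]] // hc _; apply: (vlt_le_trans VR (st i.+1 isT)).
  rewrite nderivn_deriv hornerMn; apply: (vdivM VR); last exact: (vdivX VR).
  exact: vunit_natmul.
(* Some term of positive order makes [P] unstable. If its order is at least 2, the linear term has
   even smaller value by [N1]; so the linear term always bounds [P(a)]. *)
have h1 c : A c -> a - c0 <=v a - c -> P^`().[a] * (a - c) <=v P.[a].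
  move=> Ac hc; have [->|Pa0] := eqVneq P.[a] 0; first exact: (vdivx0 VR).
  have [i i0 hi] : exists2 i, (0 < i)%N & P^`N(i).[a] * (a - c) ^+ i <=v P.[a].
    apply: contrapT => no; apply: (nst c Ac); split=> // i i0 h.
    by apply: no; exists i.
  case: i i0 hi => [|[|i]] // _ hi; first by rewrite nderivn1 expr1 in hi.
  apply: (vdiv_trans VR) hi; rewrite exprSr mulrA.
  by apply: (vdivM VR); [apply: (vltW VR); apply: (N1 c i.+2)|apply: (vdiv_refl VR)].
have h2 c : A c -> a - c0 <=v a - c -> a - c <=v q.
  move=> Ac hc; have := h1 c Ac hc.
  by rewrite -[P.[a]](divfK P10) -/q mulrC => /(vdiv_mul2r VR _ _ P10).
have h3 c : A c -> a - c <=v q.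
  move=> Ac; case: (vdiv_total VR (a - c0) (a - c)) => h; first exact: h2.
  by apply: (vdiv_trans VR h); apply: h2 => //; apply: (vdiv_refl VR).
have [|z [oz rz mz]] := newton_lemma VR hN P10.
  case=> [|[|i]] // _ /=.
  apply/(vltE VR); first by rewrite expf_neq0.
  have -> : P.[a] ^+ i.+1 = q ^+ i.+1 * P^`().[a] ^+ i.+1 by rewrite -exprMn divfK.
  rewrite exprS mulrA; apply/(vlt_mul2r VR); first by rewrite expf_neq0.
  apply: (vlt_le_trans VR (N1 c0 i.+2 (vdiv_refl VR _) isT)).
  by apply: (vdivM VR); [apply: (vdiv_refl VR)|apply: (vdivX VR); apply: h3].
exists (a + q * z); split=> // c Ac.
rewrite [X in _ <=v X]addrC addKr; apply: (vdiv_trans VR (h3 c Ac)).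
by exists z => //; rewrite mulrC.
Qed.
End ValuedPolynomials.

Section ValueMin.
Variables (K : fieldType) (O : K -> Prop).
Hypothesis VR : valuation_ring O.

Lemma vdiv_min (F : nat -> K) n i0 : (i0 < n)%N -> F i0 != 0 ->
  exists j, [/\ (j < n)%N, F j != 0 & forall i, (i < n)%N -> vdiv O (F j) (F i)].
Proof.
elim: n i0 => // n IH i0 i0n Fi0.
have [[i1 i1n Fi1]|no] := EM (exists2 i, (i < n)%N & F i != 0).
  have [j [jn Fj hj]] := IH i1 i1n Fi1.
  case: (vdiv_total VR (F j) (F n)) => h.
    exists j; split=> //; first exact: ltnW.
    by move=> i; rewrite ltnS leq_eqVlt => /orP [/eqP ->|/hj].
  exists n; split=> //; first exact: (vdiv_neq0 h).
  move=> i; rewrite ltnS leq_eqVlt => /orP [/eqP ->|/hj]; first exact: (vdiv_refl VR).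
  exact: (vdiv_trans VR).
have z i : (i < n)%N -> F i = 0.
  by move=> hi; apply/eqP/negPn/negP => h; apply: no; exists i.
have e : i0 = n.
  by apply/eqP; move: i0n; rewrite ltnS leq_eqVlt => /orP [//|/z e]; rewrite e eqxx in Fi0.
exists n; split=> //; first by rewrite -e.
move=> i; rewrite ltnS leq_eqVlt => /orP [/eqP ->|/z ->]; first exact: (vdiv_refl VR).
exact: (vdivx0 VR).
Qed.

(** The terms of [P(a)] cancel, so the least value is attained by at least two of them: a slope of
    the Newton polygon. *)
Lemma algebraic_value (P : {poly K}) a : P != 0 -> P.[a] = 0 -> a != 0 ->
  exists i j, [/\ (i < j)%N, P`_i != 0, P`_j != 0 & vunit O (a ^+ (j - i) / (P`_i / P`_j))].
Proof.
move=> P0 Pa a0; pose F i := P`_i * a ^+ i.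
have F0 i : (F i != 0) = (P`_i != 0) by rewrite mulf_eq0 expf_eq0 (negPf a0) andbF orbF.
have [||j [jn Fj hj]] := @vdiv_min F (size P) (size P).-1 _ _.
- by rewrite prednK // size_poly_gt0.
- by rewrite F0 -lead_coefE lead_coef_eq0.
have [i [iin ij Fi]] : exists i, [/\ (i < size P)%N, i != j & vdiv O (F i) (F j)].
  apply: contrapT => no.
  have : vlt O (F j) (P.[a] - F j).
    rewrite horner_coef (bigD1 (Ordinal jn)) //= -/(F j) [X in vlt _ _ X]addrC addKr.
    apply: vlt_sum => // i ij h; apply: no; exists i; split=> //.
  by rewrite Pa sub0r => /(vltN VR) /(vlt_irrefl VR).
have {}hj := hj i iin.
have Fi0 := vdiv_neq0 Fi Fj.
have gen i' j' : (i' < j')%N -> F i' != 0 -> F j' != 0 -> vdiv O (F i') (F j') ->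
    vdiv O (F j') (F i') -> vunit O (a ^+ (j' - i') / (P`_i' / P`_j')).
  move=> lt Fi' Fj' h1 h2.
  rewrite (_ : _ / _ = F j' / F i'); first by apply/vunitE.
  have e : a ^+ j' = a ^+ (j' - i') * a ^+ i' by rewrite -exprD subnK // ltnW.
  rewrite /F e; rewrite !F0 in Fi' Fj'; move: (a ^+ i') (expf_neq0 i' a0) => A A0.
  by field; rewrite ?Fi' ?Fj' ?A0.
move: ij; rewrite neq_ltn => /orP [lt|lt].
  by exists i, j; rewrite -!F0; split=> //; apply: gen.
by exists j, i; rewrite -!F0; split=> //; apply: gen.
Qed.
End ValueMin.

(** * Residue maps *)

Record residue_map (K k : fieldType) (O : K -> Prop) (res : K -> k) : Prop := ResidueMap {
  rm_vr : valuation_ring O;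
  rmD : forall x y, O x -> O y -> res (x + y) = res x + res y;
  rmM : forall x y, O x -> O y -> res (x * y) = res x * res y;
  rm_eq0 : forall x, O x -> res x = 0 <-> vmax O x;
  rm_surj : forall a, exists2 x, O x & res x = a }.

Section ResidueMapTheory.
Variables (K k : fieldType) (O : K -> Prop) (res : K -> k).
Hypothesis RM : residue_map O res.
Let VR := rm_vr RM.

Lemma rm0 : res 0 = 0. Proof. by apply/(rm_eq0 RM); [apply: (vr0 VR)|apply: (vmax0 VR)]. Qed.
Lemma rm1 : res 1 = 1.
Proof.
have [x ox e] := rm_surj RM 1.
by rewrite -[LHS]mulr1 -e -(rmM RM) ?mul1r //; apply: (vr1 VR).
Qed.
Lemma rmN x : O x -> res (- x) = - res x.
Proof.
move=> ox; apply/eqP; rewrite -addr_eq0 -(rmD RM) ?addNr ?rm0 //; exact: (vrN VR).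
Qed.
Lemma rmB x y : O x -> O y -> res (x - y) = res x - res y.
Proof. by move=> ox oy; rewrite (rmD RM) ?rmN //; apply: (vrN VR). Qed.
Lemma rm_nat n : res n%:R = n%:R.
Proof.
elim: n => [|n IH]; first exact: rm0.
by rewrite -addn1 !natrD (rmD RM) ?IH ?rm1 //; [apply: (vr_nat VR)|apply: (vr1 VR)].
Qed.
Lemma rmX x n : O x -> res (x ^+ n) = res x ^+ n.
Proof.
move=> ox; elim: n => [|n IH]; first by rewrite !expr0 rm1.
by rewrite !exprS (rmM RM) ?IH //; apply: (vrX VR).
Qed.
Lemma rm_sum n (F : 'I_n -> K) : (forall i, O (F i)) -> res (\sum_i F i) = \sum_i res (F i).
Proof.
elim: n F => [|n IH] F oF; first by rewrite !big_ord0 rm0.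
rewrite !big_ord_recl (rmD RM) ?IH //; exact: (vr_sum VR).
Qed.
Lemma rm_eqP x y : O x -> O y -> res x = res y <-> vmax O (x - y).
Proof.
move=> ox oy; rewrite -(rm_eq0 RM); last exact: (vrB VR).
by rewrite rmB //; split=> [->|/eqP]; [rewrite subrr|rewrite subr_eq0 => /eqP].
Qed.
Lemma rm_unit x : O x -> res x <> 0 <-> vunit O x.
Proof.
move=> ox; rewrite (rm_eq0 RM) //; split=> [h|/vunit_not_max //].
by case: (vunitP ox).
Qed.
Lemma rmV x : vunit O x -> res x^-1 = (res x)^-1.
Proof.
move=> [x0 [ox oi]]; have /eqP h : res x <> 0 by apply/rm_unit.
by apply: (mulfI h); rewrite -(rmM RM) // !divff // rm1.
Qed.
Lemma rm_horner (P : {poly K}) x : (forall i, O P`_i) -> O x ->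
  res P.[x] = \sum_(i < size P) res P`_i * res x ^+ i.
Proof.
move=> oP ox; rewrite horner_coef rm_sum; last by move=> i; apply: (vrM VR) => //; apply: (vrX VR).
by apply: eq_bigr => i _; rewrite (rmM RM) ?rmX //; apply: (vrX VR).
Qed.
Lemma rm_char0 : (forall n, (0 < n)%N -> n%:R != 0 :> k) ->
  forall n, (0 < n)%N -> vunit O n%:R.
Proof.
by move=> h n /h /eqP n0; apply/rm_unit; rewrite ?rm_nat //; apply: (vr_nat VR).
Qed.
End ResidueMapTheory.

(** * Place-preserving isomorphisms between subfields *)

(* A partial isomorphism between subfields of [L] and [M] is represented by its graph
   [S], a subfield of the ring [L * M]. *)
Section PartialIso.
Variables (L M k : fieldType) (OL : L -> Prop) (OM : M -> Prop) (rL : L -> k) (rM : M -> k).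
Hypothesis RL : residue_map OL rL.
Hypothesis RM : residue_map OM rM.
Let VL := rm_vr RL.
Let VM := rm_vr RM.

Definition same_place a b := (OL a <-> OM b) /\ (OL a -> rL a = rM b).

Record pfield (S : L -> M -> Prop) : Prop := PField {
  pf1 : S 1 1;
  pfB : forall a b c d, S a b -> S c d -> S (a - c) (b - d);
  pfM : forall a b c d, S a b -> S c d -> S (a * c) (b * d);
  pfV : forall a b, S a b -> S a^-1 b^-1;
  pf_same : forall a b, S a b -> same_place a b }.

Definition ppoly (S : L -> M -> Prop) (P : {poly L}) (Q : {poly M}) := forall i, S P`_i Q`_i.

Definition unit_same a b := [/\ vunit OL a, vunit OM b & rL a = rM b].

Lemma same_place_unit a b u w : a != 0 -> b != 0 ->
  same_place a b -> unit_same u w -> same_place (a * u) (b * w).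
Proof.
move=> a0 b0 [h1 h2] [uu uw e].
have [u0 [ou oiu]] := uu; have [w0 [ow oiw]] := uw.
have e1 : OL (a * u) <-> OL a.
  by split=> h; [rewrite -[a](mulfK u0)|]; apply: (vrM VL).
have e2 : OM (b * w) <-> OM b.
  by split=> h; [rewrite -[b](mulfK w0)|]; apply: (vrM VM).
split; first by rewrite e1 e2.
rewrite e1 => oa; rewrite (rmM RL) // (rmM RM) ?e ?(h2 oa) //; exact/h1.
Qed.

Section Fixed.
Variable S : L -> M -> Prop.
Hypothesis PF : pfield S.

Lemma pf0 : S 0 0. Proof. by have := pfB PF (pf1 PF) (pf1 PF); rewrite !subrr. Qed.
Lemma pfN a b : S a b -> S (- a) (- b).
Proof. by move=> h; rewrite -sub0r -[- b]sub0r; apply: (pfB PF) => //; apply: pf0. Qed.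
Lemma pfD a b c d : S a b -> S c d -> S (a + c) (b + d).
Proof. by move=> h h'; rewrite -[c]opprK -[d]opprK; apply: (pfB PF) => //; apply: pfN. Qed.
Lemma pf_div a b c d : S a b -> S c d -> S (a / c) (b / d).
Proof. by move=> h h'; apply: (pfM PF) => //; apply: (pfV PF). Qed.
Lemma pfX a b n : S a b -> S (a ^+ n) (b ^+ n).
Proof. by move=> h; elim: n => [|n IH]; rewrite ?expr0 ?exprS; [apply: (pf1 PF)|apply: (pfM PF)]. Qed.
Lemma pf_nat n : S n%:R n%:R.
Proof. by elim: n => [|n IH]; [apply: pf0|rewrite -addn1 !natrD; apply: pfD => //; apply: (pf1 PF)]. Qed.
Lemma pf_natmul a b n : S a b -> S (a *+ n) (b *+ n).
Proof. by move=> h; rewrite -mulr_natr -[b *+ n]mulr_natr; apply: (pfM PF) => //; apply: pf_nat. Qed.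
Lemma pf_sum n (F : 'I_n -> L) (G : 'I_n -> M) : (forall i, S (F i) (G i)) -> S (\sum_i F i) (\sum_i G i).
Proof.
elim: n F G => [|n IH] F G h; first by rewrite !big_ord0; apply: pf0.
by rewrite !big_ord_recl; apply: pfD => //; apply: IH.
Qed.

Lemma pf_eq0 a b : S a b -> a = 0 <-> b = 0.
Proof.
have no b' : S 0 b' -> b' = 0.
  move=> h; apply/eqP/negPn/negP => b0.
  have := pfM PF h (pfV PF h); rewrite mul0r divff // => /(pf_same PF) [_ /(_ (vr0 VL))].
  by rewrite (rm0 RL) (rm1 RM) => /esym /eqP; rewrite oner_eq0.
have no' a' : S a' 0 -> a' = 0.
  move=> h; apply/eqP/negPn/negP => b0.
  have := pfM PF h (pfV PF h); rewrite mul0r divff // => /(pf_same PF) [_ /(_ (vr1 VL))].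
  by rewrite (rm0 RM) (rm1 RL) => /eqP; rewrite oner_eq0.
by move=> h; split=> e; [apply: no|apply: no']; rewrite -e.
Qed.
Lemma pf_neq0 a b : S a b -> (a != 0) = (b != 0).
Proof.
move=> /pf_eq0 h; apply/idP/idP; apply: contraNneq.
  by move=> e; apply/eqP/h.
by move=> e; apply/eqP/h.
Qed.
Lemma pf_funct a b b' : S a b -> S a b' -> b = b'.
Proof.
move=> h h'; apply/eqP; rewrite -subr_eq0; apply/eqP.
by have := pfB PF h h'; rewrite subrr => /pf_eq0 [->].
Qed.
Lemma pf_inj a a' b : S a b -> S a' b -> a = a'.
Proof.
move=> h h'; apply/eqP; rewrite -subr_eq0; apply/eqP.
by have := pfB PF h h'; rewrite subrr => /pf_eq0 [_ ->].
Qed.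
Lemma pf_O a b : S a b -> OL a <-> OM b. Proof. by case/(pf_same PF). Qed.
Lemma pf_res a b : S a b -> OL a -> rL a = rM b. Proof. by case/(pf_same PF). Qed.
Lemma pf_vdiv a b c d : S a b -> S c d -> vdiv OL a c <-> vdiv OM b d.
Proof.
move=> h h'; have [a0|a0] := eqVneq a 0.
  have b0 : b = 0 by apply/(pf_eq0 h).
  rewrite a0 b0; split=> /vdiv0x e; have := pf_eq0 h' => -[e1 e2].
    by rewrite e1 //; apply: (vdivx0 VM).
  by rewrite e2 //; apply: (vdivx0 VL).
have b0 := a0; rewrite (pf_neq0 h) in b0.
by rewrite !vdivE //; apply: pf_O; apply: pf_div.
Qed.
Lemma pf_vlt a b c d : S a b -> S c d -> vlt OL a c <-> vlt OM b d.
Proof. by move=> h h'; rewrite /vlt (pf_vdiv h' h). Qed.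
Lemma pf_unit a b : S a b -> vunit OL a <-> vunit OM b.
Proof. by move=> h; rewrite /vunit (pf_O h) (pf_O (pfV PF h)) (pf_neq0 h). Qed.
Lemma ppolyC a b : S a b -> ppoly S a%:P b%:P.
Proof. by move=> h i; rewrite !coefC; case: eqP => // _; apply: pf0. Qed.
Lemma ppoly0 : ppoly S 0 0. Proof. by move=> i; rewrite !coef0; apply: pf0. Qed.
Lemma ppolyX : ppoly S 'X 'X.
Proof. by move=> i; rewrite !coefX; apply: pf_nat. Qed.
Lemma ppolyXn n : ppoly S 'X^n 'X^n.
Proof. by move=> i; rewrite !coefXn; apply: pf_nat. Qed.
Lemma ppolyD P Q P' Q' : ppoly S P Q -> ppoly S P' Q' -> ppoly S (P + P') (Q + Q').
Proof. by move=> h h' i; rewrite !coefD; apply: pfD. Qed.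
Lemma ppolyB P Q P' Q' : ppoly S P Q -> ppoly S P' Q' -> ppoly S (P - P') (Q - Q').
Proof. by move=> h h' i; rewrite !coefB; apply: (pfB PF). Qed.
Lemma ppolyM P Q P' Q' : ppoly S P Q -> ppoly S P' Q' -> ppoly S (P * P') (Q * Q').
Proof. by move=> h h' i; rewrite !coefM; apply: pf_sum => j; apply: (pfM PF). Qed.
Lemma ppolyZ a b P Q : S a b -> ppoly S P Q -> ppoly S (a *: P) (b *: Q).
Proof. by move=> h h' i; rewrite !coefZ; apply: (pfM PF). Qed.
Lemma ppoly_deriv P Q : ppoly S P Q -> ppoly S P^`() Q^`().
Proof. by move=> h i; rewrite !coef_deriv; apply: pf_natmul. Qed.
Lemma ppoly_nderivn P Q n : ppoly S P Q -> ppoly S P^`N(n) Q^`N(n).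
Proof. by move=> h i; rewrite !coef_nderivn; apply: pf_natmul. Qed.
Lemma ppoly_size P Q : ppoly S P Q -> size P = size Q.
Proof.
move=> h; apply/eqP; rewrite eqn_leq; apply/andP; split; apply/leq_sizeP => j hj.
  by apply/(pf_eq0 (h j)); rewrite nth_default.
by apply/(pf_eq0 (h j)); rewrite nth_default.
Qed.
Lemma ppoly_eq0 P Q : ppoly S P Q -> (P == 0) = (Q == 0).
Proof. by move=> /ppoly_size; rewrite -!size_poly_eq0 => ->. Qed.
Lemma ppoly_horner P Q a b : ppoly S P Q -> S a b -> S P.[a] Q.[b].
Proof.
move=> h hab; rewrite !horner_coef -(ppoly_size h); apply: pf_sum => i.
by apply: (pfM PF) => //; apply: pfX.
Qed.

(** The division runs on both sides at once, because the quotients and remainders have to stay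
    related by [S]. It reduces statements about all polynomials to those of degree less than that of
    [P]. *)
Lemma ppoly_div P Q F G : ppoly S P Q -> P != 0 -> ppoly S F G ->
  exists A B C D, [/\ ppoly S A B, ppoly S C D, F = A * P + C, G = B * Q + D & (size C < size P)%N].
Proof.
move=> hP P0; move: {2}(size F).+1 (ltnSn (size F)) => n.
elim: n F G => // n IH F G sF hF.
have [lt|ge] := ltnP (size F) (size P).
  by exists 0, 0, F, G; split; rewrite ?mul0r ?add0r //; apply: ppoly0.
have sP : (0 < size P)%N by rewrite size_poly_gt0.
have sF0 : (0 < size F)%N := leq_trans sP ge.
have F0 : F != 0 by rewrite -size_poly_gt0.
pose t := (size F - size P)%N.
pose c := lead_coef F / lead_coef P; pose d := lead_coef G / lead_coef Q.
have hcd : S c d.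
  by apply: pf_div; rewrite !lead_coefE -?(ppoly_size hF) -?(ppoly_size hP).
have hm : ppoly S (c *: 'X^t) (d *: 'X^t) by apply: ppolyZ => //; apply: ppolyXn.
have hF1 : ppoly S (F - c *: 'X^t * P) (G - d *: 'X^t * Q) by apply: ppolyB => //; apply: ppolyM.
have sF1 : (size (F - c *: 'X^t * P)%R < size F)%N.
  rewrite -(prednK sF0) ltnS; apply/leq_sizeP => j; rewrite leq_eqVlt => /orP [/eqP <-|lt].
    rewrite coefB -scalerAl coefZ coefXnM ltnNge -{1}(prednK sF0) /t.
    rewrite (_ : (size F - size P <= (size F).-1)%N); last first.
      by rewrite -subn1; apply: leq_sub2l.
    rewrite (_ : ((size F).-1 - (size F - size P) = (size P).-1)%N); last first.
      by rewrite -!subn1 subnAC subKn.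
    by rewrite -!lead_coefE /c divfK ?lead_coef_eq0 // subrr.
  have sz : (size (c *: 'X^t * P)%R <= size F)%N.
    rewrite -scalerAl (leq_trans (size_scale_leq _ _)) // mulrC size_mulXn //.
    by rewrite /t subnK.
  by rewrite coefB !nth_default ?subrr // ?(leq_trans sz) // -(prednK sF0).
have [A [B [C [D [h1 h2 e1 e2 sC]]]]] := IH _ _ (leq_trans sF1 sF) hF1.
exists (A + c *: 'X^t), (B + d *: 'X^t), C, D; split=> //; first exact: ppolyD.
  by rewrite mulrDl addrAC -e1 subrK.
by rewrite mulrDl addrAC -e2 subrK.
Qed.
End Fixed.

(** The intended isomorphism of the generated fields that sends [x] to [y]. As a relation it exists
    for all [x] and [y]; that it is a bijection preserving the places is the content of
    [gen_pfield]. *)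
Definition gen (S : L -> M -> Prop) x y a b := exists P Q P' Q',
  [/\ ppoly S P Q, ppoly S P' Q', P'.[x] != 0 /\ Q'.[y] != 0,
      a = P.[x] / P'.[x] & b = Q.[y] / Q'.[y]].

Section Extension.
Variable S : L -> M -> Prop.
Hypothesis PF : pfield S.

Lemma gen_sub x y a b : S a b -> gen S x y a b.
Proof.
move=> h; exists a%:P, b%:P, 1%:P, 1%:P; split; try by apply: ppolyC => //; apply: (pf1 PF).
- by rewrite !hornerC !oner_neq0.
- by rewrite !hornerC divr1.
- by rewrite !hornerC divr1.
Qed.
Lemma gen_mem x y : gen S x y x y.
Proof.
exists 'X, 'X, 1%:P, 1%:P; split; try by apply: ppolyC => //; apply: (pf1 PF).
- exact: ppolyX.
- by rewrite !hornerC !oner_neq0.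
- by rewrite !hornerC divr1 hornerX.
- by rewrite !hornerC divr1 hornerX.
Qed.
Lemma gen_min x y (S' : L -> M -> Prop) : pfield S' -> (forall a b, S a b -> S' a b) ->
  S' x y -> forall a b, gen S x y a b -> S' a b.
Proof.
move=> PF' sub hxy a b [P [Q [P' [Q' [h h' [n1 n2] -> ->]]]]].
by apply: (pf_div PF'); apply: (ppoly_horner PF') => // i; apply: sub.
Qed.

Variable T : L -> M -> Prop.
Hypothesis T_div : forall a b c d, T a b -> T c d -> T (a / c) (b / d).
Hypothesis T_ok : forall a b, T a b -> [/\ a != 0, b != 0 & same_place a b].

(** It suffices to compare polynomial values, up to units of equal residue, with pairs in a family
    [T] of known behaviour. [T] consists of the non-zero pairs of [S] when no value is added, and of
    monomials with coefficients in [S] when one is. *)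
Lemma gen_pfield x y :
  (forall P Q, ppoly S P Q -> (P.[x] = 0 /\ Q.[y] = 0) \/
     exists c d, T c d /\ unit_same (P.[x] / c) (Q.[y] / d)) ->
  pfield (gen S x y) /\
  (forall a b, gen S x y a b -> a != 0 -> exists c d, T c d /\ vunit OL (a / c)).
Proof.
move=> H.
have norm a b : gen S x y a b -> (a = 0 /\ b = 0) \/ exists c d, T c d /\ unit_same (a / c) (b / d).
  move=> [P [Q [P' [Q' [h h' [n1 n2] -> ->]]]]].
  have [[-> ->]|[c [d [Tcd [u1 u2 e]]]]] := H P Q h; first by left; rewrite !mul0r.
  have [[e' _]|[c' [d' [Tcd' [u1' u2' e']]]]] := H P' Q' h'; first by rewrite e' eqxx in n1.
  right; exists (c / c'), (d / d'); split; first exact: T_div.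
  have [c0 d0 _] := T_ok Tcd; have [c0' d0' _] := T_ok Tcd'.
  have -> : P.[x] / P'.[x] / (c / c') = (P.[x] / c) / (P'.[x] / c') by field; rewrite ?c0 ?n1 ?c0'.
  have -> : Q.[y] / Q'.[y] / (d / d') = (Q.[y] / d) / (Q'.[y] / d') by field; rewrite ?d0 ?n2 ?d0'.
  have w1 := vunitV u1'; have w2 := vunitV u2'.
  split; [exact: (vunitM VL)|exact: (vunitM VM)|].
  have [[_ [o1 _]] [_ [o2 _]] [_ [o3 _]] [_ [o4 _]]] := And4 u1 u2 w1 w2.
  by rewrite (rmM RL o1 o3) (rmM RM o2 o4) (rmV RL u1') (rmV RM u2') e e'.
split; last first.
  move=> a b h a0; have [[e _]|[c [d [Tcd [u _ _]]]]] := norm _ _ h; first by rewrite e eqxx in a0.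
  by exists c, d.
split.
- exact/gen_sub/(pf1 PF).
- move=> a b c d [P [Q [P' [Q' [h h' [n1 n2] -> ->]]]]] [F [G [F' [G' [g g' [n1' n2'] -> ->]]]]].
  exists (P * F' - F * P'), (Q * G' - G * Q'), (P' * F'), (Q' * G'); split.
  + by apply: ppolyB => //; apply: ppolyM.
  + exact: ppolyM.
  + by rewrite !hornerM !mulf_neq0.
  + by rewrite !(hornerD, hornerN, hornerM); field; rewrite ?n1 ?n1'.
  + by rewrite !(hornerD, hornerN, hornerM); field; rewrite ?n2 ?n2'.
- move=> a b c d [P [Q [P' [Q' [h h' [n1 n2] -> ->]]]]] [F [G [F' [G' [g g' [n1' n2'] -> ->]]]]].
  exists (P * F), (Q * G), (P' * F'), (Q' * G'); split; try exact: ppolyM.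
  + by rewrite !hornerM !mulf_neq0.
  + by rewrite !hornerM; field; rewrite ?n1 ?n1'.
  + by rewrite !hornerM; field; rewrite ?n2 ?n2'.
- move=> a b hab; have [P [Q [P' [Q' [h h' [n1 n2] e1 e2]]]]] := hab.
  have [[-> ->]|[c [d [Tcd [u1 u2 e]]]]] := norm _ _ hab.
    by rewrite !invr0; rewrite ?invr0; apply/gen_sub; exact: (pf0 PF).
  exists P', Q', P, Q; split=> //.
  + have [a0 _] := u1; have [b0 _] := u2; move: a0 b0; rewrite e1 e2.
    by split; [apply: contraNneq a0|apply: contraNneq b0] => ->; rewrite !mul0r.
  + by rewrite e1 invf_div.
  + by rewrite e2 invf_div.
- move=> a b hab; have [[-> ->]|[c [d [Tcd us]]]] := norm _ _ hab.
    by apply: (pf_same PF); exact: (pf0 PF).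
  have [c0 d0 sp] := T_ok Tcd.
  by rewrite -[a](divfK c0) -[b](divfK d0) mulrC [_ * d]mulrC; apply: same_place_unit.
Qed.
End Extension.

Lemma gen_pfield_unramified (S : L -> M -> Prop) x y : pfield S ->
  (forall P Q, ppoly S P Q -> (P.[x] = 0 /\ Q.[y] = 0) \/
     exists c d, [/\ S c d, c != 0 & unit_same (P.[x] / c) (Q.[y] / d)]) ->
  pfield (gen S x y) /\
  (forall a b, gen S x y a b -> a != 0 -> exists c d, [/\ S c d, c != 0 & vunit OL (a / c)]).
Proof.
move=> PF H.
have [|||h1 h2] := @gen_pfield S PF (fun c d => S c d /\ c != 0) _ _ x y.
- move=> a b c d [h a0] [h' c0]; split; first exact: pf_div.
  by rewrite mulf_neq0 ?invr_eq0.
- move=> a b [h a0]; split=> //; first by rewrite -(pf_neq0 PF h).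
  exact: (pf_same PF).
- move=> P Q h; have [|[c [d [h1 h2 h3]]]] := H P Q h; first by left.
  by right; exists c, d.
split=> // a b h a0; have [c [d [[h3 h4] h5]]] := h2 a b h a0.
by exists c, d.
Qed.
End PartialIso.

Lemma nat_min (P : nat -> Prop) : (exists n, P n) -> exists n, P n /\ forall j, P j -> (n <= j)%N.
Proof.
move=> [n0 Pn0]; have ex : exists n, `[< P n >] by exists n0; apply/asboolP.
case: (ex_minnP ex) => n /asboolP Pn hn; exists n; split=> // j Pj.
by apply: hn; apply/asboolP.
Qed.

(** * Extensions by an element with a new residue *)

Section OneStep.
Variables (L M k : fieldType) (OL : L -> Prop) (OM : M -> Prop) (rL : L -> k) (rM : M -> k).
Hypothesis RL : residue_map OL rL.
Hypothesis RM : residue_map OM rM.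
Hypothesis NL : newtonian OL.
Hypothesis NM : newtonian OM.
Hypothesis ck : forall n, (0 < n)%N -> n%:R != 0 :> k.
Let VL := rm_vr RL.
Let VM := rm_vr RM.
Local Notation pfield := (pfield OL OM rL rM).
Local Notation unit_same := (unit_same OL OM rL rM).

Definition unramified (S S' : L -> M -> Prop) :=
  forall a b, S' a b -> a != 0 -> exists c d, [/\ S c d, c != 0 & vunit OL (a / c)].
Definition alg_pair (S : L -> M -> Prop) x y :=
  exists P Q, [/\ ppoly S P Q, P != 0, P.[x] = 0 & Q.[y] = 0].
Definition transcendental (S : L -> M -> Prop) a :=
  forall P Q, ppoly S P Q -> P != 0 -> P.[a] != 0.

Variable S : L -> M -> Prop.
Hypothesis PF : pfield S.

Lemma ppoly_normal P Q : ppoly S P Q -> P != 0 ->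
  exists j, P`_j != 0 /\ forall i, OL (P`_i / P`_j).
Proof.
move=> h P0.
have [||j [_ Pj hj]] := @vdiv_min _ _ VL (fun i => P`_i) (size P) (size P).-1 _ _.
- by rewrite prednK // size_poly_gt0.
- by rewrite -lead_coefE lead_coef_eq0.
exists j; split=> // i; apply/vdivE => //.
have [/hj //|ge] := ltnP i (size P).
by rewrite (nth_default _ ge); apply: (vdivx0 VL).
Qed.

Lemma res_ppoly P Q x x' y : ppoly S P Q -> (forall i, OL P`_i) -> OL x -> OL x' -> OM y ->
  rL x = rL x' -> rL x' = rM y ->
  [/\ OL P.[x], OM Q.[y], rL P.[x] = rL P.[x'] & rL P.[x] = rM Q.[y]].
Proof.
move=> h oP ox ox' oy e1 e2.
have oQ i : OM Q`_i by apply/(pf_O PF (h i)).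
split; [exact: (vr_horner VL)|exact: (vr_horner VM)| |].
  by rewrite !(rm_horner RL) // e1.
rewrite (rm_horner RL) // (rm_horner RM) // -(ppoly_size RL RM PF h) e1 e2.
by apply: eq_bigr => i _; rewrite (pf_res PF (h i)).
Qed.

(** If the residue of [x0] is transcendental over that of [S], any element of [M] with this residue
    can be the image. If it is algebraic, its minimal polynomial is lifted to [S] and Hensel's lemma
    gives roots on both sides; [x] is then such a root and may differ from [x0]. In both cases a
    polynomial, of small degree in the second, has the value of its coefficient of least value, so
    the extension is unramified. *)
Lemma residue_step x0 : OL x0 -> (forall c d, S c d -> OL c -> rL c <> rL x0) ->
  exists x y, [/\ pfield (gen S x y), unramified S (gen S x y), (forall d, ~ S x d) &
    alg_pair S x y \/ (x = x0 /\ transcendental S x0)].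
Proof.
move=> ox0 new.
have [y0 oy0 ey0] := rm_surj RM (rL x0).
(* Polynomials over the valuation ring of [S] whose reduction is non-zero and vanishes at the
   residue of [x0]. *)
pose ann P := [/\ exists Q, ppoly S P Q, forall i, OL P`_i, exists i, ~ vmax OL P`_i &
                  vmax OL P.[x0]].
have unit_of P Q j x y : ppoly S P Q -> P`_j != 0 -> (forall i, OL (P`_i / P`_j)) ->
    ~ ann ((P`_j)^-1 *: P) -> OL x -> rL x = rL x0 -> OM y -> rM y = rL x0 ->
    unit_same (P.[x] / P`_j) (Q.[y] / Q`_j).
  move=> h Pj oP na ox ex oy ey.
  have h' : ppoly S ((P`_j)^-1 *: P) ((Q`_j)^-1 *: Q) by apply: (ppolyZ PF) => //; apply: (pfV PF).
  have oP' i : OL ((P`_j)^-1 *: P)`_i by rewrite coefZ mulrC.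
  have [] := res_ppoly h' oP' ox ox0 oy ex (esym ey).
  rewrite !hornerZ ![_^-1 * _]mulrC => o1 o2 e1 e2.
  have r0 : rL (P.[x] / P`_j) <> 0.
    rewrite e1 => /(rm_eq0 RL) hm; apply: na; split.
    - by exists ((Q`_j)^-1 *: Q).
    - by [].
    - exists j; rewrite coefZ mulVf //; exact: (vmax1 VL).
    - rewrite hornerZ mulrC; apply: hm; rewrite mulrC -hornerZ; exact: (vr_horner VL).
  split=> //; first exact/(rm_unit RL).
  by apply/(rm_unit RM) => //; rewrite -e2.
have [noann|] := EM (forall P, ~ ann P).
  have norm P Q : ppoly S P Q -> P != 0 ->
      exists c d, [/\ S c d, c != 0 & unit_same (P.[x0] / c) (Q.[y0] / d)].
    move=> h P0; have [j [Pj hj]] := ppoly_normal h P0.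
    by exists P`_j, Q`_j; split=> //; apply: unit_of.
  exists x0, y0.
  have [|h1 h2] := @gen_pfield_unramified _ _ _ _ _ _ _ RL RM S x0 y0 PF.
    move=> P Q h; have [P0|P0] := eqVneq P 0; last by right; apply: norm.
    left; have /eqP Q0 : Q == 0 by rewrite -(ppoly_eq0 RL RM PF h) P0.
    by rewrite P0 Q0 !horner0.
  split=> //; first by move=> d h; apply: (new _ _ h).
  right; split=> // P Q h P0; have [c [d [_ _ [[u0 _] _ _]]]] := norm P Q h P0.
  by apply: contraNneq u0 => ->; rewrite mul0r.
move=> /existsNP [P1 /contrapT annP1].
have [n [[P [annP sP]] minP]] := nat_min (ex_intro (fun n => exists P, ann P /\ size P = n) _
  (ex_intro _ P1 (conj annP1 erefl))).
have small (F : {poly L}) : (size F < n)%N -> ~ ann F.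
  by move=> lt aF; have := minP (size F) (ex_intro _ F (conj aF erefl)); rewrite leqNgt lt.
have [[Q hPQ] oP [i0 Pi0] mP] := annP.
have P0 : P != 0.
  by apply: contra_notN Pi0 => /eqP ->; rewrite coef0; apply: (vmax0 VL).
have n0 : (0 < n)%N by rewrite -sP size_poly_gt0.
(* Otherwise dropping the leading term would leave the reduction unchanged and lower the degree. *)
have nle : ~ vmax OL (lead_coef P).
  move=> ml; case: (small (P - lead_coef P *: 'X^((size P).-1))).
    have sP0 : (0 < size P)%N by rewrite sP.
    rewrite -sP -[X in (_ < X)%N](prednK sP0) ltnS; apply/leq_sizeP => j; rewrite leq_eqVlt => /orP [/eqP <-|lt].
      by rewrite coefB coefZ coefXn eqxx mulr1 -lead_coefE subrr.
    rewrite coefB coefZ coefXn gtn_eqF // mulr0 subr0 nth_default //.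
    by rewrite -(prednK sP0).
  have cE j : vmax OL (P`_j - (P - lead_coef P *: 'X^((size P).-1))`_j).
    rewrite coefB opprB addrC subrK coefZ; apply: (vmaxM VL) => //.
    by rewrite coefXn; apply: (vr_nat VL).
  split.
  - exists (Q - lead_coef Q *: 'X^((size P).-1)); apply: (ppolyB PF) => //.
    apply: (ppolyZ PF); last exact: (ppolyXn PF).
    by rewrite !lead_coefE -(ppoly_size RL RM PF hPQ).
  - by move=> j; rewrite -[_`_j](subKr P`_j); apply: (vrB VL) => //; apply: vmaxW.
  - exists i0 => h; apply: Pi0; rewrite -[P`_i0](subrK (P - lead_coef P *: 'X^((size P).-1))`_i0).
    exact: (vmaxD VL).
  - rewrite hornerD hornerN; apply: (vmaxB VL) => //.
    by rewrite hornerZ hornerXn; apply: (vmaxM VL) => //; apply: (vrX VL).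
have ul : vunit OL (lead_coef P).
  have ol : OL (lead_coef P) by rewrite lead_coefE.
  by case: (vunitP ol).
have n1 : (1 < n)%N.
  rewrite ltn_neqAle n0 andbT eq_sym; apply/eqP => n1; apply: nle.
  have /size_poly1P [c c0 Pc] : size P == 1%N by rewrite sP n1.
  by move: mP; rewrite Pc hornerC lead_coefC.
have hdPQ := ppoly_deriv PF hPQ.
have oP' i : OL P^`()`_i by rewrite coef_deriv; apply: (vr_natmul VL).
(* By minimality the derivative cannot annihilate: in residue characteristic 0 its leading
   coefficient is a unit. *)
have u' : vunit OL P^`().[x0].
  have [//|m'] := vunitP (vr_horner VL oP' ox0).
  case: (small P^`()); first by rewrite -sP lt_size_deriv.
  split=> //; first by exists Q^`().
  exists n.-2; rewrite coef_deriv (_ : n.-2.+1 = (size P).-1); last by rewrite sP; case: (n) n1 => [|[|]].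
  rewrite -lead_coefE -mulr_natr => /vunit_not_max; apply; apply: (vunitM VL) => //.
  by apply: (rm_char0 RL ck); rewrite sP -subn1 subn_gt0.
pose P2 := (lead_coef P)^-1 *: P; pose Q2 := (lead_coef Q)^-1 *: Q.
have hlead : S (lead_coef P) (lead_coef Q) by rewrite !lead_coefE -(ppoly_size RL RM PF hPQ).
have h2 : ppoly S P2 Q2 by apply: (ppolyZ PF) => //; apply: (pfV PF).
have lP0 : lead_coef P != 0 by rewrite lead_coef_eq0.
have oP2 i : OL P2`_i by rewrite coefZ; apply: (vrM VL) => //; have [_ []] := ul.
have oQ2 i : OM Q2`_i by apply/(pf_O PF (h2 i)).
have mP2 : vmax OL P2.[x0] by rewrite hornerZ; apply: (vmaxMr VL) => //; have [_ []] := ul.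
have uP2 : vunit OL P2^`().[x0] by rewrite derivZ hornerZ; apply: (vunitM VL) => //; apply: vunitV.
have monP : P2 \is monic by rewrite monicE lead_coefZ mulVf.
have monQ : Q2 \is monic.
  by rewrite monicE lead_coefZ mulVf // -(pf_neq0 RL RM PF hlead).
have [oPx oQy _ e] := res_ppoly h2 oP2 ox0 ox0 oy0 erefl (esym ey0).
have mQ2 : vmax OM Q2.[y0] by apply/(rm_eq0 RM) => //; rewrite -e; apply/(rm_eq0 RL).
have h2' := ppoly_deriv PF h2.
have oP2' i : OL P2^`()`_i by rewrite coef_deriv; apply: (vr_natmul VL).
have [oPx' oQy' _ e'] := res_ppoly h2' oP2' ox0 ox0 oy0 erefl (esym ey0).
have uQ2 : vunit OM Q2^`().[y0].
  by apply/(rm_unit RM) => //; rewrite -e'; apply/(rm_unit RL).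
have [x [ox /rootP rx mx]] := newtonian_henselian VL NL monP oP2 ox0 mP2 uP2.
have [y [oy /rootP ry my]] := newtonian_henselian VM NM monQ oQ2 oy0 mQ2 uQ2.
have ex : rL x = rL x0 by apply/(rm_eqP RL).
have ey : rM y = rL x0 by rewrite -ey0; apply/(rm_eqP RM).
have P20 : P2 != 0 by rewrite scaler_eq0 invr_eq0 negb_or lP0.
exists x, y; have [|h3 h4] := @gen_pfield_unramified _ _ _ _ _ _ _ RL RM S x y PF.
  move=> F G hFG; have [A [B [C [D [hA hC -> -> sC]]]]] := ppoly_div RL RM PF h2 P20 hFG.
  rewrite !(hornerD, hornerM) rx ry !mulr0 !add0r.
  have [C0|C0] := eqVneq C 0.
    left; have /eqP D0 : D == 0 by rewrite -(ppoly_eq0 RL RM PF hC) C0.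
    by rewrite C0 D0 !horner0.
  right; have [j [Cj hj]] := ppoly_normal hC C0.
  exists C`_j, D`_j; split=> //; apply: unit_of => //; apply: small.
  by rewrite -sP (leq_ltn_trans (size_scale_leq _ _)) // (leq_trans sC) // size_scale_leq.
split=> //; first by move=> d h; apply: (new _ _ h).
by left; exists P2, Q2.
Qed.
End OneStep.

(** The hypothesis says that any two of the countably many balls meet, hence that one contains the
    other. *)
Definition ball_saturated (M : fieldType) (OM : M -> Prop) := forall c r : nat -> M,
  (forall i j, vdiv OM (r i) (c i - c j) \/ vdiv OM (r j) (c i - c j)) ->
  exists y, forall i, vdiv OM (r i) (y - c i).

Definition countable_graph (L M : fieldType) (S : L -> M -> Prop) := exists g : nat -> L * M,
  (forall n, S (g n).1 (g n).2) /\ forall a b, S a b -> exists n, g n = (a, b).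

Lemma near_value (K : fieldType) (O : K -> Prop) e w : valuation_ring O ->
  vlt O e (w - e) -> vdiv O e w /\ vdiv O w e.
Proof. by move=> V h; have := vlt_addE V h; rewrite addrC subrK. Qed.

Lemma near_unit (K k : fieldType) (O : K -> Prop) (res : K -> k) e w : residue_map O res ->
  vlt O e (w - e) -> vunit O (w / e) /\ res (w / e) = 1.
Proof.
move=> R h; have V := rm_vr R; have e0 := vlt_neq0 V h.
have u : vunit O (w / e) by apply/vunitE => //; apply: near_value.
split=> //; rewrite -(rm1 R); apply/(rm_eqP R).
- by have [_ []] := u.
- exact: (vr1 V).
- by move/(vltE V _ e0): h; rewrite mulrBl divff.
Qed.

(** * Immediate extensions *)

Section Immediate.
Variables (L M k : fieldType) (OL : L -> Prop) (OM : M -> Prop) (rL : L -> k) (rM : M -> k).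
Hypothesis RL : residue_map OL rL.
Hypothesis RM : residue_map OM rM.
Hypothesis NL : newtonian OL.
Hypothesis NM : newtonian OM.
Hypothesis ck : forall n, (0 < n)%N -> n%:R != 0 :> k.
Let VL := rm_vr RL.
Let VM := rm_vr RM.
Local Notation pfield := (pfield OL OM rL rM).
Local Notation unit_same := (unit_same OL OM rL rM).
Local Notation "x <L y" := (vlt OL x y) (at level 70).
Local Notation "x <M y" := (vlt OM x y) (at level 70).

Variable S : L -> M -> Prop.
Hypothesis PF : pfield S.

Definition near_pair a a' := forall c d, S c d ->
  exists e f, [/\ S e f, e <L a - c - e & f <M a' - d - f].

(** For each pair of [S] choose two successive better approximations of [a]. The difference of these
    two lies in the domain of [S] and has exactly the value of [a] minus the first, so it provides a
    radius that can be transported to [M]. The transported balls are nested and saturation gives a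
    common point. *)
Lemma pseudo_limit a : countable_graph S -> ball_saturated OM ->
  (forall c d, S c d -> exists c' d', S c' d' /\ a - c <L a - c') ->
  exists a', near_pair a a'.
Proof.
move=> [g [gS gsur]] BM I.
have [w hw] : {w : nat -> (L * M) * (L * M) & forall n, [/\ S (w n).1.1 (w n).1.2,
    S (w n).2.1 (w n).2.2, a - (g n).1 <L a - (w n).1.1 & a - (w n).1.1 <L a - (w n).2.1]}.
  apply: (@choice _ _ (fun n w => [/\ S w.1.1 w.1.2,
    S w.2.1 w.2.2, a - (g n).1 <L a - w.1.1 & a - w.1.1 <L a - w.2.1])) => n.
  have [c1 [d1 [h1 l1]]] := I _ _ (gS n); have [c2 [d2 [h2 l2]]] := I _ _ h1.
  by exists ((c1, d1), (c2, d2)).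
have key x y : x <L y -> vdiv OL x (x - y) /\ vdiv OL (x - y) x.
  by move=> h; apply: (vlt_addE VL); apply/vltN.
have R1 n : vdiv OL (a - (w n).1.1) ((w n).2.1 - (w n).1.1) /\
            vdiv OL ((w n).2.1 - (w n).1.1) (a - (w n).1.1).
  have [_ _ _ l2] := hw n; have := key _ _ l2.
  by rewrite (_ : a - _ - _ = (w n).2.1 - (w n).1.1) //; ring.
have [|a' ha'] := BM (fun n => (w n).1.2) (fun n => (w n).2.2 - (w n).1.2).
  move=> i j; have [si ti _ _] := hw i; have [sj tj _ _] := hw j.
  have e : (w i).1.1 - (w j).1.1 = (a - (w j).1.1) - (a - (w i).1.1) by ring.
  case: (vdiv_total VL (a - (w i).1.1) (a - (w j).1.1)) => h; [left|right].
    apply/(pf_vdiv RL RM PF (pfB PF ti si) (pfB PF si sj)).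
    apply: (vdiv_trans VL (proj2 (R1 i))); rewrite e; apply: (vdivB VL) => //; exact: (vdiv_refl VL).
  apply/(pf_vdiv RL RM PF (pfB PF tj sj) (pfB PF si sj)).
  apply: (vdiv_trans VL (proj2 (R1 j))); rewrite e; apply: (vdivB VL) => //; exact: (vdiv_refl VL).
exists a' => c d h; have [n gn] := gsur _ _ h.
have [sn tn l1 l2] := hw n; rewrite gn /= in l1.
exists ((w n).1.1 - c), ((w n).1.2 - d).
have l3 : (w n).1.1 - c <L a - (w n).1.1.
  have [_] := key _ _ l1; rewrite (_ : a - c - _ = (w n).1.1 - c); last by ring.
  by move=> h1; apply: (vle_lt_trans VL h1).
split; first exact: (pfB PF).
  by rewrite (_ : a - c - _ = a - (w n).1.1) //; ring.
rewrite (_ : a' - d - _ = a' - (w n).1.2); last by ring.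
apply: (vlt_le_trans VM _ (ha' n)).
apply/(pf_vlt RL RM PF (pfB PF sn h) (pfB PF tn sn)).
exact: (vlt_le_trans VL l3 (proj1 (R1 n))).
Qed.

Lemma near_stable a a' P Q c d : near_pair a a' -> ppoly S P Q -> S c d ->
  stable OL (a - c) c P <-> stable OM (a' - d) d Q.
Proof.
move=> hn h hc; have [e [f [hef le lf]]] := hn c d hc.
have [e1 e2] := near_value VL le; have [f1 f2] := near_value VM lf.
rewrite (stable_equiv VL c P e2 e1) (stable_equiv VM d Q f2 f1) /stable.
rewrite (pf_neq0 RL RM PF (ppoly_horner RL RM PF h hc)).
have aux i : P.[c] <L P^`N(i).[c] * e ^+ i <-> Q.[d] <M Q^`N(i).[d] * f ^+ i.
  apply: (pf_vlt RL RM PF); first exact: (ppoly_horner RL RM PF).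
  apply: (pfM PF); last exact: (pfX PF).
  by apply: (ppoly_horner RL RM PF) => //; apply: (ppoly_nderivn PF).
by split=> -[h1 h2]; split=> // i i0; [rewrite -aux|rewrite aux]; apply: h2.
Qed.

(** Kaplansky's dichotomy. If every non-zero polynomial is eventually stable, the pseudo-limit [a']
    can be the image of [a]. Otherwise take an unstable polynomial of least degree; its derivative
    is stable, so [immediate_root] moves [a] and [a'] to roots that approximate the same elements
    equally well. *)
Lemma immediate_step a : countable_graph S -> ball_saturated OM ->
  (forall c d, S c d -> exists c' d', S c' d' /\ a - c <L a - c') ->
  exists x y, [/\ pfield (gen S x y), unramified OL S (gen S x y), (forall d, ~ S x d) &
    alg_pair S x y \/ (x = a /\ transcendental S a)].
Proof.
move=> cS BM I; have [a' hn] := pseudo_limit cS BM I.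
pose Stab P := exists c d, S c d /\ stable OL (a - c) c P.
have resL := rm_char0 RL ck; have resM := rm_char0 RM ck.
(* Where [C] is stable, its value at [x] is its value at [c] times a unit of residue 1, and likewise
   for [D] in [M]. *)
have fin C D x y : ppoly S C D -> Stab C ->
    (forall c d, S c d -> vdiv OL (a - c) (x - a)) ->
    (forall c d, S c d -> vdiv OM (a' - d) (y - a')) ->
    exists c d, [/\ S c d, c != 0 & unit_same (C.[x] / c) (D.[y] / d)].
  move=> hC [c [d [hcd st]]] hx hy.
  exists C.[c], D.[d]; split; first exact: (ppoly_horner RL RM PF).
    by case: st.
  have st' : stable OM (a' - d) d D by apply/(near_stable hn hC hcd).
  have rx : vdiv OL (a - c) (x - c).
    rewrite (_ : x - c = (x - a) + (a - c)); last by ring.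
    by apply: (vdivD VL); [apply: hx hcd|apply: (vdiv_refl VL)].
  have ry : vdiv OM (a' - d) (y - d).
    rewrite (_ : y - d = (y - a') + (a' - d)); last by ring.
    by apply: (vdivD VM); [apply: hy hcd|apply: (vdiv_refl VM)].
  have [_ l1] := stable_move VL st rx; have [_ l2] := stable_move VM st' ry.
  have [u1 r1] := near_unit RL l1; have [u2 r2] := near_unit RM l2.
  by split=> //; rewrite r1 r2.
have new x : (forall c d, S c d -> vdiv OL (a - c) (x - a)) -> forall d, ~ S x d.
  move=> hx d h; have [c' [d' [h' l]]] := I _ _ h.
  by have := hx _ _ h'; rewrite -(opprB a x) => /(vdivN VL).
have norm0 P Q x y : ppoly S P Q -> P = 0 -> P.[x] = 0 /\ Q.[y] = 0.
  move=> h P0; have /eqP Q0 : Q == 0 by rewrite -(ppoly_eq0 RL RM PF h) P0.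
  by rewrite P0 Q0 !horner0.
have [all|] := EM (forall P Q, ppoly S P Q -> P != 0 -> Stab P).
  exists a, a'.
  have ha c (d : M) : S c d -> vdiv OL (a - c) (a - a) by rewrite subrr => _; apply: (vdivx0 VL).
  have ha' (c : L) d : S c d -> vdiv OM (a' - d) (a' - a') by rewrite subrr => _; apply: (vdivx0 VM).
  have norm P Q : ppoly S P Q -> P != 0 ->
      exists c d, [/\ S c d, c != 0 & unit_same (P.[a] / c) (Q.[a'] / d)].
    by move=> h P0; apply: fin => //; apply: all P0.
  have [|h1 h2] := @gen_pfield_unramified _ _ _ _ _ _ _ RL RM S a a' PF.
    by move=> P Q h; have [P0|P0] := eqVneq P 0; [left; apply: norm0|right; apply: norm].
  split=> //; first by apply: new => c d; apply: ha.
  right; split=> // P Q h P0; have [c [d [_ _ [[u0 _] _ _]]]] := norm P Q h P0.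
  by apply: contraNneq u0 => ->; rewrite mul0r.
move=> nall.
pose bad n := exists P Q, [/\ ppoly S P Q, P != 0, ~ Stab P & size P = n].
have [|n [[P [Q [hPQ P0 nst sP]]] minP]] := @nat_min bad.
  apply: contrapT => no; apply: nall => P Q h P0; apply: contrapT => ns; apply: no.
  by exists (size P), P, Q.
have small F G : ppoly S F G -> F != 0 -> (size F < size P)%N -> Stab F.
  move=> h F0 lt; apply: contrapT => ns.
  by have := minP (size F); rewrite leqNgt -sP lt => H; suff : false by []; apply: H; exists F, G.
have P10 : P^`() != 0.
  have sP1 : (1 < size P)%N.
    rewrite ltn_neqAle size_poly_gt0 P0 andbT eq_sym; apply/negP => /size_poly1P [c c0 Pc].
    apply: nst; exists 0, 0; split; first exact: (pf0 PF).
    by rewrite Pc; apply: stable_const.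
  apply/eqP => /polyP /(_ (size P).-2); rewrite coef_deriv coef0.
  rewrite (_ : (size P).-2.+1 = (size P).-1); last by case: (size P) sP1 => [|[]].
  rewrite -lead_coefE -mulr_natr => /eqP; rewrite mulf_eq0 lead_coef_eq0 (negPf P0) /=.
  by apply/negP; have [|] := resL (size P).-1; first by rewrite -subn1 subn_gt0.
have hP' := ppoly_deriv PF hPQ.
have [c0 [d0 [h0 st0]]] : Stab P^`().
  by apply: (small _ _ hP') => //; apply: lt_size_deriv.
have [b [Pb hb]] : exists b, P.[b] = 0 /\ forall c, (exists d, S c d) -> vdiv OL (a - c) (b - a).
  apply: (immediate_root VL resL NL).
  - by move=> c [d /I [c' [d' [h l]]]]; exists c' => //; exists d'.
  - by exists c0; [exists d0|apply/(stable_sub VL)].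
  - by move=> c [d h] /(stable_sub VL) st; apply: nst; exists c, d.
have [b' [Qb' hb']] : exists b, Q.[b] = 0 /\ forall d, (exists c, S c d) -> vdiv OM (a' - d) (b - a').
  apply: (immediate_root VM resM NM).
  - move=> d [c h]; have [c' [d' [h' l]]] := I _ _ h; exists d'; first by exists c'.
    have [e [f [hef /(near_value VL) [e1 _] /(near_value VM) [_ f2]]]] := hn _ _ h.
    have [e' [f' [hef' /(near_value VL) [_ e2'] /(near_value VM) [f1' _]]]] := hn _ _ h'.
    apply: (vle_lt_trans VM f2); apply: (vlt_le_trans VM _ f1').
    apply/(pf_vlt RL RM PF hef hef'); apply: (vle_lt_trans VL e1).
    exact: (vlt_le_trans VL l e2').
  - exists d0; first by exists c0.
    by apply/(stable_sub VM)/(near_stable hn hP' h0).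
  - by move=> d [c h] /(stable_sub VM) /(near_stable hn hPQ h) st; apply: nst; exists c, d.
exists b, b'.
have hb1 c (d : M) : S c d -> vdiv OL (a - c) (b - a) by move=> h; apply: hb; exists d.
have hb1' (c : L) d : S c d -> vdiv OM (a' - d) (b' - a') by move=> h; apply: hb'; exists c.
have [|h1 h2] := @gen_pfield_unramified _ _ _ _ _ _ _ RL RM S b b' PF.
  move=> F G hFG; have [A [B [C [D [hA hC -> -> sC]]]]] := ppoly_div RL RM PF hPQ P0 hFG.
  rewrite !(hornerD, hornerM) Pb Qb' !mulr0 !add0r.
  have [C0|C0] := eqVneq C 0; first by left; apply: norm0.
  by right; apply: fin => //; apply: small sC.
split=> //; first by apply: new => c d; apply: hb1.
by left; exists P, Q.
Qed.
End Immediate.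

(** * Relatively algebraically closed partial isomorphisms *)

Section AlgebraicHull.
Variable L : fieldType.

Lemma roots_ex (P : {poly L}) : exists s : seq L, P != 0 -> forall x, P.[x] = 0 -> x \in s.
Proof.
have [->|P0] := eqVneq P 0; first by exists [::].
pose good n := exists s : seq L, [/\ uniq s, all (root P) s & (size P - size s)%N = n].
have [|n [[s [us rs sz]] minn]] := @nat_min good; first by exists (size P), [::]; rewrite subn0.
exists s => _ x /rootP rx; apply: contrapT => /negP xs.
have us' : uniq (x :: s) by rewrite /= xs.
have rs' : all (root P) (x :: s) by rewrite /= rx.
have lt : (size (x :: s) < size P)%N by apply: max_poly_roots.
have := minn (size P - size (x :: s))%N; rewrite -sz leqNgt => H.
suff : ~~ (size P - size (x :: s) < size P - size s)%N by rewrite ltn_sub2l //= ltnW.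
by apply: H; exists (x :: s).
Qed.

Definition roots (P : {poly L}) : seq L := projT1 (cid (roots_ex P)).
Lemma mem_roots (P : {poly L}) x : P != 0 -> P.[x] = 0 -> x \in roots P.
Proof. by rewrite /roots; case: cid => s /= h P0; apply: h. Qed.

(** One round of closure, with tags for copying, differences, products, inverses and roots of
    polynomials with listed coefficients. Coding the operations by numbers keeps every round, and
    thereby the union of all rounds, enumerated. *)
Definition hull_step (g : nat -> L) (n : nat) : L :=
  match unpickle n : option (nat * (nat * nat) * (seq nat * nat)) with
  | Some (0%N, (i, j), _) => g i
  | Some (1%N, (i, j), _) => g i - g j
  | Some (2%N, (i, j), _) => g i * g j
  | Some (3%N, (i, j), _) => (g i)^-1
  | Some (_, _, (s, r)) => nth 0 (roots (Poly (map g s))) r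
  | None => 0
  end.

Fixpoint hull_iter (g : nat -> L) (n : nat) : nat -> L :=
  if n is n'.+1 then hull_step (hull_iter g n') else g.

Definition hull (g : nat -> L) (n : nat) : L :=
  match unpickle n : option (nat * nat) with Some (i, j) => hull_iter g i j | None => 0 end.

Variable g : nat -> L.
Definition in_hull x := exists n, hull g n = x.

Lemma in_hullP x : in_hull x <-> exists i j, hull_iter g i j = x.
Proof.
split=> [[n]|[i [j <-]]].
  rewrite /hull; case: unpickle => [[i j]|] e; first by exists i, j.
  exists 1%N, (pickle (1%N, (0%N, 0%N), ([::] : seq nat, 0%N))) => /=.
  by rewrite /hull_step pickleK subrr.
by exists (pickle (i, j)); rewrite /hull pickleK.
Qed.

Lemma hull_stepE t i j s r : hull_step g (pickle (t, (i, j), (s, r))) =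
  match t with 0%N => g i | 1%N => g i - g j | 2%N => g i * g j | 3%N => (g i)^-1
  | _ => nth 0 (roots (Poly (map g s))) r end.
Proof. by rewrite /hull_step pickleK. Qed.
End AlgebraicHull.

Section AlgebraicHullClosed.
Variables (L : fieldType) (g : nat -> L).
Local Notation C := (in_hull g).

Lemma hull_mono n m x : (n <= m)%N -> (exists j, hull_iter g n j = x) -> exists j, hull_iter g m j = x.
Proof.
move=> /subnK <-; elim: (m - n)%N => // k IH /IH [j <-]; rewrite addSn /=.
by exists (pickle (0%N, (j, 0%N), ([::] : seq nat, 0%N))); rewrite hull_stepE.
Qed.

Lemma hull_base n : C (g n).
Proof. by apply/in_hullP; exists 0%N, n. Qed.

Lemma hull_two x y : C x -> C y -> exists n i j, hull_iter g n i = x /\ hull_iter g n j = y.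
Proof.
move=> /in_hullP [n [i ex]] /in_hullP [m [j ey]].
have [i' ei] := @hull_mono n (maxn n m) x (leq_maxl _ _) (ex_intro _ i ex).
have [j' ej] := @hull_mono m (maxn n m) y (leq_maxr _ _) (ex_intro _ j ey).
by exists (maxn n m), i', j'.
Qed.

Lemma hullB x y : C x -> C y -> C (x - y).
Proof.
move=> hx hy; have [n [i [j [<- <-]]]] := hull_two hx hy.
apply/in_hullP; exists n.+1, (pickle (1%N, (i, j), ([::] : seq nat, 0%N))).
by rewrite /= hull_stepE.
Qed.
Lemma hullM x y : C x -> C y -> C (x * y).
Proof.
move=> hx hy; have [n [i [j [<- <-]]]] := hull_two hx hy.
apply/in_hullP; exists n.+1, (pickle (2%N, (i, j), ([::] : seq nat, 0%N))).
by rewrite /= hull_stepE.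
Qed.
Lemma hullV x : C x -> C x^-1.
Proof.
move=> /in_hullP [n [i <-]].
apply/in_hullP; exists n.+1, (pickle (3%N, (i, 0%N), ([::] : seq nat, 0%N))).
by rewrite /= hull_stepE.
Qed.
Lemma hull_root (P : {poly L}) x : P != 0 -> (forall i, C P`_i) -> P.[x] = 0 -> C x.
Proof.
move=> P0 hC Px.
have [n [s es]] : exists n s, map (hull_iter g n) s = polyseq P.
  have : forall i, C (polyseq P)`_i by [].
  elim: (polyseq P) => [|a t IH] h; first by exists 0%N, [::].
  have [|n [s es]] := IH; first by move=> i; apply: (h i.+1).
  have [m [j ej]] := proj1 (in_hullP g a) (h 0%N).
  have [j' ej'] := @hull_mono m (maxn n m) a (leq_maxr _ _) (ex_intro _ j ej).
  suff [s' es'] : exists s', map (hull_iter g (maxn n m)) s' = t.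
    by exists (maxn n m), (j' :: s'); rewrite /= ej' es'.
  rewrite -es; elim: s {es} => [|b s [s' IHs]]; first by exists [::].
  have [b' eb] := @hull_mono n (maxn n m) (hull_iter g n b) (leq_maxl _ _) (ex_intro _ b erefl).
  by exists (b' :: s'); rewrite /= eb IHs.
have xr := mem_roots P0 Px.
apply/in_hullP; exists n.+1, (pickle (4%N, (0%N, 0%N), (s, index x (roots P)))).
by rewrite /= hull_stepE es polyseqK nth_index.
Qed.
End AlgebraicHullClosed.

Definition swap (L M : Type) (S : L -> M -> Prop) : M -> L -> Prop := fun b a => S a b.

Section Swap.
Variables (L M k : fieldType) (OL : L -> Prop) (OM : M -> Prop) (rL : L -> k) (rM : M -> k).
Implicit Type S : L -> M -> Prop.

Lemma same_place_swap a b : same_place OL OM rL rM a b -> same_place OM OL rM rL b a.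
Proof. by move=> [h1 h2]; split=> [|/h1 /h2 ->]; [rewrite h1|]. Qed.

Lemma pfield_swap S : pfield OL OM rL rM S -> pfield OM OL rM rL (swap S).
Proof.
move=> [h1 h2 h3 h4 h5]; split; rewrite /swap //.
- by move=> a b c d ?; apply: h2.
- by move=> a b c d ?; apply: h3.
- by move=> a b ?; apply: h4.
- by move=> a b /h5; apply: same_place_swap.
Qed.

Lemma gen_swap S x y b a : gen (swap S) y x b a -> gen S x y a b.
Proof. by move=> [P [Q [P' [Q' [h h' [n1 n2] e1 e2]]]]]; exists Q, P, Q', P'. Qed.

Lemma countable_swap S : countable_graph S -> countable_graph (swap S).
Proof.
move=> [g [h1 h2]]; exists (fun n => ((g n).2, (g n).1)); split; first exact: h1.
by move=> a b /h2 [n gn]; exists n; rewrite gn.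
Qed.
End Swap.

Section ClosureSteps.
Variables (L M k : fieldType) (OL : L -> Prop) (OM : M -> Prop) (rL : L -> k) (rM : M -> k).
Hypothesis RL : residue_map OL rL.
Hypothesis RM : residue_map OM rM.
Hypothesis NL : newtonian OL.
Hypothesis NM : newtonian OM.
Hypothesis ck : forall n, (0 < n)%N -> n%:R != 0 :> k.
Let VL := rm_vr RL.
Let VM := rm_vr RM.
Local Notation pfield := (pfield OL OM rL rM).
Implicit Type S : L -> M -> Prop.

Definition divisible_values S := forall a b n, S a b -> a != 0 -> (0 < n)%N ->
  exists c d, S c d /\ vunit OL (c ^+ n / a).
Definition closed_left S := forall a P Q, ppoly S P Q -> P != 0 -> P.[a] = 0 -> exists b, S a b.
Definition closed_right S := forall b P Q, ppoly S P Q -> P != 0 -> Q.[b] = 0 -> exists a, S a b.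

Lemma ppoly_sum S n (F : 'I_n -> {poly L}) (G : 'I_n -> {poly M}) : pfield S ->
  (forall i, ppoly S (F i) (G i)) -> ppoly S (\sum_i F i) (\sum_i G i).
Proof. by move=> PF h i; rewrite !coef_sum; apply: (pf_sum PF) => j; apply: h. Qed.

Lemma ppolyX_exp S P Q n : pfield S -> ppoly S P Q -> ppoly S (P ^+ n) (Q ^+ n).
Proof.
move=> PF h; elim: n => [|n IH]; rewrite ?expr0 ?exprS; last exact: (ppolyM PF).
by apply: (ppolyC PF); apply: (pf1 PF).
Qed.

Lemma ppoly_comp S P Q F G : pfield S -> ppoly S P Q -> ppoly S F G ->
  ppoly S (P \Po F) (Q \Po G).
Proof.
move=> PF h h'; rewrite !comp_polyE -(ppoly_size RL RM PF h).
by apply: (ppoly_sum PF) => i; apply: (ppolyZ PF) => //; apply: (ppolyX_exp _ PF).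
Qed.

Lemma ppoly_affine S P Q c d e f : pfield S -> ppoly S P Q -> P != 0 -> S c d -> S e f -> e != 0 ->
  exists F G, [/\ ppoly S F G, F != 0 & forall x, F.[x] = P.[c + e * x]].
Proof.
move=> PF h P0 hc he e0.
exists (P \Po (e *: 'X + c%:P)), (Q \Po (f *: 'X + d%:P)); split.
- apply: ppoly_comp => //; apply: (ppolyD PF); last exact: (ppolyC PF).
  by apply: (ppolyZ PF) => //; apply: (ppolyX PF).
- rewrite -size_poly_eq0 size_comp_poly2 ?size_poly_eq0 //.
  by rewrite -mul_polyC size_MXaddC polyC_eq0 (negPf e0) /= size_polyC e0.
- by move=> x; rewrite horner_comp !hornerE addrC.
Qed.

Lemma unramified_trans S S' S'' : pfield S ->
  (forall a b, S' a b -> a != 0 -> exists c d, [/\ S c d, c != 0 & vunit OL (a / c)]) ->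
  unramified OL S' S'' -> unramified OL S S''.
Proof.
move=> PF h h' a b hab a0; have [c [d [hc c0 u]]] := h' _ _ hab a0.
have [e [f [he e0 u']]] := h _ _ hc c0; exists e, f; split=> //.
by rewrite (_ : a / e = (a / c) * (c / e)); [apply: (vunitM VL)|field; rewrite ?c0 ?e0].
Qed.

Lemma divisible_unramified S S' : pfield S -> (forall a b, S a b -> S' a b) ->
  divisible_values S -> unramified OL S S' -> divisible_values S'.
Proof.
move=> PF sub dv un a b n hab a0 n0; have [c [d [hc c0 u]]] := un _ _ hab a0.
have [e [f [he u']]] := dv _ _ n hc c0 n0; exists e, f; split; first exact: sub.
rewrite (_ : _ / a = (e ^+ n / c) * (a / c)^-1); last by field; rewrite ?c0 ?a0.
by apply: (vunitM VL) => //; apply: vunitV.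
Qed.

Lemma vunitX_inv (K : fieldType) (O : K -> Prop) (x : K) n : valuation_ring O -> (0 < n)%N ->
  vunit O (x ^+ n) -> vunit O x.
Proof.
move=> V n0 [xn0 [o1 o2]]; split; last split.
- by move: xn0; rewrite expf_eq0 n0.
- exact: (vrX_inv V n0).
- by apply: (vrX_inv V n0); rewrite exprVn.
Qed.

(** Shifting [P] by [c] makes [a - c] a root, so [v(a - c)] lies in the divisible hull of the values
    of [S], which adds nothing. *)
Lemma algebraic_unramified S P Q a : pfield S -> divisible_values S -> ppoly S P Q -> P != 0 ->
  P.[a] = 0 -> (forall d, ~ S a d) ->
  forall c d, S c d -> exists e f, S e f /\ vunit OL ((a - c) / e).
Proof.
move=> PF dv h P0 Pa na c d hc.
have [F [G [hFG F0 FE]]] := ppoly_affine PF h P0 hc (pf1 PF) (oner_neq0 _).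
have ac0 : a - c != 0.
  by rewrite subr_eq0; apply/eqP => e; apply: (na d); rewrite e.
have Fac : F.[a - c] = 0 by rewrite FE mul1r addrC subrK.
have [i [j [lt Fi Fj u]]] := algebraic_value VL F0 Fac ac0.
have q0 : F`_i / F`_j != 0 by rewrite mulf_neq0 ?invr_eq0.
have n0 : (0 < j - i)%N by rewrite subn_gt0.
have [e [f [he u']]] := dv _ _ (j - i)%N (pf_div PF (hFG i) (hFG j)) q0 n0.
exists e, f; split=> //; apply: (vunitX_inv VL n0); rewrite expr_div_n.
have e0 : e ^+ (j - i) != 0.
  by have [+ _] := u'; apply: contraNneq => ->; rewrite mul0r.
rewrite (_ : _ / e ^+ _ = ((a - c) ^+ (j - i) / (F`_i / F`_j)) * (e ^+ (j - i) / (F`_i / F`_j))^-1).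
  by apply: (vunitM VL) => //; apply: vunitV.
by move: (e ^+ _) e0 (F`_i / F`_j) q0 => E E0 q q0; field; rewrite ?E0 ?q0.
Qed.

(** If the values [v(a - c)] have no maximum, the extension is immediate. If [c] attains the maximum
    and [e] has this value, the residue of [(a - c) / e] is new, since otherwise [c] could be
    improved. *)
Lemma one_step S a : pfield S -> countable_graph S -> ball_saturated OM ->
  (forall d, ~ S a d) -> (forall c d, S c d -> exists e f, S e f /\ vunit OL ((a - c) / e)) ->
  exists x y, [/\ pfield (gen S x y), unramified OL S (gen S x y), (forall d, ~ S x d) &
    alg_pair S x y \/ ((exists d, gen S x y a d) /\ transcendental S a)].
Proof.
move=> PF cS BM na V.
have [I|] := EM (forall c d, S c d -> exists c' d', S c' d' /\ vlt OL (a - c) (a - c')).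
  have [x [y [h1 h2 h3 h4]]] := immediate_step RL RM NL NM ck PF cS BM I.
  exists x, y; split=> //; case: h4 => [h4|[-> h4]]; [by left|right; split=> //].
  by exists y; apply: (gen_mem PF).
move=> /existsNP [c] /existsNP [d] /not_implyP [hc nI].
have [e [f [he u]]] := V c d hc.
have [u0 [ou _]] := u.
have e0 : e != 0 by apply: contraNneq u0 => ->; rewrite invr0 mulr0.
have [|x [y [h1 h2 h3 h4]]] := residue_step RL RM NL NM ck PF ou.
  move=> c1 d1 h1 oc1 er; apply: nI; exists (c + e * c1), (d + f * d1).
  split; first by apply: (pfD PF) => //; apply: (pfM PF).
  have ac0 : a - c != 0 by apply: contraNneq u0 => ->; rewrite mul0r.
  apply/(vltE VL) => //.
  rewrite (_ : _ / _ = ((a - c) / e - c1) * ((a - c) / e)^-1); last by field; rewrite ?e0 ?ac0.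
  apply: (vmaxM VL); last by have [_ [_ ?]] := u.
  by apply/(rm_eqP RL).
exists x, y; split=> //; case: h4 => [h4|[ex tr]]; [by left|right; split].
  exists (d + f * y); rewrite (_ : a = c + e * x); last by rewrite ex; field; rewrite ?e0.
  apply: (pfD h1); first exact: (gen_sub PF).
  by apply: (pfM h1); [apply: (gen_sub PF)|apply: (gen_mem PF)].
move=> P Q h P0; have [F [G [hFG F0 FE]]] := ppoly_affine PF h P0 hc he e0.
have := tr _ _ hFG F0; rewrite FE (_ : c + _ = a) //.
by field; rewrite ?e0.
Qed.

Lemma gen_in_hull S (g : nat -> L) x y : pfield S -> (forall a b, S a b -> in_hull g a) ->
  in_hull g x -> forall a b, gen S x y a b -> in_hull g a.
Proof.
move=> PF hS hx a b [P [Q [P' [Q' [h h' [n1 n2] -> _]]]]].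
have C0 : in_hull g 0 by apply: (hS _ 0); apply: (pf0 PF).
have CD u v : in_hull g u -> in_hull g v -> in_hull g (u + v).
  by move=> hu hv; rewrite -[v]opprK -[- v]sub0r; apply: hullB => //; apply: hullB.
have Ch (P0 : {poly L}) Q0 : ppoly S P0 Q0 -> in_hull g P0.[x].
  move=> h0; rewrite horner_coef; apply: (big_ind (in_hull g)) => // i _.
  apply: hullM; first exact: (hS _ _ (h0 i)).
  elim: {i} (nat_of_ord i) => [|i IH]; rewrite ?expr0 ?exprS; last exact: hullM.
  by apply: (hS _ 1); apply: (pf1 PF).
by apply: hullM; [apply: Ch h|apply: hullV; apply: Ch h'].
Qed.

Lemma countable_in_hull S (g : nat -> L) : pfield S -> (forall a b, S a b -> in_hull g a) ->
  countable_graph S.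
Proof.
move=> PF hS.
have [w hw] : {w : nat -> L * M & forall n, S (w n).1 (w n).2 /\
    forall b, S (hull g n) b -> w n = (hull g n, b)}.
  apply: (@choice _ _ (fun n z => S z.1 z.2 /\ forall b, S (hull g n) b -> z = (hull g n, b))) => n.
  have [[b hb]|no] := EM (exists b, S (hull g n) b).
    exists (hull g n, b); split=> // b' hb'; congr (_, _).
    exact: (pf_funct RL RM PF hb hb').
  exists (1, 1); split; first exact: (pf1 PF).
  by move=> b hb; case: no; exists b.
exists w; split=> [n|a b hab]; first by case: (hw n).
have [n en] := hS _ _ hab; exists n; have [_ h] := hw n.
by rewrite (h b) en.
Qed.
End ClosureSteps.

Section Closure.
Variables (L M k : fieldType) (OL : L -> Prop) (OM : M -> Prop) (rL : L -> k) (rM : M -> k).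
Hypothesis RL : residue_map OL rL.
Hypothesis RM : residue_map OM rM.
Hypothesis NL : newtonian OL.
Hypothesis NM : newtonian OM.
Hypothesis ck : forall n, (0 < n)%N -> n%:R != 0 :> k.
Let VL := rm_vr RL.
Let VM := rm_vr RM.
Local Notation pfield := (pfield OL OM rL rM).
Implicit Type S : L -> M -> Prop.

Lemma divisible_swap S : pfield S -> divisible_values OL S -> divisible_values OM (swap S).
Proof.
move=> PF dv b a n hab b0 n0.
have a0 : a != 0 by rewrite (pf_neq0 RL RM PF hab).
have [c [d [hc u]]] := dv a b n hab a0 n0; exists d, c; split=> //.
have h : S (c ^+ n / a) (d ^+ n / b) by apply: (pf_div PF) => //; apply: (pfX PF).
exact/(pf_unit RL RM PF h).
Qed.

(* Zorn's lemma is applied to the extensions whose domain is contained in a fixed countable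
   field [in_hull g] that is closed under taking roots, so that countability is preserved. *)
Lemma closure_ex S : pfield S -> countable_graph S -> divisible_values OL S ->
  ball_saturated OL -> ball_saturated OM ->
  exists S', [/\ (forall a b, S a b -> S' a b), pfield S', countable_graph S', unramified OL S S' &
              closed_left S' /\ closed_right S'].
Proof.
move=> PF [g [gS gsur]] dv BL BM.
pose C := in_hull (fun n => (g n).1).
have CS a b : S a b -> C a by move=> /gsur [n gn]; have := hull_base (fun n => (g n).1) n; rewrite gn.
pose rel (X : set (L * M)) a b := X (a, b).
pose good S' := [/\ forall a b, S a b -> S' a b, pfield S', unramified OL S S' &
                    forall a b, S' a b -> C a].
have goodS : good S.
  by split=> // a b h a0; exists a, b; split=> //; rewrite divff //; apply: (vunit1 VL).
pose F (X : set (L * M)) := X = set0 \/ good (rel X).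
have [X [FX maxX]] : exists X, F X /\ forall Y, (X `<` Y)%classic -> ~ F Y.
  apply: Zorn_bigcup => G GF tot.
  have [[X0 [GX0 gX0]]|no] := EM (exists X, G X /\ good (rel X)); last first.
    left; rewrite predeqE => z; split=> // -[X GX Xz].
    by case: (GF X GX) => [e|gX]; [rewrite e in Xz|apply: no; exists X].
  right.
  have two a b c d : rel (\bigcup_(X in G) X)%classic a b -> rel (\bigcup_(X in G) X)%classic c d ->
      exists X, [/\ G X, good (rel X), rel X a b & rel X c d].
    have gX X z : G X -> X z -> good (rel X).
      by move=> GX Xz; case: (GF X GX) => // e; rewrite e in Xz.
    move=> [X GX Xz] [Y GY Yz]; case: (tot X Y GX GY) => sub.
      by exists Y; split=> //; [apply: gX Yz|apply: sub].
    by exists X; split=> //; [apply: gX Xz|apply: sub].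
  have up X a b : G X -> rel X a b -> rel (\bigcup_(X in G) X)%classic a b.
    by move=> GX h; exists X.
  have [s0 p0 _ _] := gX0.
  split.
  - by move=> a b h; apply: (up X0) => //; apply: s0.
  - split.
    + by apply: (up X0) => //; apply: (pf1 p0).
    + move=> a b c d h h'; have [X [GX [_ p _ _] q q']] := two _ _ _ _ h h'.
      by apply: (up X) => //; apply: (pfB p).
    + move=> a b c d h h'; have [X [GX [_ p _ _] q q']] := two _ _ _ _ h h'.
      by apply: (up X) => //; apply: (pfM p).
    + move=> a b h; have [X [GX [_ p _ _] q q']] := two _ _ _ _ h h.
      by apply: (up X) => //; apply: (pfV p).
    + move=> a b h; have [X [GX [_ p _ _] q q']] := two _ _ _ _ h h.
      exact: (pf_same p).
  - move=> a b h; have [X [GX [_ _ u _] q q']] := two _ _ _ _ h h; exact: u q.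
  - move=> a b h; have [X [GX [_ _ _ c] q q']] := two _ _ _ _ h h; exact: c q.
have {FX} [sub PX unX CX] : good (rel X).
  case: FX => // X0; exfalso; apply: (maxX (fun z => S z.1 z.2)); last by right.
  split; first by rewrite X0.
  by move=> h; have := h (1, 1) (pf1 PF); rewrite X0.
have max x y : pfield (gen (rel X) x y) -> unramified OL (rel X) (gen (rel X) x y) ->
    C x -> rel X x y.
  move=> pg ug Cx; apply: contrapT => nxy.
  apply: (maxX (fun z => gen (rel X) x y z.1 z.2)).
    split; first by move=> [a b] h; apply: (gen_sub PX).
    by move=> h; apply: nxy; apply: (h (x, y)); apply: (gen_mem PX).
  right; suff : good (gen (rel X) x y) by [].
  split.
  - by move=> a b /sub h; apply: (gen_sub PX).
  - exact: pg.
  - exact: (unramified_trans RL PF unX ug).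
  - move=> a b; apply: (gen_in_hull PX) => // c d; exact: CX.
have dvX : divisible_values OL (rel X) := divisible_unramified RL PF sub dv unX.
have cX : countable_graph (rel X) := countable_in_hull RL RM PX CX.
exists (rel X); split=> //; split.
  (* A missing root allows [one_step]. Its transcendental outcome contradicts [P(a) = 0]; its
     algebraic outcome is an element of the hull and contradicts maximality. *)
  move=> a P Q h P0 Pa; apply: contrapT => na'.
  have na d : ~ rel X a d by move=> hd; apply: na'; exists d.
  have [x [y [pg ug nx alt]]] := one_step RL RM NL NM ck PX cX BM na (algebraic_unramified RL RM PX dvX h P0 Pa na).
  case: alt => [[P' [Q' [h' P0' Px _]]]|[_ tr]]; last first.
    by have := tr P Q h P0; rewrite Pa eqxx.
  apply: (nx y); apply: max => //.
  by apply: (hull_root P0') => // i; apply: CX (h' i).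
move=> b P Q h P0 Qb; apply: contrapT => nb'.
have nb d : ~ swap (rel X) b d by move=> hd; apply: nb'; exists d.
have PX' := pfield_swap PX; have dvX' := divisible_swap PX dvX.
have Q0 : Q != 0 by rewrite -(ppoly_eq0 RL RM PX h).
have h' : ppoly (swap (rel X)) Q P by move=> i; apply: h.
have [y [x [pg ug ny alt]]] := one_step RM RL NM NL ck PX' (countable_swap cX) BL nb
  (algebraic_unramified RM RL PX' dvX' h' Q0 Qb nb).
case: alt => [[Q' [P' [h2 Q0' Qy Px]]]|[_ tr]]; last by have := tr Q P h' Q0; rewrite Qb eqxx.
have h3 : ppoly (rel X) P' Q' by move=> i; apply: h2.
have gE : swap (gen (swap (rel X)) y x) = gen (rel X) x y.
  apply: funext => a; apply: funext => c; apply: propext; split; first exact: gen_swap.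
  exact: (@gen_swap _ _ (swap (rel X)) y x).
have pg' : pfield (gen (rel X) x y) by rewrite -gE; apply: pfield_swap.
apply: (ny x); apply: max => //.
  move=> a c hac a0.
  have c0 : c != 0 by rewrite -(pf_neq0 RL RM pg' hac).
  have hca : gen (swap (rel X)) y x c a by rewrite -gE in hac.
  have [d' [c' [hd d0 u]]] := ug _ _ hca c0.
  exists c', d'; split=> //; first by rewrite (pf_neq0 RL RM PX hd).
  by apply/(pf_unit RL RM pg' (pf_div pg' hac (gen_sub PX x y hd))).
apply: (hull_root (P := P')) => //; first by rewrite (ppoly_eq0 RL RM PX h3).
by move=> i; apply: CX (h3 i).
Qed.
End Closure.

(** * Adjoining a new value *)

(** [x j] is a [j!]-th root of [x 0]. Adjoining the whole sequence keeps the value group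
    divisible. *)
Definition coherent (K : fieldType) (x : nat -> K) := forall j, x j.+1 ^+ j.+1 = x j.

Definition root_saturated (K : fieldType) (O : K -> Prop) := forall a, a != 0 ->
  exists x : nat -> K, coherent x /\ vunit O (a / x 0%N).

Definition cut_saturated (K : fieldType) (O : K -> Prop) :=
  forall (d : nat -> K) (s : nat -> Prop),
    (forall i, s i -> d i != 0) -> (forall i j, s i -> ~ s j -> vlt O (d i) (d j)) ->
    exists y : nat -> K, [/\ coherent y, y 0%N != 0,
      forall i, s i -> vlt O (d i) (y 0%N) & forall i, ~ s i -> vlt O (y 0%N) (d i)].

Lemma coherent0 (K : fieldType) (x : nat -> K) : coherent x -> forall j, x j ^+ j`! = x 0%N.
Proof.
move=> cx; elim=> [|j IH]; first by rewrite fact0 expr1.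
by rewrite factS exprM cx IH.
Qed.

Lemma coherent_neq0 (K : fieldType) (x : nat -> K) : coherent x -> x 0%N != 0 -> forall j, x j != 0.
Proof.
move=> cx x0 j; apply: contraNneq x0 => xj.
by rewrite -(coherent0 cx j) xj expr0n eqn0Ngt fact_gt0.
Qed.

Lemma coherent_le j m : (j <= m)%N -> exists t, forall (K : fieldType) (x : nat -> K),
  coherent x -> x j = x m ^+ t.
Proof.
move=> /subnK <-; elim: (m - j)%N => [|k [t IH]].
  by exists 1%N => K x _; rewrite add0n expr1.
by exists ((k + j).+1 * t)%N => K x cx; rewrite addSn exprM cx; apply: IH.
Qed.

Lemma pfield_union (L M k : fieldType) (OL : L -> Prop) (OM : M -> Prop) (rL : L -> k) (rM : M -> k)
    (F : nat -> L -> M -> Prop) : (forall j, pfield OL OM rL rM (F j)) ->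
  (forall j a b, F j a b -> F j.+1 a b) -> pfield OL OM rL rM (fun a b => exists j, F j a b).
Proof.
move=> pf inc.
have mono i j a b : (i <= j)%N -> F i a b -> F j a b.
  by move=> /subnK <-; elim: (j - i)%N => // n IH h; apply: inc; apply: IH.
split.
- by exists 0%N; apply: (pf1 (pf 0%N)).
- move=> a b c d [i h] [j h']; exists (maxn i j).
  by apply: (pfB (pf _)); [apply: mono h|apply: mono h']; rewrite ?leq_maxl ?leq_maxr.
- move=> a b c d [i h] [j h']; exists (maxn i j).
  by apply: (pfM (pf _)); [apply: mono h|apply: mono h']; rewrite ?leq_maxl ?leq_maxr.
- by move=> a b [i h]; exists i; apply: (pfV (pf _)).
- by move=> a b [i h]; apply: (pf_same (pf i)).
Qed.

Section ValueStep.
Variables (L M k : fieldType) (OL : L -> Prop) (OM : M -> Prop) (rL : L -> k) (rM : M -> k).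
Hypothesis RL : residue_map OL rL.
Hypothesis RM : residue_map OM rM.
Let VL := rm_vr RL.
Let VM := rm_vr RM.
Local Notation pfield := (pfield OL OM rL rM).
Local Notation unit_same := (unit_same OL OM rL rM).
Variable S : L -> M -> Prop.
Hypothesis PF : pfield S.
Hypothesis dv : divisible_values OL S.
Variables (X : nat -> L) (Y : nat -> M).
Hypothesis cX : coherent X.
Hypothesis cY : coherent Y.
Hypothesis X0 : X 0%N != 0.
Hypothesis Y0 : Y 0%N != 0.
Hypothesis newX : forall e f, S e f -> ~ vunit OL (X 0%N / e).
Hypothesis cut : forall e f, S e f -> vlt OL e (X 0%N) <-> vlt OM f (Y 0%N).
Hypothesis cut' : forall e f, S e f -> vlt OL (X 0%N) e <-> vlt OM (Y 0%N) f.
Let Xn j : X j != 0 := coherent_neq0 cX X0 j.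
Let Yn j : Y j != 0 := coherent_neq0 cY Y0 j.

(** Raise both sides to the power [j!]. Since values of [S] are divisible, [c ^ j!] has the value of
    some [e ^ n] with [e] in [S], and the question becomes the comparison of [e] with [X 0], on
    which both cuts agree. *)
Lemma value_compare c d j n : S c d -> c != 0 -> (0 < n)%N ->
  (vlt OL c (X j ^+ n) /\ vlt OM d (Y j ^+ n)) \/ (vlt OL (X j ^+ n) c /\ vlt OM (Y j ^+ n) d).
Proof.
move=> h c0 n0; have d0 : d != 0 by rewrite -(pf_neq0 RL RM PF h).
have hj := pfX PF j`! h.
have cj : c ^+ j`! != 0 by rewrite expf_neq0.
have dj : d ^+ j`! != 0 by rewrite expf_neq0.
have [e [f [he u]]] := dv hj cj n0.
have w : vunit OM (f ^+ n / d ^+ j`!).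
  have hq : S (e ^+ n / c ^+ j`!) (f ^+ n / d ^+ j`!) by apply: (pf_div PF) => //; apply: (pfX PF).
  exact/(pf_unit RL RM PF hq).
have [q1 q2] := proj1 (@vunitE _ OL _ (e ^+ n) cj) u; have [r1 r2] := proj1 (@vunitE _ OM _ (f ^+ n) dj) w.
have XE : (X j ^+ n) ^+ j`! = X 0%N ^+ n by rewrite exprAC (coherent0 cX).
have YE : (Y j ^+ n) ^+ j`! = Y 0%N ^+ n by rewrite exprAC (coherent0 cY).
have e0 : e != 0.
  by have [+ _] := u; apply: contraNneq => ->; rewrite expr0n eqn0Ngt n0 mul0r.
have [lt|lt] : vlt OL e (X 0%N) \/ vlt OL (X 0%N) e.
  apply: contrapT => /not_orP [/contrapT h1 /contrapT h2].
  by apply: (newX he); apply/vunitE.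
- left; have lt' := proj1 (cut he) lt.
  split; apply: (@vltX_inv _ _ _ j`!) => //; rewrite ?XE ?YE.
    by apply: (vle_lt_trans VL q1); apply: vltX.
  by apply: (vle_lt_trans VM r1); apply: vltX.
- right; have lt' := proj1 (cut' he) lt.
  split; apply: (@vltX_inv _ _ _ j`!) => //; rewrite ?XE ?YE.
    by apply: (vlt_le_trans VL _ q2); apply: vltX.
  by apply: (vlt_le_trans VM _ r2); apply: vltX.
Qed.

Definition value_monomial j a b := exists c d q r,
  [/\ S c d, c != 0, a = c * X j ^+ q / X j ^+ r & b = d * Y j ^+ q / Y j ^+ r].

(** No multiple of the value of [X j] is a value of [S], so the non-zero terms of a polynomial in
    [X j] have distinct values and the least of them determines its value. The same term is least in
    [M]. *)
Lemma value_gen j : pfield (gen S (X j) (Y j)) /\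
  (forall a b, gen S (X j) (Y j) a b -> a != 0 -> exists c d, value_monomial j c d /\ vunit OL (a / c)).
Proof.
apply: (gen_pfield RL RM PF).
- move=> a b a' b' [c [d [q [r [h c0 -> ->]]]]] [c' [d' [q' [r' [h' c0' -> ->]]]]].
  exists (c / c'), (d / d'), (q + r')%N, (r + q')%N; split.
  + exact: (pf_div PF).
  + by rewrite mulf_neq0 ?invr_eq0.
  + rewrite !exprD; move: (X j ^+ q) (X j ^+ q') (X j ^+ r) (X j ^+ r') (expf_neq0 q (Xn j))
      (expf_neq0 q' (Xn j)) (expf_neq0 r (Xn j)) (expf_neq0 r' (Xn j)) => A B C D A0 B0 C0 D0.
    by field; rewrite ?A0 ?B0 ?C0 ?D0 ?c0'.
  + have d0' : d' != 0 by rewrite -(pf_neq0 RL RM PF h').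
    rewrite !exprD; move: (Y j ^+ q) (Y j ^+ q') (Y j ^+ r) (Y j ^+ r') (expf_neq0 q (Yn j))
      (expf_neq0 q' (Yn j)) (expf_neq0 r (Yn j)) (expf_neq0 r' (Yn j)) => A B C D A0 B0 C0 D0.
    by field; rewrite ?A0 ?B0 ?C0 ?D0 ?d0'.
- move=> a b [c [d [q [r [h c0 -> ->]]]]].
  have d0 : d != 0 by rewrite -(pf_neq0 RL RM PF h).
  have inf u w : u != 0 -> w != 0 -> vlt OL u 1 -> vlt OM w 1 -> same_place OL OM rL rM u w.
    move=> u0 w0; rewrite /vlt !vdiv1 => nu nw.
    by split=> [|/nu //]; split.
  have fin u w : vlt OL 1 u -> vlt OM 1 w -> same_place OL OM rL rM u w.
    move=> /(vlt1 VL) mu /(vlt1 VM) mw.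
    split; first by split=> _; [apply: vmaxW mw|apply: vmaxW mu].
    move=> _; rewrite (proj2 (rm_eq0 RL (vmaxW mu)) mu).
    by rewrite (proj2 (rm_eq0 RM (vmaxW mw)) mw).
  split; rewrite ?mulf_neq0 ?invr_eq0 ?expf_neq0 //.
  have [lt|lt|->] := ltngtP q r; last by rewrite !mulfK ?expf_neq0 //; apply: (pf_same PF).
  + have n0 : (0 < r - q)%N by rewrite subn_gt0.
    have -> : c * X j ^+ q / X j ^+ r = c / X j ^+ (r - q).
      rewrite (_ : X j ^+ r = X j ^+ (r - q) * X j ^+ q); last by rewrite -exprD subnK // ltnW.
      have := expf_neq0 q (Xn j); have := expf_neq0 (r - q) (Xn j).
      by move: (X j ^+ q) (X j ^+ (r - q)) => A B B0 A0; field; rewrite ?A0 ?B0.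
    have -> : d * Y j ^+ q / Y j ^+ r = d / Y j ^+ (r - q).
      rewrite (_ : Y j ^+ r = Y j ^+ (r - q) * Y j ^+ q); last by rewrite -exprD subnK // ltnW.
      have := expf_neq0 q (Yn j); have := expf_neq0 (r - q) (Yn j).
      by move: (Y j ^+ q) (Y j ^+ (r - q)) => A B B0 A0; field; rewrite ?A0 ?B0.
    have xn := expf_neq0 (r - q) (Xn j); have yn := expf_neq0 (r - q) (Yn j).
    case: (value_compare j h c0 n0) => -[h1 h2].
      apply: inf; rewrite ?mulf_neq0 ?invr_eq0 //.
        by apply/(vlt_mul2r VL _ _ xn); rewrite divfK // mul1r.
      by apply/(vlt_mul2r VM _ _ yn); rewrite divfK // mul1r.
    apply: fin.
      by apply/(vlt_mul2r VL _ _ xn); rewrite divfK // mul1r.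
    by apply/(vlt_mul2r VM _ _ yn); rewrite divfK // mul1r.
  + have n0 : (0 < q - r)%N by rewrite subn_gt0.
    have -> : c * X j ^+ q / X j ^+ r = c * X j ^+ (q - r).
      rewrite (_ : X j ^+ q = X j ^+ (q - r) * X j ^+ r); last by rewrite -exprD subnK // ltnW.
      by rewrite mulrA mulfK // expf_neq0.
    have -> : d * Y j ^+ q / Y j ^+ r = d * Y j ^+ (q - r).
      rewrite (_ : Y j ^+ q = Y j ^+ (q - r) * Y j ^+ r); last by rewrite -exprD subnK // ltnW.
      by rewrite mulrA mulfK // expf_neq0.
    have ci0 : c^-1 != 0 by rewrite invr_eq0.
    have di0 : d^-1 != 0 by rewrite invr_eq0.
    case: (value_compare j (pfV PF h) ci0 n0) => -[h1 h2].
      apply: fin.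
        by apply/(vlt_mul2l VL _ _ ci0); rewrite mulKf // mulr1.
      by apply/(vlt_mul2l VM _ _ di0); rewrite mulKf // mulr1.
    apply: inf; rewrite ?mulf_neq0 ?expf_neq0 //.
      by apply/(vlt_mul2l VL _ _ ci0); rewrite mulKf // mulr1.
    by apply/(vlt_mul2l VM _ _ di0); rewrite mulKf // mulr1.
- move=> P Q h; have [P0|P0] := eqVneq P 0.
    left; have /eqP Q0 : Q == 0 by rewrite -(ppoly_eq0 RL RM PF h) P0.
    by rewrite P0 Q0 !horner0.
  right; pose t i := P`_i * X j ^+ i; pose w i := Q`_i * Y j ^+ i.
  have t0 i : (t i != 0) = (P`_i != 0) by rewrite mulf_eq0 expf_eq0 (negPf (Xn j)) andbF orbF.
  have w0 i : (w i != 0) = (P`_i != 0).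
    by rewrite mulf_eq0 expf_eq0 (negPf (Yn j)) andbF orbF -(pf_neq0 RL RM PF (h i)).
  have cmp i l : (i < l)%N -> P`_i != 0 -> P`_l != 0 ->
      (vlt OL (t i) (t l) /\ vlt OM (w i) (w l)) \/ (vlt OL (t l) (t i) /\ vlt OM (w l) (w i)).
    move=> lt Pi Pl; have n0 : (0 < l - i)%N by rewrite subn_gt0.
    have Ql : Q`_l != 0 by rewrite -(pf_neq0 RL RM PF (h l)).
    have q0 : P`_i / P`_l != 0 by rewrite mulf_neq0 ?invr_eq0.
    have z1 : P`_l * X j ^+ i != 0 by rewrite mulf_neq0 ?expf_neq0.
    have z2 : Q`_l * Y j ^+ i != 0 by rewrite mulf_neq0 ?expf_neq0.
    have e1 : t i = (P`_l * X j ^+ i) * (P`_i / P`_l) by rewrite /t; field; rewrite ?Pl.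
    have e2 : t l = (P`_l * X j ^+ i) * X j ^+ (l - i).
      by rewrite /t -mulrA -exprD subnKC // ltnW.
    have e3 : w i = (Q`_l * Y j ^+ i) * (Q`_i / Q`_l) by rewrite /w; field; rewrite ?Ql.
    have e4 : w l = (Q`_l * Y j ^+ i) * Y j ^+ (l - i).
      by rewrite /w -mulrA -exprD subnKC // ltnW.
    rewrite e1 e2 e3 e4 !vlt_mul2l //.
    exact: (value_compare j (pf_div PF (h i) (h l)) q0 n0).
  have [||m [mn tm hm]] := @vdiv_min _ _ VL t (size P) (size P).-1 _ _.
  - by rewrite prednK // size_poly_gt0.
  - by rewrite t0 -lead_coefE lead_coef_eq0.
  have wm : w m != 0 by rewrite w0 -t0.
  have str i : (i < size P)%N -> i != m -> vlt OL (t m) (t i) /\ vlt OM (w m) (w i).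
    move=> iP im; have [Pi|Pi] := eqVneq P`_i 0.
      by rewrite /t /w Pi (proj1 (pf_eq0 RL RM PF (h i)) Pi) !mul0r; split; apply/vltx0.
    have Pm : P`_m != 0 by rewrite -t0.
    have no : ~ vlt OL (t i) (t m) by move=> lt; apply: lt; apply: hm.
    move: im; rewrite neq_ltn => /orP [lt|lt]; first by case: (cmp _ _ lt Pi Pm) => -[].
    by case: (cmp _ _ lt Pm Pi) => -[].
  exists (t m), (w m); split.
    exists P`_m, Q`_m, m, 0%N; split; rewrite ?expr0 ?divr1 //; by rewrite -t0.
  have l1 : vlt OL (t m) (P.[X j] - t m).
    rewrite horner_coef (bigD1 (Ordinal mn)) //= -/(t m) [X in vlt _ _ X]addrC addKr.
    by apply: vlt_sum => // i im; case: (str i (ltn_ord i) im).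
  have mn' := mn; rewrite (ppoly_size RL RM PF h) in mn'.
  have l2 : vlt OM (w m) (Q.[Y j] - w m).
    rewrite horner_coef (bigD1 (Ordinal mn')) //= -/(w m) [X in vlt _ _ X]addrC addKr.
    apply: vlt_sum => // i im; case: (str i _ im) => //.
    by rewrite (ppoly_size RL RM PF h).
  have [u1 r1] := near_unit RL l1; have [u2 r2] := near_unit RM l2.
  by split=> //; rewrite r1 r2.
Qed.

Definition value_ext a b := exists j, gen S (X j) (Y j) a b.

Lemma value_ext_pfield : pfield value_ext.
Proof.
apply: pfield_union => [j|j a b]; first by case: (value_gen j).
apply: (gen_min RL RM); first by case: (value_gen j.+1).
  by move=> c d; apply: (gen_sub PF).
by have := pfX (proj1 (value_gen j.+1)) j.+1 (gen_mem PF _ _); rewrite cX cY.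
Qed.

Lemma value_ext_sub a b : S a b -> value_ext a b.
Proof. by move=> h; exists 0%N; apply: (gen_sub PF). Qed.

Lemma value_ext_mem j : value_ext (X j) (Y j).
Proof. by exists j; apply: (gen_mem PF). Qed.

Lemma value_ext_divisible : divisible_values OL value_ext.
Proof.
move=> a b n [j hab] a0 n0; have [_ un] := value_gen j.
have [c [d [[c' [d' [q [r [h c0 -> _]]]]] u]]] := un _ _ hab a0.
have [e [f [he u']]] := dv h c0 n0.
(* The index [m] is at least [j] and [m + 1] is a multiple of [n]; hence [X j], a power of [X m], is
   an [n]-th power of a power of [X (m + 1)]. *)
have le : (j <= (j.+1 * n).-1)%N by rewrite -ltnS prednK ?muln_gt0 // leq_pmulr.
have [t ht] := coherent_le le.
set m := (j.+1 * n).-1 in ht; have mE : (m.+1 = j.+1 * n)%N by rewrite /m prednK // muln_gt0.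
pose s := (j.+1 * t)%N.
have XE : X j = (X m.+1 ^+ s) ^+ n.
  by rewrite (ht _ _ cX) -cX -!exprM mE /s mulnAC.
exists (e * (X m.+1 ^+ s) ^+ q / (X m.+1 ^+ s) ^+ r), (f * (Y m.+1 ^+ s) ^+ q / (Y m.+1 ^+ s) ^+ r).
split.
  have pe := value_ext_pfield; have hm := pfX pe s (value_ext_mem m.+1).
  apply: (pf_div pe); last exact: (pfX pe).
  by apply: (pfM pe); [apply: value_ext_sub|apply: (pfX pe)].
have Z0 : X m.+1 ^+ s != 0 by rewrite expf_neq0.
rewrite XE in u; move: (X m.+1 ^+ s) Z0 u => Z Z0 u.
have -> : (e * Z ^+ q / Z ^+ r) ^+ n / a =
   (e ^+ n / c') * (a / (c' * (Z ^+ n) ^+ q / (Z ^+ n) ^+ r))^-1.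
  rewrite expr_div_n exprMn !(exprAC _ n).
  have := expf_neq0 n (expf_neq0 q Z0); have := expf_neq0 n (expf_neq0 r Z0).
  rewrite !(exprAC _ _ n).
  move: ((Z ^+ n) ^+ q) ((Z ^+ n) ^+ r) => A B B0 A0.
  by field; rewrite ?A0 ?B0 ?a0 ?c0.
by apply: (vunitM VL) => //; apply: vunitV.
Qed.

Lemma value_ext_countable : countable_graph S -> countable_graph value_ext.
Proof.
move=> [g [gS gsur]].
pose h n := match unpickle n : option (bool * nat) with
            | Some (true, i) => (g i).1 | Some (false, i) => X i | None => 0 end.
apply: (countable_in_hull RL RM (g := h) value_ext_pfield) => a b [j].
apply: (gen_in_hull PF).
  move=> c d /gsur [n gn]; have := hull_base h (pickle (true, n)).
  by rewrite /h pickleK gn.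
by have := hull_base h (pickle (false, j)); rewrite /h pickleK.
Qed.
End ValueStep.

(** * Back and forth *)

Lemma root_one (K k : fieldType) (O : K -> Prop) (res : K -> k) u n : residue_map O res ->
  newtonian O -> (forall n, (0 < n)%N -> n%:R != 0 :> k) -> (0 < n)%N -> O u -> res u = 1 ->
  exists r, [/\ r ^+ n = u, O r & res r = 1].
Proof.
move=> R N ck n0 ou ru; have V := rm_vr R.
have [||||b [ob /rootP rb mb]] := @newtonian_henselian _ _ V N ('X^n - u%:P) 1 _ _ (vr1 V).
- by rewrite monicXnsubC.
- move=> i; rewrite coefB coefXn coefC; apply: (vrB V); first exact: (vr_nat V).
  by case: eqP => _ //; apply: (vr0 V).
- rewrite !hornerE expr1n; apply/(rm_eqP R) => //; first exact: (vr1 V).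
  by rewrite ru (rm1 R).
- rewrite derivB derivXn derivC subr0 hornerMn hornerXn expr1n.
  exact: (rm_char0 R ck).
move: rb; rewrite !hornerE => /eqP; rewrite subr_eq0 => /eqP rb.
exists b; split=> //; rewrite -(rm1 R); apply/(rm_eqP R) => //; exact: (vr1 V).
Qed.

Lemma coherent_one (K k : fieldType) (O : K -> Prop) (res : K -> k) u : residue_map O res ->
  newtonian O -> (forall n, (0 < n)%N -> n%:R != 0 :> k) -> O u -> res u = 1 ->
  exists x : nat -> K, coherent x /\ x 0%N = u.
Proof.
move=> R N ck ou ru.
have ex (w : {v : K | O v /\ res v = 1}) (n : nat) :
    exists w' : {v : K | O v /\ res v = 1}, sval w' ^+ n.+1 = sval w.
  case: w => v [ov rv] /=; have [r [h1 h2 h3]] := root_one R N ck (ltn0Sn n) ov rv.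
  by exists (exist _ r (conj h2 h3)).
pose f := fix f n : {v : K | O v /\ res v = 1} := match n with
  | 0%N => exist _ u (conj ou ru) | n'.+1 => projT1 (cid (ex (f n') n')) end.
exists (fun n => sval (f n)); split=> // j /=.
by case: (cid _).
Qed.

Section BackAndForth.
Variables (L M k : fieldType) (OL : L -> Prop) (OM : M -> Prop) (rL : L -> k) (rM : M -> k).
Hypothesis RL : residue_map OL rL.
Hypothesis RM : residue_map OM rM.
Hypothesis NL : newtonian OL.
Hypothesis NM : newtonian OM.
Hypothesis ck : forall n, (0 < n)%N -> n%:R != 0 :> k.
Hypothesis BL : ball_saturated OL.
Hypothesis BM : ball_saturated OM.
Let VL := rm_vr RL.
Let VM := rm_vr RM.
Local Notation pfield := (pfield OL OM rL rM).

Definition bf_good (S : L -> M -> Prop) := [/\ pfield S, countable_graph S, divisible_values OL S,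
  closed_left S & closed_right S].

Lemma bf_closure S : pfield S -> countable_graph S -> divisible_values OL S ->
  exists S', [/\ (forall a b, S a b -> S' a b), bf_good S' & unramified OL S S'].
Proof.
move=> PF cS dv; have [S' [sub pf' cS' un [cl cr]]] := closure_ex RL RM NL NM ck PF cS dv BL BM.
by exists S'; split=> //; split=> //; apply: (divisible_unramified RL PF sub dv un).
Qed.

Lemma gen_countable S x y : pfield S -> countable_graph S -> pfield (gen S x y) ->
  countable_graph (gen S x y).
Proof.
move=> PF [g [gS gsur]] pg.
pose h n := if n is n'.+1 then (g n').1 else x.
apply: (countable_in_hull RL RM (g := h) pg); apply: (gen_in_hull PF).
  by move=> c d /gsur [n gn]; have := hull_base h n.+1; rewrite /= gn.
exact: (hull_base h 0).
Qed.

Lemma bf_residue S x0 : bf_good S -> OL x0 ->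
  exists S', [/\ (forall a b, S a b -> S' a b), bf_good S', unramified OL S S' &
    exists e f, [/\ S' e f, OL e & rL e = rL x0]].
Proof.
move=> gS ox0; have [PF cS dv cl cr] := gS.
have [[e [f [he oe re]]]|no] := EM (exists e f, [/\ S e f, OL e & rL e = rL x0]).
  exists S; split=> //; last by exists e, f.
  by move=> a b h a0; exists a, b; split=> //; rewrite divff //; apply: (vunit1 VL).
have nx d : ~ S x0 d by move=> h; apply: no; exists x0, d.
(* For integral [c] the difference is a unit because the residue of [x0] is new; for other [c] it
   has the value of [c]. *)
have V c d : S c d -> exists e f, S e f /\ vunit OL ((x0 - c) / e).
  move=> h; have [oc|noc] := EM (OL c).
    exists 1, 1; split; first exact: (pf1 PF).
    rewrite divr1; apply/(rm_unit RL); first exact: (vrB VL).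
    by rewrite (rmB RL) // => /eqP; rewrite subr_eq0 => /eqP e; apply: no; exists c, d.
  exists c, d; split=> //; have c0 : c != 0 by apply: contra_notN noc => /eqP ->; apply: (vr0 VL).
  have mc := vrN_max VL noc.
  rewrite mulrBl divff // addrC; apply: (vunit_add VL); last exact: (vmaxMr VL).
  by apply: (vunitN VL); apply: (vunit1 VL).
have [x [y [pg ug nx' alt]]] := one_step RL RM NL NM ck PF cS BM nx V.
case: alt => [[P [Q [h P0 Px _]]]|[[d hd] _]].
  by have [d hd] := cl x P Q h P0 Px; case: (nx' d).
have dvg := divisible_unramified RL PF (fun a b => gen_sub PF x y (a:=a) (b:=b)) dv ug.
have [S' [sub gS' un]] := bf_closure pg (gen_countable PF cS pg) dvg.
exists S'; split=> //.
- by move=> a b h; apply: sub; apply: (gen_sub PF).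
- exact: (unramified_trans RL PF ug un).
- by exists x0, d; split=> //; apply: sub.
Qed.

Hypothesis rootL : root_saturated OL.
Hypothesis cutM : cut_saturated OM.

(** When [a] adds no value, [one_step] applies, and its algebraic outcome is excluded because [S] is
    algebraically closed in [L]. Otherwise some [a - c] has a new value. This element is first
    rescaled so that it has a coherent system of roots, and then sent to an element of [M] that
    fills the corresponding cut. *)
Lemma bf_forth S a : bf_good S -> exists S', [/\ (forall a b, S a b -> S' a b), bf_good S' &
  exists b, S' a b].
Proof.
move=> gS; have [PF cS dv cl cr] := gS.
have [ex|na'] := EM (exists b, S a b); first by exists S.
have na d : ~ S a d by move=> h; apply: na'; exists d.
have [V|] := EM (forall c d, S c d -> exists e f, S e f /\ vunit OL ((a - c) / e)).
  have [x [y [pg ug nx' alt]]] := one_step RL RM NL NM ck PF cS BM na V.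
  case: alt => [[P [Q [h P0 Px _]]]|[[d hd] _]].
    by have [d hd] := cl x P Q h P0 Px; case: (nx' d).
  have dvg := divisible_unramified RL PF (fun a b => gen_sub PF x y (a:=a) (b:=b)) dv ug.
  have [S' [sub gS' un]] := bf_closure pg (gen_countable PF cS pg) dvg.
  exists S'; split=> //; last by exists d; apply: sub.
  by move=> u w h; apply: sub; apply: (gen_sub PF).
move=> /existsNP [c] /existsNP [d] /not_implyP [hc nV].
have ac0 : a - c != 0 by rewrite subr_eq0; apply/eqP => e; apply: (na d); rewrite e.
have [x [cx ux]] := rootL ac0.
have [S1 [sub1 gS1 un1 [e [f [he oe re]]]]] := bf_residue gS (proj1 (proj2 ux)).
have [PF1 cS1 dv1 cl1 cr1] := gS1.
have ue : vunit OL e by apply/(rm_unit RL) => //; rewrite re; apply/(rm_unit RL) => //; case: ux => _ [].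
have [e0 _] := ue.
have x0 : x 0%N != 0 by have [+ _] := ux; apply: contraNneq => ->; rewrite invr0 mulr0.
have uu : vunit OL ((a - c) / x 0%N / e) by apply: (vunitM VL) => //; apply: vunitV.
have ru : rL ((a - c) / x 0%N / e) = 1.
  rewrite (rmM RL) ?(rmV RL) // ?re; first by rewrite divff //; apply/eqP/(rm_unit RL) => //; case: ux => _ [].
    by case: ux => _ [].
  by case: ue => _ [].
(* Once the residue of [(a - c) / x 0] has been adjoined and divided out, the remaining unit has
   residue 1 and its roots exist by Hensel's lemma. Thus [(a - c) / e] itself begins a coherent
   sequence. *)
have [rho [crho erho]] := coherent_one RL NL ck (proj1 (proj2 uu)) ru.
pose X j := x j * rho j.
have cX : coherent X by move=> j; rewrite /X exprMn cx crho.
have XE : X 0%N = (a - c) / e by rewrite /X erho; field; rewrite ?e0 ?x0.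
have X0 : X 0%N != 0 by rewrite XE mulf_neq0 ?invr_eq0.
(* Adjoining the residue was unramified, so the value of [a - c] is still new over [S1]. *)
have newX c1 d1 : S1 c1 d1 -> ~ vunit OL (X 0%N / c1).
  move=> h1 u1; have [u10 _] := u1.
  have c10 : c1 != 0 by apply: contraNneq u10 => ->; rewrite invr0 mulr0.
  have [c2 [d2 [h2 c20 u2]]] := un1 _ _ (pfM PF1 he h1) (mulf_neq0 e0 c10).
  apply: nV; exists c2, d2; split=> //.
  rewrite (_ : _ / c2 = (X 0%N / c1) * (e * c1 / c2)); first exact: (vunitM VL).
  by rewrite XE; field; rewrite ?e0 ?c10 ?c20.
have [g [gS1' gsur]] := cS1.
have tri c1 d1 : S1 c1 d1 -> ~ vlt OL c1 (X 0%N) -> vlt OL (X 0%N) c1.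
  move=> h1 h2 h3; apply: (newX _ _ h1).
  have c10 : c1 != 0.
    by apply/eqP => c10; apply: (h2); move=> h4; rewrite c10 in h3;
      move: (vdiv0x h3) X0 => ->; rewrite eqxx.
  by apply/vunitE => //; split=> //; apply: vleNgt.
have [||Y [cY Y0 lowY highY]] := @cutM (fun n => (g n).2) (fun n => vlt OL (g n).1 (X 0%N)) _ _.
- move=> i h; rewrite -(pf_neq0 RL RM PF1 (gS1' i)); exact: (vlt_neq0 VL h).
- move=> i j hi hj; apply/(pf_vlt RL RM PF1 (gS1' i) (gS1' j)).
  exact: (vlt_trans VL hi (tri _ _ (gS1' j) hj)).
have cut c1 d1 : S1 c1 d1 -> vlt OL c1 (X 0%N) <-> vlt OM d1 (Y 0%N).
  move=> h1; have [n gn] := gsur _ _ h1; split=> h2.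
    by have := lowY n; rewrite gn; apply.
  apply: contrapT => h3; have := highY n; rewrite gn => /(_ h3) h4.
  exact: (vlt_irrefl VM (vlt_trans VM h2 h4)).
have cut' c1 d1 : S1 c1 d1 -> vlt OL (X 0%N) c1 <-> vlt OM (Y 0%N) d1.
  move=> h1; have [n gn] := gsur _ _ h1; split=> h2.
    have := highY n; rewrite gn; apply=> h3; exact: (vlt_irrefl VL (vlt_trans VL h2 h3)).
  apply: (tri _ _ h1) => /(cut _ _ h1) h3; exact: (vlt_irrefl VM (vlt_trans VM h2 h3)).
have pv := value_ext_pfield RL RM PF1 dv1 cX cY X0 Y0 newX cut cut'.
have dvv := value_ext_divisible RL RM PF1 dv1 cX cY X0 Y0 newX cut cut'.
have cv := value_ext_countable RL RM PF1 dv1 cX cY X0 Y0 newX cut cut' cS1.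
have [S' [sub gS' _]] := bf_closure pv cv dvv.
have [pS' _ _ _ _] := gS'.
exists S'; split=> //; first by move=> u w h; apply: sub; apply: (value_ext_sub PF1); apply: sub1.
exists (d + f * Y 0%N).
rewrite (_ : a = c + e * X 0%N); last by rewrite XE; field; rewrite ?e0.
apply: (pfD pS'); first by apply: sub; apply: (value_ext_sub PF1); apply: sub1.
apply: (pfM pS'); apply: sub; first exact: (value_ext_sub PF1).
exact: (value_ext_mem PF1).
Qed.
End BackAndForth.

Lemma bf_swap (L M k : fieldType) (OL : L -> Prop) (OM : M -> Prop) (rL : L -> k) (rM : M -> k) S :
  residue_map OL rL -> residue_map OM rM ->
  bf_good OL OM rL rM S -> bf_good OM OL rM rL (swap S).
Proof.
move=> RL RM [PF cS dv cl cr]; split.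
- exact: pfield_swap.
- exact: countable_swap.
- exact: (divisible_swap RL RM PF).
- move=> b Q P h Q0 Qb; apply: (cr b P Q) => //.
  by have h' : ppoly S P Q := h; rewrite (ppoly_eq0 RL RM PF h').
- move=> a Q P h Q0 Pa; apply: (cl a P Q) => //.
  by have h' : ppoly S P Q := h; rewrite (ppoly_eq0 RL RM PF h').
Qed.

Section ElementaryEquivalence.
Variables (L M k : fieldType) (OL : L -> Prop) (OM : M -> Prop) (rL : L -> k) (rM : M -> k).
Hypothesis RL : residue_map OL rL.
Hypothesis RM : residue_map OM rM.
Hypothesis NL : newtonian OL.
Hypothesis NM : newtonian OM.
Hypothesis ck : forall n, (0 < n)%N -> n%:R != 0 :> k.
Hypothesis BL : ball_saturated OL.
Hypothesis BM : ball_saturated OM.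
Hypothesis rootL : root_saturated OL.
Hypothesis rootM : root_saturated OM.
Hypothesis cutL : cut_saturated OL.
Hypothesis cutM : cut_saturated OM.
Let VL := rm_vr RL.
Let VM := rm_vr RM.

Lemma pf_teval S (e : nat -> L) (e' : nat -> M) t : pfield OL OM rL rM S ->
  (forall i, S (e i) (e' i)) -> S (teval e t) (teval e' t).
Proof.
move=> PF he; elim: t => [i|||t h t' h'|t h t' h'|t h] /=.
- exact: he.
- exact: (pf0 PF).
- exact: (pf1 PF).
- exact: (pfD PF).
- exact: (pfM PF).
- exact: (pfN PF).
Qed.

Lemma bf_sat f : forall S (e : nat -> L) (e' : nat -> M), bf_good OL OM rL rM S ->
  (forall i, S (e i) (e' i)) -> sat e f <-> sat e' f.
Proof.
have updS S (e : nat -> L) (e' : nat -> M) i x y : S x y -> (forall i, S (e i) (e' i)) ->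
    forall j, S (upd e i x j) (upd e' i y j).
  by move=> hxy he j; rewrite /upd; case: eqP.
have forth S (e : nat -> L) (e' : nat -> M) x : bf_good OL OM rL rM S -> (forall i, S (e i) (e' i)) ->
    exists S' y, [/\ bf_good OL OM rL rM S', (forall i, S' (e i) (e' i)) & S' x y].
  move=> gS he; have [S' [sub gS' [y hy]]] := bf_forth RL RM NL NM ck BL BM rootL cutM x gS.
  by exists S', y; split=> // i; apply: sub.
have back S (e : nat -> L) (e' : nat -> M) y : bf_good OL OM rL rM S -> (forall i, S (e i) (e' i)) ->
    exists S' x, [/\ bf_good OL OM rL rM S', (forall i, S' (e i) (e' i)) & S' x y].
  move=> gS he; have [S' [sub gS' [x hx]]] :=
    bf_forth RM RL NM NL ck BM BL rootM cutL y (bf_swap RL RM gS).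
  by exists (swap S'), x; split=> //; [apply: (bf_swap RM RL gS')|move=> i; apply: sub; apply: he].
elim: f => /= [t t'||f ih|f ihf g ihg|f ihf g ihg|f ihf g ihg|i f ih|i f ih] S e e' gS he.
- have [PF _ _ _ _] := gS; have h := pf_teval t PF he; have h' := pf_teval t' PF he.
  split=> E; first by rewrite E in h; apply: (pf_funct RL RM PF h h').
  by rewrite E in h; apply: (pf_inj RL RM PF h h').
- by [].
- by rewrite (ih _ _ _ gS he).
- by rewrite (ihf _ _ _ gS he) (ihg _ _ _ gS he).
- by rewrite (ihf _ _ _ gS he) (ihg _ _ _ gS he).
- by rewrite (ihf _ _ _ gS he) (ihg _ _ _ gS he).
- split=> H.
    move=> y; have [S' [x [gS' he' hxy]]] := back S e e' y gS he.
    by apply/(ih _ _ _ gS' (updS _ _ _ i _ _ hxy he')).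
  move=> x; have [S' [y [gS' he' hxy]]] := forth S e e' x gS he.
  by apply/(ih _ _ _ gS' (updS _ _ _ i _ _ hxy he')).
- split=> -[z H].
    have [S' [y [gS' he' hxy]]] := forth S e e' z gS he.
    by exists y; apply/(ih _ _ _ gS' (updS _ _ _ i _ _ hxy he')).
  have [S' [x [gS' he' hxy]]] := back S e e' z gS he.
  by exists x; apply/(ih _ _ _ gS' (updS _ _ _ i _ _ hxy he')).
Qed.

Definition prime_graph (a : L) (b : M) := exists (n : int) (d : nat),
  [/\ (0 < d)%N, a = n%:~R / d%:R & b = n%:~R / d%:R].

Lemma int_unit (K : fieldType) (O : K -> Prop) (res : K -> k) : residue_map O res ->
  forall n : int, n != 0 -> vunit O n%:~R.
Proof.
move=> R; have V := rm_vr R; have cu := rm_char0 R ck.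
case=> n n0; first by apply: cu; rewrite lt0n.
by rewrite NegzE mulrNz; apply: (vunitN V); apply: cu.
Qed.

Lemma res_int (K : fieldType) (O : K -> Prop) (res : K -> k) : residue_map O res ->
  forall n : int, O n%:~R /\ res n%:~R = n%:~R.
Proof.
move=> R; have V := rm_vr R; case=> n.
  by split; [apply: (vr_nat V)|rewrite -!pmulrn (rm_nat R)].
rewrite NegzE !mulrNz; split; first by apply: (vrN V); apply: (vr_nat V).
by rewrite (rmN R) -?pmulrn ?(rm_nat R) //; apply: (vr_nat V).
Qed.

Lemma prime_graph_pfield : pfield OL OM rL rM prime_graph.
Proof.
have cL := rm_char0 RL ck; have cM := rm_char0 RM ck.
have nzL d : (0 < d)%N -> d%:R != 0 :> L by move=> /cL [].
have nzM d : (0 < d)%N -> d%:R != 0 :> M by move=> /cM [].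
split.
- by exists 1, 1%N; rewrite !divr1.
- move=> a b c d [n [e [e0 -> ->]]] [n' [e' [e0' -> ->]]].
  exists (n * e'%:Z - n' * e%:Z), (e * e')%N; rewrite muln_gt0 e0 e0'; split=> //.
    rewrite rmorphB !rmorphM /= -!pmulrn ?natrM; field.
    by rewrite ?nzL.
  rewrite rmorphB !rmorphM /= -!pmulrn ?natrM; field.
  by rewrite ?nzM.
- move=> a b c d [n [e [e0 -> ->]]] [n' [e' [e0' -> ->]]].
  exists (n * n'), (e * e')%N; rewrite muln_gt0 e0 e0'; split=> //.
    by rewrite !rmorphM /= ?natrM; field; rewrite ?nzL.
  by rewrite !rmorphM /= ?natrM; field; rewrite ?nzM.
- move=> a b [[[|n]|n] [e [e0 -> ->]]].
  + by exists 0, 1%N; rewrite !mulr0z !mul0r !invr0.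
  + by exists e%:Z, n.+1; rewrite !invf_div.
  + by exists (- e%:Z), n.+1; rewrite !invf_div NegzE !mulrNz !invrN !mulrN !mulNr.
- move=> a b [n [e [e0 -> ->]]].
  have [on rn] := res_int RL n; have [on' rn'] := res_int RM n.
  have [_ [_ oe]] := cL e e0; have [_ [_ oe']] := cM e e0.
  split; first by split=> _; [apply: (vrM VM)|apply: (vrM VL)].
  move=> _; rewrite (rmM RL) // (rmM RM) // rn rn' (rmV RL) ?(rmV RM); last exact: cL.
    by rewrite (rm_nat RL) (rm_nat RM).
  exact: cM.
Qed.

Lemma saturated_equiv : elem_equiv L M.
Proof.
move=> f sf.
have PF := prime_graph_pfield.
have cP : countable_graph prime_graph.
  pose g n := match unpickle n : option (int * nat) with
    | Some (i, d) => (i%:~R / d.+1%:R, i%:~R / d.+1%:R) : L * M | None => (0 / 1%:R, 0 / 1%:R) end.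
  exists g; split.
    move=> n; rewrite /g; case: unpickle => [[i d]|]; first by exists i, d.+1.
    by exists 0, 1%N.
  move=> a b [i [[|d] [// _ -> ->]]]; exists (pickle (i, d)).
  by rewrite /g pickleK.
have dvP : divisible_values OL prime_graph.
  move=> a b n [i [d [d0 -> _]]] a0 n0; exists 1, 1; split; first exact: (pf1 PF).
  rewrite expr1n div1r; apply: vunitV; apply: (vunitM VL).
    apply: (int_unit RL); apply: contraNneq a0 => ->; by rewrite mul0r.
  by apply: vunitV; apply: (rm_char0 RL ck).
have [S [sub gS _]] := bf_closure RL RM NL NM ck BL BM PF cP dvP.
have [PS _ _ _ _] := gS.
rewrite (models_sentence (fun=> 0 : L) sf) (models_sentence (fun=> 0 : M) sf).
by apply: (bf_sat f gS) => i; apply: (pf0 PS).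
Qed.
End ElementaryEquivalence.

(** * Ultraproducts of valued fields *)

Definition divisible (K : fieldType) (O : K -> Prop) :=
  forall (x : K) n, x != 0 -> (0 < n)%N -> exists y, vunit O (y ^+ n / x).
Definition nontrivial (K : fieldType) (O : K -> Prop) := exists t : K, t != 0 /\ vmax O t.

Lemma UF_forall_lt N (A : nat -> nat -> Prop) : (forall i, (i < N)%N -> UF (A i)) ->
  UF (fun n => forall i, (i < N)%N -> A i n).
Proof.
elim: N => [|N IH] h; first exact: UFT.
have h1 := IH (fun i hi => h i (ltnW hi)).
apply: UFS (UFI h1 (h N (ltnSn N))) => n [q1 q2] i.
by rewrite ltnS leq_eqVlt => /orP [/eqP ->|/q1].
Qed.

(** * Finite parts of cuts in divisible value groups *)

Section FiniteCuts.
Variables (K : fieldType) (O : K -> Prop).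
Hypothesis VR : valuation_ring O.

Lemma vdiv_max_ex (A : nat -> Prop) (F : nat -> K) N : (exists i, (i < N)%N /\ A i) ->
  exists i, [/\ (i < N)%N, A i & forall j, (j < N)%N -> A j -> vdiv O (F j) (F i)].
Proof.
elim: N => [[i []] //|N IH] ex.
have [exN|no] := EM (exists i, (i < N)%N /\ A i); last first.
  have [i [iN Ai]] := ex.
  have only j : (j < N.+1)%N -> A j -> j = N.
    rewrite ltnS leq_eqVlt => /orP [/eqP -> //|lt Aj]; by case: no; exists j.
  exists i; split=> // j jN Aj; rewrite (only j jN Aj) (only i iN Ai); exact: (vdiv_refl VR).
have [i [iN Ai hi]] := IH exN.
have [AN|nAN] := EM (A N); last first.
  exists i; split=> //; first exact: ltnW.
  by move=> j; rewrite ltnS leq_eqVlt => /orP [/eqP ->|/hi].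
case: (vdiv_total VR (F i) (F N)) => le.
  exists N; split=> // j; rewrite ltnS leq_eqVlt => /orP [/eqP -> _|lt Aj]; first exact: (vdiv_refl VR).
  exact: (vdiv_trans VR (hi j lt Aj)).
exists i; split=> //; first exact: ltnW.
by move=> j; rewrite ltnS leq_eqVlt => /orP [/eqP ->|/hi].
Qed.

Lemma vdiv_min_ex (A : nat -> Prop) (F : nat -> K) N : (exists i, (i < N)%N /\ A i) ->
  exists i, [/\ (i < N)%N, A i & forall j, (j < N)%N -> A j -> vdiv O (F i) (F j)].
Proof.
elim: N => [[i []] //|N IH] ex.
have [exN|no] := EM (exists i, (i < N)%N /\ A i); last first.
  have [i [iN Ai]] := ex.
  have only j : (j < N.+1)%N -> A j -> j = N.
    rewrite ltnS leq_eqVlt => /orP [/eqP -> //|lt Aj]; by case: no; exists j.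
  exists i; split=> // j jN Aj; rewrite (only j jN Aj) (only i iN Ai); exact: (vdiv_refl VR).
have [i [iN Ai hi]] := IH exN.
have [AN|nAN] := EM (A N); last first.
  exists i; split=> //; first exact: ltnW.
  by move=> j; rewrite ltnS leq_eqVlt => /orP [/eqP ->|/hi].
case: (vdiv_total VR (F N) (F i)) => le.
  exists N; split=> // j; rewrite ltnS leq_eqVlt => /orP [/eqP -> _|lt Aj]; first exact: (vdiv_refl VR).
  exact: (vdiv_trans VR le (hi j lt Aj)).
exists i; split=> //; first exact: ltnW.
by move=> j; rewrite ltnS leq_eqVlt => /orP [/eqP ->|/hi].
Qed.

Hypothesis DV : divisible O.
Hypothesis NT : nontrivial O.

(** A non-trivial divisible value group is densely ordered without end points: a square root of a
    product separates two values, and a factor [t] passes beyond one. An upper element may be 0,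
    that is, of infinite value. *)
Lemma finite_cut (d : nat -> K) (s : nat -> Prop) N :
  (forall i, (i < N)%N -> s i -> d i != 0) ->
  (forall i j, (i < N)%N -> (j < N)%N -> s i -> ~ s j -> vlt O (d i) (d j)) ->
  exists z, [/\ z != 0, forall i, (i < N)%N -> s i -> vlt O (d i) z &
              forall i, (i < N)%N -> ~ s i -> vlt O z (d i)].
Proof.
move=> nz lt; have [t [t0 mt]] := NT.
have mul_t l : l != 0 -> vlt O l (l * t) by move=> l0; apply/(vltE VR) => //; rewrite mulrC mulKf // mulrC.
suff [z [z0 h1 h2]] : exists z, [/\ z != 0,
    forall i, (i < N)%N -> s i -> (forall j, (j < N)%N -> s j -> vdiv O (d j) (d i)) -> vlt O (d i) z &
    forall i, (i < N)%N -> ~ s i -> (forall j, (j < N)%N -> ~ s j -> vdiv O (d i) (d j)) -> vlt O z (d i)].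
  exists z; split=> // i iN si.
    have [i' [iN' si' hi']] := @vdiv_max_ex s d N (ex_intro _ i (conj iN si)).
    exact: (vle_lt_trans VR (hi' i iN si) (h1 i' iN' si' hi')).
  have [i' [iN' si' hi']] := @vdiv_min_ex (fun i => ~ s i) d N (ex_intro _ i (conj iN si)).
  exact: (vlt_le_trans VR (h2 i' iN' si' hi') (hi' i iN si)).
have [exl|nol] := EM (exists i, (i < N)%N /\ s i); have [exu|nou] := EM (exists i, (i < N)%N /\ ~ s i).
- have [l [lN sl hl]] := @vdiv_max_ex s d N exl.
  have [u [uN su hu]] := @vdiv_min_ex (fun i => ~ s i) d N exu.
  have l0 := nz l lN sl; have luu := lt l u lN uN sl su.
  have [w [w0 w1 w2]] : exists w, [/\ w != 0, vlt O (d l) w & vlt O w (d u)].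
    have [u0|u0] := eqVneq (d u) 0.
      exists (d l * t); rewrite u0; split; [by rewrite mulf_neq0|exact: mul_t|].
      by apply/(vltx0 VR); rewrite mulf_neq0.
    have lu0 : d l * d u != 0 by rewrite mulf_neq0.
    have [w uw] := DV lu0 (isT : (0 < 2)%N).
    have [q1 q2] := proj1 (vunitE _ _ lu0) uw.
    exists w; split.
    + by have [+ _] := uw; apply: contraNneq => ->; rewrite expr0n mul0r.
    + apply: (@vltX_inv _ _ VR 2%N); apply: (vlt_le_trans VR _ q1).
      by rewrite expr2; apply/(vlt_mul2l VR).
    + apply: (@vltX_inv _ _ VR 2%N); apply: (vle_lt_trans VR q2).
      by rewrite expr2; apply/(vlt_mul2r VR).
  exists w; split=> // i iN si hi.
    by apply: (vle_lt_trans VR (hl i iN si) w1).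
  by apply: (vlt_le_trans VR w2 (hu i iN si)).
- have [l [lN sl hl]] := @vdiv_max_ex s d N exl.
  have l0 := nz l lN sl.
  exists (d l * t); split; first by rewrite mulf_neq0.
    by move=> i iN si _; apply: (vle_lt_trans VR (hl i iN si)); apply: mul_t.
  by move=> i iN si; case: nou; exists i.
- have [u [uN su hu]] := @vdiv_min_ex (fun i => ~ s i) d N exu.
  have [u0|u0] := eqVneq (d u) 0.
    exists 1; split; first exact: oner_neq0.
      by move=> i iN si; case: nol; exists i.
    move=> i iN si _; apply: (vlt_le_trans VR _ (hu i iN si)); rewrite u0.
    by apply/(vltx0 VR); apply: oner_neq0.
  exists (d u / t); split; first by rewrite mulf_neq0 ?invr_eq0.
    by move=> i iN si; case: nol; exists i.
  move=> i iN si _; apply: (vlt_le_trans VR _ (hu i iN si)).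
  by rewrite -[X in vlt _ _ X](divfK t0); apply: mul_t; rewrite mulf_neq0 ?invr_eq0.
- exists 1; split; first exact: oner_neq0.
    by move=> i iN si; case: nol; exists i.
  by move=> i iN si; case: nou; exists i.
Qed.

(** Saturation asks for finitely many stages at a time; these are powers of a single element with
    decreasing exponents. *)
Lemma coherent_prefix (y : K) N : exists x : nat -> K,
  x 0%N = y ^+ (\prod_(1 <= i < N.+1) i) /\ forall j, (j < N)%N -> x j.+1 ^+ j.+1 = x j.
Proof.
exists (fun j => y ^+ (\prod_(j.+1 <= i < N.+1) i)); split=> // j jN.
by rewrite -exprM [in RHS]big_ltn 1?mulnC // ltnS.
Qed.
End FiniteCuts.

Lemma prod_pos N : (0 < \prod_(1 <= i < N.+1) i)%N.
Proof. by rewrite big_nat_cond prodn_cond_gt0 // => i /andP [/andP []]. Qed.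

Section UltraValued.
Variables (K : nat -> fieldType) (O : forall n, K n -> Prop).
Hypothesis VR : forall n, valuation_ring (@O n).
Local Notation K' := (ultra K).
Local Notation O' := (upred O).

Lemma ultra_vr : valuation_ring O'.
Proof.
split.
- by rewrite -cls0; apply/upredE/UFT => n; apply: (vr0 (VR n)).
- by rewrite -cls1; apply/upredE/UFT => n; apply: (vr1 (VR n)).
- move=> x y; have [f ->] := cls_surj x; have [g ->] := cls_surj y.
  rewrite -clsB !upredE => hf hg; apply: UFS (UFI hf hg) => n []; exact: (vrB (VR n)).
- move=> x y; have [f ->] := cls_surj x; have [g ->] := cls_surj y.
  rewrite -clsM !upredE => hf hg; apply: UFS (UFI hf hg) => n []; exact: (vrM (VR n)).
- move=> x _; have [f ->] := cls_surj x; rewrite -clsV !upredE -UFor.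
  apply: UFT => n; have [h|h] := EM (O (f n)); [by left|right; exact: (vrV (VR n))].
Qed.

Lemma ultra_vdiv f g : vdiv O' (cls f) (cls g) <-> UF (fun n => vdiv (@O n) (f n) (g n)).
Proof.
split=> [[c]|].
  have [h ->] := cls_surj c; rewrite upredE -clsM clsE => h1 h2.
  by apply: UFS (UFI h1 h2) => n [q1 q2]; exists (h n).
have -> : (fun n => vdiv (@O n) (f n) (g n)) = (fun n => exists c, O c /\ g n = c * f n).
  by apply: funext => n; apply: propext; split=> [[c]|[c []]]; exists c.
move/(UFchoice (fun n => 0)) => [h hh]; exists (cls h).
  by apply/upredE; apply: UFS hh => n [].
by rewrite -clsM clsE; apply: UFS hh => n [].
Qed.
Lemma ultra_vlt f g : vlt O' (cls f) (cls g) <-> UF (fun n => vlt (@O n) (f n) (g n)).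
Proof. by rewrite /vlt UFN ultra_vdiv. Qed.
Lemma ultra_vunit f : vunit O' (cls f) <-> UF (fun n => vunit (@O n) (f n)).
Proof. by rewrite /vunit !UFand -clsV !upredE cls_neq0. Qed.
Lemma ultra_vmax f : vmax O' (cls f) <-> UF (fun n => vmax (@O n) (f n)).
Proof. by rewrite /vmax UFand UFN upredE ultra_vunit. Qed.

Lemma ultra_newtonian : (forall n, newtonian (@O n)) -> newtonian O'.
Proof.
move=> N P P0 P1 hP.
have sP : (1 < size P)%N.
  by rewrite ltnNge; apply/negP => sz; move: P1; rewrite nth_default // => /esym /eqP;
     rewrite oner_eq0.
pose f i := urep P`_i; pose Q n := \poly_(i < size P) f i n.
have Q0 : UF (fun n => (Q n)`_0 = 1).
  move: P0; rewrite -(urepK P`_0) -cls1 clsE; apply: UFS => n.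
  by rewrite coef_poly (ltnW sP).
have Q1 : UF (fun n => (Q n)`_1 = 1).
  by move: P1; rewrite -(urepK P`_1) -cls1 clsE; apply: UFS => n; rewrite coef_poly sP.
(* [P] has finitely many coefficients, so one set of the ultrafilter serves for all of them. *)
have Q2 : UF (fun n => forall i, (i < size P)%N -> (2 <= i)%N -> vmax (@O n) (Q n)`_i).
  apply: UF_forall_lt => i iP; rewrite UFimp => /UFconst i2.
  move: (hP i i2); rewrite -(urepK P`_i) ultra_vmax; apply: UFS => n.
  by rewrite coef_poly iP.
have : UF (fun n => exists z, [/\ O z, (Q n).[z] = 0 & vmax (@O n) (z + 1)]).
  apply: UFS (UFI Q0 (UFI Q1 Q2)) => n [q0 [q1 q2]]; apply: (N n) => // i i2.
  have [iP|iP] := ltnP i (size P); first exact: q2.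
  by rewrite coef_poly ltnNge iP; apply: (vmax0 (VR n)).
move/(UFchoice (fun n => 0)) => [z hz]; exists (cls z); split.
- by apply/upredE; apply: UFS hz => n [].
- have -> : P.[cls z] = cls (fun n => (Q n).[z n]).
    rewrite horner_coef.
    have -> : cls (fun n => (Q n).[z n]) = cls (fun n => \sum_(i < size P) f i n * z n ^+ i).
      by apply/clsE/UFT => n; rewrite horner_poly.
    rewrite (cls_sum (fun (i : 'I_(size P)) n => f i n * z n ^+ i)); apply: eq_bigr => i _.
    by rewrite clsM clsX /f urepK.
  by apply/cls_eq0; apply: UFS hz => n [].
- by rewrite -cls1 -clsD ultra_vmax; apply: UFS hz => n [].
Qed.

Lemma ultra_ball : ball_saturated O'.
Proof.
move=> c r h; pose C i := urep (c i); pose R i := urep (r i).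
have [|f hf] := @UFsat K (fun n => 0) (fun k n x => vdiv (@O n) (R k n) (x - C k n)) _; last first.
  exists (cls f) => i; rewrite -(urepK (r i)) -(urepK (c i)) -clsB ultra_vdiv; exact: hf.
move=> k.
have : UF (fun n => forall i, (i < k.+1)%N -> forall j, (j < k.+1)%N ->
    vdiv (@O n) (R i n) (C i n - C j n) \/ vdiv (@O n) (R j n) (C i n - C j n)).
  apply: UF_forall_lt => i _; apply: UF_forall_lt => j _.
  have := h i j; rewrite -(urepK (r i)) -(urepK (c i)) -(urepK (r j)) -(urepK (c j)) -clsB !ultra_vdiv.
  by rewrite UFor.
apply: UFS => n hn.
(* Among finitely many balls that meet pairwise, the smallest is contained in the others; its centre
   is the point. *)
have [i [ik _ hi]] := @vdiv_max_ex _ _ (VR n) (fun=> True) (fun j => R j n) k.+1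
  (ex_intro _ 0%N (conj (ltn0Sn k) I)).
exists (C i n) => j jk; have jk' : (j < k.+1)%N by [].
case: (hn i ik j jk') => // h1; exact: (vdiv_trans (VR n) (hi j jk' I)).
Qed.

Lemma ultra_divisible : (forall n, divisible (@O n)) -> divisible O'.
Proof.
move=> D x j; have [f ->] := cls_surj x => /cls_neq0 f0 j0.
have : UF (fun n => exists y, vunit (@O n) (y ^+ j / f n)) by apply: UFS f0 => n f0; apply: D.
move/(UFchoice (fun n => 0)) => [y hy]; exists (cls y).
by rewrite -clsX -cls_div ultra_vunit.
Qed.

Lemma ultra_nontrivial : (forall n, nontrivial (@O n)) -> nontrivial O'.
Proof.
move=> N; have := UFT N; move/(UFchoice (fun n => 0)) => [t ht]; exists (cls t); split.
  by apply/cls_neq0; apply: UFS ht => n [].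
by apply/ultra_vmax; apply: UFS ht => n [].
Qed.

Lemma ultra_root : (forall n, divisible (@O n)) -> root_saturated O'.
Proof.
move=> D a; have [f ->] := cls_surj a => /cls_neq0 f0.
have [|g hg] := @UFsat (fun n => nat -> K n) (fun n i => 0)
  (fun k n x => (if k is j.+1 then x j.+1 ^+ j.+1 = x j else vunit (@O n) (f n / x 0%N))) _; last first.
  exists (fun j => cls (fun n => g n j)); split=> [j|].
    by rewrite -clsX clsE; have := hg j.+1.
  by rewrite -cls_div ultra_vunit; have := hg 0%N.
move=> k; apply: UFS f0 => n f0.
have [y uy] := D n (f n) _ f0 (prod_pos k).
have [x [x0 hx]] := coherent_prefix y k.
exists x; case=> [|j] jk; last exact: hx.
by rewrite x0 -invf_div; apply: vunitV.
Qed.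

Lemma ultra_cut : (forall n, divisible (@O n)) -> (forall n, nontrivial (@O n)) -> cut_saturated O'.
Proof.
move=> D N d s nz lt; pose F i := urep (d i).
have [|g hg] := @UFsat (fun n => nat -> K n) (fun n i => 0)
  (fun k n x => [/\ (if k is j.+1 then x j.+1 ^+ j.+1 = x j else True), x 0%N != 0,
     s k -> vlt (@O n) (F k n) (x 0%N) & ~ s k -> vlt (@O n) (x 0%N) (F k n)]) _; last first.
  exists (fun j => cls (fun n => g n j)); split=> [j||i si|i si].
  - by rewrite -clsX clsE; apply: UFS (hg j.+1) => n [].
  - by apply/cls_neq0; apply: UFS (hg 0%N) => n [].
  - by rewrite -(urepK (d i)) ultra_vlt; apply: UFS (hg i) => n [_ _ + _]; apply.
  - by rewrite -(urepK (d i)) ultra_vlt; apply: UFS (hg i) => n [_ _ _ ]; apply.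
move=> k.
have h1 : UF (fun n => forall i, (i < k.+1)%N -> s i -> F i n != 0).
  apply: UF_forall_lt => i _; rewrite UFimp => /UFconst /nz.
  by rewrite -(urepK (d i)) cls_neq0.
have h2 : UF (fun n => forall i, (i < k.+1)%N -> forall j, (j < k.+1)%N -> s i -> ~ s j ->
    vlt (@O n) (F i n) (F j n)).
  apply: UF_forall_lt => i _; apply: UF_forall_lt => j _.
  rewrite UFimp => /UFconst si; rewrite UFimp => /UFconst sj.
  by have := lt i j si sj; rewrite -(urepK (d i)) -(urepK (d j)) ultra_vlt.
apply: UFS (UFI h1 h2) => n [q1 q2].
have [z [z0 zl zu]] := @finite_cut _ _ (VR n) (D n) (N n) (fun i => F i n) s k.+1 q1
  (fun i j hi hj => q2 i hi j hj).
have [y uy] := D n z _ z0 (prod_pos k).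
have [x [x0 hx]] := coherent_prefix y k.
have [e1 e2] := proj1 (vunitE _ _ z0) uy.
have xn0 : x 0%N != 0.
  by rewrite x0; have [+ _] := uy; apply: contraNneq => ->; rewrite mul0r.
exists x => j jk; split=> //.
- by case: j jk.
- by move=> sj; rewrite x0; apply: (vlt_le_trans (VR n) (zl j jk sj)).
- by move=> sj; rewrite x0; apply: (vle_lt_trans (VR n) _ (zu j jk sj)).
Qed.
End UltraValued.

Section UltraResidue.
Variables (K k : nat -> fieldType) (O : forall n, K n -> Prop) (res : forall n, K n -> k n).
Hypothesis R : forall n, residue_map (@O n) (@res n).
Let VR n := rm_vr (R n).

Definition ultra_res (x : ultra K) : ultra k := cls (fun n => res (urep x n)).

Lemma ultra_resE f : ultra_res (cls f) = cls (fun n => res (f n)).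
Proof. by apply/clsE; have /clsE := urepK (cls f); apply: UFS => n ->. Qed.

Lemma ultra_residue_map : residue_map (upred O) ultra_res.
Proof.
split.
- exact: (ultra_vr VR).
- move=> x y; have [f ->] := cls_surj x; have [g ->] := cls_surj y.
  rewrite -clsD !ultra_resE !upredE -clsD => hf hg; apply/clsE; apply: UFS (UFI hf hg) => n [].
  exact: (rmD (R n)).
- move=> x y; have [f ->] := cls_surj x; have [g ->] := cls_surj y.
  rewrite -clsM !ultra_resE !upredE -clsM => hf hg; apply/clsE; apply: UFS (UFI hf hg) => n [].
  exact: (rmM (R n)).
- move=> x; have [f ->] := cls_surj x; rewrite ultra_resE upredE ultra_vmax cls_eq0 => hf.
  by apply: UFiff; apply: UFS hf => n; apply: (rm_eq0 (R n)).
- move=> a; have [f ->] := cls_surj a.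
  have [x hx] : {x & forall n, O (x n) /\ res (x n) = f n}.
    have h n : exists x : K n, O x /\ res x = f n by have [x] := rm_surj (R n) (f n); exists x.
    by exists (fun n => projT1 (cid (h n))) => n; case: cid.
  exists (cls x); first by apply/upredE/UFT => n; case: (hx n).
  by rewrite ultra_resE; apply/clsE/UFT => n; case: (hx n).
Qed.
End UltraResidue.

(* The Ax-Kochen-Ershov principle in residue characteristic 0, for divisible value groups
   and a common residue field. *)
Theorem ax_kochen_ershov (L M k : fieldType) (OL : L -> Prop) (OM : M -> Prop) (rL : L -> k) (rM : M -> k) :
  residue_map OL rL -> residue_map OM rM -> newtonian OL -> newtonian OM ->
  divisible OL -> divisible OM -> nontrivial OL -> nontrivial OM ->
  (forall n, (0 < n)%N -> n%:R != 0 :> k) -> elem_equiv L M.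
Proof.
move=> RL RM NL NM DL DM TL TM ck f sf.
rewrite (ultrapower_equiv L sf) (ultrapower_equiv M sf).
have VL (n : nat) := rm_vr RL; have VM (n : nat) := rm_vr RM.
apply: (saturated_equiv (ultra_residue_map (fun=> RL)) (ultra_residue_map (fun=> RM))) sf => //.
- exact: ultra_newtonian.
- exact: ultra_newtonian.
- by move=> n n0; rewrite -cls_nat; apply/cls_neq0/UFT => _; apply: ck.
- exact: ultra_ball.
- exact: ultra_ball.
- exact: ultra_root.
- exact: ultra_root.
- exact: ultra_cut.
- exact: ultra_cut.
Qed.

(** * Real valuations from archimedean valuation rings *)

Lemma real_rational_between (x y : R) : (x < y)%Re ->
  exists a b n : nat, [/\ (0 < n)%N, (x < (INR a - INR b) / INR n)%Re & ((INR a - INR b) / INR n < y)%Re].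
Proof.
move=> xy; have [n [hn n0]] := archimed_cor1 (y - x) (Rlt_Rminus _ _ xy).
have n0' : (0 < INR n)%Re by apply: lt_0_INR.
have [h1 h2] := archimed (INR n * x).
set z := up (INR n * x) in h1 h2.
have [a [b zE]] : exists a b, IZR z = (INR a - INR b)%Re.
  case: z {h1 h2} => [|r|r].
  - by exists 0%N, 0%N; rewrite /=; lra.
  - by exists (BinPos.Pos.to_nat r), 0%N; rewrite INR_IPR /=; rewrite /IZR; lra.
  - by exists 0%N, (BinPos.Pos.to_nat r); rewrite INR_IPR /=; rewrite /IZR; lra.
exists a, b, n; rewrite -zE; split.
- by apply/ltP.
- apply: (Rmult_lt_reg_l (INR n)) => //; rewrite /Rdiv -Rmult_assoc (Rmult_comm (INR n) (IZR z)) Rmult_assoc.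
  rewrite Rinv_r; lra.
- apply: (Rmult_lt_reg_l (INR n)) => //; rewrite /Rdiv -Rmult_assoc (Rmult_comm (INR n) (IZR z)) Rmult_assoc.
  rewrite Rinv_r; last lra.
  have : (INR n * / INR n < INR n * (y - x))%Re by apply: Rmult_lt_compat_l.
  rewrite Rinv_r; lra.
Qed.

Section RealValuation.
Variables (F : fieldType) (O : F -> Prop) (q : F).
Implicit Types x y z : F.
Hypothesis VR : valuation_ring O.
Hypothesis q0 : q != 0.
Hypothesis mq : vmax O q.
Hypothesis arch : forall z, exists n, O (q ^+ n * z).

(** The rational lower bounds for [v(z) / v(q)], written with natural numbers only. Their supremum
    is the Hölder embedding normalized by [v(q) = 1]. *)
Definition val_below (z : F) (r : R) := exists n a b : nat,
  [/\ (0 < n)%N, O (z ^+ n * q ^+ b / q ^+ a) & r = ((INR a - INR b) / INR n)%Re].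

Lemma val_below1 r : val_below 1 r -> (r <= 0)%Re.
Proof.
move=> [n [a [b [n0 h ->]]]].
have ab : (a <= b)%N.
  rewrite leqNgt; apply/negP => lt; move: h; rewrite expr1n mul1r.
  rewrite -(subnK (ltnW lt)) exprD invfM mulrCA mulfV ?expf_neq0 // mulr1.
  apply: vmax_inv; rewrite ?expf_neq0 //; apply: (vmaxX VR) => //.
  by rewrite subn_gt0.
have nR : (0 < INR n)%Re by apply/lt_0_INR/ltP.
have abR : (INR a <= INR b)%Re by apply/le_INR/leP.
have := Rinv_0_lt_compat _ nR; rewrite /Rdiv => hi.
have : (0 <= (INR b - INR a) * / INR n)%Re by apply: Rmult_le_pos; lra.
lra.
Qed.

Lemma val_belowM x y r s : val_below x r -> val_below y s -> val_below (x * y) (r + s).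
Proof.
move=> [n [a [b [n0 h ->]]]] [n' [a' [b' [n0' h' ->]]]].
exists (n * n')%N, (a * n' + a' * n)%N, (b * n' + b' * n)%N; split.
- by rewrite muln_gt0 n0.
- rewrite (_ : _ / _ = (x ^+ n * q ^+ b / q ^+ a) ^+ n' * (y ^+ n' * q ^+ b' / q ^+ a') ^+ n).
    by apply: (vrM VR); apply: (vrX VR).
  rewrite !(expr_div_n, exprMn) -!exprM !exprD (mulnC n' n).
  have := expf_neq0 (a * n') q0; have := expf_neq0 (a' * n) q0.
  move: (q ^+ (a * n')) (q ^+ (a' * n)) => A B B0 A0.
  by field; rewrite ?A0 ?B0.
- have nR : (0 < INR n)%Re by apply/lt_0_INR/ltP.
  have nR' : (0 < INR n')%Re by apply/lt_0_INR/ltP.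
  by rewrite !plus_INR !mult_INR Rfrac_add //; lra.
Qed.

Lemma val_below_total z n a b : z != 0 -> (0 < n)%N ->
  val_below z ((INR a - INR b) / INR n) \/ val_below z^-1 (- ((INR a - INR b) / INR n)).
Proof.
move=> z0 n0; have [h|h] := EM (O (z ^+ n * q ^+ b / q ^+ a)); [left|right].
  by exists n, a, b.
exists n, b, a; split=> //; last by rewrite /Rdiv; lra.
rewrite (_ : _ / _ = (z ^+ n * q ^+ b / q ^+ a)^-1); first exact: (vrV VR).
rewrite exprVn; have := expf_neq0 n z0; have := expf_neq0 a q0; have := expf_neq0 b q0.
by move: (z ^+ n) (q ^+ a) (q ^+ b) => A B C C0 B0 A0; field; rewrite ?A0 ?B0 ?C0.
Qed.

Lemma val_below_ex z : z != 0 -> exists r, val_below z r.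
Proof.
move=> z0; have [N hN] := arch z.
exists ((INR 0 - INR N) / INR 1)%Re; exists 1%N, 0%N, N.
by rewrite expr1 expr0 divr1 mulrC.
Qed.

Lemma val_below_bound z : z != 0 -> bound (val_below z).
Proof.
move=> z0; have zi0 : z^-1 != 0 by rewrite invr_eq0.
have [s hs] := val_below_ex zi0.
exists (- s)%Re => r hr; have := val_belowM hr hs; rewrite divff // => /val_below1; lra.
Qed.

Lemma val_sup_ex z : exists u : R, z != 0 -> is_lub (val_below z) u.
Proof.
have [->|z0] := eqVneq z 0; first by exists R0.
have [u hu] := completeness _ (val_below_bound z0) (val_below_ex z0).
by exists u.
Qed.

Definition val_sup z : R := projT1 (cid (val_sup_ex z)).
Arguments val_sup z%_R.
Lemma val_supP z : z != 0 -> is_lub (val_below z) (val_sup z).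
Proof. by rewrite /val_sup; case: cid. Qed.

Lemma val_sup_ub z r : z != 0 -> val_below z r -> (r <= val_sup z)%Re.
Proof. by move=> z0 h; have [ub _] := val_supP z0; apply: ub. Qed.
Lemma val_sup_approx z t : z != 0 -> (t < val_sup z)%Re -> exists r, val_below z r /\ (t < r)%Re.
Proof.
move=> z0 lt; have [_ lub] := val_supP z0; apply: contrapT => no.
have : (val_sup z <= t)%Re.
  by apply: lub => r hr; apply: Rnot_lt_le => tr; apply: no; exists r.
lra.
Qed.

Lemma val_sup_super x y : x != 0 -> y != 0 -> (val_sup x + val_sup y <= val_sup (x * y))%Re.
Proof.
move=> x0 y0; apply: Rnot_lt_le => lt.
have [|r [hr tr]] := @val_sup_approx x (val_sup (x * y) - val_sup y)%Re x0; first lra.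
have [|s [hs ts]] := @val_sup_approx y (val_sup (x * y) - r)%Re y0; first lra.
have := @val_sup_ub (x * y) _ (mulf_neq0 x0 y0) (val_belowM hr hs); lra.
Qed.

Lemma val_below0 z : O z -> val_below z 0.
Proof.
move=> oz; exists 1%N, 0%N, 0%N; split=> //; first by rewrite expr1 expr0 mulr1 divr1.
by rewrite /Rdiv; lra.
Qed.

Lemma val_sup_ge0 z : z != 0 -> O z -> (0 <= val_sup z)%Re.
Proof. by move=> z0 oz; apply: val_sup_ub => //; apply: val_below0. Qed.

Lemma val_sup1 : val_sup 1 = 0%Re.
Proof.
have h1 : (0 <= val_sup 1)%Re := val_sup_ge0 (oner_neq0 F) (vr1 VR).
have [_ lub] := @val_supP 1 (oner_neq0 F).
have : (val_sup 1 <= 0)%Re by apply: lub => r /val_below1.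
lra.
Qed.

Lemma val_supV z : z != 0 -> val_sup z^-1 = (- val_sup z)%Re.
Proof.
move=> z0; have zi0 : z^-1 != 0 by rewrite invr_eq0.
have := val_sup_super z0 zi0; rewrite divff // val_sup1 => le.
apply: Rle_antisym; first lra.
(* A rational in the gap would bound neither [z] from below nor, with opposite sign, [z^-1], against
   [val_below_total]. *)
apply: Rnot_lt_le => lt.
have [|a [b [n [n0 h1 h2]]]] := @real_rational_between (val_sup z) (- val_sup z^-1)%Re; first lra.
case: (val_below_total a b z0 n0) => h.
  have := val_sup_ub z0 h; lra.
have := val_sup_ub zi0 h; lra.
Qed.

Lemma val_supM x y : x != 0 -> y != 0 -> val_sup (x * y) = (val_sup x + val_sup y)%Re.
Proof.
move=> x0 y0; have yi0 : y^-1 != 0 by rewrite invr_eq0.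
have h1 := val_sup_super x0 y0; have := @val_sup_super (x * y) y^-1 (mulf_neq0 x0 y0) yi0.
rewrite mulfK // val_supV // => h2; lra.
Qed.

Lemma val_sup_real : real_valuation val_sup.
Proof.
split; first exact: val_supM.
have half x y : x != 0 -> y != 0 -> x + y != 0 -> O (y / x) -> (val_sup x <= val_sup (x + y))%Re.
  move=> x0 y0 xy0 o.
  have e : x + y = x * (1 + y / x) by field; rewrite ?x0.
  have z0 : 1 + y / x != 0 by apply: contraNneq xy0 => z0; rewrite e z0 mulr0.
  rewrite e val_supM //; have := val_sup_ge0 z0 (vrD VR (vr1 VR) o); lra.
move=> x y x0 y0 xy0; have [o|o] := EM (O (y / x)).
  exact: Rle_trans (Rmin_l _ _) (half x y x0 y0 xy0 o).
apply: Rle_trans (Rmin_r _ _) _; rewrite addrC; apply: half => //; first by rewrite addrC.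
by rewrite -invf_div; apply: (vrV VR).
Qed.

Lemma val_sup_pos z : z != 0 -> (0 < val_sup z)%Re -> O z.
Proof.
move=> z0 lt; apply: contrapT => nz; have zi0 : z^-1 != 0 by rewrite invr_eq0.
have := val_sup_ge0 zi0 (vrV VR nz); rewrite val_supV //; lra.
Qed.

Lemma val_sup_unif : val_sup q = 1%Re.
Proof.
have qi0 : q^-1 != 0 by rewrite invr_eq0.
have h1 : (1 <= val_sup q)%Re.
  apply: val_sup_ub => //; exists 1%N, 1%N, 0%N; split=> //=; last by rewrite /Rdiv; lra.
  by rewrite !expr1 expr0 mulr1 divff //; apply: (vr1 VR).
have h2 : (- (1) <= val_sup q^-1)%Re.
  apply: val_sup_ub => //; exists 1%N, 0%N, 1%N; split=> //=; last by rewrite /Rdiv; lra.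
  by rewrite !expr1 expr0 divr1 mulVf //; apply: (vr1 VR).
rewrite val_supV // in h2; lra.
Qed.

Lemma val_supX z n : z != 0 -> val_sup (z ^+ n) = (INR n * val_sup z)%Re.
Proof.
move=> z0; elim: n => [|n IH]; first by rewrite expr0 val_sup1 /=; lra.
rewrite exprS val_supM ?expf_neq0 // IH S_INR; lra.
Qed.

(** Archimedean with respect to [q] does not mean rank 1: [O] may have values that are infinitesimal
    against [v(q)], and then the ring of [val_sup] is strictly larger. Each property is passed to
    this larger ring. *)
Lemma perfectoid_of_vr p : q = p%:R -> prime p -> char0 F -> dense_divisible O -> semiperfect_mod O p ->
  (forall c : nat -> F, (forall i j, (i <= j)%N -> O ((c j - c i) / q ^+ i)) ->
     exists l, forall i, O ((l - c i) / q ^+ i)) ->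
  perfectoid0p p F.
Proof.
move=> qE pp c0 D SP comp; split=> //; exists val_sup.
have bigO z n : z != 0 -> (INR n < val_sup z)%Re -> O (z / q ^+ n).
  move=> z0 lt; have qn : q ^+ n != 0 by rewrite expf_neq0.
  apply: val_sup_pos; first by rewrite mulf_neq0 ?invr_eq0.
  rewrite val_supM ?invr_eq0 // val_supV // val_supX // val_sup_unif; lra.
have bigO' z n : z != 0 -> O (z / q ^+ n) -> (INR n <= val_sup z)%Re.
  move=> z0 o; have qn : q ^+ n != 0 by rewrite expf_neq0.
  have := @val_sup_ge0 (z / q ^+ n); rewrite mulf_neq0 ?invr_eq0 // => /(_ isT o).
  rewrite val_supM ?invr_eq0 // val_supV // val_supX // val_sup_unif; lra.
split.
- exact: val_sup_real.
- exists q; split=> //; rewrite val_sup_unif; lra.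
- move=> s cs.
  have [N hN] : {N : nat -> nat & forall k n m, (N k <= n)%N -> (N k <= m)%N -> s n != s m ->
      (INR k < val_sup (s n - s m))%Re}.
    by apply: (@choice _ _ (fun k N => forall n m, (N <= n)%N -> (N <= m)%N -> s n != s m ->
      (INR k < val_sup (s n - s m))%Re)) => k; apply: cs.
  pose N' := fix f k := if k is k'.+1 then maxn (N k) (f k') else N 0%N.
  have NN' k : (N k <= N' k)%N by case: k => [|k] //=; rewrite leq_maxl.
  have N'mono i j : (i <= j)%N -> (N' i <= N' j)%N.
    move=> /subnK <-; elim: (j - i)%N => // m IH; rewrite addSn; apply: (leq_trans IH).
    by rewrite /= leq_maxr.
  have O0 k : O (0 / q ^+ k) by rewrite mul0r; apply: (vr0 VR).
  have close k n m : (N k <= n)%N -> (N k <= m)%N -> O ((s n - s m) / q ^+ k).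
    move=> hn hm; have [->|ne] := eqVneq (s n) (s m); first by rewrite subrr.
    by apply: bigO; [rewrite subr_eq0|apply: hN].
  have [|l hl] := comp (fun k => s (N' k)).
    move=> i j ij; apply: close; last exact: NN'.
    by apply: (leq_trans (NN' i)); apply: N'mono.
  exists l => Mx; have [k hk] := INR_unbounded (Mx + 1).
  exists (N k) => n hn ne.
  have e : s n - l = (s n - s (N' k)) - (l - s (N' k)) by ring.
  have := @bigO' (s n - l) k; rewrite subr_eq0 ne => /(_ isT) h.
  have : (INR k <= val_sup (s n - l))%Re.
    apply: h; rewrite e mulrBl; apply: (vrB VR); last exact: hl.
    exact: close.
  lra.
- by right; rewrite -qE val_sup_unif; lra.
- split.
    move=> x ox.
    have [->|x0] := eqVneq x 0.
      exists 0, 0; split; try by left.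
      by rewrite mulr0 subr0 expr0n; case: (p) pp.
    have rO z : O z -> rv_O val_sup z.
      by move=> oz; have [->|z0] := eqVneq z 0; [left|right; apply: val_sup_ge0].
    have ux : (0 <= val_sup x)%Re by case: ox => // e; rewrite e eqxx in x0.
    have [o|no] := EM (O x).
      have [y [z [oy oz e]]] := SP x o.
      by exists y, z; split=> //; apply: rO.
    have xi0 : x^-1 != 0 by rewrite invr_eq0.
    have vx0 : val_sup x = 0%Re.
      have := val_sup_ge0 xi0 (vrV VR no); rewrite val_supV //; lra.
    (* Here [x] is outside [O] but has real value 0. Multiplying by a [p]-th power brings it into
       [O], and the solution is scaled back by [x], which costs nothing in real value. *)
    have o1 : O (x^-1 ^+ p * x).
      rewrite -(prednK (prime_gt0 pp)) exprSr mulfVK //; apply: (vrX VR); exact: (vrV VR).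
    have [y [z [oy oz e]]] := SP _ o1.
    have xp0 : x ^+ p != 0 by rewrite expf_neq0.
    have rMx w t : w != 0 -> val_sup w = 0%Re -> O t -> rv_O val_sup (t * w).
      move=> w0 vw ot; have [->|t0] := eqVneq t 0; first by left; rewrite mul0r.
      right; rewrite val_supM // vw; have := val_sup_ge0 t0 ot; lra.
    exists (y * x), (z * x ^+ p); split.
    + exact: rMx.
    + by apply: rMx => //; rewrite val_supX // vx0; lra.
    + rewrite mulrA -e exprVn exprMn; move: (x ^+ p) xp0 => A A0.
      by field; rewrite ?A0.
  move=> [x [x0 ux hmin]].
  have mx : vmax O x.
    apply/vmaxVP => // o; have xi0 : x^-1 != 0 by rewrite invr_eq0.
    have := val_sup_ge0 xi0 o; rewrite val_supV //; lra.
  (* With exponent 3, [v(x) <= 3 v(y) <= 2 v(x)] puts [v(y)] strictly between 0 and [v(x)], even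
     though only weak inequalities survive in the real valuation. *)
  have [y [y0 /vmaxW h1 /vmaxW h2]] := D x x 3%N x0 mx x0 isT.
  have yn0 : y ^+ 3 != 0 by rewrite expf_neq0.
  have := @val_sup_ge0 (y ^+ 3 / x); rewrite mulf_neq0 ?invr_eq0 // => /(_ isT h1).
  rewrite val_supM ?invr_eq0 // val_supV // val_supX // /= => g1.
  have := @val_sup_ge0 (x * x / y ^+ 3); rewrite !mulf_neq0 ?invr_eq0 // => /(_ isT h2).
  rewrite !val_supM ?mulf_neq0 ?invr_eq0 // val_supV // val_supX // /= => g2.
  have := hmin y y0; lra.
Qed.
End RealValuation.

(** * Residue fields and coarsenings *)

Section ResidueField.
Variables (K : fieldType) (O : K -> Prop).
Hypothesis VR : valuation_ring O.

Program Definition residue_setoid : setoid_field := {|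
  sf_car := {x : K | O x};
  sf_eq x y := vmax O (sval x - sval y);
  sf_zero := exist _ 0 (vr0 VR); sf_one := exist _ 1 (vr1 VR);
  sf_add x y := exist _ (sval x + sval y) (vrD VR (svalP x) (svalP y));
  sf_mul x y := exist _ (sval x * sval y) (vrM VR (svalP x) (svalP y));
  sf_opp x := exist _ (- sval x) (vrN VR (svalP x)) |}.
Next Obligation. by move=> x /=; rewrite subrr; apply: vmax0. Qed.
Next Obligation. by move=> x y /=; rewrite -(opprB (sval x)) vmaxN. Qed.
Next Obligation.
move=> x y z /= h h'; rewrite (_ : _ - _ = (sval x - sval y) + (sval y - sval z)); last by ring.
exact: vmaxD.
Qed.
Next Obligation.
move=> x x' y y' /= h h'.
rewrite (_ : _ - _ = (sval x - sval x') + (sval y - sval y')); last by ring.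
exact: vmaxD.
Qed.
Next Obligation.
move=> x x' y y' /= h h'.
rewrite (_ : _ - _ = (sval x - sval x') * sval y + sval x' * (sval y - sval y')); last by ring.
by apply: vmaxD => //; [apply: vmaxM => //; apply: svalP|apply: vmaxMr => //; apply: svalP].
Qed.
Next Obligation. by move=> x x' /= h; rewrite -opprD; apply/vmaxN. Qed.
Next Obligation. by move=> x y z /=; rewrite (_ : _ - _ = 0); [apply: vmax0|ring]. Qed.
Next Obligation. by move=> x y /=; rewrite (_ : _ - _ = 0); [apply: vmax0|ring]. Qed.
Next Obligation. by move=> x /=; rewrite (_ : _ - _ = 0); [apply: vmax0|ring]. Qed.
Next Obligation. by move=> x /=; rewrite (_ : _ - _ = 0); [apply: vmax0|ring]. Qed.
Next Obligation. by move=> x y z /=; rewrite (_ : _ - _ = 0); [apply: vmax0|ring]. Qed.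
Next Obligation. by move=> x y /=; rewrite (_ : _ - _ = 0); [apply: vmax0|ring]. Qed.
Next Obligation. by move=> x /=; rewrite (_ : _ - _ = 0); [apply: vmax0|ring]. Qed.
Next Obligation. by move=> x y z /=; rewrite (_ : _ - _ = 0); [apply: vmax0|ring]. Qed.
Next Obligation. by rewrite /= subr0; apply: vmax1. Qed.
Next Obligation.
move=> [x ox] /=; rewrite subr0 => nm.
have [x0 [_ oi]] : vunit O x by case: (vunitP ox).
by exists (exist _ x^-1 oi) => /=; rewrite mulVf // subrr; apply: vmax0.
Qed.

Lemma residue_map_ex : exists (k : fieldType) (res : K -> k), residue_map O res.
Proof.
pose k := quot_field residue_setoid.
pose cl (x : K) (ox : O x) : k := qcls (exist _ x ox : sf_car residue_setoid).
have [res hres] : {res : K -> k & forall x ox, res x = cl x ox}.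
  apply: (@choice _ _ (fun x z => forall ox, z = cl x ox)) => x.
  have [ox|no] := EM (O x); last by exists 0 => ox.
  by exists (cl x ox) => ox'; rewrite (Prop_irrelevance ox ox').
exists k, res; split=> //.
- move=> x y ox oy; rewrite (hres _ ox) (hres _ oy) (hres _ (vrD VR ox oy)).
  by rewrite /cl -qclsD; apply/qclsE; rewrite /= subrr; apply: vmax0.
- move=> x y ox oy; rewrite (hres _ ox) (hres _ oy) (hres _ (vrM VR ox oy)).
  by rewrite /cl -qclsM; apply/qclsE; rewrite /= subrr; apply: vmax0.
- move=> x ox; rewrite (hres _ ox) /cl -(qcls0 residue_setoid).
  by rewrite qclsE /= subr0.
- move=> a; have [[x ox] ->] := qcls_surj a; exists x => //; exact: hres.
Qed.
End ResidueField.

Lemma natr_unit (K : fieldType) (O : K -> Prop) p n : valuation_ring O -> prime p ->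
  vmax O p%:R -> coprime p n -> vunit O n%:R.
Proof.
move=> V pp mp cp; case: (vunitP (vr_nat V n)) => // mn.
have [a _] := Bezoutl n (prime_gt0 pp); rewrite (eqP cp) => /dvdnP [b e].
case: (vmax1 V); have -> : 1 = b%:R * p%:R - a%:R * n%:R :> K.
  by rewrite -!natrM -e natrD addrK.
by apply: (vmaxB V); apply: (vmaxMr V) => //; apply: (vr_nat V).
Qed.

(** * The coarsening with residue characteristic 0 *)

Section Coarsening.
Variables (K : fieldType) (O : K -> Prop) (p : nat).
Hypothesis V : valuation_ring O.
Hypothesis pp : prime p.
Hypothesis N : newtonian O.
Hypothesis mp : vmax O p%:R.
Hypothesis p0 : p%:R != 0 :> K.
Hypothesis D : dense_divisible O.
Hypothesis SP : semiperfect_mod O p.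
Hypothesis B : ball_saturated O.

(** The localization of [O] at [p]: the least coarsening in which [p] becomes a unit. *)
Definition coarsening (x : K) := exists n, O (p%:R ^+ n * x).
Local Notation W := coarsening.
Let q : K := p%:R.
Let qn n : q ^+ n != 0. Proof. exact: expf_neq0. Qed.

Lemma coarsening_sub x : O x -> W x. Proof. by exists 0%N; rewrite expr0 mul1r. Qed.

Lemma coarsening_vr : valuation_ring W.
Proof.
have oq n : O (q ^+ n) by apply: (vrX V); apply: vmaxW.
split.
- exact/coarsening_sub/(vr0 V).
- exact/coarsening_sub/(vr1 V).
- move=> x y [n hn] [m hm]; exists (n + m)%N; rewrite -/q.
  rewrite (_ : _ * _ = q ^+ m * (q ^+ n * x) - q ^+ n * (q ^+ m * y)); last by rewrite exprD; ring.
  by apply: (vrB V); apply: (vrM V).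
- move=> x y [n hn] [m hm]; exists (n + m)%N; rewrite -/q.
  rewrite (_ : _ * _ = (q ^+ n * x) * (q ^+ m * y)); last by rewrite exprD; ring.
  exact: (vrM V).
- move=> x _; have [h|h] := EM (O x); [left|right]; apply: coarsening_sub => //; exact: (vrV V).
Qed.
Let VW := coarsening_vr.

Lemma coarsening_max x : vmax W x <-> forall n, O (x / q ^+ n).
Proof.
rewrite vmaxP; last exact: VW.
split=> [[->|h] n|h]; first by rewrite mul0r; apply: (vr0 V).
  by apply: contrapT => no; apply: h; exists n; rewrite -/q -invf_div; apply: (vrV V).
have [->|x0] := eqVneq x 0; [by left|right=> -[n hn]].
apply: (vmax_inv V mp p0); rewrite (_ : _^-1 = (x / q ^+ n.+1) * (q ^+ n * x^-1)); first exact: (vrM V).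
by rewrite exprS -/q; have := qn n; move: (q ^+ n) => A A0; field; rewrite ?A0 ?x0 ?p0.
Qed.

Lemma coarsening_max_sub x : vmax W x -> vmax O x.
Proof.
move=> /coarsening_max /(_ 1%N); rewrite expr1 => o.
by rewrite -[x](divfK p0) mulrC; apply: (vmaxM V).
Qed.

Lemma coarsening_unit x : vunit O x -> vunit W x.
Proof. by move=> [x0 [o oi]]; split=> //; split; apply: coarsening_sub. Qed.

Lemma coarsening_unit_p : vunit W q.
Proof.
split=> //; split; first by apply: coarsening_sub; apply: vmaxW.
by exists 1%N; rewrite expr1 divff //; apply: (vr1 V).
Qed.

(** The maximal ideal of the coarsening is contained in that of [O], so [O] already provides a root.
    The equation itself shows that [z + 1] lies in the smaller ideal. *)
Lemma coarsening_newtonian : newtonian W.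
Proof.
move=> P P0 P1 hP.
have [z [oz Pz mz]] := N P0 P1 (fun i i2 => coarsening_max_sub (hP i i2)).
have wz := coarsening_sub oz; exists z; split=> //.
have -> : z + 1 = - (P - 'X - 1%:P).[z] by rewrite !(hornerD, hornerN, hornerX, hornerC) Pz; ring.
apply/(vmaxN VW); apply: (vmax_horner VW) => // i; rewrite !coefB coefX coefC.
case: i => [|[|i]] /=; rewrite ?P0 ?P1 ?subr0 ?subrr ?sub0r ?addNr //; try exact: (vmax0 VW).
exact: hP.
Qed.

(** [dense_divisible] for [a = p] finds an [n]-divisible value within [v(p)] of the given one, a
    difference that the coarsening ignores. *)
Lemma coarsening_divisible : divisible W.
Proof.
move=> x n x0 n0; have [y [y0 h1 h2]] := D p0 mp x0 n0.
have yn : y ^+ n != 0 by rewrite expf_neq0.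
exists y; split; first by rewrite mulf_neq0 ?invr_eq0.
split; first by apply: coarsening_sub; apply: vmaxW.
by exists 1%N; rewrite expr1 invf_div mulrA; apply: vmaxW.
Qed.

Lemma coarsening_nat n : (0 < n)%N -> vunit W n%:R.
Proof.
move=> n0; have [m' cp ->] := pfactor_coprime pp n0.
rewrite natrM natrX; apply: (vunitM VW); first exact/coarsening_unit/(natr_unit V pp mp cp).
exact/(vunitX VW)/coarsening_unit_p.
Qed.

(** The image of [O] in the residue field is archimedean with respect to [p] by the choice of the
    coarsening. A Cauchy sequence lifts to nested balls with radii [p ^ i], which have a common
    point by saturation. The other properties lift and reduce. *)
Lemma coarsening_residue_perfectoid (F : fieldType) (res : K -> F) : residue_map W res -> perfectoid0p p F.
Proof.
move=> R; pose OF z := exists x, O x /\ res x = z.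
have cF : char0 F.
  case=> // n e; have := proj2 (rm_unit R (vr_nat VW n.+1)) (coarsening_nat (ltn0Sn n)).
  by rewrite (rm_nat R).
have OFE x : W x -> OF (res x) <-> O x.
  move=> wx; split=> [[y [oy e]]|ox]; last by exists x.
  have /coarsening_max_sub mxy : vmax W (x - y) by apply/(rm_eqP R) => //; apply: coarsening_sub.
  by rewrite -[x](subrK y); apply: (vrD V) => //; apply: vmaxW.
have VF : valuation_ring OF.
  split.
  - by exists 0; rewrite (rm0 R); split=> //; apply: (vr0 V).
  - by exists 1; rewrite (rm1 R); split=> //; apply: (vr1 V).
  - move=> _ _ [x [ox <-]] [y [oy <-]]; exists (x - y).
    by rewrite (rmB R (coarsening_sub ox) (coarsening_sub oy)); split=> //; apply: (vrB V).
  - move=> _ _ [x [ox <-]] [y [oy <-]]; exists (x * y).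
    by rewrite (rmM R (coarsening_sub ox) (coarsening_sub oy)); split=> //; apply: (vrM V).
  - move=> z z0; have [x wx ex] := rm_surj R z.
    have ux : vunit W x by apply/(rm_unit R) => //; rewrite ex; apply/eqP.
    have [o|no] := EM (O x); [by left; exists x|right; exists x^-1].
    by rewrite (rmV R) // ex; split=> //; apply: (vrV V).
have maxE x : W x -> vmax OF (res x) <-> vmax O x.
  move=> wx; have [mx|nmx] := EM (vmax W x).
    rewrite (proj2 (rm_eq0 R wx) mx); split=> _; first exact: coarsening_max_sub.
    exact: (vmax0 VF).
  have ux : vunit W x by case: (vunitP wx).
  have [x0 [_ wix]] := ux.
  have r0 : res x != 0 by apply/eqP/(rm_unit R).
  by rewrite (vmaxVP VF r0) (vmaxVP V x0) -(rmV R) // OFE.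
have resq : res q = p%:R := rm_nat R p.
have q0F : p%:R != 0 :> F.
  by apply/eqP => /cF e; move: pp; rewrite e.
have wq : W q by apply: coarsening_sub; apply: vmaxW.
have mqF : vmax OF p%:R by rewrite -resq; apply/maxE.
have resdiv x n : W x -> res (x / q ^+ n) = res x / p%:R ^+ n.
  move=> wx; have [_ [_ wi]] := vunitX VW n coarsening_unit_p.
  by rewrite (rmM R) // (rmV R) ?(rmX R) ?resq //; apply: (vunitX VW n coarsening_unit_p).
have wdiv x n : W x -> W (x / q ^+ n).
  by move=> wx; apply: (vrM VW) => //; have [_ []] := vunitX VW n coarsening_unit_p.
apply: (@perfectoid_of_vr F OF p%:R VF q0F mqF) => //.
- move=> z; have [x [n on] <-] := rm_surj R z; exists n.
  rewrite -resq -(rmX R) // -(rmM R).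
  + by exists (q ^+ n * x).
  + exact: (vrX VW).
  + by exists n.
- move=> a x n a0 ma x0 n0.
  have [a' wa ea] := rm_surj R a; have [x' wx ex] := rm_surj R x.
  have ua : vunit W a' by apply/(rm_unit R) => //; rewrite ea; apply/eqP.
  have ux : vunit W x' by apply/(rm_unit R) => //; rewrite ex; apply/eqP.
  have [a0' [_ wia]] := ua; have [x0' [_ wix]] := ux.
  have ma' : vmax O a' by apply/(maxE a' wa); rewrite ea.
  have [y [y0 h1 h2]] := D a0' ma' x0' n0.
  have w1 := coarsening_sub (vmaxW h1); have w2 := coarsening_sub (vmaxW h2).
  have yn0 : y ^+ n != 0 by rewrite expf_neq0.
  have uyn : vunit W (y ^+ n).
    split=> //; split.
      by rewrite -[y ^+ n](divfK x0'); apply: (vrM VW).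
    rewrite (_ : _^-1 = (a' * x' / y ^+ n) * (a'^-1 * x'^-1)).
      by apply: (vrM VW) => //; apply: (vrM VW).
    by field; rewrite ?a0' ?x0' ?yn0.
  have uy : vunit W y := vunitX_inv VW n0 uyn.
  have ry0 : res y != 0 by apply/eqP/(rm_unit R) => //; case: uy => _ [].
  have [_ [wy _]] := uy; have [_ [wyn wiyn]] := uyn.
  exists (res y); split=> //.
    rewrite -(rmX R) // -ex -(rmV R) // -(rmM R) //; exact/maxE.
  rewrite -(rmX R) // -ex -ea -(rmV R) // -!(rmM R) //; last exact: (vrM VW).
  exact/maxE.
- move=> z [x [ox <-]]; have [y [w [oy ow e]]] := SP ox.
  exists (res y), (res w); split; [by exists y|by exists w|].
  have ws := coarsening_sub.
  rewrite -(rmX R); last exact: ws.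
  rewrite -(rmB R); [|exact/ws/(vrX V)|exact: ws].
  by rewrite e (rmM R) ?resq //; apply: ws.
- move=> c hc.
  have [c' hc'] : {c' : nat -> K & forall i, W (c' i) /\ res (c' i) = c i}.
    have h i : exists x, W x /\ res x = c i by have [x] := rm_surj R (c i); exists x.
    by exists (fun i => projT1 (cid (h i))) => i; case: cid.
  have close i j : (i <= j)%N -> O ((c' j - c' i) / q ^+ i).
    move=> ij; have [wi ei] := hc' i; have [wj ej] := hc' j.
    have wd := vrB VW wj wi.
    apply/OFE; first exact: wdiv.
    by rewrite resdiv // (rmB R) // ei ej; apply: hc.
  have [|l hl] := B (c := c') (r := fun i => q ^+ i).
    move=> i j; have [ij|ji] := leqP i j; [left|right]; apply/vdivE => //.
      by rewrite -opprB mulNr; apply: (vrN V); apply: close.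
    by apply: close; apply: ltnW.
  have {}hl i : O ((l - c' i) / q ^+ i) by apply/vdivE.
  have wl : W l.
    have [w0 _] := hc' 0%N; rewrite -[l](subrK (c' 0%N)); apply: (vrD VW) => //.
    by have := hl 0%N; rewrite expr0 divr1; apply: coarsening_sub.
  exists (res l) => i; have [wi <-] := hc' i.
  have wd := vrB VW wl wi.
  by rewrite -(rmB R) // -resdiv //; apply/OFE => //; apply: wdiv.
Qed.
End Coarsening.

(** * Composition of valuations *)

Section Composite.
Variables (K k1 k2 : fieldType) (O1 : K -> Prop) (O2 : k1 -> Prop) (r1 : K -> k1) (r2 : k1 -> k2).
Hypothesis R1 : residue_map O1 r1.
Hypothesis R2 : residue_map O2 r2.
Let V1 := rm_vr R1.
Let V2 := rm_vr R2.

Definition composite x := O1 x /\ O2 (r1 x).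
Local Notation O := composite.

Lemma composite_vr : valuation_ring O.
Proof.
split.
- by split; [apply: (vr0 V1)|rewrite (rm0 R1); apply: (vr0 V2)].
- by split; [apply: (vr1 V1)|rewrite (rm1 R1); apply: (vr1 V2)].
- by move=> x y [h1 h2] [h1' h2']; split; [apply: (vrB V1)|rewrite (rmB R1) //; apply: (vrB V2)].
- by move=> x y [h1 h2] [h1' h2']; split; [apply: (vrM V1)|rewrite (rmM R1) //; apply: (vrM V2)].
- move=> x x0; have [o|no] := EM (O1 x); last first.
    right; split; first exact: (vrV V1).
    rewrite (proj2 (rm_eq0 R1 (vrV V1 no)) (vrN_max V1 no)); exact: (vr0 V2).
  have [m|nm] := EM (vmax O1 x).
    by left; split=> //; rewrite (proj2 (rm_eq0 R1 o) m); apply: (vr0 V2).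
  have u : vunit O1 x by case: (vunitP o).
  have [h|h] := EM (O2 (r1 x)); [by left|right; split; first by case: u => _ []].
  by rewrite (rmV R1) //; apply: (vrV V2).
Qed.

Lemma composite_unit x : O1 x -> vunit O2 (r1 x) -> vunit O x.
Proof.
move=> o [r0 [h1 h2]]; have u : vunit O1 x by apply/(rm_unit R1) => //; apply/eqP.
have [x0 [_ oi]] := u; split=> //; split; first by [].
by split=> //; rewrite (rmV R1).
Qed.

Lemma composite_max x : O1 x -> vmax O2 (r1 x) <-> vmax O x.
Proof.
move=> o; split=> [m|[[_ o2] nu]].
  split; first by split=> //; apply: vmaxW.
  move=> [x0 [_ [oi o2i]]].
  have u : vunit O1 x by split.
  apply: (vunit_not_max _ m); split; first by apply/eqP/(rm_unit R1).
  by split; [apply: vmaxW m|rewrite -(rmV R1)].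
by case: (vunitP o2) => // u; case: nu; apply: composite_unit.
Qed.

Lemma composite_residue : residue_map O (r2 \o r1).
Proof.
split.
- exact: composite_vr.
- by move=> x y [h1 h2] [h1' h2'] /=; rewrite (rmD R1) // (rmD R2).
- by move=> x y [h1 h2] [h1' h2'] /=; rewrite (rmM R1) // (rmM R2).
- by move=> x [h1 h2] /=; rewrite (rm_eq0 R2) // composite_max.
- move=> a; have [y oy ey] := rm_surj R2 a; have [x ox ex] := rm_surj R1 y.
  by exists x; [split=> //; rewrite ex|rewrite /= ex].
Qed.

(** The polynomial is reduced and solved in [k1]. Any lift of that root is an approximate root with
    invertible derivative for [O1], and Newton's lemma corrects it without changing its residue. *)
Lemma composite_newtonian : newtonian O1 -> newtonian O2 -> newtonian O.
Proof.
move=> N1 N2 P P0 P1 hP; have V := composite_vr.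
have sP : (1 < size P)%N.
  by rewrite ltnNge; apply/negP => sz; move: P1; rewrite nth_default // => /esym /eqP;
     rewrite oner_eq0.
have oP i : O1 P`_i.
  case: i => [|[|i]]; rewrite ?P0 ?P1; try exact: (vr1 V1).
  by have [[]] := hP i.+2 isT.
have mP i : (2 <= i)%N -> vmax O2 (r1 P`_i) by move=> /hP; rewrite -composite_max.
pose Q := \poly_(i < size P) r1 P`_i.
have [|||zz [oz Qz mz]] := N2 Q.
- by rewrite coef_poly (ltnW sP) P0 (rm1 R1).
- by rewrite coef_poly sP P1 (rm1 R1).
- by move=> i i2; rewrite coef_poly; case: ifP => _; [apply: mP|apply: (vmax0 V2)].
have [x0 ox0 ex0] := rm_surj R1 zz.
have oPx := vr_horner V1 oP ox0.
have mPx : vmax O1 P.[x0].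
  apply/(rm_eq0 R1) => //; rewrite (rm_horner R1) // ex0 -[RHS]Qz horner_poly.
  by [].
have oP' i : O1 (P^`() - 1%:P)`_i.
  rewrite coefB coefC coef_deriv; apply: (vrB V1); first exact: (vr_natmul V1).
  by case: eqP => _; [apply: (vr1 V1)|apply: (vr0 V1)].
have uP' : vunit O1 P^`().[x0].
  have -> : P^`().[x0] = 1 + (P^`() - 1%:P).[x0] by rewrite hornerD hornerN hornerC; ring.
  have oh := vr_horner V1 oP' ox0.
  apply/(rm_unit R1); first by apply: (vrD V1) => //; apply: (vr1 V1).
  rewrite (rmD R1) //; last exact: (vr1 V1).
  rewrite (rm1 R1); apply/eqP; suff [] : vunit O2 (1 + r1 (P^`() - 1%:P).[x0]) by [].
  apply: (vunit_1max V2); rewrite (rm_horner R1) //; apply: (vmax_sum V2) => i _.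
  rewrite ex0; apply: (vmaxM V2); last exact: (vrX V2).
  rewrite coefB coefC coef_deriv; case: (nat_of_ord i) => [|j] /=.
    by rewrite mulr1n P1 subrr (rm0 R1); apply: (vmax0 V2).
  rewrite subr0 -mulr_natr (rmM R1) //; last exact: (vr_nat V1).
  by apply: (vmaxM V2); [apply: mP|rewrite (rm_nat R1); apply: (vr_nat V2)].
have [d0 [_ oi]] := uP'.
have [|z [oz' rz mz']] := newton_lemma V1 N1 d0.
  case=> [|[|i]] // _ /=; rewrite [P.[x0] ^+ _]exprS -exprVn.
  apply: (vmaxM V1); last exact: (vrX V1).
  apply: (vmaxMr V1); first by apply: (vr_horner V1) => //; apply: (vr_nderivn V1).
  by apply: (vmaxM V1) => //; apply: (vrX V1).
set b := x0 + _ in rz.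
have mb : vmax O1 (b - x0).
  by rewrite /b addrC addKr -mulrA; apply: (vmaxM V1) => //; apply: (vrM V1).
have ob : O1 b by rewrite -[b](subrK x0); apply: (vrD V1) => //; apply: vmaxW.
have eb : r1 b = zz by rewrite -ex0; apply/(rm_eqP R1).
have o1 := vr1 V1.
exists b; split=> //; first by split=> //; rewrite eb.
apply/composite_max; first exact: (vrD V1).
by rewrite (rmD R1) // eb (rm1 R1).
Qed.

(** A first factor corrects the value for [O1]; the quotient is then a unit whose residue is
    corrected by a second factor lifted from [k1]. *)
Lemma composite_divisible : divisible O1 -> divisible O2 -> divisible O.
Proof.
move=> D1 D2 x n x0 n0; have [y1 u1] := D1 x n x0 n0; have [w0 [ow _]] := u1.
have r0 : r1 (y1 ^+ n / x) != 0 by apply/eqP/(rm_unit R1).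
have ri0 : (r1 (y1 ^+ n / x))^-1 != 0 by rewrite invr_eq0.
have [y2] := D2 _ n ri0 n0; rewrite invrK => u2.
have [y3 oy3 e3] := rm_surj R1 y2.
exists (y1 * y3); rewrite (_ : _ / x = y3 ^+ n * (y1 ^+ n / x)); last first.
  by rewrite exprMn; field; rewrite ?x0.
have o3 : O1 (y3 ^+ n) by apply: (vrX V1).
apply: composite_unit; first exact: (vrM V1).
by rewrite (rmM R1) // (rmX R1) // e3.
Qed.

Lemma composite_nontrivial : nontrivial O1 -> nontrivial O.
Proof.
move=> [t [t0 mt]]; exists t; split=> //; apply/composite_max; first exact: vmaxW.
by rewrite (proj2 (rm_eq0 R1 (vmaxW mt)) mt); apply: (vmax0 V2).
Qed.
End Composite.

Lemma core_ex p (K : nat -> fieldType) : prime p -> (forall n, C0p p (K n)) ->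
  exists (F : fieldType) (W : ultra K -> Prop) (res : ultra K -> F),
    [/\ residue_map W res, newtonian W, divisible W, nontrivial W & perfectoid0p p F].
Proof.
move=> pp hK.
have [O hO] : {O : forall n, K n -> Prop & forall n, [/\ valuation_ring (O n), henselian (O n),
    mixed_char (O n) p, semiperfect_mod (O n) p & regular_value_group (O n) /\ nondiscrete (O n)]}.
  by exists (fun n => projT1 (cid (hK n))) => n; case: cid.
have VR n : valuation_ring (O n) by case: (hO n).
pose U := upred O; have VU : valuation_ring U := ultra_vr VR.
have NU : newtonian U.
  by apply: ultra_newtonian => // n; case: (hO n) => _ h _ _ _; apply: henselian_newtonian.
have mU : vmax U p%:R.
  by rewrite -cls_nat; apply/ultra_vmax/UFT => n; case: (hO n) => _ _ [].
have p0 : p%:R != 0 :> ultra K.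
  rewrite -cls_nat; apply/cls_neq0/UFT => n; apply/eqP => e.
  by case: (hO n) => _ _ [/(_ p e) pe _] _ _; rewrite pe in pp.
have DU : dense_divisible U.
  move=> a x n; have [f ->] := cls_surj a; have [g ->] := cls_surj x.
  move=> /cls_neq0 a0 /ultra_vmax ma /cls_neq0 x0 n0.
  have : UF (fun i => exists y, [/\ y != 0, vmax (O i) (y ^+ n / g i) & vmax (O i) (f i * g i / y ^+ n)]).
    apply: UFS (UFI a0 (UFI ma x0)) => i [h1 [h2 h3]].
    by case: (hO i) => _ _ _ _ [reg nd]; apply: (regular_dense (VR i) reg nd).
  move/(UFchoice (fun n => 0)) => [y hy]; exists (cls y); split.
  - by apply/cls_neq0; apply: UFS hy => i [].
  - by rewrite -clsX -cls_div ultra_vmax; apply: UFS hy => i [].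
  - by rewrite -clsX -clsM -cls_div ultra_vmax; apply: UFS hy => i [].
have SU : semiperfect_mod U p.
  move=> x; have [f ->] := cls_surj x => /upredE ox.
  have : UF (fun i => exists y, O i y /\ exists z, O i z /\ y ^+ p - f i = p%:R * z).
    apply: UFS ox => i ox; case: (hO i) => _ _ _ SP _; have [y [z [oy oz e]]] := SP _ ox.
    by exists y; split=> //; exists z.
  move/(UFchoice (fun n => 0)) => [y hy].
  have : UF (fun i => exists z, O i z /\ y i ^+ p - f i = p%:R * z) by apply: UFS hy => i [].
  move/(UFchoice (fun n => 0)) => [z hz]; exists (cls y), (cls z); split.
  - by apply/upredE; apply: UFS hy => i [].
  - by apply/upredE; apply: UFS hz => i [].
  - by rewrite -clsX -clsB -cls_nat -clsM clsE; apply: UFS hz => i [].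
have BU : ball_saturated U := ultra_ball VR.
have VW := coarsening_vr VU mU.
have [F [res R]] := residue_map_ex VW.
exists F, (coarsening U p), res; split=> //.
- exact: (coarsening_newtonian VU NU mU p0).
- exact: (coarsening_divisible mU p0 DU).
(* At index [n] this is [p ^ n]; as the ultrafilter contains all final segments, it is divisible by
   every fixed power of [p] and so lies in the maximal ideal of the coarsening. *)
- exists (cls (fun n => p%:R ^+ n)); split.
    apply/cls_neq0/UFT => n; apply/eqP => /eqP; rewrite expf_eq0 => /andP [_ /eqP e].
    by case: (hO n) => _ _ [/(_ p e) pe _] _ _; rewrite pe in pp.
  apply/(coarsening_max VU mU p0) => k.
  rewrite -cls_nat -clsX -cls_div; apply/upredE; apply: UFS (UFinf k) => n kn.
  have q0 : p%:R != 0 :> K n.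
    by apply/eqP => e; case: (hO n) => _ _ [/(_ p e) pe _] _ _; rewrite pe in pp.
  rewrite -exprB ?unitfE //; apply: (vrX (VR n)).
  by case: (hO n) => _ _ [_ /vmaxW].
- exact: (coarsening_residue_perfectoid VU pp mU p0 DU SU BU R).
Qed.

(** * Perfectoid fields *)

Section RealValuationTheory.
Variables (K : fieldType) (v : K -> R).
Implicit Types x y z : K.
Hypothesis RV : real_valuation v.
Arguments v _%_R.

Lemma rvM x y : x != 0 -> y != 0 -> v (x * y) = (v x + v y)%Re.
Proof. by case: RV => h _; apply: h. Qed.
Lemma rvD x y : x != 0 -> y != 0 -> x + y != 0 -> (Rmin (v x) (v y) <= v (x + y))%Re.
Proof. by case: RV => _ h; apply: h. Qed.
Lemma rv1 : v 1 = 0%Re.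
Proof. by have := @rvM 1 1 (oner_neq0 _) (oner_neq0 _); rewrite mulr1; lra. Qed.
Lemma rvV x : x != 0 -> v x^-1 = (- v x)%Re.
Proof.
move=> x0; have xi0 : x^-1 != 0 by rewrite invr_eq0.
have := @rvM x x^-1 x0 xi0; rewrite divff // rv1; lra.
Qed.
Lemma rvN1 : v (-1) = 0%Re.
Proof.
have n0 : (-1 : K) != 0 by rewrite oppr_eq0 oner_eq0.
by have := @rvM (-1) (-1) n0 n0; rewrite mulrNN mulr1 rv1; lra.
Qed.
Lemma rvN x : x != 0 -> v (- x) = v x.
Proof.
move=> x0; have n0 : (-1 : K) != 0 by rewrite oppr_eq0 oner_eq0.
rewrite -mulN1r rvM // rvN1; lra.
Qed.
Lemma rvX x n : x != 0 -> v (x ^+ n) = (INR n * v x)%Re.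
Proof.
move=> x0; elim: n => [|n IH]; first by rewrite expr0 rv1 /=; lra.
by rewrite exprS rvM ?expf_neq0 // IH S_INR; lra.
Qed.
Lemma rv_div x y : x != 0 -> y != 0 -> v (x / y) = (v x - v y)%Re.
Proof. by move=> x0 y0; rewrite rvM ?invr_eq0 // rvV //; lra. Qed.

Lemma rv_O_nz x : x != 0 -> rv_O v x <-> (0 <= v x)%Re.
Proof. by move=> x0; split=> [[e|//]|h]; [rewrite e eqxx in x0|right]. Qed.

Lemma rv_vr : valuation_ring (rv_O v).
Proof.
have ON x : rv_O v x -> rv_O v (- x).
  move=> [->|h]; first by rewrite oppr0; left.
  have [->|x0] := eqVneq x 0; first by rewrite oppr0; left.
  by right; rewrite rvN.
have OD x y : rv_O v x -> rv_O v y -> rv_O v (x + y).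
  move=> hx hy; have [->|x0] := eqVneq x 0; first by rewrite add0r.
  have [->|y0] := eqVneq y 0; first by rewrite addr0.
  have [->|xy0] := eqVneq (x + y) 0; first by left.
  right; apply: Rle_trans (rvD x0 y0 xy0); apply: Rmin_glb; exact/rv_O_nz.
split.
- by left.
- by right; rewrite rv1; lra.
- by move=> x y hx hy; apply: OD => //; apply: ON.
- move=> x y hx hy; have [->|x0] := eqVneq x 0; first by rewrite mul0r; left.
  have [->|y0] := eqVneq y 0; first by rewrite mulr0; left.
  by right; rewrite rvM //; move: hx hy; rewrite !rv_O_nz //; lra.
- move=> x x0; rewrite !rv_O_nz ?invr_eq0 // rvV //; lra.
Qed.

Lemma rv_maxE x : x != 0 -> vmax (rv_O v) x <-> (0 < v x)%Re.
Proof.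
move=> x0; rewrite (vmaxVP rv_vr x0) rv_O_nz ?invr_eq0 // rvV //; lra.
Qed.
Lemma rv_separated x y : y != 0 -> (0 < v y)%Re -> (forall n, rv_O v (x / y ^+ n)) -> x = 0.
Proof.
move=> y0 vy h; apply/eqP/negPn/negP => x0.
have [n hn] := INR_unbounded (v x / v y).
have := h n; rewrite rv_O_nz ?mulf_neq0 ?invr_eq0 ?expf_neq0 // rv_div ?expf_neq0 // rvX // => le.
have : (v x / v y * v y < INR n * v y)%Re by apply: Rmult_lt_compat_r.
rewrite /Rdiv Rmult_assoc Rinv_l; lra.
Qed.

Hypothesis CV : rv_complete v.

Lemma rv_ball_complete y (c : nat -> K) : y != 0 -> (0 < v y)%Re ->
  (forall i j, (i <= j)%N -> rv_O v ((c j - c i) / y ^+ i)) ->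
  exists l, forall i, rv_O v ((l - c i) / y ^+ i).
Proof.
move=> y0 vy h.
have yn n : y ^+ n != 0 by rewrite expf_neq0.
have big Mx : exists n, (Mx < INR n * v y)%Re.
  have [n hn] := INR_unbounded (Mx / v y); exists n.
  have : (Mx / v y * v y < INR n * v y)%Re by apply: Rmult_lt_compat_r.
  rewrite /Rdiv Rmult_assoc Rinv_l; lra.
have [|l hl] := CV (s := c).
  move=> Mx; have [n hn] := big Mx; exists n => i j hi hj ne.
  have o : rv_O v ((c i - c j) / y ^+ n).
    rewrite (_ : c i - c j = (c i - c n) - (c j - c n)); last by ring.
    by rewrite mulrBl; apply: (vrB rv_vr); apply: h.
  move: o; rewrite rv_O_nz ?mulf_neq0 ?invr_eq0 ?subr_eq0 // rv_div ?subr_eq0 // rvX //; lra.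
exists l => i; have [N hN] := hl (INR i * v y)%Re.
pose m := maxn i N.
rewrite (_ : l - c i = (c m - c i) - (c m - l)); last by ring.
rewrite mulrBl; apply: (vrB rv_vr); first by apply: h; rewrite leq_maxl.
have [->|ne] := eqVneq (c m) l; first by rewrite subrr mul0r; left.
have := hN m (leq_maxr _ _) ne.
by rewrite rv_O_nz ?mulf_neq0 ?invr_eq0 ?subr_eq0 // rv_div ?subr_eq0 // rvX //; lra.
Qed.

(* Iteration of the contraction [z |-> -1 - (d_2 z^2 + d_3 z^3 + ...)]. *)
Lemma rv_newtonian (q : K) : q != 0 -> (0 < v q)%Re -> newtonian (rv_O v).
Proof.
move=> q0 vq P P0 P1 hP; have V := rv_vr.
pose Q : {poly K} := P - 'X - 1%:P.
have mQ i : vmax (rv_O v) Q`_i.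
  rewrite /Q !coefB coefX coefC.
  by case: i => [|[|i]] /=; rewrite ?P0 ?P1 ?subr0 ?subrr ?sub0r ?addNr //;
    try exact: (vmax0 V); apply: hP.
(* The contraction factor is a non-zero coefficient of least value, or [q] if all coefficients
   vanish. *)
have [d [d0 md hd]] : exists d, [/\ d != 0, vmax (rv_O v) d & forall i, vdiv (rv_O v) d Q`_i].
  have [Q0|Q0] := eqVneq Q 0.
    exists q; split=> //; first exact/rv_maxE.
    by move=> i; rewrite Q0 coef0; apply: (vdivx0 V).
  have [||j [_ Pj hj]] := @vdiv_min _ _ V (fun i => Q`_i) (size Q) (size Q).-1 _ _.
  - by rewrite prednK // size_poly_gt0.
  - by rewrite -lead_coefE lead_coef_eq0.
  exists Q`_j; split=> // i; have [/hj //|ge] := ltnP i (size Q).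
  by rewrite (nth_default _ ge); apply: (vdivx0 V).
have vd : (0 < v d)%Re by apply/rv_maxE.
have oQ i : rv_O v Q`_i := vmaxW (mQ i).
have lip x y : rv_O v x -> rv_O v y -> exists2 e, rv_O v e & Q.[x] - Q.[y] = d * (x - y) * e.
  move=> ox oy; rewrite !horner_coef -sumrB.
  apply: (big_ind (fun s => exists2 e, rv_O v e & s = d * (x - y) * e)).
  - by exists 0; [apply: (vr0 V)|rewrite mulr0].
  - by move=> _ _ [e1 h1 ->] [e2 h2 ->]; exists (e1 + e2); [apply: (vrD V)|ring].
  move=> i _; have [c oc e] := hd i.
  exists (c * \sum_(j < i) x ^+ (i.-1 - j) * y ^+ j); last by rewrite -mulrBr subrXX e; ring.
  apply: (vrM V) => //; apply: (vr_sum V) => j; apply: (vrM V); exact: (vrX V).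
pose z := fix z n := if n is n'.+1 then - 1 - Q.[z n'] else -1.
have oz n : rv_O v (z n).
  have o1 : rv_O v (-1) by apply: (vrN V); apply: (vr1 V).
  by elim: n => [|n IH] //=; apply: (vrB V) => //; apply: (vr_horner V).
have step n : exists2 e, rv_O v e & z n.+1 - z n = d ^+ n * e.
  elim: n => [|n [e oe IH]].
    by exists (z 1%N - z 0%N); [apply: (vrB V)|rewrite expr0 mul1r].
  have [e' oe' h] := lip _ _ (oz n) (oz n.+1).
  exists (- (e * e')); first by apply: (vrN V); apply: (vrM V).
  rewrite (_ : _ - _ = Q.[z n] - Q.[z n.+1]); last by rewrite /=; ring.
  by rewrite h -(opprB (z n.+1)) IH exprS; ring.
have dn n : d ^+ n != 0 by rewrite expf_neq0.
have cauchy i j : (i <= j)%N -> rv_O v ((z j - z i) / d ^+ i).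
  move=> /subnK <-; elim: (j - i)%N => [|n IH]; first by rewrite add0n subrr mul0r; left.
  rewrite addSn (_ : z (n + i).+1 - z i = (z (n + i).+1 - z (n + i)%N) + (z (n + i)%N - z i)); last by ring.
  rewrite mulrDl; apply: (vrD V) => //; have [e oe ->] := step (n + i)%N.
  rewrite exprD mulrAC mulfK // ; apply: (vrM V) => //; apply: (vrX V); exact: vmaxW.
have [l hl] := rv_ball_complete d0 vd cauchy.
have ol : rv_O v l.
  by rewrite -[l](subrK (z 0%N)); apply: (vrD V) => //; have := hl 0%N; rewrite expr0 divr1.
have fix_l : l - (- 1 - Q.[l]) = 0.
  apply: (@rv_separated _ d) => // n.
  have -> : l - (-1 - Q.[l]) = (l - z n.+1) + (Q.[l] - Q.[z n]) by rewrite /=; ring.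
  rewrite mulrDl; apply: (vrD V).
    rewrite (_ : _ / _ = d * ((l - z n.+1) / d ^+ n.+1)).
      by apply: (vrM V) => //; apply: vmaxW.
    by rewrite exprS; have := dn n; move: (d ^+ n) => A A0; field; rewrite ?d0 ?A0.
  have [e oe ->] := lip _ _ ol (oz n).
  rewrite (_ : _ / _ = d * ((l - z n) / d ^+ n) * e); last by ring.
  by apply: (vrM V) => //; apply: (vrM V) => //; apply: vmaxW.
exists l; split=> //.
  rewrite -[RHS]fix_l /Q !(hornerD, hornerN, hornerX, hornerC); ring.
rewrite (_ : l + 1 = - Q.[l]); last first.
  by apply/eqP; rewrite -subr_eq0 -[X in _ == X]fix_l; apply/eqP; ring.
by apply/(vmaxN V); apply: (vmax_horner V).
Qed.
End RealValuationTheory.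

(** A non-trivial convex subgroup of an archimedean group is the whole group, so [y = 1] always
    serves. *)
Lemma rv_regular (K : fieldType) (v : K -> R) : real_valuation v -> rv_nondiscrete v ->
  regular_value_group (rv_O v) /\ nondiscrete (rv_O v).
Proof.
move=> RV nd; have V := rv_vr RV.
split; last first.
  move=> [x [x0 mx hx]]; apply: nd; exists x; split=> //; first exact/(rv_maxE RV).
  move=> y y0 vy; have := hx y y0 (proj2 (rv_maxE RV y0) vy).
  by rewrite /vle rv_O_nz ?mulf_neq0 ?invr_eq0 // rv_div //; lra.
move=> H [H0 H1 HD Hc] [h [Hh nuh]] x x0 n n0.
have HV y : H y -> H y^-1 by move=> hy; rewrite -[y^-1]mul1r; apply: HD.
have HM y z : H y -> H z -> H (y * z) by move=> hy /HV hz; rewrite -[z]invrK; apply: HD.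
have [a [Ha va]] : exists a, H a /\ (0 < v a)%Re.
  have h0 := H0 _ Hh; have hi0 : h^-1 != 0 by rewrite invr_eq0.
  case: (Rtotal_order (v h) 0) => [lt|[e|gt]]; last by exists h.
    by exists h^-1; split; [apply: HV|rewrite rvV //; lra].
  by case: nuh; split=> //; rewrite !rv_O_nz // rvV //; lra.
have a0 := H0 _ Ha.
have HX i : H (a ^+ i) by elim: i => [|i IH]; rewrite ?expr0 ?exprS //; apply: HM.
have Hpos y : y != 0 -> (0 <= v y)%Re -> H y.
  move=> y0 vy; have [i hi] := INR_unbounded (v y / v a).
  apply: (Hc (a ^+ i)) => //; first by rewrite /vle divr1; apply/rv_O_nz.
  rewrite /vle rv_O_nz ?mulf_neq0 ?invr_eq0 ?expf_neq0 // rv_div ?expf_neq0 // rvX //.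
  have : (v y / v a * v a < INR i * v a)%Re by apply: Rmult_lt_compat_r.
  rewrite /Rdiv Rmult_assoc Rinv_l; lra.
exists 1; split; first exact: oner_neq0.
rewrite expr1n div1r; have xi0 : x^-1 != 0 by rewrite invr_eq0.
case: (Rle_dec 0 (v x)) => h1; first by apply: HV; apply: Hpos.
by apply: Hpos => //; rewrite rvV //; lra.
Qed.

Lemma perfectoid_C0p p (K : fieldType) : prime p -> perfectoid0p p K -> C0p p K.
Proof.
move=> pp [c0 [v [RV [t [t0 vt]] CV mp [SP nd]]]].
have V := rv_vr RV.
have p0 : p%:R != 0 :> K by apply/eqP => /c0 e; rewrite e in pp.
have vp : (0 < v p%:R)%Re by case: mp => // e; rewrite e eqxx in p0.
exists (rv_O v); split=> //.
- exact: (newtonian_henselian V (rv_newtonian RV CV p0 vp)).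
- by split=> //; apply/(rv_maxE RV).
- exact: rv_regular.
Qed.

(* With K* = ultra K, its core field F, L = ultra K* and F* = ultra F -> F2, both L (via
   L -> F* -> F2) and F* carry valuations to which the Ax-Kochen-Ershov principle applies,
   so that K* = L = F* = F up to elementary equivalence. *)
Theorem C0p_ultraproduct_perfectoid p (K : nat -> fieldType) : prime p -> (forall n, C0p p (K n)) ->
  exists F, perfectoid0p p F /\ elem_equiv (ultra K) F.
Proof.
move=> pp hK.
have [F [W [res [R N D T PF]]]] := core_ex pp hK.
have [F2 [W2 [res2 [R2 N2 D2 T2 [c2 _]]]]] := core_ex pp (fun _ : nat => perfectoid_C0p pp PF).
exists F; split=> // f sf.
rewrite (ultrapower_equiv (ultra K) sf) (ultrapower_equiv F sf).
have VW (n : nat) := rm_vr R.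
have RU := ultra_residue_map (fun _ : nat => R).
have NU : newtonian (upred (fun _ : nat => W)) by apply: ultra_newtonian.
have DU : divisible (upred (fun _ : nat => W)) by apply: ultra_divisible.
have TU : nontrivial (upred (fun _ : nat => W)) by apply: ultra_nontrivial.
apply: (ax_kochen_ershov (composite_residue RU R2) R2) sf => //.
- exact: (composite_newtonian RU R2 NU N2).
- exact: (composite_divisible RU DU D2).
- exact: (composite_nontrivial RU R2 TU).
- by case=> // n _; apply/eqP => /c2.
Qed.

(** * Definable properties *)

(** A semantic notion, uniform in the field: formulas are obtained from closure properties, and what
    they express is read off directly. *)
Definition definable (P : forall K : fieldType, (nat -> K) -> Prop) :=
  exists f, forall (K : fieldType) (e : nat -> K), sat e f <-> P K e.
Definition axiomatizable (Q : fieldType -> Prop) :=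
  exists2 f, sentence f & forall K : fieldType, models K f <-> Q K.

Lemma def_eq a b : definable (fun K e => teval e a = teval e b).
Proof. by exists (fEq a b). Qed.
Lemma def_not P : definable P -> definable (fun K e => ~ P K e).
Proof. by move=> [f hf]; exists (fNot f) => K e /=; rewrite hf. Qed.
Lemma def_and P Q : definable P -> definable Q -> definable (fun K e => P K e /\ Q K e).
Proof. by move=> [f hf] [g hg]; exists (fAnd f g) => K e /=; rewrite hf hg. Qed.
Lemma def_or P Q : definable P -> definable Q -> definable (fun K e => P K e \/ Q K e).
Proof. by move=> [f hf] [g hg]; exists (fOr f g) => K e /=; rewrite hf hg. Qed.
Lemma def_imp P Q : definable P -> definable Q -> definable (fun K e => P K e -> Q K e).
Proof. by move=> [f hf] [g hg]; exists (fImp f g) => K e /=; rewrite hf hg. Qed.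
Lemma def_all i P : definable P -> definable (fun K e => forall x, P K (upd e i x)).
Proof. by move=> [f hf]; exists (fAll i f) => K e /=; split=> h x; apply/hf. Qed.
Lemma def_ex i P : definable P -> definable (fun K e => exists x, P K (upd e i x)).
Proof. by move=> [f hf]; exists (fEx i f) => K e /=; split=> -[x /hf h]; exists x. Qed.
Lemma def_iff P Q : (forall K e, P K e <-> Q K e) -> definable P -> definable Q.
Proof. by move=> h [f hf]; exists f => K e; rewrite hf. Qed.
Lemma def_true : definable (fun K e => True).
Proof. by exists (fImp fFalse fFalse) => K e /=; split. Qed.
Lemma def_forall_lt m (P : nat -> forall K : fieldType, (nat -> K) -> Prop) :
  (forall i, definable (P i)) -> definable (fun K e => forall i, (i < m)%N -> P i K e).
Proof.
move=> dP; elim: m => [|m IH]; first by apply: def_iff def_true => K e; split.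
apply: def_iff (def_and IH (dP m)) => K e; split=> [[h1 h2] i|h].
  by rewrite ltnS leq_eqVlt => /orP [/eqP ->|/h1].
by split=> [i im|]; apply: h => //; apply: ltnW.
Qed.

Definition close_all f := foldr fAll f (form_fv f).
Definition close_ex f := foldr fEx f (form_fv f).

Lemma close_all_sentence f : sentence (close_all f).
Proof.
rewrite /sentence /close_all.
have h s g : form_fv (foldr fAll g s) = [seq j <- form_fv g | j \notin s].
  elim: s => [|i s IH] /=; first by rewrite filter_predT.
  by rewrite IH -filter_predI; apply: eq_filter => j /=; rewrite inE negb_or.
by rewrite h -(filter_pred0 (form_fv f)); apply: eq_in_filter => j ->.
Qed.
Lemma close_ex_sentence f : sentence (close_ex f).
Proof.
rewrite /sentence /close_ex.
have h s g : form_fv (foldr fEx g s) = [seq j <- form_fv g | j \notin s].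
  elim: s => [|i s IH] /=; first by rewrite filter_predT.
  by rewrite IH -filter_predI; apply: eq_filter => j /=; rewrite inE negb_or.
by rewrite h -(filter_pred0 (form_fv f)); apply: eq_in_filter => j ->.
Qed.
Lemma upd_id (K : Type) (e : nat -> K) i : upd e i (e i) =1 e.
Proof. by move=> j; rewrite /upd; case: eqP => [->|]. Qed.

Lemma close_allE (K : fieldType) f : models K (close_all f) <-> forall e : nat -> K, sat e f.
Proof.
rewrite /models /close_all; elim: (form_fv f) => [|i s IH] //=.
rewrite -IH; split=> h e; last by move=> x; apply: h.
by apply/(sat_ext _ (@upd_id _ e i)); apply: h.
Qed.
Lemma close_exE (K : fieldType) f : models K (close_ex f) <-> exists e : nat -> K, sat e f.
Proof.
rewrite (models_sentence (fun=> 0) (close_ex_sentence f)).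
have -> : sat (fun=> 0 : K) (close_ex f) <-> exists e : nat -> K, sat e (close_ex f).
  by split=> [h|[e h]]; [exists (fun=> 0)|apply/(sat_sentence _ e (close_ex_sentence f))].
rewrite /close_ex; elim: (form_fv f) => [|i s IH] //=.
rewrite -IH; split=> [[e [x h]]|[e h]]; first by exists (upd e i x).
by exists e, (e i); apply/(sat_ext _ (@upd_id _ e i)).
Qed.

Lemma ax_all P : definable P -> axiomatizable (fun K => forall e : nat -> K, P K e).
Proof.
move=> [f hf]; exists (close_all f); first exact: close_all_sentence.
by move=> K; rewrite close_allE; split=> h e; apply/hf.
Qed.
Lemma ax_ex P : definable P -> axiomatizable (fun K => exists e : nat -> K, P K e).
Proof.
move=> [f hf]; exists (close_ex f); first exact: close_ex_sentence.
by move=> K; rewrite close_exE; split=> -[e /hf h]; exists e.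
Qed.
(** * Rootless polynomials over a perfectoid field *)

Section Rootless.
Variables (K : fieldType) (v : K -> R).
Implicit Types x y z : K.
Implicit Types P Q : {poly K}.
Arguments v _%_R.
Hypothesis RV : real_valuation v.

Definition vge (b : R) x := x = 0 \/ (b <= v x)%Re.
Definition vgt (b : R) x := x = 0 \/ (b < v x)%Re.

Lemma vge_nz b x : x != 0 -> vge b x -> (b <= v x)%Re.
Proof. by move=> x0 [e|//]; rewrite e eqxx in x0. Qed.
Lemma vgt_nz b x : x != 0 -> vgt b x -> (b < v x)%Re.
Proof. by move=> x0 [e|//]; rewrite e eqxx in x0. Qed.
Lemma vgeW b c x : (c <= b)%Re -> vge b x -> vge c x.
Proof. by move=> cb [->|h]; [left|right; lra]. Qed.
Lemma vgeD b x y : vge b x -> vge b y -> vge b (x + y).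
Proof.
move=> hx hy; have [->|x0] := eqVneq x 0; first by rewrite add0r.
have [->|y0] := eqVneq y 0; first by rewrite addr0.
have [->|xy0] := eqVneq (x + y) 0; first by left.
right; apply: Rle_trans (rvD RV x0 y0 xy0); apply: Rmin_glb; exact: vge_nz.
Qed.
Lemma vgtD b x y : vgt b x -> vgt b y -> vgt b (x + y).
Proof.
move=> hx hy; have [->|x0] := eqVneq x 0; first by rewrite add0r.
have [->|y0] := eqVneq y 0; first by rewrite addr0.
have [->|xy0] := eqVneq (x + y) 0; first by left.
right; apply: Rlt_le_trans (rvD RV x0 y0 xy0); apply: Rmin_glb_lt; exact: vgt_nz.
Qed.
Lemma vgeN b x : vge b x -> vge b (- x).
Proof.
move=> hx; have [->|x0] := eqVneq x 0; first by rewrite oppr0; left.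
by right; rewrite (rvN RV) //; apply: vge_nz.
Qed.
Lemma vgtN b x : vgt b x -> vgt b (- x).
Proof.
move=> hx; have [->|x0] := eqVneq x 0; first by rewrite oppr0; left.
by right; rewrite (rvN RV) //; apply: vgt_nz.
Qed.
Lemma vgeM b c x y : vge b x -> vge c y -> vge (b + c) (x * y).
Proof.
move=> hx hy; have [->|x0] := eqVneq x 0; first by rewrite mul0r; left.
have [->|y0] := eqVneq y 0; first by rewrite mulr0; left.
by right; rewrite (rvM RV) //; move: (vge_nz x0 hx) (vge_nz y0 hy); lra.
Qed.
Lemma vge_sum b n (F : 'I_n -> K) : (forall i, vge b (F i)) -> vge b (\sum_i F i).
Proof. by move=> h; apply: (big_ind (vge b)) => //; [left|apply: vgeD]. Qed.
Lemma vgt_sum b n (F : 'I_n -> K) : (forall i, vgt b (F i)) -> vgt b (\sum_i F i).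
Proof. by move=> h; apply: (big_ind (vgt b)) => //; [left|apply: vgtD]. Qed.

Lemma Rabs_geN (a : R) : (- Rabs a <= a)%Re.
Proof. by split_Rabs; lra. Qed.

Lemma family_bound (F : nat -> K) n : exists2 M, (0 <= M)%Re & forall i, (i < n)%N -> vge (- M) (F i).
Proof.
elim: n => [|n [M M0 IH]]; first by exists 0%Re; [lra|].
exists (M + Rabs (v (F n)))%Re; first by have := Rabs_pos (v (F n)); lra.
move=> i; rewrite ltnS leq_eqVlt => /orP [/eqP ->|/IH].
  by right; have := Rabs_geN (v (F n)); lra.
by apply: vgeW; have := Rabs_pos (v (F n)); lra.
Qed.

Lemma poly_bound P M : exists2 C, (0 <= C)%Re & forall z, vge (- M) z -> vge (- C) P.[z].
Proof.
elim/poly_ind: P => [|P c [C C0 IH]].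
  by exists 0%Re => [|z _]; [lra|rewrite horner0; left].
exists (C + Rabs M + Rabs (v c))%Re => [|z hz].
  by have := Rabs_pos M; have := Rabs_pos (v c); lra.
have hM := Rabs_geN (v c); have := Rle_abs M; have := Rabs_pos M; have := Rabs_pos (v c) => h1 h2 h3.
rewrite hornerMXaddC; apply: vgeD; last by right; lra.
by apply: vgeW (vgeM (IH z hz) hz); lra.
Qed.

Hypothesis NW : newtonian (rv_O v).
Variable n : nat.
Variable P : {poly K}.
Hypothesis n0 : (0 < n)%N.
Hypothesis sP : size P = n.+1.
Hypothesis mP : P \is monic.
Hypothesis rP : forall z, P.[z] != 0.
Hypothesis cP : coprimep P P^`().

(** If [P(z)] were very small while [P'(z)] is not, Newton's method would produce a root. *)
Lemma newton_bounded C M : exists C', forall z, vge (- M) z -> P^`().[z] != 0 ->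
  (v P^`().[z] <= C)%Re -> (v P.[z] <= C')%Re.
Proof.
have [D D0 hD] : exists2 D, (0 <= D)%Re & forall i, (i < n.+1)%N -> forall z, vge (- M) z -> vge (- D) P^`N(i).[z].
  elim: (n.+1) => [|k [D D0 hD]]; first by exists 0%Re => //; lra.
  have [E E0 hE] := poly_bound P^`N(k) M; exists (D + E)%Re; first by lra.
  move=> i; rewrite ltnS leq_eqVlt => /orP [/eqP -> z /hE|/hD h z /h]; apply: vgeW; lra.
have C0 := Rle_abs C; have C1 := Rabs_pos C.
(* For [i >= 2] the scaled Taylor coefficient has value at least [- D + (i - 1) v(P(z)) - i |C|],
   positive beyond this bound because [2 (i - 1) >= i]. *)
exists (D + 2 * Rabs C)%Re => z hz d0 hC.
case: (Rle_or_lt (v P.[z]) (D + 2 * Rabs C)) => // lt; exfalso.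
have [|y [_ ry _]] := newton_lemma (rv_vr RV) NW d0; last by have := rP (z + P.[z] / P^`().[z] * y); rewrite ry eqxx.
case=> [|[|i]] // _ /=.
have [ge|lti] := leqP n.+1 i.+2.
  rewrite (_ : P^`N(i.+2) = 0); first by rewrite horner0 !mul0r; apply: (vmax0 (rv_vr RV)).
  by apply/polyP => j; rewrite coef_nderivn nth_default ?mul0rn ?coef0 // sP (leq_trans ge) // leq_addr.
have [->|N0] := eqVneq P^`N(i.+2).[z] 0; first by rewrite !mul0r; apply: (vmax0 (rv_vr RV)).
have hN := vge_nz N0 (hD _ lti z hz).
have Pz := rP z.
apply/(rv_maxE RV); first by rewrite !mulf_neq0 ?invr_eq0 ?expf_neq0.
rewrite (rvM RV) ?mulf_neq0 ?invr_eq0 ?expf_neq0 // (rvM RV) ?expf_neq0 // (rvV RV) ?expf_neq0 // !(rvX RV) //.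
have i0 := pos_INR i; rewrite !S_INR; nra.
Qed.

(** For [z] of very negative value, the term [z ^ n] dominates. On the remaining ball a Bezout
    identity for [P] and [P'] prevents both from being small, and [newton_bounded] treats the points
    where [P'] is not. *)
Lemma rootless_bounded : exists C, forall z, (v P.[z] <= C)%Re.
Proof.
have [M M0 hM] := family_bound (fun i => P`_i) n.
have [[U W] /= UW] := Bezout_eq1_coprimepP _ _ cP.
have [CU CU0 hU] := poly_bound U M; have [CW CW0 hW] := poly_bound W M.
have [C' hC'] := newton_bounded CW M.
exists (CU + Rabs C')%Re => z; have aC := Rle_abs C'; have aC0 := Rabs_pos C'.
have Pz := rP z.
have [hz|hz] := EM (vge (- M) z); last first.
  have z0 : z != 0 by apply: contra_notN hz => /eqP ->; left.
  have vz : (v z < - M)%Re by case: (Rlt_le_dec (v z) (- M)) => // h; case: hz; right.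
  suff : ~ (0 < v P.[z])%Re by lra.
  move=> pos; have zn0 : z ^+ n != 0 by rewrite expf_neq0.
  have nz : (INR n * v z <= v z)%Re.
    by case: (n) n0 => // m _; rewrite S_INR; have := pos_INR m; nra.
  have : vgt (INR n * v z) (z ^+ n).
    have -> : z ^+ n = P.[z] - \sum_(i < n) P`_i * z ^+ i.
      rewrite horner_coef sP big_ord_recr /= -[n in P`_n]/(n.+1.-1) -sP -lead_coefE (monicP mP); ring.
    apply: vgtD; first by right; lra.
    apply/vgtN/vgt_sum => i.
    have [->|Pi] := eqVneq (P : seq K)`_i 0; first by rewrite mul0r; left.
    right; rewrite (rvM RV) ?expf_neq0 // (rvX RV) //.
    suff : forall b : R, (- M <= b)%Re -> (INR n * v z < b + INR i * v z)%Re.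
      by apply; apply: vge_nz Pi (hM i (ltn_ord i)).
    move=> b; have : (INR i.+1 <= INR n)%Re by apply/le_INR/leP.
    have : (v z < 0)%Re by lra.
    rewrite S_INR => h1 h2 h3; have : (INR n * v z <= (INR i + 1) * v z)%Re by nra.
    lra.
  by move=> /(vgt_nz zn0); rewrite (rvX RV) //; lra.
case: (Rle_or_lt (v P.[z]) CU) => lt; first by lra.
have e1 : U.[z] * P.[z] + W.[z] * P^`().[z] = 1 by rewrite -!hornerM -hornerD UW hornerC.
have h : vgt 0 (U.[z] * P.[z]).
  have [->|U0] := eqVneq U.[z] 0; first by rewrite mul0r; left.
  by right; rewrite (rvM RV) //; have := vge_nz U0 (hU z hz); lra.
have WP : W.[z] * P^`().[z] != 0.
  apply/eqP => e; move: e1; rewrite e addr0 => e1; move: h; rewrite e1 => /(vgt_nz (oner_neq0 _)).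
  rewrite (rv1 RV); lra.
have : ~ (0 < v (W.[z] * P^`().[z]))%Re.
  move=> pos; have : vgt 0 (1 : K) by rewrite -e1; apply: vgtD => //; right.
  by move=> /(vgt_nz (oner_neq0 _)); rewrite (rv1 RV); lra.
move: WP; rewrite mulf_eq0 negb_or => /andP [W0 d0]; rewrite (rvM RV) // => le.
have := vge_nz W0 (hW z hz) => hw.
have : (v P^`().[z] <= CW)%Re by lra.
move=> /(hC' z hz d0); lra.
Qed.

(* Newton's method at [y] for [P * (1 + xi) - P(y)]. *)
Lemma rootless_open y : P^`().[y] != 0 ->
  exists d, forall xi, vge d xi -> exists z, P.[z] * (1 + xi) = P.[y].
Proof.
move=> d0; pose a i := P^`N(i).[y] * P.[y] ^+ i.-1 / P^`().[y] ^+ i.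
have [M M0 hM] := family_bound a n.+1.
exists (M + 1)%Re => xi hxi.
have [->|x0] := eqVneq xi 0; first by exists y; rewrite addr0 mulr1.
have vx := vge_nz x0 hxi; have V := rv_vr RV.
have ux : vunit (rv_O v) (1 + xi) by apply: (vunit_1max V); apply/(rv_maxE RV) => //; lra.
have [w0 [ow oiw]] := ux.
pose g : {poly K} := (1 + xi) *: P - P.[y]%:P.
have gy : g.[y] = xi * P.[y] by rewrite /g hornerD hornerN hornerZ hornerC; ring.
have dg : g^`() = (1 + xi) *: P^`() by rewrite /g derivB derivZ derivC subr0.
have [||z [_ rz _]] := newton_lemma (f := g) (c := y) V NW.
- by rewrite dg hornerZ mulf_neq0.
- case=> [|[|i]] // _; have -> : g^`N(i.+2) = (1 + xi) *: P^`N(i.+2).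
    apply/polyP => j; rewrite !(coef_nderivn, coefZ) /g coefB coefZ coefC /=.
    by rewrite addSn /= subr0 mulrnAr.
  rewrite dg gy !hornerZ [i.+2.-1]/= (_ : _ / _ = a i.+2 * xi ^+ i.+1 / (1 + xi) ^+ i.+1); last first.
    rewrite /a [i.+2.-1]/= !exprMn !(exprS _ i.+1).
    move: (P^`().[y] ^+ i.+1) (expf_neq0 i.+1 d0) ((1 + xi) ^+ i.+1) (expf_neq0 i.+1 w0) => A A0 B B0.
    by field; rewrite ?d0 ?A0 ?B0 ?w0.
  have [ge|lti] := leqP n.+1 i.+2.
    rewrite /a (_ : P^`N(i.+2) = 0); first by rewrite horner0 !mul0r; apply: (vmax0 V).
    by apply/polyP => j; rewrite coef_nderivn nth_default ?mul0rn ?coef0 // sP (leq_trans ge) // leq_addr.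
  rewrite -exprVn; apply: (vmaxM V); last exact: (vrX V).
  have [->|a0] := eqVneq (a i.+2) 0; first by rewrite mul0r; apply: (vmax0 V).
  apply/(rv_maxE RV); first by rewrite mulf_neq0 ?expf_neq0.
  have := vge_nz a0 (hM _ lti) => ha.
  rewrite (@rvM _ _ RV (a i.+2)) ?expf_neq0 // (rvX RV) // S_INR; have := pos_INR i; nra.
exists (y + g.[y] / g^`().[y] * z).
by apply/eqP; rewrite -subr_eq0 -[X in _ == X]rz /g !(hornerD, hornerN, hornerZ, hornerC); apply/eqP; ring.
Qed.
End Rootless.

(** A value smaller than [b - a] exists by [nondiscrete_div]. Its multiples, started at a
    sufficiently negative multiple of [v(q) = 1], cannot jump over the interval. *)
Lemma rv_dense (K : fieldType) (v : K -> R) (q : K) : real_valuation v -> q != 0 -> v q = 1%Re ->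
  nondiscrete (rv_O v) -> forall a b : R, (a < b)%Re -> exists2 x : K, x != 0 & (a < v x < b)%Re.
Proof.
move=> RV q0 vq nd a b ab; have V := rv_vr RV.
have mq : vmax (rv_O v) q by apply/(rv_maxE RV) => //; lra.
have [N hN] := INR_unbounded (/ (b - a)).
have [e [e0 me oe]] := nondiscrete_div V N nd q0 mq.
have ve : (0 < v e)%Re by apply/(rv_maxE RV).
have se : (v e < b - a)%Re.
  move: oe; rewrite (rv_O_nz v) ?mulf_neq0 ?invr_eq0 ?expf_neq0 // (rv_div RV) ?expf_neq0 // (rvX RV) // vq S_INR => le.
  have h : (/ (b - a) * (b - a) = 1)%Re by rewrite Rinv_l; lra.
  have iN := Rinv_0_lt_compat (b - a) ltac:(lra).
  have h2 : (/ (b - a) * (b - a) < INR N * (b - a))%Re by apply: Rmult_lt_compat_r; lra.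
  case: (Rlt_le_dec (v e) (b - a)) => // le2; exfalso.
  have : (INR N * (b - a) <= INR N * v e)%Re by apply: Rmult_le_compat_l => //; apply: pos_INR.
  lra.
have [k hk] := INR_unbounded (- a).
have ex : exists i, (`[< a + INR k < INR i * v e >])%Re.
  have [i hi] := INR_unbounded ((a + INR k) / v e); exists i; apply/asboolP.
  have : ((a + INR k) / v e * v e < INR i * v e)%Re by apply: Rmult_lt_compat_r.
  rewrite /Rdiv Rmult_assoc Rinv_l; lra.
case: (ex_minnP ex) => i /asboolP hi imin.
exists (e ^+ i / q ^+ k); first by rewrite mulf_neq0 ?invr_eq0 ?expf_neq0.
rewrite (rv_div RV) ?expf_neq0 // !(rvX RV) // vq; split; first lra.
case: i hi imin => [|i] hi imin; first by move: hi; rewrite /=; lra.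
have : ~ (a + INR k < INR i * v e)%Re by move=> /asboolP /imin; rewrite ltnn.
rewrite S_INR; lra.
Qed.

Definition normalized p (K : fieldType) (v : K -> R) :=
  [/\ real_valuation v, v p%:R = 1%Re, newtonian (rv_O v), rv_semiperfect_mod v p &
      forall a b : R, (a < b)%Re -> exists2 x : K, x != 0 & (a < v x < b)%Re].

Lemma perfectoid_normalized p (K : fieldType) : prime p -> perfectoid0p p K ->
  exists v : K -> R, normalized p v.
Proof.
move=> pp [c0 [w [RW _ CW mp [SP nd]]]].
have p0 : p%:R != 0 :> K by apply/eqP => /c0 e; rewrite e in pp.
have wp : (0 < w p%:R)%Re by case: mp => // e; rewrite e eqxx in p0.
have wi := Rinv_0_lt_compat _ wp.
pose v x := (w x * / w p%:R)%Re.
have Ov : rv_O v = rv_O w.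
  apply/funext => x; apply/propext; rewrite /rv_O /v.
  split=> -[->|h]; try by left.
    right; case: (Rle_dec 0 (w x)) => // nh; exfalso.
    have : (w x * / w p%:R < 0 * / w p%:R)%Re by apply: Rmult_lt_compat_r => //; lra.
    lra.
  by right; apply: Rmult_le_pos => //; lra.
have RV : real_valuation v.
  split=> x y x0 y0; first by rewrite /v (rvM RW) //; lra.
  move=> xy0; have := rvD RW x0 y0 xy0; rewrite /v.
  case: (Rle_or_lt (w x) (w y)) => h.
    rewrite (Rmin_left _ _ h) Rmin_left; last by apply: Rmult_le_compat_r => //; lra.
    by move=> h'; apply: Rmult_le_compat_r => //; lra.
  rewrite (Rmin_right _ _ (Rlt_le _ _ h)) Rmin_right; last by apply: Rmult_le_compat_r; lra.
  by move=> h'; apply: Rmult_le_compat_r => //; lra.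
have vp : v p%:R = 1%Re by rewrite /v Rinv_r //; lra.
exists v; split=> //.
- by rewrite Ov; apply: (rv_newtonian RW CW p0 wp).
- by rewrite /rv_semiperfect_mod Ov; exact: SP.
- apply: (rv_dense RV p0 vp); rewrite Ov; exact: (proj2 (rv_regular RW nd)).
Qed.

(** * The neighbourhoods defined by a rootless polynomial *)

Section Neighbourhood.
Variables (K : fieldType) (p n r : nat) (c : nat -> K).
Implicit Types a x y z w : K.

(* [c 2, c 3, ...] are the coefficients of a monic polynomial [f] of degree [n], and
   [inB x] says that [x = t / f(z) - s] for some [z], where [s = c 0] and [t = c 1]. *)
Definition fval z := z ^+ n + \sum_(i < n) c i.+2 * z ^+ i.
Definition inB x := exists z, (x + c 0%N) * fval z = c 1%N.
(** These clauses hold for a set between two suitable balls and conversely confine it between balls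
    whose radii depend on [r] alone: the product clause excludes very negative values and the
    inverse clause forces large values in. Products and inverses are named by variables to suit the
    formulas. *)
Definition goodB :=
  [/\ forall z, ~ fval z = 0,
      forall x y w, w = p%:R ^+ r * (x * y) -> inB x -> inB y -> inB w,
      forall x y, x * y = 1 -> inB x \/ inB y & forall x, x = 0 -> inB x].
(* Approximations of [v(x) >= 0] and [v(x) > 0]. *)
Definition almost_int j x := inB (p%:R ^+ r.+1 * x ^+ j).
Definition clearly_small j x := forall w, x * w = 1 -> ~ almost_int j w.

End Neighbourhood.

Section GoodExists.
Variables (K : fieldType) (p : nat).
Implicit Types a x y z w : K.
Hypothesis pp : prime p.
Variable v : K -> R.
Hypothesis RV : real_valuation v.
Hypothesis vp : v p%:R = 1%Re.
Hypothesis p0 : p%:R != 0 :> K.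
Hypothesis c0 : char0 K.
Hypothesis NW : newtonian (rv_O v).
Arguments v _%_R.

Lemma char0_size_deriv (P : {poly K}) : (1 < size P)%N -> (0 < size P^`() < size P)%N.
Proof.
move=> sP; have P0 : P != 0 by rewrite -size_poly_gt0 (ltn_trans _ sP).
rewrite lt_size_deriv // andbT size_poly_gt0; apply/eqP => d0.
move: (congr1 (fun Q : {poly K} => Q`_(size P).-2) d0).
rewrite coef0 coef_deriv prednK; last by rewrite -subn1 subn_gt0.
rewrite -mulr_natr => /eqP; rewrite mulf_eq0 -lead_coefE lead_coef_eq0 (negbTE P0) /=.
by move=> /eqP /c0 e; move: sP; case: (size P) e => [|[]].
Qed.

(** The degree [m + 1] is at most that of any rootless monic polynomial of positive degree. *)
Definition least_rootless m :=
  forall Q : {poly K}, Q \is monic -> (1 < size Q)%N -> (forall z, Q.[z] != 0) -> (m.+1 < size Q)%N.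

(** A non-constant common divisor of [Q] and its derivative would be rootless, like [Q], and of
    smaller degree. *)
Lemma least_rootless_coprime m (Q : {poly K}) : least_rootless m -> Q \is monic -> size Q = m.+2 ->
  (forall z, Q.[z] != 0) -> coprimep Q Q^`().
Proof.
move=> hmin mQ sQ rQ; have Q0 : Q != 0 by apply: monic_neq0.
rewrite coprimep_def; apply/negPn/negP => g1; pose g := gcdp Q Q^`().
have /andP [d0 dQ] := char0_size_deriv (P := Q) ltac:(by rewrite sQ).
have g0 : g != 0 by rewrite gcdp_eq0 negb_and Q0.
have [h eQ] := dvdpP _ _ (dvdp_gcdl Q Q^`()).
have sg : (size g < size Q)%N by apply: leq_ltn_trans dQ; apply: dvdp_leq (dvdp_gcdr _ _); rewrite -size_poly_gt0.
have sg1 : (1 < size g)%N by rewrite ltn_neqAle eq_sym g1 size_poly_gt0.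
have lg : (lead_coef g)^-1 != 0 by rewrite invr_eq0 lead_coef_eq0.
have := hmin ((lead_coef g)^-1 *: g); rewrite size_scale // => /(_ _ sg1) h'.
suff : (m.+1 < size g)%N by rewrite ltnNge -ltnS -sQ sg.
apply: h'; first by rewrite monicE lead_coefZ mulVf // lead_coef_eq0.
move=> z; rewrite hornerZ mulf_neq0 //.
by apply: contra (rQ z) => /eqP e; rewrite eQ hornerM -/g e mulr0.
Qed.

(** By [rootless_open] near a point [y0] with non-zero derivative, the values [t / Q(z) - t / Q(y0)]
    fill the valuation ring once [t] is large. By [rootless_bounded] they have bounded denominators.
    The inverse clause holds since [x] or [x^-1] is integral. *)
Lemma good_exists (P : {poly K}) : P \is monic -> (1 < size P)%N -> (forall z, P.[z] != 0) ->
  exists m r c, least_rootless m /\ @goodB K p m.+1 r c.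
Proof.
move=> mP0 sP0 rP0.
have ex : exists n, `[< exists Q : {poly K}, [/\ Q \is monic, size Q = n.+2 & forall z, Q.[z] != 0] >].
  exists (size P).-2; apply/asboolP; exists P; split=> //.
  by case: (size P) sP0 => [|[]].
case: (ex_minnP ex) => m /asboolP [Q [mQ sQ rQ]] hmin'; pose n := m.+1.
have hmin : least_rootless m.
  move=> Q' mQ' sQ' rQ'; have := hmin' (size Q').-2.
  case eQ : (size Q') sQ' => [|[|k]] //= _; rewrite !ltnS; apply.
  by apply/asboolP; exists Q'.
have cQ := least_rootless_coprime hmin mQ sQ rQ.
have [C hC] := rootless_bounded RV NW (ltn0Sn m) sQ mQ rQ cQ.
(* A non-zero derivative cannot vanish at as many distinct natural numbers as its size. *)
have [y0 dy] : exists y, Q^`().[y] != 0.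
  apply: contrapT => no.
  have : Q^`() = 0.
    apply/eqP; apply/negPn/negP => d0.
    have := @max_poly_roots _ Q^`() [seq (i%:R : K) | i <- iota 0 (size Q^`())] d0.
    rewrite size_map size_iota ltnn => h; suff : false by []; apply: h.
      by apply/allP => x _; apply: contrapT => /negP h; apply: no; exists x.
    rewrite map_inj_uniq ?iota_uniq // => i j e.
    wlog ij : i j e / (i <= j)%N by move=> W; case: (leqP i j) => [|/ltnW] /W; [apply|move=> ->].
    apply/eqP; rewrite eqn_leq ij /= -subn_eq0; apply/eqP/c0.
    by rewrite natrB // e subrr.
  by move=> e; have := char0_size_deriv (P := Q); rewrite e size_poly0 sQ => /(_ isT).
have [d hd] := rootless_open RV NW sQ dy.
have f0 := rQ y0.
(* With [v(t) = - m'], the relative perturbation [x * Q(y0) / t] has value at least [d] for integral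
   [x]. All elements of the set have value at least [- (m' + |C|)], so multiplying a product of two
   by [p ^ r'] makes it integral. *)
have [m' hm'] := INR_unbounded (Rabs d + Rabs (v Q.[y0])).
have [r' hr'] := INR_unbounded (2 * (INR m' + Rabs C)).
pose t : K := p%:R ^- m'; pose cc i := if i is i'.+1 then (if i' is i''.+1 then Q`_i'' else t) else t / Q.[y0].
have t0 : t != 0 by rewrite invr_eq0 expf_neq0.
have vt : v t = (- INR m')%Re by rewrite /t (rvV RV) ?expf_neq0 // (rvX RV) // vp; lra.
have fE z : fval n cc z = Q.[z].
  have lQ : Q`_m.+1 = 1 by rewrite -(monicP mQ) lead_coefE sQ.
  rewrite /fval horner_coef sQ [RHS]big_ord_recr /= lQ mul1r addrC.
  by [].
have a1 := Rle_abs C; have a2 := Rabs_pos C; have a3 := Rle_abs (v Q.[y0]); have a4 := Rabs_pos (v Q.[y0]).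
have a5 := Rle_abs d; have a6 := Rabs_geN (v Q.[y0]).
have intB x : rv_O v x -> inB n cc x.
  move=> ox; have [|z hz] := hd (x * Q.[y0] / t).
    have [->|x0] := eqVneq x 0; first by rewrite !mul0r; left.
    right; rewrite (rv_div RV) ?mulf_neq0 // (rvM RV) // vt.
    by move: ox; rewrite rv_O_nz //; lra.
  exists z; rewrite fE /=.
  transitivity (t / Q.[y0] * (Q.[z] * (1 + x * Q.[y0] / t))); last by rewrite hz divfK.
  by field; rewrite ?f0 ?t0.
have Bbd x : inB n cc x -> vge v (- (INR m' + Rabs C)) x.
  move=> [z]; rewrite fE /= => e; have z0 := rQ z.
  have -> : x = t / Q.[z] - t / Q.[y0] by rewrite -{1}e mulfK // addrK.
  apply: (vgeD RV); last apply: (vgeN RV); right; rewrite (rv_div RV) // vt.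
    by have := hC z; lra.
  by have := hC y0; lra.
exists m, r', cc; split=> //; split.
- by move=> z; rewrite fE; apply/eqP.
- move=> x y w -> /Bbd hx /Bbd hy; apply: intB.
  have [->|x0] := eqVneq x 0; first by rewrite mul0r mulr0; left.
  have [->|y0'] := eqVneq y 0; first by rewrite !mulr0; left.
  right; rewrite (rvM RV) ?mulf_neq0 ?expf_neq0 // (rvX RV) // (rvM RV) // vp.
  by have := vge_nz x0 hx; have := vge_nz y0' hy; lra.
- move=> x y xy; have x0 : x != 0 by apply/eqP => e; move: xy; rewrite e mul0r => /esym /eqP; rewrite oner_eq0.
  have -> : y = x^-1 by rewrite -[y](mulKf x0) xy mulr1.
  case: (Rle_or_lt 0 (v x)) => h; [left|right]; apply: intB; right; rewrite ?(rvV RV) //; lra.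
- by move=> x ->; apply: intB; left.
Qed.

Definition monic_of n (c : nat -> K) : {poly K} := 'X^n + \poly_(i < n) c i.+2.

Lemma monic_ofE n c z : (monic_of n c).[z] = fval n c z.
Proof. by rewrite /monic_of hornerD hornerXn horner_poly. Qed.
Lemma size_monic_of n c : size (monic_of n c) = n.+1.
Proof. by rewrite /monic_of size_polyDl size_polyXn // ltnS size_poly. Qed.
Lemma monic_ofP n c : monic_of n c \is monic.
Proof. by rewrite monicE /monic_of lead_coefDl ?lead_coefXn // size_polyXn ltnS size_poly. Qed.

(** * Quantitative forms of the axioms, for all good parameters *)

Section Clauses.
Variables (m r : nat) (c : nat -> K).
Hypothesis hmin : least_rootless m.
Hypothesis hG : goodB p m.+1 r c.
Local Notation B := (inB m.+1 c).

(** The set is bounded, since the least degree makes its polynomial separable. If [v(x) < - r], the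
    product clause puts [p ^ (r k) x ^ (k + 1)] in it for every [k], with values tending to minus
    infinity. *)
Lemma inB_lower x : x != 0 -> B x -> (- INR r <= v x)%Re.
Proof.
have [G1 G2 _ _] := hG.
have rf z : (monic_of m.+1 c).[z] != 0 by rewrite monic_ofE; apply/eqP.
have cf := least_rootless_coprime hmin (monic_ofP _ _) (size_monic_of _ _) rf.
have [C hC] := rootless_bounded RV NW (ltn0Sn m) (size_monic_of _ _) (monic_ofP _ _) rf cf.
have [M hM] : exists M, forall y, B y -> vge v M y.
  exists (Rmin (v (c 1%N) - C) (v (c 0%N))) => y [z hz].
  have fz := rf z; rewrite monic_ofE in fz.
  have -> : y = c 1%N / fval m.+1 c z - c 0%N by rewrite -hz mulfK // addrK.
  apply: (vgeD RV); last by apply: (vgeN RV); right; apply: Rmin_r.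
  have [->|t0] := eqVneq (c 1%N) 0; first by rewrite mul0r; left.
  right; apply: Rle_trans (Rmin_l _ _) _; rewrite (rv_div RV) //.
  have := hC z; rewrite monic_ofE; lra.
move=> x0 Bx; case: (Rle_or_lt (- INR r) (v x)) => // lt; exfalso.
have pn k : p%:R ^+ k != 0 :> K by rewrite expf_neq0.
have Bk k : B (p%:R ^+ (r * k) * x ^+ k.+1).
  elim: k => [|k IH]; first by rewrite muln0 mul1r expr1.
  apply: (G2 x _ _ _ Bx IH); rewrite mulnS exprD exprS; ring.
have [k hk] := INR_unbounded (- M / (- INR r - v x)).
have : (- M / (- INR r - v x) * (- INR r - v x) < INR k * (- INR r - v x))%Re by apply: Rmult_lt_compat_r; lra.
rewrite /Rdiv Rmult_assoc Rinv_l ?Rmult_1_r; last lra.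
have xk0 : x ^+ k.+1 != 0 by rewrite expf_neq0.
have := vge_nz (mulf_neq0 (pn _) xk0) (hM _ (Bk k)).
rewrite (rvM RV) // !(rvX RV) // vp -multE mult_INR S_INR.
have r0 := pos_INR r; nra.
Qed.

Lemma inB_upper x : x = 0 \/ (INR r < v x)%Re -> B x.
Proof.
have [_ _ G3 G4] := hG; case=> [/G4 //|h].
have [/G4 //|x0] := eqVneq x 0.
have xi0 : x^-1 != 0 by rewrite invr_eq0.
case: (G3 x x^-1) => //; first by rewrite divff.
by move=> /(inB_lower xi0); rewrite (rvV RV) //; lra.
Qed.

Local Notation C := (almost_int p m.+1 r c).
Local Notation E := (clearly_small p m.+1 r c).
Local Notation q := (2 * INR r + 1)%Re.

(** Together with the converse below: membership forces [v(x) >= - q / j] and follows from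
    [v(x) > - 1 / j]. Both bounds tend to 0 as [j] grows. *)
Lemma almost_int_lower j x : x != 0 -> C j x -> (- q <= INR j * v x)%Re.
Proof.
move=> x0; rewrite /almost_int => /inB_lower; rewrite mulf_neq0 ?expf_neq0 // => /(_ isT).
rewrite (rvM RV) ?expf_neq0 // !(rvX RV) // vp S_INR; lra.
Qed.
Lemma almost_int_upper j x : x != 0 -> (-1 < INR j * v x)%Re -> C j x.
Proof.
move=> x0 h; apply: inB_upper; right.
by rewrite (rvM RV) ?expf_neq0 // !(rvX RV) // vp S_INR; lra.
Qed.
Lemma almost_int0 j : C j 0.
Proof.
apply: inB_upper; case: j => [|j]; last by left; rewrite expr0n mulr0.
by right; rewrite expr0 mulr1 (rvX RV) // vp S_INR; lra.
Qed.
Lemma clearly_small_lower j x : x != 0 -> E j x -> (1 <= INR j * v x)%Re.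
Proof.
move=> x0 /(_ x^-1 (divff x0)) nC; have xi0 : x^-1 != 0 by rewrite invr_eq0.
case: (Rle_or_lt 1 (INR j * v x)) => // lt; case: nC; apply: almost_int_upper => //.
by rewrite (rvV RV) //; lra.
Qed.
Lemma clearly_small_upper j x : x = 0 \/ (q < INR j * v x)%Re -> E j x.
Proof.
move=> h w xw; have x0 : x != 0 by apply/eqP => e; move: xw; rewrite e mul0r => /esym /eqP; rewrite oner_eq0.
have h' : (q < INR j * v x)%Re by case: h => // e; rewrite e eqxx in x0.
have -> : w = x^-1 by rewrite -[w](mulKf x0) xw mulr1.
have xi0 : x^-1 != 0 by rewrite invr_eq0.
move=> /(almost_int_lower xi0); rewrite (rvV RV) //; lra.
Qed.

(** The number [q + 1], the factor by which an exponent must grow so that the necessary condition at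
    the larger exponent implies the sufficient one at the smaller. *)
Local Notation k := (2 * r).+2.

Lemma INR_k : INR k = (q + 1)%Re.
Proof. by rewrite !S_INR -multE mult_INR /=; lra. Qed.
Lemma scale_int j (a : R) : (- q <= INR (j * k) * a)%Re -> (-1 < INR j * a)%Re.
Proof. by rewrite -multE mult_INR INR_k; have := pos_INR r; nra. Qed.
Lemma scale_small j i (a : R) : (i * k <= j)%N -> (1 <= INR i * a)%Re -> (q < INR j * a)%Re.
Proof.
move=> /leP /le_INR; rewrite -multE mult_INR INR_k.
have := pos_INR r; have := pos_INR i => i0 r0 h1 h2; have a0 : (0 < a)%Re by nra.
have : (INR i * (q + 1) * a <= INR j * a)%Re by apply: Rmult_le_compat_r; lra.
nra.
Qed.
Lemma almost_intB j x y : C (j * k) x -> C (j * k) y -> C j (x - y).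
Proof.
case: j => [|j] hx hy.
  have [->|xy0] := eqVneq (x - y) 0; first exact: almost_int0.
  by apply: almost_int_upper => //; rewrite /=; lra.
have h z : C (j.+1 * k) z -> vgt v (- / INR j.+1) z.
  move=> hz; have [->|z0] := eqVneq z 0; first by left.
  right; have := scale_int (almost_int_lower z0 hz).
  have j0 := lt_0_INR _ (ltP (ltn0Sn j)).
  move=> lt; apply: (Rmult_lt_reg_l (INR j.+1)) => //.
  by rewrite Ropp_mult_distr_r_reverse Rinv_r; lra.
have [->|xy0] := eqVneq (x - y) 0; first exact: almost_int0.
apply: almost_int_upper => //.
have := vgt_nz xy0 (vgtD RV (h _ hx) (vgtN RV (h _ hy))).
have j0 := lt_0_INR _ (ltP (ltn0Sn j)).
move=> /(Rmult_lt_compat_l _ _ _ j0); rewrite Ropp_mult_distr_r_reverse Rinv_r; lra.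
Qed.

Lemma almost_intM j x y : C (2 * j * k) x -> C (2 * j * k) y -> C j (x * y).
Proof.
have [->|x0] := eqVneq x 0; first by rewrite mul0r => _ _; apply: almost_int0.
have [->|y0] := eqVneq y 0; first by rewrite mulr0 => _ _; apply: almost_int0.
move=> /(almost_int_lower x0) /scale_int hx /(almost_int_lower y0) /scale_int hy.
apply: almost_int_upper; first by rewrite mulf_neq0.
move: hx hy; rewrite (rvM RV) // -multE mult_INR /=; lra.
Qed.

Lemma almost_int_total i j x y : x * y = 1 -> C i x \/ C j y.
Proof.
move=> xy; have x0 : x != 0 by apply/eqP => e; move: xy; rewrite e mul0r => /esym /eqP; rewrite oner_eq0.
have xi0 : x^-1 != 0 by rewrite invr_eq0.
have -> : y = x^-1 by rewrite -[y](mulKf x0) xy mulr1.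
case: (Rle_or_lt 0 (v x)) => h; [left|right]; apply: almost_int_upper => //.
  by have := pos_INR i; nra.
by rewrite (rvV RV) //; have := pos_INR j; nra.
Qed.

Lemma clearly_small_p : E k p%:R.
Proof. by apply: clearly_small_upper; right; rewrite vp INR_k; lra. Qed.
Lemma almost_int1 j : C j 1.
Proof. by apply: almost_int_upper; rewrite ?oner_neq0 // (rv1 RV); lra. Qed.

Lemma clearly_small_lift i j x : (i * k <= j)%N -> E i x -> E j x.
Proof.
move=> ij h; apply: clearly_small_upper; have [->|x0] := eqVneq x 0; [by left|right].
by apply: scale_small ij _; apply: clearly_small_lower.
Qed.

(** The root comes from Hensel's lemma. The equation writes [z + 1] as a sum of terms
    [d i * z ^ (i + 2)], so its value is at least the bound [1 / j] for the coefficients. *)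
Lemma clearly_small_newton l j (d : nat -> K) : (forall i, (i < l)%N -> E j (d i)) ->
  exists z, 1 + z + \sum_(i < l) d i * z ^+ i.+2 = 0 /\ E (j * k) (z + 1).
Proof.
move=> hd; have V := rv_vr RV.
have vd i : (i < l)%N -> d i = 0 \/ (1 <= INR j * v (d i))%Re.
  by move=> il; have [->|d0] := eqVneq (d i) 0; [left|right; apply: clearly_small_lower (hd i il)].
pose Q : {poly K} := \poly_(i < l.+2) (if i is i'.+2 then d i' else 1).
have [|||z [oz Qz mz]] := NW (P := Q); rewrite ?coef_poly //.
  case=> [|[|i]] // _; rewrite coef_poly; case: ifP => [il|_]; last exact: (vmax0 V).
  have [->|d0] := eqVneq (d i) 0; first exact: (vmax0 V).
  apply/(rv_maxE RV) => //; case: (vd i il) => [e|]; first by rewrite e eqxx in d0.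
  by have := pos_INR j; nra.
have ez : 1 + z + \sum_(i < l) d i * z ^+ i.+2 = 0.
  rewrite -[RHS]Qz horner_poly !big_ord_recl /= expr0 expr1 !mul1r addrA.
  by congr (_ + _).
exists z; split=> //; apply: clearly_small_upper.
have [|z0] := eqVneq (z + 1) 0; [by left|right].
apply: (@scale_small _ j) => //.
(* For [j = 0] the hypothesis forces all coefficients to be 0, hence [z + 1 = 0]. *)
have [j0|j0] := posnP j.
  exfalso; move: z0; rewrite addrC -[1 + z](addrK (\sum_(i < l) d i * z ^+ i.+2)) ez.
  rewrite big1 ?subr0 ?eqxx // => i _; case: (vd i (ltn_ord i)) => [->|]; first by rewrite mul0r.
  by rewrite j0 /= => h; exfalso; lra.
have jp : (0 < INR j)%Re by apply/lt_0_INR/ltP.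
suff : vge v (/ INR j) (z + 1).
  move=> /(vge_nz z0) h; have := Rmult_le_compat_l _ _ _ (Rlt_le _ _ jp) h.
  by rewrite Rinv_r //; lra.
have -> : z + 1 = - \sum_(i < l) d i * z ^+ i.+2 by apply/eqP; rewrite -subr_eq0 opprK -[X in _ == X]ez; apply/eqP; ring.
apply: (vgeN RV); apply: (vge_sum RV) => i.
apply: (@vgeW _ v (/ INR j + 0)%Re); first by lra.
apply: (vgeM RV); last exact: (vrX V).
case: (vd i (ltn_ord i)) => [->|h]; first by left.
right; apply: (Rmult_le_reg_l (INR j)) => //; rewrite Rinv_r; lra.
Qed.

Hypothesis SP : rv_semiperfect_mod v p.
Hypothesis DV : forall a b : R, (a < b)%Re -> exists2 x : K, x != 0 & (a < v x < b)%Re.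

(* A [p]-th root modulo [p], with error [p z], is corrected by [g s] with
   [s ^ p = - (p z / g ^ p)] modulo [p]. *)
Lemma semiperfect_improved x : rv_O v x ->
  exists y, vge v (1 + / (2 * INR p)) (y ^+ p - x).
Proof.
move=> ox; have V := rv_vr RV.
have p1 : (1 <= INR p)%Re by rewrite -[1%Re]/(INR 1); apply/le_INR/leP/prime_gt0.
have ip : (INR p * / (2 * INR p) = / 2)%Re.
  by rewrite Rinv_mult (Rmult_comm (/ 2)) -Rmult_assoc Rinv_r; lra.
(* The value of [g] is below [1 / p], so that [g ^ p] divides [p], and above [1 / (2 p)], so that
   the cross terms [p g w] and the remainder [g ^ p p z3] gain at least [1 / (2 p)]. *)
have [g g0 [hg1 hg2]] := DV (a := (/ (2 * INR p))%Re) (b := (/ INR p)%Re)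
   ltac:(by apply: Rinv_lt_contravar; [nra|lra]).
have vg : (INR p * v g < 1)%Re.
  by have := Rmult_lt_compat_l (INR p) _ _ ltac:(lra) hg2; rewrite Rinv_r; lra.
have ipos : (0 < / (2 * INR p))%Re by apply: Rinv_0_lt_compat; lra.
have [y [z [oy oz e]]] := SP ox.
have gp0 : g ^+ p != 0 by rewrite expf_neq0.
have oz2 : rv_O v (- (p%:R * z / g ^+ p)).
  apply: (vrN V); rewrite mulrAC; apply: (vrM V) => //.
  by right; rewrite (rv_div RV) // vp (rvX RV) //; lra.
have [s [z3 [os oz3 e3]]] := SP oz2.
have [w ow ew] : exists2 w, rv_O v w & (y + g * s) ^+ p = y ^+ p + (g * s) ^+ p + p%:R * g * w.
  case ep : p pp => [//|p'] pp'; rewrite exprDn big_ord_recl big_ord_recr /= subn0 subnn !expr0 mulr1 mul1r.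
  rewrite bin0 binn !mulr1n.
  have [w ow ew] : exists2 w, rv_O v w & \sum_(i < p') y ^+ (p'.+1 - bump 0 i) * (g * s) ^+ bump 0 i *+ 'C(p'.+1, bump 0 i) = p'.+1%:R * g * w.
    apply: (big_ind (fun t => exists2 w, rv_O v w & t = p'.+1%:R * g * w)).
    - by exists 0; [apply: (vr0 V)|rewrite mulr0].
    - by move=> _ _ [w1 h1 ->] [w2 h2 ->]; exists (w1 + w2); [apply: (vrD V)|ring].
    move=> i _; have /dvdnP [a ea] : (p'.+1 %| 'C(p'.+1, bump 0 i))%N.
      by apply: prime_dvd_bin => //; rewrite /bump /= add1n ltnS ltn_ord.
    have og : rv_O v g by right; lra.
    exists (y ^+ (p'.+1 - bump 0 i) * (g ^+ i * s ^+ i.+1) * a%:R).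
      by apply: (vrM V); [apply: (vrM V); [|apply: (vrM V)]; apply: (vrX V)|apply: (vr_nat V)].
    by rewrite ea -mulr_natr natrM /bump /= add1n exprMn exprS; ring.
  by exists w => //; rewrite ew; ring.
exists (y + g * s); have -> : (y + g * s) ^+ p - x = g ^+ p * (p%:R * z3) + p%:R * g * w.
  rewrite ew exprMn -e3 opprK mulrDr [g ^+ p * (_ / _)]mulrC divfK // -e; ring.
have O0 u : rv_O v u -> vge v 0 u by [].
have vp1 : vge v 1 p%:R by right; lra.
apply: (vgeD RV).
  apply: (@vgeW _ v (INR p * v g + (1 + 0))%Re); first by nra.
  apply: (vgeM RV); first by right; rewrite (rvX RV) //; lra.
  by apply: (vgeM RV) => //; apply: O0.
apply: (@vgeW _ v (1 + v g + 0)%Re); first by lra.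
by apply: (vgeM RV); [apply: (vgeM RV) => //; right; lra|apply: O0].
Qed.

(** Here [x] is only approximately integral, so it is multiplied by a small [u ^ p] before a root is
    extracted. Dividing back loses accuracy; the gain in [semiperfect_improved] pays for this. *)
Lemma almost_int_semiperfect x : C (8 * p * k) x ->
  exists y z, y ^+ p - x = p%:R * z /\ E (4 * p * k) z.
Proof.
move=> Cx; have p1 : (1 <= INR p)%Re by rewrite -[1%Re]/(INR 1); apply/le_INR/leP/prime_gt0.
have iq : (INR p * / INR p = 1)%Re by rewrite Rinv_r; lra.
have ip : (/ (2 * INR p) = / 2 * / INR p)%Re by rewrite Rinv_mult.
have iq0 : (0 < / INR p)%Re by apply: Rinv_0_lt_compat; lra.
(* The hypothesis gives [v(x) > - 1 / (8 p)], so [p v(u) > 1 / (8 p)] makes [x u ^ p] integral,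
   while [p v(u) < 1 / (4 p)] leaves at least [1 / (4 p)] of the gain [1 / (2 p)]. *)
have [u u0 [hu1 hu2]] := DV (a := (/ 8 * / INR p * / INR p)%Re) (b := (/ 4 * / INR p * / INR p)%Re) ltac:(nra).
have pu1 : (/ 8 * / INR p < INR p * v u)%Re.
  have := Rmult_lt_compat_l (INR p) _ _ ltac:(lra) hu1.
  by rewrite -Rmult_assoc [(INR p * _)%Re]Rmult_comm Rmult_assoc iq Rmult_1_r.
have pu2 : (INR p * v u < / 4 * / INR p)%Re.
  have := Rmult_lt_compat_l (INR p) _ _ ltac:(lra) hu2.
  by rewrite -Rmult_assoc [(INR p * (_ * _))%Re]Rmult_comm Rmult_assoc iq Rmult_1_r.
have up0 : u ^+ p != 0 by rewrite expf_neq0.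
have oxu : rv_O v (x * u ^+ p).
  have [->|x0] := eqVneq x 0; first by rewrite mul0r; left.
  right; rewrite (rvM RV) // (rvX RV) //.
  have := scale_int (almost_int_lower x0 Cx).
  rewrite -multE mult_INR (_ : INR 8 = 8%Re); last by rewrite /=; lra.
  move=> h; have : (-/ 8 * / INR p < v x)%Re; last by lra.
  apply: (Rmult_lt_reg_l (INR p)); first by lra.
  have -> : (INR p * (- / 8 * / INR p) = - / 8)%Re by rewrite -Rmult_assoc [(INR p * _)%Re]Rmult_comm Rmult_assoc iq; lra.
  lra.
have [y hy] := semiperfect_improved oxu.
exists (y / u), (((y / u) ^+ p - x) / p%:R); split; first by rewrite [RHS]mulrC divfK.
apply: clearly_small_upper; set z := _ / _; have [|z0] := eqVneq z 0; [by left|right].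
apply: (@scale_small _ (4 * p)) => //.
suff h : vge v (/ 4 * / INR p)%Re z.
  have := Rmult_le_compat_l (4 * INR p) _ _ ltac:(lra) (vge_nz z0 h).
  rewrite -multE mult_INR (_ : INR 4 = 4%Re); last by rewrite /=; lra.
  by rewrite (_ : (4 * INR p * (/ 4 * / INR p) = INR p * / INR p)%Re) ?iq; lra.
have -> : z = (y ^+ p - x * u ^+ p) * ((u ^+ p)^-1 * p%:R^-1).
  rewrite /z expr_div_n; move: (u ^+ p) up0 => U U0; field; rewrite ?U0 ?p0.
  by [].
apply: (@vgeW _ v ((1 + / (2 * INR p)) + (- (INR p * v u) + - 1))%Re); first by rewrite ip; lra.
apply: (vgeM RV) => //; apply: (vgeM RV); right.
  by rewrite (rvV RV) // (rvX RV) //; lra.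
by rewrite (rvV RV) // vp; lra.
Qed.

(** The value of [y ^ l] is placed between the first and the third quarter of the interval of length
    [v(a)] that begins at [v(x)], so both quotients have value at least [v(a) / 4]. *)
Lemma clearly_small_dense i a x l : (0 < l)%N -> a != 0 -> E i a -> x != 0 ->
  exists y z1 z2, [/\ y != 0, y ^+ l = x * z1, a * x = y ^+ l * z2, E (4 * i * k) z1 & E (4 * i * k) z2].
Proof.
move=> l0 a0 /(clearly_small_lower a0) va x0.
have lp : (0 < INR l)%Re by apply/lt_0_INR/ltP.
have i0 := pos_INR i; have va0 : (0 < v a)%Re by nra.
have [y y0 [h1 h2]] := DV (a := ((v x + v a * / 4) * / INR l)%Re) (b := ((v x + 3 * v a * / 4) * / INR l)%Re)
  ltac:(by apply: Rmult_lt_compat_r; [apply: Rinv_0_lt_compat|lra]).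
have yl0 : y ^+ l != 0 by rewrite expf_neq0.
have iq : (/ INR l * INR l = 1)%Re by rewrite Rinv_l; lra.
have {}h1 := Rmult_lt_compat_r _ _ _ lp h1; have {}h2 := Rmult_lt_compat_r _ _ _ lp h2.
rewrite Rmult_assoc iq in h1; rewrite Rmult_assoc iq in h2.
have small z : z != 0 -> (v a * / 4 <= v z)%Re -> E (4 * i * k) z.
  move=> z0 h; apply: clearly_small_upper; right; apply: (@scale_small _ (4 * i)) => //.
  rewrite -multE mult_INR (_ : INR 4 = 4%Re); last by rewrite /=; lra.
  nra.
exists y, (y ^+ l / x), (a * x / y ^+ l); split=> //.
- by rewrite [RHS]mulrC divfK.
- by rewrite [RHS]mulrC divfK.
- by apply: small; rewrite ?mulf_neq0 ?invr_eq0 // (rv_div RV) // (rvX RV) //; lra.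
- apply: small; rewrite ?mulf_neq0 ?invr_eq0 // (rv_div RV) ?mulf_neq0 // (rvX RV) // (rvM RV) //; lra.
Qed.
End Clauses.
End GoodExists.

(** * The valuation ring cut out by the neighbourhoods *)

Section CutOut.
Variables (K : fieldType) (p k : nat) (C : nat -> K -> Prop).
Implicit Types a x y z w : K.
Let E j x := forall w, x * w = 1 -> ~ C j w.
Hypothesis pp : prime p.
Hypothesis c0 : char0 K.
Hypothesis C1 : forall j, C j 1.
Hypothesis CB : forall j x y, C (j * k) x -> C (j * k) y -> C j (x - y).
Hypothesis CM : forall j x y, C (2 * j * k) x -> C (2 * j * k) y -> C j (x * y).
Hypothesis Ctot : forall i j x y, x * y = 1 -> C i x \/ C j y.
Hypothesis Ep : E k p%:R.
Hypothesis Elift : forall i j x, (i * k <= j)%N -> E i x -> E j x.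
Hypothesis Enewton : forall l j (d : nat -> K), (forall i, (i < l)%N -> E j (d i)) ->
  exists z, 1 + z + \sum_(i < l) d i * z ^+ i.+2 = 0 /\ E (j * k) (z + 1).
Hypothesis Esemi : forall x, C (8 * p * k) x -> exists y z, y ^+ p - x = p%:R * z /\ E (4 * p * k) z.
Hypothesis Edense : forall i a x l, (0 < l)%N -> a != 0 -> E i a -> x != 0 ->
  exists y z1 z2, [/\ y != 0, y ^+ l = x * z1, a * x = y ^+ l * z2, E (4 * i * k) z1 & E (4 * i * k) z2].

(** An integral element satisfies all conditions [C j], whereas an element of the maximal ideal is
    detected by one [E j]. Hence an axiom with finitely many elements of that ideal as data follows
    from statements with fixed exponents. *)
Definition cut x := forall j, C j x.
Local Notation O := cut.

Lemma cut_vr : valuation_ring O.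
Proof.
have OB x y : O x -> O y -> O (x - y) by move=> hx hy j; apply: CB.
split=> //; first by rewrite -(subrr 1); apply: OB.
  by move=> x y hx hy j; apply: CM.
move=> x x0; apply: contrapT => /not_orP [/existsNP [i hi] /existsNP [j hj]].
by case: (@Ctot i j x x^-1) => //; rewrite divff.
Qed.

Lemma cut_max x : vmax O x <-> exists j, E j x.
Proof.
have [->|x0] := eqVneq x 0.
  split=> _; last exact: (vmax0 cut_vr).
  by exists 0%N => w; rewrite mul0r => /esym /eqP; rewrite oner_eq0.
rewrite (vmaxVP cut_vr x0); split=> [/existsNP [j hj]|[j hj] h]; last exact: (hj x^-1 (divff x0)).
by exists j => w xw; rewrite -[w](mulKf x0) xw mulr1.
Qed.

Lemma cut_newtonian : newtonian O.
Proof.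
move=> P P0 P1 hP.
(* The finitely many coefficients are witnessed at different exponents; [Elift] raises them to a
   common one. *)
have [j hj] : exists j, forall i, (i < size P)%N -> E j P`_i.+2.
  elim: (size P) => [|l [j hj]]; first by exists 0%N.
  have /cut_max [j' hj'] := hP l.+2 isT; exists (j * k + j' * k)%N => i.
  rewrite ltnS leq_eqVlt => /orP [/eqP ->|/hj h].
    by apply: Elift hj'; rewrite leq_addl.
  by apply: Elift h; rewrite leq_addr.
have [z [ez hz]] := Enewton hj.
have mz : vmax O (z + 1) by apply/cut_max; exists (j * k)%N.
exists z; split=> //.
  by rewrite -[z](addrK 1); apply: (vrB cut_vr) => //; apply: vmaxW.
rewrite (@horner_coef_wide _ (size P).+2) ?(leq_trans _ (leqnSn _)) ?leqnSn //.
by rewrite !big_ord_recl /= P0 P1 expr0 expr1 !mul1r addrA.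
Qed.

Lemma cut_C0p : C0p p K.
Proof.
have V := cut_vr; exists O; split=> //.
- exact: (newtonian_henselian V cut_newtonian).
- by split=> //; apply/cut_max; exists k.
- move=> x ox; have /Esemi := ox (8 * p * k)%N; move=> [y [z [e hz]]].
  have oz : O z by apply: vmaxW; apply/cut_max; exists (4 * p * k)%N.
  (* [y] is integral because its [p]-th power [x + p z] is. *)
  exists y, z; split=> //; apply: (vrX_inv V (prime_gt0 pp)).
  by rewrite -[y ^+ p](subrK x) e; apply: (vrD V) => //; apply: (vrM V) => //; apply: (vr_nat V).
apply: (dense_regular V) => a x l a0 /cut_max [i Ea] x0 l0.
have [y [z1 [z2 [y0 e1 e2 h1 h2]]]] := Edense l0 a0 Ea x0.
exists y; split=> //; apply/cut_max; exists (4 * i * k)%N.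
  by rewrite e1 mulrC mulKf.
by rewrite e2 mulrC mulKf // expf_neq0.
Qed.
End CutOut.

(** * Transfer of the neighbourhoods *)

Definition tpow a n := iter n (tMul a) tOne.
Definition tnat n := iter n (tAdd tOne) tZero.
Definition tsum n (F : nat -> rterm) := foldr (fun i => tAdd (F i)) tZero (iota 0 n).

Lemma teval_pow (K : fieldType) (e : nat -> K) a n : teval e (tpow a n) = teval e a ^+ n.
Proof. by elim: n => [|n IH]; rewrite ?expr0 // exprS -IH. Qed.
Lemma teval_nat (K : fieldType) (e : nat -> K) n : teval e (tnat n) = n%:R.
Proof. by elim: n => [|n IH] //; rewrite -[n.+1]add1n natrD -IH. Qed.
Lemma teval_sum (K : fieldType) (e : nat -> K) n F : teval e (tsum n F) = \sum_(i < n) teval e (F i).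
Proof.
rewrite /tsum -(big_mkord xpredT (fun i => teval e (F i))) /index_iota subn0.
by elim: (iota 0 n) => [|i s IH]; rewrite ?big_nil // big_cons -IH.
Qed.
Definition tevalE := (teval_pow, teval_nat, teval_sum).

(* Below 10 an assignment holds bound variables; above, it interleaves two parameter sequences. *)
Definition par (K : Type) (e : nat -> K) i := e (10 + 2 * i)%N.
Definition par' (K : Type) (e : nat -> K) i := e (11 + 2 * i)%N.
Definition env (K : fieldType) (a : seq K) (c d : nat -> K) i :=
  if (i < 10)%N then a`_i else if odd i then d (i - 11)./2 else c (i - 10)./2.

Lemma par_env (K : fieldType) a (c d : nat -> K) : par (env a c d) = c.
Proof.
apply/funext => i; rewrite /par /env ltnNge leq_addr /= oddD mul2n odd_double /=.
by rewrite addKn doubleK.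
Qed.
Lemma par'_env (K : fieldType) a (c d : nat -> K) : par' (env a c d) = d.
Proof.
apply/funext => i; rewrite /par' /env ltnNge (leq_trans _ (leq_addr _ _)) //= oddD mul2n odd_double /=.
by rewrite addKn doubleK.
Qed.

Section Definability.
Variables p n r : nat.
Local Notation C K c := (@almost_int K p n r c).
Local Notation E K c := (@clearly_small K p n r c).

Lemma def_inB a : (forall (K : fieldType) (e : nat -> K) z, teval (upd e 9 z) a = teval e a) ->
  definable (fun K e => inB n (par e) (teval e a)).
Proof.
move=> ha; pose f := tAdd (tpow (tVar 9) n) (tsum n (fun i => tMul (tVar (10 + 2 * i.+2)) (tpow (tVar 9) i))).
exists (fEx 9 (fEq (tMul (tAdd a (tVar 10)) f) (tVar 12))) => K e /=.
have fE z : teval (upd e 9 z) f = fval n (par e) z.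
  by rewrite /= !tevalE /fval; congr (_ + _); apply: eq_bigr => i _ /=; rewrite tevalE.
split=> -[z hz]; exists z; first by rewrite -fE -(ha K e z); exact: hz.
by move: hz; rewrite -fE -(ha K e z).
Qed.
Lemma def_inBv (i : nat) : i != 9 -> definable (fun K e => inB n (par e) (e i)).
Proof. by move=> i9; apply: (@def_inB (tVar i)) => K e z; rewrite /= /upd (negbTE i9). Qed.
Lemma def_C j (i : nat) : i != 9 -> definable (fun K e => C K (par e) j (e i)).
Proof.
move=> i9; pose a := tMul (tpow (tnat p) r.+1) (tpow (tVar i) j).
have aE (K : fieldType) (e : nat -> K) : teval e a = p%:R ^+ r.+1 * e i ^+ j.
  by rewrite -[LHS]/(teval e (tpow (tnat p) r.+1) * teval e (tpow (tVar i) j)) !tevalE.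
have ha (K : fieldType) (e : nat -> K) z : teval (upd e 9 z) a = teval e a.
  by rewrite !aE /upd (negbTE i9).
by have h := def_inB ha; apply: def_iff h => K e; rewrite aE.
Qed.
Lemma def_E j (i : nat) : i != 8 -> i != 9 -> definable (fun K e => E K (par e) j (e i)).
Proof.
move=> i8 i9; have D : definable (fun K e => e i * e 8 = 1 -> ~ C K (par e) j (e 8)).
  by apply: def_imp; [exact: (def_eq (tMul (tVar i) (tVar 8)) tOne)|apply/def_not/def_C].
have h := def_all 8 D; apply: def_iff h => K e.
have ei w : upd e 8 w i = e i by rewrite /upd (negbTE i8).
by split=> h w; have := h w; rewrite ei.
Qed.
Lemma def_rootless : definable (fun K e => forall z : K, ~ fval n (par e) z = 0).
Proof.
pose f := tAdd (tpow (tVar 9) n) (tsum n (fun i => tMul (tVar (10 + 2 * i.+2)) (tpow (tVar 9) i))).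
have h := def_all 9 (def_not (def_eq f tZero)); apply: def_iff h => K e.
have fE z : teval (upd e 9 z) f = fval n (par e) z.
  by rewrite /= !tevalE /fval; congr (_ + _); apply: eq_bigr => i _ /=; rewrite tevalE.
by split=> h z; have := h z; rewrite fE.
Qed.
Lemma def_good : definable (fun K e => @goodB K p n r (par e)).
Proof.
have D1 : definable (fun K e => e 2 = p%:R ^+ r * (e 0 * e 1) -> inB n (par e) (e 0) ->
    inB n (par e) (e 1) -> inB n (par e) (e 2)).
  apply: def_imp; last by do !apply: def_imp; apply: def_inBv.
  apply: def_iff (def_eq (tVar 2) (tMul (tpow (tnat p) r) (tMul (tVar 0) (tVar 1)))) => K e.
  by rewrite /= !tevalE.
have D2 : definable (fun K e => e 0 * e 1 = 1 -> inB n (par e) (e 0) \/ inB n (par e) (e 1)).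
  apply: def_imp; first exact: (def_eq (tMul (tVar 0) (tVar 1)) tOne).
  by apply: def_or; apply: def_inBv.
have D3 : definable (fun K e => e 0 = 0 -> inB n (par e) (e 0)).
  by apply: def_imp; [exact: (def_eq (tVar 0) tZero)|apply: def_inBv].
have h := def_and def_rootless (def_and (def_all 0 (def_all 1 (def_all 2 D1)))
  (def_and (def_all 0 (def_all 1 D2)) (def_all 0 D3))).
by apply: def_iff h => K e; split=> [[h1 [h2 [h3 h4]]]|[h1 h2 h3 h4]].
Qed.
End Definability.

Lemma transfer (K F : fieldType) Q : elem_equiv K F -> axiomatizable Q -> Q F -> Q K.
Proof. by move=> KF [f sf hf] /hf h; apply/hf/(KF f sf). Qed.

Lemma char0_transfer (K F : fieldType) : elem_equiv K F -> char0 F -> char0 K.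
Proof.
move=> KF cF n; have [-> //|n0] := posnP n; suff h : (n%:R : K) <> 0 by [].
have Q : axiomatizable (fun K => forall e : nat -> K, ~ teval e (tnat n) = teval e tZero).
  by apply: ax_all; apply/def_not/def_eq.
have := transfer KF Q _ (fun=> 0); rewrite tevalE; apply=> e.
by rewrite tevalE => /cF n1; rewrite n1 in n0.
Qed.

(** An existential sentence first gives a rootless polynomial over [F] of the same degree. The least
    such degree and good parameters are found in [F], and the existence of good parameters, for the
    same [n] and [r], returns to [K]. *)
Lemma rootless_C0p p (K F : fieldType) (P : {poly K}) : prime p -> perfectoid0p p F -> elem_equiv K F ->
  P \is monic -> (1 < size P)%N -> (forall z, P.[z] != 0) -> C0p p K.
Proof.
move=> pp PF KF mP sP rP.
have [cF _] := PF; have cK := char0_transfer KF cF.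
have p0 : p%:R != 0 :> F by apply/eqP => /cF e; rewrite e in pp.
have [v [RV vp NW SP DV]] := perfectoid_normalized pp PF.
have [P' [mP' sP' rP']] : exists P' : {poly F}, [/\ P' \is monic, (1 < size P')%N & forall z, P'.[z] != 0].
  have FK : elem_equiv F K by move=> f sf; rewrite (KF f sf).
  have A : axiomatizable (fun K => exists e : nat -> K, forall z : K, ~ fval (size P).-1 (par e) z = 0).
    by apply: ax_ex; apply: def_rootless.
  have [|e he] := transfer FK A.
    exists (env [::] (fun i => P`_i.-2) (fun=> 0)) => z; rewrite par_env /fval => h.
    have := rP z; rewrite horner_coef.
    case eP : (size P) sP h => [//|s] _; rewrite big_ord_recr /=.
    have -> : P`_s = 1 by rewrite -(monicP mP) lead_coefE eP.
    by rewrite mul1r addrC => ->; rewrite eqxx.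
  exists (monic_of (size P).-1 (par e)); rewrite size_monic_of monic_ofP (ltn_predK sP); split=> // z.
  by rewrite monic_ofE; apply/eqP.
have [m [r [c' [hm G']]]] := good_exists RV vp p0 cF NW mP' sP' rP'.
pose n := m.+1; pose k := (2 * r).+2.
have [c G] : exists c, @goodB K p n r c.
  have A : axiomatizable (fun K => exists e : nat -> K, goodB p n r (par e)) by apply: ax_ex; apply: def_good.
  have [|e he] := transfer KF A; last by exists (par e).
  by exists (env [::] c' c'); rewrite par_env.
pose C := almost_int p n r c; pose E := clearly_small p n r c.
pose gd (K : fieldType) (e : nat -> K) := goodB p n r (par e).
have dG : definable gd := def_good p n r.
have gc a d : gd K (env a c d) by rewrite /gd par_env.
(* A clause valid in [F] for every good parameter sequence transfers as one universal implication,
   and so applies to the parameters chosen in [K]. *)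
have T Q : definable Q -> (forall e : nat -> F, gd F e -> Q F e) ->
    forall (a : seq K) (d : nat -> K), Q K (env a c d).
  move=> dQ h a d; apply: (transfer KF (ax_all (def_imp dG dQ))) (gc a d); exact: h.
pose aC (K : fieldType) (e : nat -> K) j i := almost_int p n r (par e) j (e i).
pose aE (K : fieldType) (e : nat -> K) j i := clearly_small p n r (par e) j (e i).
have dC j (i : nat) : i != 9 -> definable (fun K e => @aC K e j i) by apply: def_C.
have dE j (i : nat) : i != 8 -> i != 9 -> definable (fun K e => @aE K e j i) by apply: def_E.
apply: (@cut_C0p K p k C pp cK).
- move=> j; have := T (fun K e => e 0 = 1 -> aC K e j 0) _ _ [:: 1] c.
  rewrite /aC par_env; apply=> //.
    by apply: def_imp; [exact: (def_eq (tVar 0) tOne)|apply: dC].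
  by move=> e he ->; apply: (almost_int1 RV vp p0 cF NW hm he).
- move=> j x y hx hy; have := T (fun K e => aC K e (j * k)%N 0 -> aC K e (j * k)%N 1 -> e 2 = e 0 - e 1 -> aC K e j 2) _ _ [:: x; y; x - y] c.
  rewrite /aC par_env; apply=> //.
    do 2![apply: def_imp; first exact: dC]; apply: def_imp; last exact: dC.
    exact: (def_eq (tVar 2) (tAdd (tVar 0) (tOpp (tVar 1)))).
  by move=> e he h1 h2 ->; apply: (almost_intB RV vp p0 cF NW hm he).
- move=> j x y hx hy; have := T (fun K e => aC K e (2 * j * k)%N 0 -> aC K e (2 * j * k)%N 1 -> e 2 = e 0 * e 1 -> aC K e j 2) _ _ [:: x; y; x * y] c.
  rewrite /aC par_env; apply=> //.
    do 2![apply: def_imp; first exact: dC]; apply: def_imp; last exact: dC.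
    exact: (def_eq (tVar 2) (tMul (tVar 0) (tVar 1))).
  by move=> e he h1 h2 ->; apply: (almost_intM RV vp p0 cF NW hm he).
- move=> i j x y xy; have := T (fun K e => e 0 * e 1 = 1 -> aC K e i 0 \/ aC K e j 1) _ _ [:: x; y] c.
  rewrite /aC par_env; apply=> //.
    apply: def_imp; first exact: (def_eq (tMul (tVar 0) (tVar 1)) tOne).
    by apply: def_or; apply: dC.
  by move=> e he; apply: (almost_int_total RV vp p0 cF NW hm he).
- have := T (fun K e => e 0 = p%:R -> aE K e k 0) _ _ [:: p%:R] c.
  rewrite /aE par_env; apply=> //.
    apply: def_imp; last exact: dE.
    by have h := def_eq (tVar 0) (tnat p); apply: def_iff h => K' e; rewrite tevalE.
  by move=> e he ->; apply: (clearly_small_p RV vp p0 cF NW hm he).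
- move=> i j x ij hx; have := T (fun K e => aE K e i 0 -> aE K e j 0) _ _ [:: x] c.
  rewrite /aE par_env; apply=> //; first by apply: def_imp; apply: dE.
  by move=> e he; apply: (clearly_small_lift RV vp p0 cF NW hm he).
- move=> l j d hd.
  (* The coefficients [d] occupy the second parameter sequence, and [z + 1] is named [w] because
     [def_E] is stated for variables. *)
  pose body (K : fieldType) (e : nat -> K) := 1 + e 0 + \sum_(i < l) par' e i * e 0 ^+ i.+2 = 0.
  have := T (fun K e => (forall i, (i < l)%N -> clearly_small p n r (par e) j (par' e i)) ->
    exists z w, [/\ w = z + 1, body K (upd (upd e 0 z) 1 w) & aE K (upd (upd e 0 z) 1 w) (j * k)%N 1]) _ _ [::] d.
  rewrite par'_env par_env => /(_ _ _ hd); case.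
  + apply: def_imp; first by apply: def_forall_lt => i; apply: def_E.
    have D1 : definable body.
      pose t := tAdd (tAdd tOne (tVar 0)) (tsum l (fun i => tMul (tVar (11 + 2 * i)) (tpow (tVar 0) i.+2))).
      have h := def_eq t tZero; apply: def_iff h => K' e.
      rewrite -[teval e t]/(1 + e 0 + teval e (tsum _ _)) tevalE /body.
      rewrite (eq_bigr (fun i : 'I_l => par' e i * e 0 ^+ i.+2)) // => i _.
      by rewrite -[LHS]/(par' e i * teval e (tpow (tVar 0) i.+2)) tevalE.
    have h := def_ex 0 (def_ex 1 (def_and (def_eq (tVar 1) (tAdd (tVar 0) tOne)) (def_and D1 (@dE (j * k)%N 1 isT isT)))).
    apply: def_iff h => K' e; split=> -[z [w]]; first by move=> [h1 [h2 h3]]; exists z, w.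
    by move=> [h1 h2 h3]; exists z, w.
  + move=> e he hd'; have [z [ez sz]] := clearly_small_newton RV vp p0 cF NW hm he hd'.
    by exists z, (z + 1).
  move=> z [_ [-> ez sz]]; exists z; split.
    by move: ez; rewrite /body -[par' _]/(par' (env [::] c d)) par'_env.
  by move: sz; rewrite /aE -[par _]/(par (env [::] c d)) par_env.
- move=> x hx.
  have := T (fun K e => aC K e (8 * p * k)%N 0 -> exists y z, 
     y ^+ p - e 0 = p%:R * z /\ aE K (upd (upd e 1 y) 2 z) (4 * p * k)%N 2) _ _ [:: x] c.
  rewrite /aC par_env => /(_ _ _ hx); case.
  + apply: def_imp; first exact: dC.
    have D1 : definable (fun K e => e 1 ^+ p - e 0 = p%:R * e 2).
      have h := def_eq (tAdd (tpow (tVar 1) p) (tOpp (tVar 0))) (tMul (tnat p) (tVar 2)).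
      by apply: def_iff h => K' e; rewrite /= !tevalE.
    have h := def_ex 1 (def_ex 2 (def_and D1 (@dE (4 * p * k)%N 2 isT isT))); exact: h.
  + by move=> e he; apply: (almost_int_semiperfect pp RV vp p0 cF NW hm he SP DV).
  move=> y [z [e1 sz]]; exists y, z; split=> //.
  by move: sz; rewrite /aE -[par _]/(par (env [:: x] c c)) par_env.
move=> i a x l l0 a0 ha x0.
have := T (fun K e => ~ e 0 = 0 -> aE K e i 0 -> ~ e 1 = 0 -> exists y z1 z2,
   ((~ y = 0 /\ y ^+ l = e 1 * z1 /\ e 0 * e 1 = y ^+ l * z2) /\
   aE K (upd (upd (upd e 2 y) 3 z1) 4 z2) (4 * i * k)%N 3 /\
   aE K (upd (upd (upd e 2 y) 3 z1) 4 z2) (4 * i * k)%N 4)) _ _ [:: a; x] c.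
have a0' : a <> 0 by apply/eqP. have x0' : x <> 0 by apply/eqP.
rewrite /aE par_env => /(_ _ _ a0' ha x0'); case.
- do 3![apply: def_imp; first by [apply: dE|apply: def_not; exact: (def_eq (tVar _) tZero)]].
  have D1 : definable (fun K e => ~ e 2 = 0 /\ e 2 ^+ l = e 1 * e 3 /\ e 0 * e 1 = e 2 ^+ l * e 4).
    apply: def_and; first by apply: def_not; exact: (def_eq (tVar 2) tZero).
    apply: def_and.
      have h := def_eq (tpow (tVar 2) l) (tMul (tVar 1) (tVar 3)).
      by apply: def_iff h => K' e; rewrite tevalE.
    have h := def_eq (tMul (tVar 0) (tVar 1)) (tMul (tpow (tVar 2) l) (tVar 4)).
    by apply: def_iff h => K' e; rewrite /= tevalE.
  have h := def_ex 2 (def_ex 3 (def_ex 4 (def_and D1 (def_and (@dE (4 * i * k)%N 3 isT isT) (@dE (4 * i * k)%N 4 isT isT))))).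
  exact: h.
- move=> e he /eqP e0 he' /eqP e1.
  have [y [z1 [z2 [/eqP y0 h1 h2 h3 h4]]]] := clearly_small_dense RV vp p0 cF NW hm he DV l0 e0 he' e1.
  by exists y, z1, z2.
move=> y [z1 [z2 [[/eqP y0 [h1 h2]] [h3 h4]]]]; exists y, z1, z2; split=> //.
  by move: h3; rewrite -[par _]/(par (env [:: a; x] c c)) par_env.
by move: h4; rewrite -[par _]/(par (env [:: a; x] c c)) par_env.
Qed.

(** * Valuation rings of algebraically closed fields *)

Section Chevalley.
Variables (K : fieldType) (p : nat).
Implicit Types a x y z : K.
Implicit Types A : set K.
Hypothesis pp : prime p.
Hypothesis c0 : char0 K.
Local Notation q := (p%:R : K).

(* The empty set is allowed, for the union of the empty chain in Zorn's lemma. *)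
Definition p_ring A :=
  [/\ forall x, A x -> A 1, forall x y, A x -> A y -> A (x - y),
      forall x y, A x -> A y -> A (x * y) & forall x, A x -> q * x <> 1].

Lemma p_ring_max : exists A, [/\ p_ring A, A 1 & forall B, p_ring B -> (forall x, A x -> B x) -> forall x, B x -> A x].
Proof.
have [A [PA mA]] : exists A, p_ring A /\ forall B, (A `<` B)%classic -> ~ p_ring B.
  apply: Zorn_bigcup => F FP tot; split.
  - by move=> x [X FX Xx]; exists X => //; case: (FP X FX) => h _ _ _; apply: h Xx.
  - move=> x y [X FX Xx] [Y FY Yy]; case: (tot X Y FX FY) => s.
      by exists Y => //; case: (FP Y FY) => _ h _ _; apply: h => //; apply: s.
    by exists X => //; case: (FP X FX) => _ h _ _; apply: h => //; apply: s.
  - move=> x y [X FX Xx] [Y FY Yy]; case: (tot X Y FX FY) => s.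
      by exists Y => //; case: (FP Y FY) => _ _ h _; apply: h => //; apply: s.
    by exists X => //; case: (FP X FX) => _ _ h _; apply: h => //; apply: s.
  - by move=> x [X FX Xx]; case: (FP X FX) => _ _ _ h; apply: h.
have max B : p_ring B -> (forall x, A x -> B x) -> forall x, B x -> A x.
  move=> PB AB x Bx; apply: contrapT => nA; apply: (mA B) => //; split=> //.
  by move=> BA; apply: nA; apply: BA.
(* The image of the integers is such a ring, so the maximal one is not empty and contains 1. *)
exists A; split=> //; pose Z x := exists m n, x = m%:R - n%:R.
have PZ : p_ring Z.
  split.
  - by move=> x _; exists 1%N, 0%N; rewrite subr0.
  - by move=> _ _ [m [n ->]] [m' [n' ->]]; exists (m + n')%N, (n + m')%N; rewrite !natrD; ring.
  - move=> _ _ [m [n ->]] [m' [n' ->]]; exists (m * m' + n * n')%N, (m * n' + n * m')%N.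
    by rewrite !natrD !natrM; ring.
  - move=> _ [m [n ->]] e.
    have e' : (p * m)%:R = (p * n + 1)%:R :> K.
      rewrite natrD !natrM (_ : q * m%:R = q * (m%:R - n%:R) + q * n%:R); last by ring.
      by rewrite e addrC.
    have {}e' : (p * m = p * n + 1)%N.
      have inj i j : (i <= j)%N -> i%:R = j%:R :> K -> i = j.
        move=> ij eij; apply/eqP; rewrite eqn_leq ij /= -subn_eq0; apply/eqP/c0.
        by rewrite natrB // eij subrr.
      by case: (leqP (p * m) (p * n + 1)) => [|/ltnW] h; [apply: inj|apply/esym/inj].
    have : (p %| p * n + 1)%N by rewrite -e' dvdn_mulr.
    by rewrite dvdn_addr ?dvdn_mulr // dvdn1 => /eqP p1; move: pp; rewrite p1.
have [[x Ax]|no] := EM (exists x, A x); first by case: PA => h _ _ _; apply: h Ax.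
by apply: (max Z PZ) => [x Ax|]; [case: no; exists x|exists 1%N, 0%N; rewrite subr0].
Qed.

Variable A : set K.
Hypothesis PA : p_ring A.
Hypothesis A1 : A 1.
Hypothesis Amax : forall B, p_ring B -> (forall x, A x -> B x) -> forall x, B x -> A x.
Let AB x y : A x -> A y -> A (x - y). Proof. by case: PA => _ h _ _; apply: h. Qed.
Let AM x y : A x -> A y -> A (x * y). Proof. by case: PA => _ _ h _; apply: h. Qed.
Let A0 : A 0. Proof. by rewrite -(subrr 1); apply: AB. Qed.
Let AD x y : A x -> A y -> A (x + y).
Proof. by move=> hx hy; rewrite -[y]opprK -[- y]sub0r; apply: AB => //; apply: AB. Qed.
Let AX x n : A x -> A (x ^+ n).
Proof. by move=> h; elim: n => [|n IH]; rewrite ?expr0 ?exprS //; apply: AM. Qed.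
Let Anat n : A n%:R.
Proof. by elim: n => [|n IH] //; rewrite -addn1 natrD; apply: AD. Qed.
Let Asum n (F : 'I_n -> K) : (forall i, A (F i)) -> A (\sum_i F i).
Proof. by move=> h; apply: (big_ind A). Qed.

Definition over (P : {poly K}) := forall i, A P`_i.
(** A polynomial certificate, with a bound on its size, that [p] becomes invertible in [A[x]]. *)
Definition p_inverse x n := exists P, [/\ over P, (size P <= n)%N & q * P.[x] = 1].

Lemma p_inverse_ex x : ~ A x -> exists n, p_inverse x n.
Proof.
move=> nA; apply: contrapT => no; apply: nA.
pose B y := exists2 P, over P & y = P.[x].
apply: (Amax (B := B)).
- split.
  + by move=> y _; exists 1; [move=> i; rewrite coefC; case: eqP|rewrite hornerC].
  + move=> _ _ [P hP ->] [Q hQ ->]; exists (P - Q); last by rewrite hornerD hornerN.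
    by move=> i; rewrite coefB; apply: AB.
  + move=> _ _ [P hP ->] [Q hQ ->]; exists (P * Q); last by rewrite hornerM.
    by move=> i; rewrite coefM; apply: Asum => j; apply: AM.
  + by move=> _ [P hP ->] e; apply: no; exists (size P), P.
- by move=> y Ay; exists y%:P; [move=> i; rewrite coefC; case: eqP|rewrite hornerC].
by exists 'X; [move=> i; rewrite coefX; case: eqP|rewrite hornerX].
Qed.

(** If the inverse of [u = 1 - q a] were missing, [p] would be invertible in [A[u^-1]]. Clearing
    denominators would put [u ^ n] in [q A]; but [u ^ n] is 1 modulo [q A], so [q] would be
    invertible in [A]. *)
Lemma one_sub_unit a : A a -> 1 - q * a != 0 /\ A (1 - q * a)^-1.
Proof.
move=> Aa; set u := 1 - q * a.
have u0 : u != 0.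
  apply/eqP => e; case: PA => _ _ _ /(_ a Aa); apply.
  by apply/eqP; rewrite eq_sym -subr_eq0; apply/eqP.
have Au : A u by apply: AB => //; apply: AM.
split=> //; apply: contrapT => /p_inverse_ex [n [P [hP sP e]]].
have e' : q * (\sum_(i < n) P`_i * u ^+ (n - i)) = u ^+ n.
  transitivity (q * P.[u^-1] * u ^+ n); last by rewrite e mul1r.
  rewrite (horner_coef_wide _ sP) -mulrA mulr_suml; congr (_ * _); apply: eq_bigr => i _.
  rewrite -mulrA exprVn; congr (_ * _).
  have -> : u ^+ n = u ^+ (n - i) * u ^+ i by rewrite -exprD subnK // ltnW.
  by rewrite mulrCA mulVf ?expf_neq0 // mulr1.
have [b Ab eb] : exists2 b, A b & u ^+ n = 1 - q * b.
  elim: (n) => [|k [b Ab eb]]; first by exists 0; rewrite ?mulr0 ?subr0.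
  exists (b + a - q * a * b); last by rewrite exprS eb /u; ring.
  by apply: AB; [apply: AD|apply: AM => //; apply: AM].
case: PA => _ _ _ /(_ (b + \sum_(i < n) P`_i * u ^+ (n - i))); apply.
  by apply: AD => //; apply: Asum => i; apply: AM => //; apply: AX.
by rewrite mulrDr e' eb; ring.
Qed.

(** The certificate for [x^-1], multiplied by [x ^ n], expresses a unit multiple of [x ^ n] through
    lower powers. This replaces the top term of the certificate for [x]. *)
Lemma p_inverse_reduce x m n : x != 0 -> p_inverse x n.+1 -> p_inverse x^-1 m -> (m <= n.+1)%N ->
  p_inverse x n.
Proof.
move=> x0 [P [hP sP eP]] [Q [hQ sQ eQ]] mn.
have sQ' : (size Q <= n.+1)%N by apply: leq_trans mn.
pose Q0 := \poly_(i < n) Q`_(n - i).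
have hQ0 : over Q0 by move=> i; rewrite coef_poly; case: ifP.
have e0 : q * Q0.[x] = (1 - q * Q`_0) * x ^+ n.
  transitivity (q * Q.[x^-1] * x ^+ n - q * Q`_0 * x ^+ n); last by rewrite eQ mulrBl.
  rewrite (horner_coef_wide _ sQ') big_ord_recl /= expr0 mulr1.
  rewrite /Q0 horner_poly.
  have -> : \sum_(i < n) Q`_(n - i) * x ^+ i = x ^+ n * \sum_(i < n) Q`_(bump 0 i) * x^-1 ^+ bump 0 i.
    rewrite mulr_sumr [RHS](reindex_inj rev_ord_inj) /=; apply: eq_bigr => i _.
    have -> : bump 0 (n - i.+1) = (n - i)%N by rewrite /bump /= add1n subnSK.
    rewrite mulrCA; congr (_ * _); rewrite exprVn.
    have -> : x ^+ n = x ^+ (n - i) * x ^+ i by rewrite -exprD subnK // ltnW.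
    by rewrite mulrAC divff ?mul1r // expf_neq0.
  ring.
have [u0 Au] := one_sub_unit (hQ 0%N).
pose P0 := \poly_(i < n) P`_i.
exists (P0 + (P`_n * q / (1 - q * Q`_0)) *: Q0); split.
- move=> i; rewrite coefD coefZ coef_poly; apply: AD; first by case: ifP.
  by apply: AM => //; apply: AM => //; apply: AM.
- by rewrite (leq_trans (size_polyD _ _)) // geq_max size_poly (leq_trans (size_scale_leq _ _)) ?size_poly.
transitivity (q * P.[x]) => //; rewrite (horner_coef_wide _ sP) big_ord_recr /= hornerD hornerZ horner_poly.
have -> : x ^+ n = q * Q0.[x] / (1 - q * Q`_0) by rewrite e0 [RHS]mulrC mulKf.
ring.
Qed.

(** Chevalley's argument: if both [x] and [x^-1] were missing, take certificates of least size for
    each; the larger could be shortened by the other. *)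
Lemma p_ring_vr : valuation_ring A.
Proof.
split=> // x x0; apply: contrapT => /not_orP [nx nxi].
have ex : exists n, `[< p_inverse x n >] by have [n h] := p_inverse_ex nx; exists n; apply/asboolP.
have exi : exists n, `[< p_inverse x^-1 n >] by have [n h] := p_inverse_ex nxi; exists n; apply/asboolP.
case: (ex_minnP ex) => n /asboolP hn nmin; case: (ex_minnP exi) => m /asboolP hm mmin.
have pos y : ~ p_inverse y 0.
  move=> [P [_ + e]]; rewrite leqn0 size_poly_eq0 => /eqP P0.
  by move: e; rewrite P0 horner0 mulr0 => /esym /eqP; rewrite oner_eq0.
case: n => [|n] in hn nmin; first exact: (pos _ hn).
case: m => [|m] in hm mmin; first exact: (pos _ hm).
case: (leqP m n) => h.
  by have /asboolP/nmin := p_inverse_reduce x0 hn hm h; rewrite ltnn.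
have xi0 : x^-1 != 0 by rewrite invr_eq0.
rewrite -{1}[x]invrK in hn; have /asboolP/mmin := p_inverse_reduce xi0 hm hn (ltnW h).
by rewrite ltnn.
Qed.

Lemma p_ring_max_p : vmax A q.
Proof.
split=> // -[q0 [_ qi]]; case: PA => _ _ _ /(_ q^-1 qi); apply; exact: divff.
Qed.
End Chevalley.

(** * Membership of algebraically closed fields in the class *)

Section AlgebraicallyClosed.
Variables (K : fieldType) (p : nat).
Implicit Types x y z : K.
Hypothesis pp : prime p.
Hypothesis c0 : char0 K.
Hypothesis AC : forall P : {poly K}, P \is monic -> (1 < size P)%N -> exists z, P.[z] = 0.

Lemma root_ex n x : (0 < n)%N -> exists y, y ^+ n = x.
Proof.
move=> n0; have sx : (size (- x%:P)%R < size ('X^n : {poly K}))%N.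
  by rewrite size_polyN size_polyXn ltnS (leq_trans (size_polyC_leq1 _)).
have [||y hy] := AC (P := 'X^n - x%:P).
- by rewrite monicE lead_coefDl ?lead_coefXn.
- by rewrite size_polyDl // size_polyXn ltnS.
exists y; apply/eqP; rewrite -subr_eq0; apply/eqP; rewrite -[RHS]hy.
by rewrite hornerD hornerN hornerC hornerXn.
Qed.

Lemma split_ex (P : {poly K}) : P \is monic -> exists s : seq K, P = \prod_(b <- s) ('X - b%:P).
Proof.
move: {2}(size P) (leqnn (size P)) => n; elim: n P => [|n IH] P sP mP.
  by move: (monic_neq0 mP); rewrite -size_poly_eq0 -leqn0 sP.
have [s1|s1] := leqP (size P) 1.
  exists [::]; rewrite big_nil (size1_polyC s1); move: mP.
  by rewrite {1}(size1_polyC s1) monicE lead_coefC => /eqP ->.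
have [z /rootP/factor_theorem [Q eP]] := AC mP s1.
have mQ : Q \is monic by rewrite eP monicMr ?monicXsubC // in mP.
have [|s es] := IH Q _ mQ.
  by move: sP; rewrite eP size_Mmonic ?monicXsubC ?monic_neq0 // size_XsubC addn2.
by exists (z :: s); rewrite big_cons eP es mulrC.
Qed.

(** Roots of a monic polynomial over a valuation ring are integral. Since [f(a)] is the product of
    the [a - b] over the roots [b], its smallness forces some factor to be small. Roots of all
    degrees give the remaining properties. *)
Lemma closed_C0p : C0p p K.
Proof.
have [A [PA A1 Amax]] := p_ring_max pp c0.
have V := p_ring_vr PA A1 Amax; have mq := p_ring_max_p PA A1.
exists A; split=> //.
- move=> f a mf fO aO fa _; have [s ef] := split_ex mf.
  have rO b : b \in s -> A b.
    move=> bs; apply: contrapT => nb; have mb := vrN_max V nb.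
    have rb : f.[b] = 0 by apply/rootP; rewrite ef root_prod_XsubC.
    have b0 : b != 0 by apply/eqP => e; apply: nb; rewrite e; apply: (vr0 V).
    have [l sf] : exists l, size f = l.+1.
      by case e : (size f) => [|l]; [move: (monic_neq0 mf); rewrite -size_poly_eq0 e|exists l].
    apply: (vunit_not_max (vunit1 V)).
    have -> : 1 = - \sum_(i < l) f`_i * b^-1 ^+ (l - i) :> K.
      apply/eqP; rewrite -addr_eq0 addrC; apply/eqP.
      have lf : f`_l = 1 by rewrite -(monicP mf) lead_coefE sf.
      transitivity (f.[b] / b ^+ l); last by rewrite rb mul0r.
      rewrite horner_coef sf big_ord_recr /= lf mul1r mulrDl divff ?expf_neq0 // mulr_suml; congr (_ + _).
      apply: eq_bigr => i _; rewrite -mulrA; congr (_ * _).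
      have -> : b ^+ l = b ^+ (l - i) * b ^+ i by rewrite -exprD subnK // ltnW.
      by rewrite exprVn invfM mulrCA divff ?mulr1 // expf_neq0.
    apply/(vmaxN V)/(vmax_sum V) => i _; apply: (vmaxMr V) => //; apply: (vmaxX V) => //.
    by rewrite subn_gt0.
  have [b bs mb] : exists2 b, b \in s & vmax A (a - b).
    apply: contrapT => no; apply: (@vunit_not_max _ _ f.[a]) fa.
    rewrite ef horner_prod; have {}no b : b \in s -> vunit A (a - b).
      move=> bs; case: (vunitP (vrB V aO (rO b bs))) => // mb; by case: no; exists b.
    elim: (s) no => [|b s' IH] h; first by rewrite big_nil; apply: (vunit1 V).
    rewrite big_cons hornerXsubC; apply: (vunitM V); first by apply: h; rewrite mem_head.
    by apply: IH => b' hb'; apply: h; rewrite inE hb' orbT.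
  exists b; split; [exact: rO|by rewrite ef root_prod_XsubC|].
  by rewrite -opprB; apply/(vmaxN V).
- move=> x ox; have [y e] := root_ex x (prime_gt0 pp); exists y, 0; rewrite e mulr0 subrr; split=> //.
    by apply: (vrX_inv V (prime_gt0 pp)); rewrite e.
  exact: (vr0 V).
apply: (dense_regular V) => a x n a0 ma x0 n0.
(* The value of [y ^ n] is the midpoint of the interval, [v(x)] plus half of [v(a)]. *)
have [b eb] := root_ex a (ltn0Sn 1); have [y ey] := root_ex (x * b) n0.
have mb : vmax A b by apply: (vmaxX_inv V (n := 2)); rewrite eb.
have b0 : b != 0 by apply/eqP => e; move: a0; rewrite -eb e expr0n eqxx.
exists y; split.
- by apply/eqP => e; move/eqP: ey; rewrite e expr0n gtn_eqF // eq_sym mulf_eq0 (negbTE x0) (negbTE b0).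
- by rewrite ey mulrC mulKf.
- by rewrite ey -eb (_ : _ / _ = b) //; field; rewrite ?x0 ?b0.
Qed.
End AlgebraicallyClosed.

(** * Models of the theory of perfectoid fields *)

(** The coding shows that there are countably many sentences, so that a countable index set suffices
    for compactness. *)
Fixpoint term_code (t : rterm) : GenTree.tree nat :=
  match t with
  | tVar i => GenTree.Leaf i
  | tZero => GenTree.Node 0 [::]
  | tOne => GenTree.Node 1 [::]
  | tAdd a b => GenTree.Node 2 [:: term_code a; term_code b]
  | tMul a b => GenTree.Node 3 [:: term_code a; term_code b]
  | tOpp a => GenTree.Node 4 [:: term_code a]
  end.
Fixpoint term_decode (t : GenTree.tree nat) : rterm :=
  match t with
  | GenTree.Leaf i => tVar i
  | GenTree.Node 1 _ => tOne
  | GenTree.Node 2 [:: a; b] => tAdd (term_decode a) (term_decode b)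
  | GenTree.Node 3 [:: a; b] => tMul (term_decode a) (term_decode b)
  | GenTree.Node 4 [:: a] => tOpp (term_decode a)
  | _ => tZero
  end.
Lemma term_codeK : cancel term_code term_decode.
Proof. by elim=> //= [a -> b ->|a -> b ->|a ->]. Qed.

Fixpoint form_code (f : rform) : GenTree.tree nat :=
  match f with
  | fEq a b => GenTree.Node 0 [:: term_code a; term_code b]
  | fFalse => GenTree.Node 1 [::]
  | fNot g => GenTree.Node 2 [:: form_code g]
  | fAnd g h => GenTree.Node 3 [:: form_code g; form_code h]
  | fOr g h => GenTree.Node 4 [:: form_code g; form_code h]
  | fImp g h => GenTree.Node 5 [:: form_code g; form_code h]
  | fAll i g => GenTree.Node 6 [:: GenTree.Leaf i; form_code g]
  | fEx i g => GenTree.Node 7 [:: GenTree.Leaf i; form_code g]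
  end.
Fixpoint form_decode (t : GenTree.tree nat) : rform :=
  match t with
  | GenTree.Node 0 [:: a; b] => fEq (term_decode a) (term_decode b)
  | GenTree.Node 2 [:: g] => fNot (form_decode g)
  | GenTree.Node 3 [:: g; h] => fAnd (form_decode g) (form_decode h)
  | GenTree.Node 4 [:: g; h] => fOr (form_decode g) (form_decode h)
  | GenTree.Node 5 [:: g; h] => fImp (form_decode g) (form_decode h)
  | GenTree.Node 6 [:: GenTree.Leaf i; g] => fAll i (form_decode g)
  | GenTree.Node 7 [:: GenTree.Leaf i; g] => fEx i (form_decode g)
  | _ => fFalse
  end.
Lemma form_codeK : cancel form_code form_decode.
Proof.
by elim=> //= [a b|g ->|g -> h ->|g -> h ->|g -> h ->|i g ->|i g ->] //; rewrite !term_codeK.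
Qed.

Lemma enum_form : exists e : nat -> rform, forall f, exists n, e n = f.
Proof.
exists (fun n => if unpickle n is Some t then form_decode t else fFalse) => f.
by exists (pickle (form_code f)); rewrite pickleK form_codeK.
Qed.

Lemma not_models (K : fieldType) f : sentence f -> models K (fNot f) <-> ~ models K f.
Proof.
move=> sf; have sn : sentence (fNot f) by [].
by rewrite (models_sentence (fun=> 0) sn) (models_sentence (fun=> 0) sf).
Qed.

Section Theory.
Variable p : nat.
Hypothesis pp : prime p.

Definition perfectoid_theory f := sentence f /\ forall F, perfectoid0p p F -> models F f.

(** Compactness by an ultraproduct: the [n]-th factor satisfies those of the first [n + 1] sentences
    that hold in [K]. The ultraproduct is equivalent to [K] and, by [C0p_ultraproduct_perfectoid],
    to a single perfectoid field. *)
Lemma theory_perfectoid (K : fieldType) : (forall f, perfectoid_theory f -> models K f) ->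
  exists F, perfectoid0p p F /\ elem_equiv K F.
Proof.
move=> hK; have [enumf hen] := enum_form.
pose good i := sentence (enumf i) /\ models K (enumf i).
have [F hF] : exists F : nat -> fieldType, forall n, perfectoid0p p (F n) /\
    forall i, (i <= n)%N -> good i -> models (F n) (enumf i).
  suff h n : {F | perfectoid0p p F /\ forall i, (i <= n)%N -> good i -> models F (enumf i)}.
    by exists (fun n => projT1 (h n)) => n; case: (h n).
  apply: cid; pose Q (L : fieldType) := forall i, (i < n.+1)%N -> good i -> models L (enumf i).
  have [f sf hf] : axiomatizable Q.
    rewrite /Q; elim: (n.+1) => [|m [f sf hf]].
      by exists (fImp fFalse fFalse) => // L; split=> // _ e.
    have [gm|gm] := EM (good m); last first.
      exists f => // L; rewrite hf; split=> h i; last by move=> im; apply: h; apply: ltnW.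
      by rewrite ltnS leq_eqVlt => /orP [/eqP ->|/h].
    have sfm : sentence (fAnd f (enumf m)) by rewrite /sentence /= sf (proj1 gm).
    exists (fAnd f (enumf m)) => // L.
    rewrite (models_sentence (fun=> 0) sfm) /= -(models_sentence _ sf) -(models_sentence _ (proj1 gm)) hf.
    split=> [[h1 h2] i|h]; first by rewrite ltnS leq_eqVlt => /orP [/eqP ->|/h1].
    by split=> [i im|]; apply: h => //; apply: ltnW.
  (* If no perfectoid field satisfied [f], its negation would belong to the theory and hold in
     [K]. *)
  apply: contrapT => no.
  have : models K (fNot f).
    apply: hK; split=> // F PF; apply/(not_models _ sf) => /hf h; apply: no; exists F; split=> //; exact: h.
  by move=> /(not_models _ sf); apply; apply/hf => i _ [].
have [F0 [PF EF]] := C0p_ultraproduct_perfectoid pp (fun n => perfectoid_C0p pp (proj1 (hF n))).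
exists F0; split=> // f sf; rewrite -(EF f sf).
have mono g : sentence g -> models K g -> models (ultra F) g.
  move=> sg Kg; apply/(los_sentence F sg); have [i ei] := hen g.
  apply: UFS (UFinf i) => n leq; rewrite -ei; apply: (proj2 (hF n)) => //.
  by rewrite /good ei.
split; first exact: mono.
move=> h; apply: contrapT => /(not_models _ sf) /(mono (fNot f) sf) /(not_models _ sf); exact.
Qed.

Lemma theory_C0p (K : fieldType) : (forall f, perfectoid_theory f -> models K f) -> C0p p K.
Proof.
move=> /theory_perfectoid [F [PF KF]].
have [ac|] := EM (forall P : {poly K}, P \is monic -> (1 < size P)%N -> exists z, P.[z] = 0).
  by apply: (closed_C0p pp _ ac); apply: (char0_transfer KF); case: PF.
move=> /existsNP [P] /not_implyP [mP] /not_implyP [sP nr].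
by apply: (rootless_C0p pp PF KF mP sP) => z; apply/eqP => rz; apply: nr; exists z.
Qed.

Lemma C0p_theory (K : fieldType) f : C0p p K -> perfectoid_theory f -> models K f.
Proof.
move=> cK [sf hf]; have [F [PF EF]] := C0p_ultraproduct_perfectoid pp (fun _ : nat => cK).
by apply/(ultrapower_equiv K sf)/(EF f sf)/hf.
Qed.
End Theory.

Theorem theorem3p8 (p : nat) (hp : prime p) :
  elementary (C0p p) /\
  (forall K : fieldType, perfectoid0p p K -> C0p p K) /\
  (forall D : fieldType -> Prop, elementary D ->
     (forall K : fieldType, perfectoid0p p K -> D K) ->
     forall K : fieldType, C0p p K -> D K).
Proof.
split; last split; last first.
- move=> D [T [sT hT]] hD K cK; apply/hT => f Tf; apply: (C0p_theory hp cK).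
  by split; [apply: sT|move=> F /hD /hT; apply].
- by move=> K; apply: perfectoid_C0p.
exists (perfectoid_theory p); split; first by move=> f [].
by move=> K; split=> [cK f|]; [apply: C0p_theory|apply: theory_C0p].
Qed.
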